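(* Assume that $b$ changes sign on $\mathbb T$ and that $\mathcal Z$ is infinite. If there exists $r\in\mathbb R$ such that $\Omega_r=\{t\in\mathbb T:\int_0^tb(s)ds>r\}$ is not connected, then $L$ is not $\mathcal S_\mu$-globally solvable, for every $\mu\ge1/2$.
   Context: Let $\mathbb T=\mathbb R/2\pi\mathbb Z$, $n\ge1$. Let $P=\sum_{|\alpha|+|\beta|\le m}c_{\alpha,\beta}x^\beta\partial_x^\alpha$, $c_{\alpha,\beta}\in\mathbb R$, order $m\ge2$, be self-adjoint and globally elliptic on $\mathbb R^n$ ($\sum_{|\alpha|+|\beta|=m}c_{\alpha,\beta}x^\beta(i\xi)^\alpha\ne0$ for $(x,\xi)\ne(0,0)$), with real eigenvalues $\lambda_j$ ($|\lambda_j|\sim\rho j^{m/(2n)}$) and orthonormal eigenfunctions $\varphi_j$. For $\sigma>1,\mu\ge1/2$, $\mathcal S_{\sigma,\mu}$ is the space of smooth $u$ on $\mathbb T\times\mathbb R^n$ with $\sup_{\alpha,\beta,\gamma}C^{-|\alpha+\beta|-\gamma}\gamma!^{-\sigma}(\alpha!\beta!)^{-\mu}\sup|x^\alpha\partial_x^\beta\partial_t^\gamma u|<\infty$ for some $C>0$; $\mathscr F_\mu=\bigcup_{\sigma>1}\mathcal S_{\sigma,\mu}$; $u=\sum u_j(t)\varphi_j(x)$. $L=D_t+c(t)P$, $D_t=i^{-1}\partial_t$, $c=a+ib$, $a,b$ real Gevrey on $\mathbb T$, $c_0=\frac1{2\pi}\int_0^{2\pi}c$, $\mathcal Z=\{j:\lambda_jc_0\in\mathbb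 Z\}$. $\mathscr E_{L,\mu}$ is the set of $f\in\mathscr F_\mu$ with $\int_0^{2\pi}\exp(i\lambda_j\int_0^tc(s)ds)f_j(t)dt=0$ for all $j\in\mathcal Z$; $L$ is $\mathcal S_\mu$-globally solvable if for every $f\in\mathscr E_{L,\mu}$ there is $u\in\mathscr F_\mu$ with $Lu=f$. *)

(* Defs.v *)
From HB Require Import structures.
From mathcomp Require Import all_boot all_order all_algebra.
From mathcomp Require Import all_classical all_reals all_analysis.
From mathcomp.real_closed Require Import complex.
Import Order.TTheory GRing.Theory Num.Theory.
Import numFieldNormedType.Exports.

Set Implicit Arguments.
Unset Strict Implicit.
Unset Printing Implicit Defensive.

Local Open Scope ring_scope.
Local Open Scope complex_scope.
Local Open Scope classical_set_scope.

Definition ci {R : realType} : R[i] := 0 +i* 1.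
Definition cconj {R : realType} (z : R[i]) : R[i] := complex.Re z -i* complex.Im z.
Definition cabs {R : realType} (z : R[i]) : R :=
  Num.sqrt (complex.Re z ^+ 2 + complex.Im z ^+ 2).
Definition cexp {R : realType} (z : R[i]) : R[i] :=
  (expR (complex.Re z))%:C * (cos (complex.Im z) +i* sin (complex.Im z)).

Definition cRe {R : realType} {X : Type} (f : X -> R[i]) : X -> R :=
  fun x => complex.Re (f x).
Definition cIm {R : realType} {X : Type} (f : X -> R[i]) : X -> R :=
  fun x => complex.Im (f x).

Definition iD {R : realType} {X : normedModType R} (ds : seq X) (f : X -> R)
  : X -> R := foldr (fun v g => fun x => 'D_v g x) f ds.

Definition rsmooth {R : realType} {X : normedModType R} (f : X -> R) : Prop :=
  forall ds : seq X, continuous (iD ds f) /\ forall x v : X, derivable (iD ds f) x v.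

Definition csmooth {R : realType} {X : normedModType R} (f : X -> R[i]) : Prop :=
  rsmooth (cRe f) /\ rsmooth (cIm f).

Definition ciD {R : realType} {X : normedModType R} (ds : seq X) (f : X -> R[i])
  : X -> R[i] := fun x => iD ds (cRe f) x +i* iD ds (cIm f) x.

Definition mabs {n : nat} (al : 'I_n -> nat) : nat := (\sum_(i < n) al i)%N.
Definition mfact {n : nat} (al : 'I_n -> nat) : nat := (\prod_(i < n) (al i)`!)%N.
Definition mpow {R : realType} {n : nat} (x : 'rV[R]_n) (al : 'I_n -> nat) : R :=
  \prod_(i < n) x ord0 i ^+ al i.
(* the list of directions realizing d_x^al *)
Definition mdirs {R : realType} {n : nat} (al : 'I_n -> nat) : seq 'rV[R]_n :=
  flatten [seq nseq (al i) (delta_mx 0 i : 'rV[R]_n) | i <- enum 'I_n].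

(* multi-indices with entries <= m : enough to index all (al,be) with |al|+|be| <= m *)
Definition midx (n m : nat) := {ffun 'I_n -> 'I_m.+1}.
Definition mi {n m : nat} (al : midx n m) : 'I_n -> nat := fun i => nat_of_ord (al i).

Definition Pop {R : realType} {n m : nat} (cP : midx n m -> midx n m -> R)
  (u : 'rV[R]_n -> R[i]) : 'rV[R]_n -> R[i] :=
  fun x => \sum_(al : midx n m) \sum_(be : midx n m | (mabs (mi al) + mabs (mi be) <= m)%N)
     (cP al be * mpow x (mi be))%:C * ciD (mdirs (mi al)) u x.

(* formal adjoint (the coefficients are real):
   P^* u = sum c_{al,be} (-1)^{|al|} d_x^al (x^be u) *)
Definition Pstar {R : realType} {n m : nat} (cP : midx n m -> midx n m -> R)
  (u : 'rV[R]_n -> R[i]) : 'rV[R]_n -> R[i] :=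
  fun x => \sum_(al : midx n m) \sum_(be : midx n m | (mabs (mi al) + mabs (mi be) <= m)%N)
     (cP al be * (-1) ^+ mabs (mi al))%:C *
       ciD (mdirs (mi al)) (fun y => (mpow y (mi be))%:C * u y) x.

Definition P_selfadjoint {R : realType} {n m : nat} (cP : midx n m -> midx n m -> R) :=
  forall u : 'rV[R]_n -> R[i], csmooth u -> forall x, Pop cP u x = Pstar cP u x.

Definition P_globally_elliptic {R : realType} {n m : nat}
  (cP : midx n m -> midx n m -> R) :=
  forall x xi : 'rV[R]_n, ~~ ((x == 0) && (xi == 0)) ->
    \sum_(al : midx n m) \sum_(be : midx n m | (mabs (mi al) + mabs (mi be) == m)%N)
       (cP al be * mpow x (mi be) * mpow xi (mi al))%:C * ci ^+ mabs (mi al) != 0.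

(* Integration over R^n (iterated Lebesgue integrals, Fubini/Tonelli)  *)

Definition rupd {R : realType} {n : nat} (x : 'rV[R]_n) (k : nat) (s : R) : 'rV[R]_n :=
  \row_j (if (nat_of_ord j == k)%N then s else x ord0 j).

Fixpoint iterint {R : realType} {n : nat} (k : nat) (g : 'rV[R]_n -> R) (x : 'rV[R]_n)
  : R :=
  if k is k'.+1 then
    Rintegral lebesgue_measure setT (fun s : R => iterint k' g (rupd x k' s))
  else g x.

Fixpoint eiterint {R : realType} {n : nat} (k : nat) (g : 'rV[R]_n -> \bar R)
  (x : 'rV[R]_n) : \bar R :=
  if k is k'.+1 then
    (\int[lebesgue_measure]_(s in setT) eiterint k' g (rupd x k' s))%E
  else g x.

Definition intRn {R : realType} {n : nat} (g : 'rV[R]_n -> R) : R := iterint n g 0.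
Definition intC {R : realType} {n : nat} (g : 'rV[R]_n -> R[i]) : R[i] :=
  intRn (cRe g) +i* intRn (cIm g).
Definition L2norm2 {R : realType} {n : nat} (g : 'rV[R]_n -> R[i]) : \bar R :=
  eiterint n (fun x => ((cabs (g x)) ^+ 2)%:E) 0.

Definition eigen_system {R : realType} {n m : nat} (cP : midx n m -> midx n m -> R)
  (lam : nat -> R) (phi : nat -> 'rV[R]_n -> R[i]) : Prop :=
  [/\ (forall j, csmooth (phi j)),
      (forall j x, Pop cP (phi j) x = (lam j)%:C * phi j x),
      (forall j, L2norm2 (phi j) = 1%E),
      (forall j k, j <> k -> intC (fun x => phi j x * cconj (phi k x)) = 0) &
      (forall g : 'rV[R]_n -> R[i],
          continuous (cRe g) -> continuous (cIm g) -> (L2norm2 g < +oo)%E ->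
          (forall j, intC (fun x => g x * cconj (phi j x)) = 0) ->
          forall x, g x = 0)].

Definition periodic2pi {R : realType} {T : Type} (f : R -> T) : Prop :=
  forall t, f (t + 2 * pi) = f t.

Definition gevrey_T {R : realType} (a : R -> R) : Prop :=
  [/\ periodic2pi a, @rsmooth R R^o a &
      exists s : R, 1 <= s /\ exists C K : R, 0 < C /\
        forall (k : nat) (t : R),
          `|@iD R R^o (nseq k 1) a t| <= K * C ^+ k * (k`!)%:R `^ s].

(* int_0^t f   (t >= 0) *)
Definition prim {R : realType} (f : R -> R) (t : R) : R :=
  Rintegral lebesgue_measure `[0, t] f.

Definition cmean {R : realType} (a b : R -> R) : R[i] :=
  ((2 * pi)^-1 * prim a (2 * pi)) +i* ((2 * pi)^-1 * prim b (2 * pi)).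

Definition cint02pi {R : realType} (g : R -> R[i]) : R[i] :=
  Rintegral lebesgue_measure `[0, 2 * pi] (cRe g)
  +i* Rintegral lebesgue_measure `[0, 2 * pi] (cIm g).

(* functions on T x R^n = functions on R x R^n, 2pi-periodic in t       *)

Definition dirt {R : realType} {n : nat} : R * 'rV[R]_n := (1, 0).
Definition xdirs {R : realType} {n : nat} (be : 'I_n -> nat) : seq (R * 'rV[R]_n) :=
  [seq (0, v) | v <- mdirs be].

Definition GS {R : realType} {n : nat} (sigma mu : R) (u : R * 'rV[R]_n -> R[i]) : Prop :=
  [/\ csmooth u, (forall t x, u (t + 2 * pi, x) = u (t, x)) &
      exists C K : R, 0 < C /\
        forall (al be : 'I_n -> nat) (ga : nat) (t : R) (x : 'rV[R]_n),
          `|mpow x al| * cabs (ciD (xdirs be ++ nseq ga dirt) u (t, x))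
            <= K * C ^+ (mabs al + mabs be + ga) * (ga`!)%:R `^ sigma
                 * ((mfact al * mfact be)%N)%:R `^ mu].

Definition Fmu {R : realType} {n : nat} (mu : R) (u : R * 'rV[R]_n -> R[i]) : Prop :=
  exists sigma : R, 1 < sigma /\ GS sigma mu u.

Definition coef {R : realType} {n : nat} (phi : nat -> 'rV[R]_n -> R[i])
  (j : nat) (u : R * 'rV[R]_n -> R[i]) (t : R) : R[i] :=
  intC (fun x => u (t, x) * cconj (phi j x)).

(* L u = D_t u + c(t) P u,  D_t = i^{-1} d_t *)
Definition Lop {R : realType} {n m : nat} (cP : midx n m -> midx n m -> R)
  (a b : R -> R) (u : R * 'rV[R]_n -> R[i]) : R * 'rV[R]_n -> R[i] :=
  fun p => - ci * ciD [:: dirt] u p + (a p.1 +i* b p.1) * Pop cP (fun y => u (p.1, y)) p.2.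

Definition Zset {R : realType} (lam : nat -> R) (a b : R -> R) : set nat :=
  [set j | exists k : int, (lam j)%:C * cmean a b = k%:~R].

Definition E_L {R : realType} {n : nat} (lam : nat -> R) (phi : nat -> 'rV[R]_n -> R[i])
  (a b : R -> R) (mu : R) (f : R * 'rV[R]_n -> R[i]) : Prop :=
  Fmu mu f /\
  forall j, Zset lam a b j ->
    cint02pi (fun t => cexp (ci * (lam j)%:C * (prim a t +i* prim b t)) * coef phi j f t) = 0.

Definition globally_solvable {R : realType} {n m : nat} (cP : midx n m -> midx n m -> R)
  (lam : nat -> R) (phi : nat -> 'rV[R]_n -> R[i]) (a b : R -> R) (mu : R) : Prop :=
  forall f, E_L lam phi a b mu f ->
    exists u, Fmu mu u /\ forall p, Lop cP a b u p = f p.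

(* Omega_r = { t in T : int_0^t b > r }, seen in the circle via t |-> (cos t, sin t) *)
Definition Omega {R : realType} (b : R -> R) (r : R) : set (R * R) :=
  (fun t => (cos t, sin t)) @` [set t : R | (0 <= t < 2 * pi) /\ r < prim b t].

(* Main.v *)
(* Since Omega_r is disconnected, a primitive B of b takes, up to the sign of the
   eigenvalues in play, values above rho at points P1 < P2 and below rho near points
   Q1 in (P1, P2) and Q2 outside [P1, P2], all in one period. Take
   f = sum_k kappa(t) exp (- |lam_k| rho - i lam_k C(t)) phi_k(x), where C is a primitive
   of c and kappa a Gevrey function concentrated near Q1 and Q2 with total mean zero.
   The coefficients are exponentially small in |lam_k|, so that f lies in F_mu, and the
   mean condition gives the compatibility conditions. A solution u would satisfy
   (u_k exp (i lam_k C))' = i kappa exp (- |lam_k| rho); integrating from P1 to P2, where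
   exp (i lam_k C) exp (|lam_k| rho) is exponentially small, gives
   |int_P1^P2 kappa| <= K exp (- eta |lam_k|), which is absurd as |lam_k| is unbounded.

   No spectral theory of P is used. In Hermite coefficients, the anti-Wick symbol of
   P^* P shows that the form |P u|^2 dominates the m-th power of the harmonic oscillator
   up to a multiple of |u|^2, and conjugation by the weights q^|a| (Agmon's method)
   gives |u_a| <= q^(|a| - M) with q < 1 and M^m of the order of 1 + lam^2; hence
   the eigenfunctions satisfy S_1/2 estimates with losses exp (eta |lam|). Orthonormality
   then forces |lam_k| to be unbounded on an infinite set of indices. *)
Require Import Defs.
From HB Require Import structures.
From mathcomp Require Import all_boot all_order all_algebra.
From mathcomp Require Import all_classical all_reals all_analysis.
From mathcomp Require Import measurable_realfun.
From mathcomp Require Import ring lra zify.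
From mathcomp.real_closed Require Import complex.
Import Order.TTheory GRing.Theory Num.Theory.
Import numFieldNormedType.Exports.
Local Open Scope ring_scope.
Local Open Scope classical_set_scope.

Set Implicit Arguments.
Unset Strict Implicit.
Unset Printing Implicit Defensive.

(** * Ladder operators, anti-Wick symbols and Agmon estimates *)

Section ExpBounds.
Context {R : realType}.

(** About the eigenfunctions only smoothness, the eigenvalue equation, orthonormality and
    completeness are given, and no decay. This shapes the analytic half: operator identities reach
    the Hermite coefficients through cutoffs removed in a limit, Agmon's weight is applied to
    truncated sequences, and only the decay so obtained justifies Hermite series, pointwise bounds
    and integrations by parts. The Agmon rate q may be any number of an interval [rho0, 1) that does
    not depend on the eigenvalue, and [2 <= m] makes M at most linear in |lambda|. The loss q^(-M)
    is therefore exp (eta |lambda|) with eta as small as desired. This smallness is decisive twice: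
    the coefficients of f decay at a rate fixed by the gap between the levels, and so does the
    factor gained at P1 and P2; each gain has to absorb the loss. Anti-Wick symbols are used because
    a nonnegative symbol gives a nonnegative form at once, by positivity of Gaussian means. On
    polynomials these means are a purely algebraic functional, so no integral over C^n is formed. *)

Lemma exprn_le_fact_expR (n : nat) (x : R) : 0 <= x -> x ^+ n <= n`!%:R * expR x.
Proof.
move=> x0; have f0 : 0 < (n`!)%:R :> R by rewrite ltr0n fact_gt0.
case: n f0 => [|n] f0.
  by rewrite expr0 mul1r (le_trans _ (expR_ge1Dx x))// lerDl.
rewrite mulrC -ler_pdivrMr//; apply: le_trans (expR_ge1Dxn n x0).
by rewrite lerDr.
Qed.

End ExpBounds.

(* The functional s^p |-> p! is integration against exp(-s) on the half line:
   the antiderivative of exp(-s) s^p is - exp(-s) sum_(j <= p) p!/j! s^j. *)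
Section FactorialMoments.
Context {R : realType}.

Definition fmom_poly (p : nat) : {poly R} := \poly_(j < p.+1) (p`!%:R / j`!%:R).

Lemma fmom_poly0 p : (fmom_poly p).[0] = p`!%:R.
Proof. by rewrite horner_coef0 coef_poly /= fact0 divr1. Qed.

Lemma fmom_poly_ode p : deriv (fmom_poly p) = fmom_poly p - 'X^p.
Proof.
apply/polyP => j; rewrite coef_deriv coefB coefXn !coef_poly.
have fj k : (k`!)%:R != 0 :> R by rewrite pnatr_eq0 -lt0n fact_gt0.
case: (ltngtP j p) => [jp|jp|->].
- rewrite !ltnS jp (ltnW jp) subr0 -[_ *+ j.+1]mulr_natr factS natrM.
  by field; rewrite fj nat1r pnatr_eq0.
- by rewrite !ltnS [(j < p)%N]ltnNge (ltnW jp) [(j <= p)%N]leqNgt jp/= mul0rn subr0.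
- by rewrite !ltnS ltnn leqnn mul0rn divff// subrr.
Qed.

Lemma horner_bound (p : {poly R}) (s : R) : 1 <= s ->
  `|p.[s]| <= (\sum_(j < size p) `|p`_j|) * s ^+ size p.
Proof.
move=> s1; rewrite horner_coef (le_trans (ler_norm_sum _ _ _))//.
rewrite mulr_suml; apply: ler_sum => j _.
rewrite normrM ler_wpM2l// ger0_norm ?exprn_ge0 ?(le_trans _ s1)//.
by rewrite ler_weXn2l// ltnW.
Qed.

Lemma poly_expRN_small (p : {poly R}) (e : R) : 0 < e ->
  exists2 s, 0 <= s & `|p.[s] * expR (- s)| < e.
Proof.
move=> e0; pose K := \sum_(j < size p) `|p`_j|; pose d := size p.
have K0 : 0 <= K by apply: sumr_ge0.
(* From s^(d+1) <= (d+1)! exp s, the quantity K s^d exp (- s) is at most K (d+1)! / s, which this s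
   makes smaller than e. *)
pose s := 1 + K * (d.+1)`!%:R / e.
have s1 : 1 <= s by rewrite lerDl divr_ge0 ?mulr_ge0// ltW.
have s0 : 0 < s by apply: lt_le_trans s1.
exists s; first exact: ltW.
rewrite normrM (ger0_norm (expR_ge0 _)).
apply: (@le_lt_trans _ _ (K * s ^+ d * expR (- s))).
  by rewrite ler_wpM2r ?expR_ge0// horner_bound.
have := exprn_le_fact_expR d.+1 (ltW s0); rewrite exprS => h.
rewrite expRN ltr_pdivrMr ?expR_gt0//.
have h2 : K * (d.+1)`!%:R < e * s.
  by rewrite /s mulrDr mulr1 [e * (_ / _)]mulrC divfK ?gt_eqF// ltrDr.
rewrite -(ltr_pM2l s0) mulrCA (le_lt_trans (ler_wpM2l K0 h))//.
by rewrite mulrA [ltRHS]mulrA ltr_pM2r ?expR_gt0// [s * e]mulrC.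
Qed.

(** With P the combination of the polynomials [fmom_poly], P exp (- s) has derivative - (sum c s^p)
    exp (- s) <= 0. A negative value at 0 would keep it below a negative constant on the half line,
    whereas it takes arbitrarily small values there. *)
Lemma fact_functional_ge0 (T : Type) (r : seq T) (c : T -> R) (p : T -> nat) :
  (forall s, 0 <= s -> 0 <= \sum_(t <- r) c t * s ^+ p t) ->
  0 <= \sum_(t <- r) c t * (p t)`!%:R.
Proof.
move=> H; pose P : {poly R} := \sum_(t <- r) (c t)%:P * fmom_poly (p t).
have P0 : P.[0] = \sum_(t <- r) c t * (p t)`!%:R.
  rewrite horner_sum; apply: eq_bigr => t _.
  by rewrite hornerM hornerC fmom_poly0.
have dP s : (deriv P).[s] = P.[s] - \sum_(t <- r) c t * s ^+ p t.
  rewrite /P raddf_sum /= !horner_sum -sumrB; apply: eq_bigr => t _.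
  rewrite derivM derivC mul0r add0r fmom_poly_ode !hornerM hornerC hornerD hornerN hornerXn.
  by rewrite mulrDr mulrN.
pose F s := P.[s] * expR (- s).
have dF (s : R) : is_derive s (1 : R) F (- (\sum_(t <- r) c t * s ^+ p t) * expR (- s)).
  have h1 : is_derive s (1:R) (horner P) ((deriv P).[s]).
    by apply: DeriveDef; [exact: derivable_horner|rewrite derivE derive1E].
  have h2 : is_derive s (1:R) (fun s => expR (- s)) (- expR (- s)).
    have -> : (fun s : R => expR (- s)) = expR \o -%R by [].
    apply: is_derive_eq; by rewrite mulrN1.
  apply: (@is_derive_eq _ _ _ (horner P * (fun s => expR (- s)))).
  by rewrite dP /GRing.scale /=; ring.
rewrite -P0 leNgt; apply/negP => Pneg.
have [s s0 hs] := @poly_expRN_small P (- P.[0]) (ltac:(by rewrite oppr_gt0)).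
have : F s <= F 0.
  apply: (@ler0_derive1_le_cc _ F 0 s) => //.

  - move=> x; rewrite in_itv/= => /andP[x0 _]; have [_ h] := dF x.
    rewrite derive1E h mulNr oppr_le0 mulr_ge0 ?expR_ge0 ?H// ltW//.
  - apply: continuous_subspaceT => x; have [h _] := dF x.
    by apply: differentiable_continuous; apply/derivable1_diffP.
  - by rewrite in_itv/= s0 lexx.
  - by rewrite in_itv/= s0 lexx.
rewrite {2}/F oppr0 expR0 mulr1 => FP.
have := ler_norm (- F s); rewrite normrN => h.
have := le_lt_trans h hs; rewrite ltrN2 => /(le_lt_trans FP).
by rewrite ltxx.
Qed.

End FactorialMoments.

(** * Positivity of Gaussian moments on C^n *)

Section ComplexMoments.
Context {R : realType}.
Local Notation C := R[i].
Local Open Scope complex_scope.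

Lemma unity_root_exists N : (0 < N)%N -> exists w : C, N.-primitive_root w.
Proof.
move=> N0; pose p : {poly C} := 'X^N - 1; have [r Dp] := closed_field_poly_normal p.
move: Dp; rewrite lead_coefDl ?lead_coefXn ?size_polyXn ?size_polyN ?size_poly1 ?ltnS//.
rewrite scale1r => Dp.
have rn1 : all N.-unity_root r by apply/allP => z; rewrite -root_prod_XsubC -Dp.
have sz_r : (N < (size r).+1)%N.
  by rewrite -(size_prod_XsubC r id) -Dp size_XnsubC.
have [|z] := hasP (cyclic.has_prim_root N0 rn1 _ sz_r); last by exists z.
rewrite -separable.separable_prod_XsubC -Dp cyclotomic.separable_Xn_sub_1//.
by rewrite pnatr_eq0 -lt0n.
Qed.

Lemma unity_root_conj N (w : C) : N.-primitive_root w -> conjc w = w^-1.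
Proof.
move=> pw; have wN := prim_expr_order pw; have N0 := prim_order_gt0 pw.
have nw : `|w| = 1.
  apply/eqP; rewrite -(@pexpr_eq1 _ _ N)//; first by rewrite -normrX wN normr1.
have w0 : w != 0 by rewrite -normr_eq0 nw oner_eq0.
apply: (mulfI w0); rewrite divff// -sqr_normc nw expr1n//.
Qed.

Lemma Re_sum (T : Type) (r : seq T) (F : T -> C) :
  complex.Re (\sum_(t <- r) F t) = \sum_(t <- r) complex.Re (F t).
Proof.
elim: r => [|t r IH]; first by rewrite !big_nil.
by rewrite !big_cons -IH; case: (F t) (\sum_(j <- r) F j) => [a b] [c d].
Qed.

Lemma Re_realM (x : R) (z : C) : complex.Re (x%:C * z) = x * complex.Re z.
Proof. by case: z => a b /=; rewrite mul0r subr0. Qed.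

Lemma Re_Mreal (x : R) (z : C) : complex.Re (z * x%:C) = x * complex.Re z.
Proof. by rewrite mulrC Re_realM. Qed.

Lemma conjc_realM (x : R) (z : C) : conjc (x%:C * z) = x%:C * conjc z.
Proof. by case: z => a b; rewrite /GRing.mul /=; congr (_ +i* _); ring. Qed.

Lemma Re_Mnat (k : nat) (z : C) : complex.Re (z * k%:R) = k%:R * complex.Re z.
Proof. by rewrite -Re_Mreal rmorph_nat. Qed.

(** Averaging over roots of unity replaces the angular integral. N exceeds both exponents, so that
    congruence modulo N is equality. *)
Lemma sum_root_unity N (w x : C) (p q : nat) : N.-primitive_root w ->
  (p < N)%N -> (q < N)%N ->
  \sum_(l < N) (w ^+ l) ^+ p * (conjc (w ^+ l)) ^+ q = (p == q)%:R * N%:R.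
Proof.
move=> pw pN qN; have w0 : w != 0 by rewrite (prim_root_eq0 pw) -lt0n (prim_order_gt0 pw).
pose y := w ^+ p / w ^+ q.
have E l : (w ^+ l) ^+ p * (conjc (w ^+ l)) ^+ q = y ^+ l.
  rewrite (rmorphXn (@conjc R)) /= (unity_root_conj pw) /y expr_div_n -!exprM [(p * l)%N]mulnC.
  by rewrite exprVn [(q * l)%N]mulnC.
under eq_bigr do rewrite E.
have [epq|npq] := eqVneq p q.
  rewrite /y epq divff ?expf_neq0//; under eq_bigr do rewrite expr1n.
  by rewrite sumr_const card_ord mul1r.
have y1 : y - 1 != 0.
  rewrite subr_eq0; apply/eqP => y1; move: npq; rewrite -[p](modn_small pN).
  rewrite -[q](modn_small qN) -(eq_prim_root_expr pw); apply/negP; rewrite negbK; apply/eqP.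
  by apply: (mulIf (invr_neq0 (expf_neq0 q w0))); rewrite divff ?expf_neq0.
apply: (mulfI y1); rewrite mul0r mulr0 -subrX1 /y expr_div_n -!exprM ![(_ * N)%N]mulnC.
by rewrite !exprM (prim_expr_order pw) !expr1n divr1 subrr.
Qed.

(** The functional z^p conj(z)^q |-> [p = q] p! is the mean for the complex Gaussian, taken in polar
    form. At z = sqrt s w^l the average over l leaves the terms with p = q, as powers s^p, and the
    radial functional s^p |-> p! is already known to be positive. *)
Lemma moment_ge0_1 (T : eqType) (r : seq T) (c : T -> C) (p q : T -> nat) :
  (forall z : C, 0 <= complex.Re (\sum_(t <- r) c t * (z ^+ p t * (conjc z) ^+ q t))) ->
  0 <= complex.Re (\sum_(t <- r) c t * ((p t == q t)%:R * (p t)`!%:R)).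
Proof.
move=> H; pose N := (\max_(t <- r) (p t + q t)).+1.
have pN t : t \in r -> (p t < N)%N /\ (q t < N)%N.
  move=> tr; rewrite /N !ltnS; have := @leq_bigmax_seq _ r xpredT (fun t => p t + q t)%N t tr isT.
  by move=> h; split; apply: leq_trans h; [exact: leq_addr|exact: leq_addl].
have [w pw] := @unity_root_exists N isT.
rewrite Re_sum (_ : \sum_(t <- r) _ =
   \sum_(t <- r) complex.Re (c t * (p t == q t)%:R) * (p t)`!%:R); last first.
  by apply: eq_bigr => t _; rewrite [X in complex.Re X]mulrA [LHS]Re_Mnat mulrC.
apply: fact_functional_ge0 => s s0.
have N0 : (0 : R) < N%:R by rewrite ltr0n.
rewrite -(pmulr_rge0 _ N0).
have -> : N%:R * (\sum_(t <- r) complex.Re (c t * (p t == q t)%:R) * s ^+ p t) =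
   \sum_(l < N) complex.Re (\sum_(t <- r) c t *
     ((((Num.sqrt s)%:C * w ^+ l)) ^+ p t * (conjc ((Num.sqrt s)%:C * w ^+ l)) ^+ q t)).
  rewrite -Re_sum exchange_big /= mulr_sumr Re_sum !big_seq.
  apply: eq_bigr => t /pN [ptN qtN]; rewrite -mulr_sumr.
  under eq_bigr do rewrite conjc_realM !exprMn mulrACA.
  rewrite -mulr_sumr (sum_root_unity _ pw)//.
  case: eqP => [<-|_]; last by rewrite !(mul0r,mulr0).
  rewrite -exprMn -rmorphM /= -expr2 sqr_sqrtr// -rmorphXn /= mul1r.
  rewrite mulr1 [X in _ = complex.Re X]mulrA [RHS]Re_Mnat Re_Mreal.
  by rewrite [s ^+ _ * _]mulrC.
by apply: sumr_ge0 => l _; exact: H.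
Qed.

Lemma moment_ge0 (n : nat) (T : eqType) (r : seq T) (c : T -> R)
    (p q : T -> 'I_n -> nat) :
  (forall z : 'I_n -> C, 0 <= complex.Re
     (\sum_(t <- r) (c t)%:C * \prod_i (z i ^+ p t i * conjc (z i) ^+ q t i))) ->
  0 <= \sum_(t <- r) c t * \prod_i ((p t i == q t i)%:R * (p t i)`!%:R).
Proof.
move=> H.
pose mom t i : C := (p t i == q t i)%:R * (p t i)`!%:R.
(* Coordinates are integrated one at a time: those in [s] are replaced by their moments, the others
   still carry the free variable z. *)
suff G : forall (s : seq 'I_n), uniq s -> forall z : 'I_n -> C, 0 <= complex.Re
   (\sum_(t <- r) (c t)%:C * \prod_i (if i \in s then mom t i else
        z i ^+ p t i * conjc (z i) ^+ q t i)).
  have := G (enum 'I_n) (enum_uniq _) (fun=> 0); rewrite Re_sum.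
  congr (_ <= _); apply: eq_bigr => t _; rewrite Re_realM; congr (_ * _).
  under eq_bigr do rewrite mem_enum /= /mom.
  suff -> : \prod_i ((p t i == q t i)%:R * (p t i)`!%:R) =
     (\prod_i ((p t i == q t i)%:R * (p t i)`!%:R) : R)%:C by [].
  by rewrite rmorph_prod; apply: eq_bigr => i _; rewrite rmorphM /= !rmorph_nat.
elim=> [_ z|k s IH /= /andP[ks us] z].
  exact: H.
pose rest t : C := \prod_(i | i != k) (if i \in s then mom t i else
        z i ^+ p t i * conjc (z i) ^+ q t i).
have := @moment_ge0_1 T r (fun t => (c t)%:C * rest t) (fun t => p t k) (fun t => q t k).
have E x : \sum_(t <- r) ((c t)%:C * rest t) * x t = \sum_(t <- r) (c t)%:C * (x t * rest t).
  by apply: eq_bigr => t _; rewrite -mulrA [rest t * _]mulrC.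
rewrite E => G; apply: (le_trans (G _)) => [y|].
  rewrite (E (fun t => _)); have := IH us (fun i => if i == k then y else z i).
  congr (_ <= complex.Re _); apply: eq_bigr => t _; congr (_ * _).
  rewrite (bigD1 k isT) (negbTE ks) eqxx; congr (_ * _).
  by apply: eq_bigr => i ik; rewrite (negbTE ik).
rewrite le_eqVlt; apply/orP; left; apply/eqP; congr (complex.Re _).
apply: eq_bigr => t _; congr (_ * _).
rewrite [RHS](bigD1 k)//= in_cons eqxx; congr (_ * _).
by apply: eq_bigr => i ik; rewrite in_cons (negbTE ik).
Qed.

End ComplexMoments.

(* Anti-Wick calculus: a word in the ladder operators a_i (letter [(true, i)]) and
   a_i^* (letter [(false, i)]) acting on sequences indexed by N^n has an anti-Wick
   symbol, a polynomial in conj z (first multi-index) and z (second one). *)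
Section LadderWords.
Context {R : realType} {n : nat}.
Local Notation C := R[i].
Local Open Scope complex_scope.

Definition idx := {ffun 'I_n -> nat}.
Definition up (a : idx) (i : 'I_n) : idx := [ffun k => (a k + (k == i))%N].
(** When [a i = 0] the truncated subtraction leaves [a] unchanged; this is harmless where the factor
    sqrt (a i) accompanies it. *)
Definition dn (a : idx) (i : 'I_n) : idx := [ffun k => (a k - (k == i))%N].
Definition wt (a : idx) : nat := (\sum_i a i)%N.
Definition zidx : idx := [ffun=> 0%N].
Definition word := seq (bool * 'I_n).

Definition act1 (l : bool * 'I_n) (f : idx -> R) : idx -> R := fun a =>
  if l.1 then Num.sqrt (a l.2).+1%:R * f (up a l.2)
  else Num.sqrt (a l.2)%:R * f (dn a l.2).
Definition actw (w : word) (f : idx -> R) : idx -> R := foldr act1 f w.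
Definition actL (L : seq (R * word)) (f : idx -> R) (a : idx) : R :=
  \sum_(p <- L) p.1 * actw p.2 f a.

Definition delta (a : idx) : idx -> R := fun b => (a == b)%:R.

Definition sym_term := (R * (idx * idx))%type.

(** Anti-Wick order puts the a_i on the left. Prepending a_i multiplies by conj z_i. Prepending
    a_i^* uses a_i^* a_i^k = a_i^k a_i^* - k a_i^(k-1): multiplication by z_i minus the derivative
    in conj z_i. *)
Fixpoint sym (w : word) : seq sym_term :=
  if w is l :: w' then
    if l.1 then [seq (t.1, (up t.2.1 l.2, t.2.2)) | t : sym_term <- sym w']
    else [seq (t.1, (t.2.1, up t.2.2 l.2)) | t : sym_term <- sym w'] ++
         [seq (- t.1 * (t.2.1 l.2)%:R, (dn t.2.1 l.2, t.2.2)) | t : sym_term <- sym w']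
  else [:: (1, (zidx, zidx))].

Definition zmon (z : 'I_n -> C) (t : sym_term) : C :=
  t.1%:C * \prod_i (z i ^+ t.2.2 i * conjc (z i) ^+ t.2.1 i).
Definition ev (z : 'I_n -> C) (s : seq sym_term) : C := \sum_(t <- s) zmon z t.
Definition evL (z : 'I_n -> C) (L : seq (R * word)) : C :=
  \sum_(p <- L) p.1%:C * ev z (sym p.2).

(** Mean of z^p conj(z)^q for the standard complex Gaussian. *)
Definition mom1 (p q : nat) : R := (p == q)%:R * p`!%:R.
Definition mom (p q : 'I_n -> nat) : R := \prod_i mom1 (p i) (q i).
Definition sqf (a : idx) : R := \prod_i Num.sqrt (a i)`!%:R.

Lemma sqf_gt0 a : 0 < sqf a.
Proof. by apply: prodr_gt0 => i _; rewrite sqrtr_gt0 ltr0n fact_gt0. Qed.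

Lemma sqf_up a i : sqf (up a i) = Num.sqrt (a i).+1%:R * sqf a.
Proof.
rewrite /sqf (bigD1 i isT) [in RHS](bigD1 i isT) /= ffunE eqxx addn1 factS natrM.
rewrite sqrtrM ?ler0n// -mulrA; congr (_ * (_ * _)).
by apply: eq_bigr => k /negbTE ki; rewrite ffunE ki addn0.
Qed.

Lemma up_dn (a : idx) (i : 'I_n) : (0 < a i)%N -> up (dn a i) i = a.
Proof.
move=> ai; apply/ffunP => k; rewrite !ffunE; case: eqP => [->|_]; first by rewrite subnK.
by rewrite subn0 addn0.
Qed.

Lemma dn_up a i : dn (up a i) i = a.
Proof. by apply/ffunP => k; rewrite !ffunE addnK. Qed.

(** Gaussian integration by parts: the mean of z F is the mean of the derivative of F in conj z.
    That derivative falls either on conj(z)^k, which comes from the symbol, or on conj(z)^b, which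
    comes from the vector. *)
Lemma mom1_contract (k l a b : nat) :
  b%:R * mom1 (l + a) (k + (b - 1)) =
  mom1 (l + 1 + a) (k + b) - k%:R * mom1 (l + a) (k - 1 + b).
Proof.
rewrite /mom1; case: b => [|b]; case: k => [|k].
- by rewrite !mul0r subr0 addn0 addn1 addSn mul0r.
- rewrite mul0r !addn0 addn1 addSn eqSS subn1 /=.
  case: eqP => [->|_]; last by rewrite !(mul0r, mulr0) subr0.
  by rewrite !mul1r factS natrM subrr.
- rewrite mul0r subr0 !subn1 !add0n /= addn1 addSn eqSS.
  case: eqP => [->|_]; last by rewrite !(mul0r, mulr0).
  by rewrite !mul1r factS natrM.
- rewrite !subn1 /= addn1 !addSn !addnS eqSS.
  have [->|_] := eqVneq (l + a)%N (k + b).+1; last by rewrite !(mul0r, mulr0) subr0.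
  rewrite !mul1r [(k + b).+2`!]factS natrM -mulrBl; congr (_ * _).
  suff -> : ((k + b).+2 = k.+1 + b.+1)%N by rewrite natrD addrAC subrr add0r.
  by lia.
Qed.

Lemma mom_contract (k l a b : idx) (i : 'I_n) :
  (b i)%:R * mom (fun j => l j + a j)%N (fun j => k j + dn b i j)%N =
  mom (fun j => up l i j + a j)%N (fun j => k j + b j)%N -
  (k i)%:R * mom (fun j => l j + a j)%N (fun j => dn k i j + b j)%N.
Proof.
rewrite /mom !(bigD1 i isT) /= !ffunE eqxx.
pose Q := \prod_(j | j != i) mom1 (l j + a j) (k j + b j).
have -> : \prod_(j | j != i) mom1 (l j + a j) (k j + dn b i j) = Q.
  by apply: eq_bigr => j /negbTE ji; rewrite !ffunE ji subn0.
have -> : \prod_(j | j != i) mom1 (up l i j + a j) (k j + b j) = Q.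
  by apply: eq_bigr => j /negbTE ji; rewrite !ffunE ji addn0.
have -> : \prod_(j | j != i) mom1 (l j + a j) (dn k i j + b j) = Q.
  by apply: eq_bigr => j /negbTE ji; rewrite !ffunE ji subn0.
rewrite -[nat_of_bool true]/1%N [LHS]mulrA mom1_contract mulrBl.
by rewrite -[_ * mom1 _ _ * Q]mulrA.
Qed.

(** Fock space picture: the basis vector of index a is z^a / sqrt (a!), and a matrix entry of a word
    is the Gaussian mean of its symbol against z^a conj(z)^b. The factor [sqf a * sqf b] clears the
    denominators. *)
Lemma actw_delta_moment (w : word) (a b : idx) :
  actw w (delta a) b * (sqf a * sqf b) =
  \sum_(t <- sym w) t.1 * mom (fun i => t.2.2 i + a i)%N (fun i => t.2.1 i + b i)%N.
Proof.
elim: w b => [|[[] i] w IH] b /=.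
- rewrite big_seq1 /= mul1r /delta; have [<-|/eqP nab] := eqVneq a b.
    rewrite mul1r /sqf /mom -big_split /=; apply: eq_bigr => i _.
    by rewrite !ffunE /mom1 eqxx mul1r -expr2 sqr_sqrtr ?ler0n.
  rewrite mul0r; apply/esym/eqP; rewrite /mom prodf_seq_eq0; apply/hasP.
  have [i nabi] : exists i, a i != b i.
    by apply/existsP; rewrite -negb_forall; apply/negP => /forallP h; apply: nab;
      apply/ffunP => i; apply/eqP/h.
  exists i; first by rewrite mem_index_enum.
  by rewrite /= /mom1 !ffunE !add0n (negbTE nabi) mul0r.
- rewrite /act1 /= big_map /= -[_ * _ * _]mulrA [_ * (sqf a * _)]mulrC [_ * (_ * _)]mulrA.
  rewrite [_ * (sqf a * sqf b)]mulrCA -sqf_up mulrC IH.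
  apply: eq_bigr => t _; congr (_ * _); apply: eq_bigr => j _; congr mom1.
  by rewrite !ffunE addnAC addnA addnAC.
- rewrite /act1 /= big_cat !big_map /= -[RHS]big_split /=.
  have [bi0|bi0] := posnP (b i).
    rewrite bi0 sqrtr0 !mul0r big1_seq// => t _.
    by rewrite mulNr -mulrN -mulrA -mulrDr mulNr -mom_contract bi0 mul0r mulr0.
  have Eb : sqf b = Num.sqrt (b i)%:R * sqf (dn b i).
    by rewrite -{1}(up_dn bi0) sqf_up ffunE eqxx subn1 prednK.
  transitivity ((b i)%:R * (actw w (delta a) (dn b i) * (sqf a * sqf (dn b i)))).
    rewrite Eb -[X in _ = X * _](@sqr_sqrtr _ (b i)%:R) ?ler0n//; ring.
  rewrite IH mulr_sumr; apply: eq_bigr => t _.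
  by rewrite mulrCA mom_contract mulrBr mulNr mulNr -mulrA.
Qed.

Definition ofbox N (b : {ffun 'I_n -> 'I_N}) : idx := [ffun i => nat_of_ord (b i)].

Lemma actw_lin (w : word) (I : Type) (r : seq I) (c : I -> R) (f : I -> idx -> R) b :
  actw w (fun a => \sum_(i <- r) c i * f i a) b = \sum_(i <- r) c i * actw w (f i) b.
Proof.
elim: w b => [//|l w IH] b /=.
by rewrite /act1; case: l.1; rewrite IH mulr_sumr; apply: eq_bigr => i _; rewrite mulrCA.
Qed.

Lemma actw_ext (w : word) (f g : idx -> R) : f =1 g -> actw w f =1 actw w g.
Proof. by move=> fg; elim: w => [//|l w IH] b /=; rewrite /act1 !IH. Qed.

Lemma ofbox_inj N : injective (@ofbox N).
Proof.
move=> a b /ffunP h; apply/ffunP => i; apply/val_inj.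
by have := h i; rewrite !ffunE.
Qed.

Lemma ofbox_onto N (a : idx) : (forall i, a i < N)%N -> exists b : {ffun 'I_n -> 'I_N}, ofbox b = a.
Proof.
move=> h; exists [ffun i => Ordinal (h i)].
by apply/ffunP => i; rewrite !ffunE.
Qed.

Lemma box_decomp N (v : idx -> R) : (forall a, v a != 0 -> forall i, (a i < N)%N) ->
  v =1 fun b => \sum_(a : {ffun 'I_n -> 'I_N}) v (ofbox a) * delta (ofbox a) b.
Proof.
move=> h b; have [vb|vb] := eqVneq (v b) 0.
  rewrite vb big1// => a _; rewrite /delta; case: eqP => [->|_]; last by rewrite mulr0.
  by rewrite vb mul0r.
have [c cb] := ofbox_onto (h b vb).
rewrite (bigD1 c)//= /delta cb eqxx mulr1 big1 ?addr0// => a ac.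
case: eqP => [e|_]; last by rewrite mulr0.
by move: ac; rewrite (@ofbox_inj _ a c) ?eqxx// cb.
Qed.

(** The form of L at v is the Gaussian mean of its symbol times |F|^2, where F(z) is the sum of v_a
    z^a / sqrt (a!). The support condition makes F a polynomial, within reach of the moment
    functional. *)
Lemma antiWick_form_ge0 N (L : seq (R * word)) (v : idx -> R) :
  (forall z, 0 <= complex.Re (evL z L)) ->
  (forall a, v a != 0 -> forall i, (a i < N)%N) ->
  0 <= \sum_(b : {ffun 'I_n -> 'I_N}) v (ofbox b) * actL L v (ofbox b).
Proof.
move=> L0 vN; pose S := flatten [seq [seq (p.1 * t.1, t.2) | t <- sym p.2] | p <- L].
have evS z : evL z L = ev z S.
  rewrite /ev /S big_flatten /= big_map; apply: eq_bigr => p _.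
  rewrite /ev mulr_sumr big_map; apply: eq_bigr => t _.
  by rewrite /zmon /= rmorphM /= mulrA.
pose B := {ffun 'I_n -> 'I_N}.
pose cf (x : (B * B) * sym_term) : R :=
  v (ofbox x.1.1) / sqf (ofbox x.1.1) * (v (ofbox x.1.2) / sqf (ofbox x.1.2)) * x.2.1.
have := @moment_ge0 R n _ [seq (ab, t) | ab <- index_enum (B * B)%type, t <- S] cf
  (fun x i => x.2.2.2 i + ofbox x.1.1 i)%N (fun x i => x.2.2.1 i + ofbox x.1.2 i)%N.
have E : \sum_(t <- [seq (ab, t) | ab <- index_enum (B * B)%type, t <- S])
    cf t * (\prod_i (((t.2.2.2 i + ofbox t.1.1 i)%N == (t.2.2.1 i + ofbox t.1.2 i)%N)%:R *
         (t.2.2.2 i + ofbox t.1.1 i)`!%:R)) =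
    \sum_(b : B) v (ofbox b) * actL L v (ofbox b).
  rewrite big_allpairs /=.
  rewrite (eq_bigr (fun ab : B * B => v (ofbox ab.1) * v (ofbox ab.2) *
      actL L (delta (ofbox ab.1)) (ofbox ab.2))); last first.
    move=> [a b] _ /=; rewrite /S big_flatten big_map /= /actL mulr_sumr.
    apply: eq_bigr => p _; rewrite big_map /=.
    have := actw_delta_moment p.2 (ofbox a) (ofbox b).
    move=> /(canRL (mulfK _)) ->; last by rewrite gt_eqF// mulr_gt0 ?sqf_gt0.
    rewrite mulrA mulr_suml mulr_sumr; apply: eq_bigr => t _.
    rewrite /cf /mom /mom1 /= invfM; ring.
  rewrite -(pair_big xpredT xpredT (fun a b => v (ofbox a) * v (ofbox b) *
      actL L (delta (ofbox a)) (ofbox b))) /= exchange_big /=.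
  apply: eq_bigr => b _; rewrite /actL mulr_sumr; under eq_bigr do rewrite mulr_sumr.
  rewrite exchange_big /=; apply: eq_bigr => p _.
  rewrite (actw_ext p.2 (box_decomp vN)) actw_lin !mulr_sumr.
  by apply: eq_bigr => a _; ring.
rewrite E; apply => z; rewrite big_allpairs /=.
pose F : C := \sum_(a : B) (v (ofbox a) / sqf (ofbox a))%:C * \prod_i z i ^+ ofbox a i.
have -> : \sum_(ab : B * B) \sum_(t <- S) (cf (ab, t))%:C *
    (\prod_i (z i ^+ (t.2.2 i + ofbox ab.1 i) * conjc (z i) ^+ (t.2.1 i + ofbox ab.2 i))) =
    ev z S * (F * conjc F).
  rewrite /F (rmorph_sum (@conjc R)) big_distrlr /= big_distrr /=.
  rewrite -(pair_big xpredT xpredT (fun a b : B => \sum_(t <- S) (cf ((a, b), t))%:C *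
    (\prod_i (z i ^+ (t.2.2 i + ofbox a i) * conjc (z i) ^+ (t.2.1 i + ofbox b i))))) /=.
  apply: eq_bigr => a _; rewrite big_distrr /=; apply: eq_bigr => b _.
  rewrite /ev mulr_suml; apply: eq_bigr => t _; rewrite /zmon /cf /=.
  rewrite conjc_realM (rmorph_prod (@conjc R)) !rmorphM /=.
  under eq_bigr do rewrite !exprD mulrACA.
  rewrite [in LHS]big_split /= [X in _ * (_ * X) = _]big_split /=.
  under [X in _ = _ * (_ * (_ * X))]eq_bigr do rewrite (rmorphXn (@conjc R)).
  ring.
have -> : F * conjc F = (complex.Re F ^+ 2 + complex.Im F ^+ 2)%:C.
  by case: (F) => x y /=; rewrite /GRing.mul /=; congr (_ +i* _); ring.
by rewrite Re_Mreal mulr_ge0 ?addr_ge0 ?sqr_ge0// -evS.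
Qed.

End LadderWords.

Import ComplexField.Normc.

(** * Growth of symbols and the coercive estimate *)

Section Growth.
Context {R : realType} {n : nat}.
Local Notation C := R[i].
Local Notation idx := (@idx n).
Local Notation word := (@word n).
Local Open Scope complex_scope.

Definition zrad (z : 'I_n -> C) : R := Num.sqrt (\sum_i normc (z i) ^+ 2).

(** Principal symbol: the letters are multiplied as if they commuted. *)
Definition tops (z : 'I_n -> C) (w : word) : C :=
  \prod_(l <- w) (if l.1 then conjc (z l.2) else z l.2).
Definition topL (D : nat) (z : 'I_n -> C) (L : seq (R * word)) : C :=
  \sum_(p <- L) (if size p.2 == D then p.1%:C * tops z p.2 else 0).

Lemma normc_ge0 (x : C) : 0 <= normc x.
Proof. by case: x => a b; exact: sqrtr_ge0. Qed.

Lemma normcX (x : C) k : normc (x ^+ k) = normc x ^+ k.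
Proof. by elim: k => [|k IH]; rewrite ?expr0 ?normc1// !exprS normcM IH. Qed.

Lemma normc_conj (x : C) : normc (conjc x) = normc x.
Proof. by case: x => a b; rewrite /normc /= sqrrN. Qed.

Lemma normc_real (x : R) : normc x%:C = `|x|.
Proof. by rewrite /normc /= expr0n addr0 sqrtr_sqr. Qed.

Lemma normc_sqr (x : C) : normc x ^+ 2 = complex.Re x ^+ 2 + complex.Im x ^+ 2.
Proof. by case: x => a b; rewrite /normc /= sqr_sqrtr// addr_ge0 ?sqr_ge0. Qed.

Lemma normc_prod (I : Type) (r : seq I) (F : I -> C) :
  normc (\prod_(i <- r) F i) = \prod_(i <- r) normc (F i).
Proof. by elim: r => [|i r IH]; rewrite ?big_nil ?normc1// !big_cons normcM IH. Qed.

Lemma le_normc_sum (I : Type) (r : seq I) (F : I -> C) :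
  normc (\sum_(i <- r) F i) <= \sum_(i <- r) normc (F i).
Proof.
elim: r => [|i r IH]; first by rewrite !big_nil normc0.
rewrite !big_cons; apply: (le_trans (le_normcD _ _)).
by rewrite lerD2l.
Qed.

Lemma normc_ge_absRe (x : C) : `|complex.Re x| <= normc x.
Proof.
case: x => a b; rewrite /normc /= -sqrtr_sqr ler_wsqrtr// lerDl sqr_ge0//.
Qed.

Lemma ReD (x y : C) : complex.Re (x + y) = complex.Re x + complex.Re y.
Proof. by case: x y => ? ? [? ?]. Qed.

Lemma zrad_ge0 z : 0 <= zrad z. Proof. exact: sqrtr_ge0. Qed.

Lemma normc_le_zrad z i : normc (z i) <= zrad z.
Proof.
rewrite -[leLHS]ger0_norm ?normc_ge0// -sqrtr_sqr ler_wsqrtr//.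
by rewrite (bigD1 i isT)/= lerDl sumr_ge0// => j _; rewrite sqr_ge0.
Qed.

Lemma zmon_bound (z : 'I_n -> C) (t : @sym_term R n) :
  normc (zmon z t) <= `|t.1| * zrad z ^+ (wt t.2.1 + wt t.2.2).
Proof.
rewrite /zmon normcM normc_real ler_wpM2l// normc_prod.
rewrite /wt -big_split /= expr_sum; apply: ler_prod => i _.
rewrite normc_ge0 normcM !normcX normc_conj -exprD addnC.
by rewrite lerXn2r ?nnegrE ?normc_ge0 ?zrad_ge0 ?normc_le_zrad.
Qed.

Lemma wt_up (a : idx) i : wt (up a i) = (wt a).+1.
Proof.
rewrite /wt (bigD1 i isT) [in RHS](bigD1 i isT) /= ffunE eqxx addn1 addSn.
by congr (_ + _).+1; apply: eq_bigr => j /negbTE ji; rewrite ffunE ji addn0.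
Qed.

Lemma wt_dn (a : idx) i : (0 < a i)%N -> (wt (dn a i)).+1 = wt a.
Proof. by move=> ai; rewrite -(wt_up _ i) up_dn. Qed.

Lemma dn0 (a : idx) i : a i = 0%N -> dn a i = a.
Proof.
move=> ai; apply/ffunP => j; rewrite ffunE; case: eqP => [->|_]; by rewrite ?ai ?subn0.
Qed.

Lemma wt_dn_le (a : idx) i : (wt (dn a i) <= wt a)%N.
Proof. by have [/dn0->|/wt_dn<-] := posnP (a i). Qed.

Lemma wt_dn_ge (a : idx) i : (wt a <= (wt (dn a i)).+1)%N.
Proof. by have [/dn0->|/wt_dn<-] := posnP (a i). Qed.

Lemma sym_deg (w : word) t : t \in sym (R := R) w -> (wt t.2.1 + wt t.2.2 <= size w)%N.
Proof.
elim: w t => [|[b i] w IH] t /=.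
  by rewrite inE => /eqP -> /=; rewrite /wt !big1// => j _; rewrite ffunE.
case: b => /=; first by move=> /mapP[s /IH h ->] /=; rewrite wt_up addSn ltnS.
rewrite mem_cat => /orP[] /mapP[s /IH h ->] /=; first by rewrite wt_up addnS ltnS.
by apply: leqW; apply: leq_trans h; rewrite leq_add2r wt_dn_le.
Qed.

Lemma zmon_up1 z (c : R) (k l : idx) i :
  zmon z (c, (up k i, l)) = conjc (z i) * zmon z (c, (k, l)).
Proof.
rewrite /zmon /= mulrCA; congr (_ * _); rewrite (bigD1 i isT) [in RHS](bigD1 i isT) /=.
rewrite ffunE eqxx addn1 exprS mulrA mulrCA !mulrA; congr (_ * _); first by ring.
by apply: eq_bigr => j /negbTE ji; rewrite ffunE ji addn0.
Qed.

Lemma zmon_up2 z (c : R) (k l : idx) i :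
  zmon z (c, (k, up l i)) = z i * zmon z (c, (k, l)).
Proof.
rewrite /zmon /= mulrCA; congr (_ * _); rewrite (bigD1 i isT) [in RHS](bigD1 i isT) /=.
rewrite ffunE eqxx addn1 exprS !mulrA; congr (_ * _).
by apply: eq_bigr => j /negbTE ji; rewrite ffunE ji addn0.
Qed.

(** The contraction terms of [sym] lose degree, so the difference has degree below the length of the
    word. The factor 1 + |z| on the left stands for the exponent [size w - 1], which would be wrong
    for the empty word. *)
Lemma ev_tops_bound (w : word) : exists2 K : R, 0 <= K & forall z,
  (1 + zrad z) * normc (ev z (sym w) - tops z w) <= K * (1 + zrad z) ^+ size w.
Proof.
elim: w => [|[b i] w [K K0 IH]].
  exists 0 => // z; rewrite /ev /= big_seq1 /zmon /tops big_nil /= mul1r big1.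
    by rewrite subrr normc0 mulr0 mul0r.
  by move=> j _; rewrite !ffunE !expr0 mulr1.
have r0 z : 0 <= 1 + zrad z by rewrite addr_ge0 ?zrad_ge0.
have step z (y x : C) : normc y <= zrad z -> normc x * (1 + zrad z) <= K * (1 + zrad z) ^+ size w ->
    (1 + zrad z) * normc (y * x) <= K * (1 + zrad z) ^+ (size w).+1.
  move=> yz h; rewrite normcM mulrCA exprS [leRHS]mulrCA.
  apply: ler_pM => //; rewrite ?mulr_ge0 ?normc_ge0//; last by rewrite mulrC.
  by apply: (le_trans yz); rewrite lerDr.
case: b.
  exists K => // z /=; rewrite /ev /= big_map.
  under eq_bigr => t _ do rewrite zmon_up1 -surjective_pairing -surjective_pairing.
  rewrite -big_distrr /= /tops big_cons /= -mulrBr; apply: step.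
    by rewrite normc_conj normc_le_zrad.
  by rewrite mulrC; apply: IH.
exists (K + \sum_(t <- sym w) `|- t.1 * (t.2.1 i)%:R|).
  by rewrite addr_ge0// sumr_ge0.
move=> z; rewrite /ev /= big_cat !big_map /=.
under eq_bigr => t _ do rewrite zmon_up2 -surjective_pairing -surjective_pairing.
rewrite -big_distrr /= /tops big_cons /= addrAC -mulrBr [leRHS]mulrDl.
apply: (@le_trans _ _ ((1 + zrad z) * (normc (z i * (ev z (sym w) - tops z w)) +
   normc (\sum_(t <- sym w) zmon z (- t.1 * (t.2.1 i)%:R, (dn t.2.1 i, t.2.2)))))).
  by rewrite ler_wpM2l// le_normcD.
rewrite mulrDr lerD//; first by apply: step; [exact: normc_le_zrad|rewrite mulrC; exact: IH].
rewrite exprS mulrCA ler_wpM2l// (le_trans (le_normc_sum _ _))// mulr_suml.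
rewrite big_seq [leRHS]big_seq; apply: ler_sum => t /sym_deg dt.
apply: (le_trans (zmon_bound _ _)); rewrite /=.
have [k0|k0] := posnP (t.2.1 i); first by rewrite k0 mulr0 normr0 !mul0r.
rewrite ler_wpM2l//; apply: (@le_trans _ _ ((1 + zrad z) ^+ (wt (dn t.2.1 i) + wt t.2.2))).
  by rewrite lerXn2r ?nnegrE ?zrad_ge0// lerDr.
rewrite ler_weXn2l ?lerDl ?zrad_ge0//.
by apply: leq_trans dt; rewrite -(wt_dn k0) addSn leqW.
Qed.

Lemma tops_bound z (w : word) : normc (tops z w) <= zrad z ^+ size w.
Proof.
rewrite /tops normc_prod; elim: w => [|l w IH]; first by rewrite big_nil.
rewrite big_cons exprS ler_pM ?normc_ge0 ?prodr_ge0//.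
  by move=> *; exact: normc_ge0.
by case: l.1; rewrite ?normc_conj normc_le_zrad.
Qed.

Lemma evL_topL_bound (L : seq (R * word)) D : all (fun p => size p.2 <= D)%N L ->
  exists2 K : R, 0 <= K & forall z,
    (1 + zrad z) * normc (evL z L - topL D z L) <= K * (1 + zrad z) ^+ D.
Proof.
elim: L => [_|p L IH /= /andP[pD /IH [K K0 HK]]].
  by exists 0 => // z; rewrite /evL /topL !big_nil subrr normc0 mulr0 mul0r.
have r0 z : 0 <= 1 + zrad z by rewrite addr_ge0 ?zrad_ge0.
have r1 z : 1 <= 1 + zrad z by rewrite lerDl zrad_ge0.
suff [K1 K10 HK1] : exists2 K1 : R, 0 <= K1 & forall z, (1 + zrad z) *
    normc (p.1%:C * ev z (sym p.2) - (if size p.2 == D then p.1%:C * tops z p.2 else 0))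
    <= K1 * (1 + zrad z) ^+ D.
  exists (K1 + K); first exact: addr_ge0.
  move=> z; rewrite /evL /topL !big_cons opprD addrACA [leRHS]mulrDl.
  have tri (x y : C) : (1 + zrad z) * normc (x + y) <=
      (1 + zrad z) * normc x + (1 + zrad z) * normc y.
    by rewrite -mulrDr ler_wpM2l// le_normcD.
  by apply: (le_trans (tri _ _)); apply: lerD; [exact: HK1|exact: HK].
have [K2 K20 HK2] := ev_tops_bound p.2.
case: eqP => [<-|/eqP pnD].
  exists (`|p.1| * K2); first by rewrite mulr_ge0.
  move=> z; rewrite -mulrBr normcM normc_real mulrCA -mulrA ler_wpM2l//.
exists (`|p.1| * (K2 + 1)); first by rewrite mulr_ge0// addr_ge0.
move=> z; rewrite subr0 normcM normc_real mulrCA -mulrA ler_wpM2l//.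
have sD : (size p.2 < D)%N by rewrite ltn_neqAle pnD.
apply: (@le_trans _ _ ((1 + zrad z) * (normc (ev z (sym p.2) - tops z p.2) + normc (tops z p.2)))).
  by rewrite ler_wpM2l// -{1}[ev _ _](subrK (tops z p.2)) le_normcD.
rewrite [leLHS]mulrDr [leRHS]mulrDl mul1r lerD//.
  by apply: (le_trans (HK2 z)); rewrite ler_wpM2l// ler_weXn2l// ltnW.
apply: (@le_trans _ _ ((1 + zrad z) ^+ (size p.2).+1)); last by rewrite ler_weXn2l.
rewrite exprS ler_wpM2l// (le_trans (tops_bound _ _))// lerXn2r ?nnegrE ?zrad_ge0//.
by rewrite lerDr.
Qed.

Definition mulL (L1 L2 : seq (R * word)) : seq (R * word) :=
  [seq (p.1 * q.1, p.2 ++ q.2) | p <- L1, q <- L2].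

Lemma actw_cat (w1 w2 : word) (f : idx -> R) : actw (w1 ++ w2) f = actw w1 (actw w2 f).
Proof. by rewrite /actw foldr_cat. Qed.

Lemma actL_mul L1 L2 f a : actL (mulL L1 L2) f a = actL L1 (actL L2 f) a.
Proof.
rewrite /actL /mulL big_allpairs_dep /=; apply: eq_bigr => p _.
rewrite actw_lin mulr_sumr; apply: eq_bigr => q _.
by rewrite actw_cat mulrA.
Qed.

Lemma topL_mul D1 D2 z L1 L2 : all (fun p => size p.2 <= D1)%N L1 ->
  all (fun p => size p.2 <= D2)%N L2 ->
  topL (D1 + D2) z (mulL L1 L2) = topL D1 z L1 * topL D2 z L2.
Proof.
move=> /allP h1 /allP h2; rewrite /topL /mulL big_allpairs_dep /= big_distrlr /=.
rewrite big_seq [RHS]big_seq; apply: eq_bigr => p /h1 s1.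
rewrite big_seq [RHS]big_seq; apply: eq_bigr => q /h2 s2.
have eqD (x y : nat) : (x <= D1)%N -> (y <= D2)%N ->
  (x + y == D1 + D2)%N = (x == D1) && (y == D2) by lia.
rewrite size_cat eqD//.
case: eqP => _ /=; last by rewrite mul0r.
case: eqP => _ /=; last by rewrite mulr0.
by rewrite rmorphM /= /tops big_cat /=; ring.
Qed.

Lemma size_mulL D1 D2 L1 L2 : all (fun p : R * word => size p.2 <= D1)%N L1 ->
  all (fun p => size p.2 <= D2)%N L2 ->
  all (fun p => size p.2 <= D1 + D2)%N (mulL L1 L2).
Proof.
move=> /allP h1 /allP h2; apply/allP => _ /allpairsP[[p q] /= [/h1 ? /h2 ? ->]] /=.
by rewrite size_cat leq_add.
Qed.

(** The number operator in anti-Wick order: diagonal with entries |a| + n, and with principal symbol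
    |z|^2. Its m-th power measures the gain of the elliptic estimate. *)
Definition numL : seq (R * word) := [seq (1, [:: (true, i); (false, i)]) | i <- enum 'I_n].
Definition numXL m := iter m (mulL numL) [:: (1, [::])].

Lemma size_numXL m : all (fun p => size p.2 <= m.*2)%N (numXL m).
Proof.
elim: m => [//|m IH]; rewrite doubleS -add2n; apply: size_mulL => //.
by apply/allP => _ /mapP[i _ ->].
Qed.

Lemma actL_num f a : actL numL f a = (wt a + n)%:R * f a.
Proof.
rewrite /actL /numL big_map big_enum /=.
transitivity (\sum_(i < n) (a i).+1%:R * f a).
  apply: eq_bigr => i _; rewrite mul1r /act1 /= dn_up ffunE eqxx addn1 mulrA -expr2.
  by rewrite sqr_sqrtr ?ler0n.
rewrite -mulr_suml -natr_sum; congr (_%:R * _); rewrite /wt.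
under eq_bigr do rewrite -addn1.
by rewrite big_split /= sum_nat_const card_ord muln1.
Qed.

Lemma actL_numX m f a : actL (numXL m) f a = (wt a + n)%:R ^+ m * f a.
Proof.
elim: m f a => [|m IH] f a; first by rewrite /actL big_seq1.
rewrite actL_mul actL_num IH exprS mulrA//.
Qed.

Lemma topL_numX m z : topL m.*2 z (numXL m) = (zrad z ^+ m.*2)%:C.
Proof.
elim: m => [|m IH]; first by rewrite /topL big_seq1 /= /tops big_nil mulr1.
rewrite doubleS -add2n topL_mul ?size_numXL//; last by apply/allP => _ /mapP[i _ ->].
rewrite IH exprD rmorphM /=; congr (_ * _).
rewrite /topL /numL big_map big_enum /= sqr_sqrtr ?sumr_ge0// => [|i _]; last exact: sqr_ge0.
rewrite rmorph_sum; apply: eq_bigr => i _; rewrite /tops !big_cons big_nil mul1r mulr1 /=.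
rewrite normc_sqr; case: (z i) => x y; rewrite /GRing.mul /=.
by congr (_ +i* _); ring.
Qed.

Lemma poly_absorb (K c : R) D : 0 <= K -> 0 < c -> exists2 C0 : R, 0 <= C0 &
  forall r : R, 0 <= r -> K * (1 + r) ^+ D <= c * r ^+ D.+1 + C0.
Proof.
move=> K0 c0; pose R0 := 1 + K * 2 ^+ D / c.
have R01 : 1 <= R0 by rewrite lerDl divr_ge0 ?mulr_ge0 ?exprn_ge0// ltW.
have R00 : 0 <= R0 by apply: le_trans R01.
have C0 : 0 <= K * (1 + R0) ^+ D by rewrite mulr_ge0// exprn_ge0// addr_ge0.
exists (K * (1 + R0) ^+ D) => // r r0; case: (lerP r R0) => rR.
  rewrite -[leLHS]add0r lerD ?mulr_ge0 ?exprn_ge0// ?(ltW c0)//.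
  have h1 : 1 + r <= 1 + R0 by rewrite lerD2l.
  have h2 : 0 <= 1 + r by rewrite addr_ge0.
  by apply: ler_wpM2l => //; apply: lerXn2r => //; rewrite nnegrE (le_trans h2).
rewrite -[leLHS]addr0 lerD//.
have r1 : 1 <= r by rewrite (le_trans R01)// ltW.
apply: (@le_trans _ _ (K * (2 * r) ^+ D)).
  rewrite ler_wpM2l// lerXn2r ?nnegrE ?addr_ge0 ?mulr_ge0//.
  by rewrite mulr2n mulrDl mul1r lerD2r.
rewrite exprMn exprS mulrA mulrA ler_wpM2r ?exprn_ge0//.
rewrite -ler_pdivrMl//; apply: (le_trans _ (ltW rR)).
by rewrite /R0 mulrC lerDr.
Qed.

Definition Sbox N (f : idx -> R) : R := \sum_(b : {ffun 'I_n -> 'I_N}) f (ofbox b).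

(** A Garding inequality. Half of the elliptic lower bound is given to the m-th power of the number
    operator, the other half absorbs all terms of lower degree up to a constant; what remains is an
    everywhere nonnegative anti-Wick symbol. *)
Lemma coercive_form (Q : seq (R * word)) (m : nat) (c : R) : (0 < m)%N -> 0 < c ->
  all (fun p => size p.2 <= m.*2)%N Q ->
  (forall z, c * zrad z ^+ m.*2 <= complex.Re (topL m.*2 z Q)) ->
  exists c1 C1 : R, [/\ 0 < c1, 0 <= C1 & forall N (v : idx -> R),
    (forall a, v a != 0 -> forall i, (a i < N)%N) ->
    c1 * Sbox N (fun a => (wt a + n)%:R ^+ m * v a ^+ 2) <=
    Sbox N (fun a => v a * actL Q v a) + C1 * Sbox N (fun a => v a ^+ 2)].
Proof.
move=> m0 c0 sQ hQ.
have [K1 K10 HK1] := evL_topL_bound sQ.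
have [K2 K20 HK2] := evL_topL_bound (size_numXL m).
pose e := c / 2; have e0 : 0 < e by rewrite divr_gt0.
pose K := K1 + e * K2; have K0 : 0 <= K by rewrite addr_ge0// mulr_ge0// ltW.
have [C0 C00 HC0] := poly_absorb m.*2.-1 K0 e0.
exists e, C0; split=> // N v vN.
(* Q - e N^m + C0, the empty word being the identity. *)
pose L := Q ++ [seq (- e * p.1, p.2) | p <- numXL m] ++ [:: (C0, [::])].
have := antiWick_form_ge0 (L := L) _ vN.
have -> : \sum_(b : {ffun 'I_n -> 'I_N}) v (ofbox b) * actL L v (ofbox b) =
    Sbox N (fun a => v a * actL Q v a) + C0 * Sbox N (fun a => v a ^+ 2) -
    e * Sbox N (fun a => (wt a + n)%:R ^+ m * v a ^+ 2).
  rewrite /Sbox !mulr_sumr -big_split /= -sumrB; apply: eq_bigr => b _.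
  rewrite {1}/actL /L !big_cat big_seq1 big_map /=.
  have -> : \sum_(j <- numXL m) - e * j.1 * actw j.2 v (ofbox b) =
     - e * actL (numXL m) v (ofbox b).
    by rewrite /actL mulr_sumr; apply: eq_bigr => j _; rewrite mulrA.
  by rewrite actL_numX -/(actL Q v (ofbox b)); ring.
rewrite subr_ge0; apply => z.
have r0 : 0 <= zrad z := zrad_ge0 z.
have r1 : 0 < 1 + zrad z by rewrite ltr_pwDl.
have dE : m.*2 = m.*2.-1.+1 by rewrite prednK// double_gt0.
have bnd (X : R) (Y Z : C) : (1 + zrad z) * normc (Y - Z) <= X * (1 + zrad z) ^+ m.*2 ->
    `|complex.Re Y - complex.Re Z| <= X * (1 + zrad z) ^+ m.*2.-1.
  rewrite {1}dE exprS mulrCA ler_pM2l// => h; apply: le_trans h.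
  suff -> : complex.Re Y - complex.Re Z = complex.Re (Y - Z) by exact: normc_ge_absRe.
  by case: (Y) (Z) => ? ? [? ?].
have h1 := bnd _ _ _ (HK1 z); have h2 := bnd _ _ _ (HK2 z).
have -> : evL z L = evL z Q + (- e)%:C * evL z (numXL m) + C0%:C.
  rewrite /evL /L !big_cat big_seq1 big_map /= addrA; congr (_ + _ + _).
    by rewrite mulr_sumr; apply: eq_bigr => p _; rewrite rmorphM /= mulrA.
  rewrite /ev /= big_seq1 /zmon /= mul1r big1 ?mulr1// => i _.
  by rewrite !ffunE !expr0 mulr1.
have -> : complex.Re (evL z Q + (- e)%:C * evL z (numXL m) + C0%:C) =
    complex.Re (evL z Q) - e * complex.Re (evL z (numXL m)) + C0.
  by rewrite !ReD Re_realM mulNr.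
move: h1 h2; rewrite topL_numX /= => /ler_normlP[h1 _] /ler_normlP[_ h2].
have := HC0 _ r0; have := hQ z; rewrite /K -dE.
set X := (1 + zrad z) ^+ _ in h1 h2 *; set T := zrad z ^+ _ in h2 *.
have {}h2 : e * (complex.Re (evL z (numXL m)) - T) <= e * (K2 * X) by rewrite ler_wpM2l// ltW.
have -> : c = e + e by rewrite /e; field.
by move: h1 h2; set u := complex.Re _; set w := complex.Re _; set y := complex.Re _; lra.
Qed.

End Growth.

(** * Exponential decay of eigensequences *)

Section Agmon.
Context {R : realType} {n : nat}.
Local Notation idx := (@idx n).
Local Notation word := (@word n).

(** A word acts as a weighted shift: [kap] is the weight collected and [sig] the index at which the
    sequence is read. *)
Fixpoint kap (w : word) (a : idx) : R :=
  if w is l :: w' then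
    if l.1 then Num.sqrt (a l.2).+1%:R * kap w' (up a l.2)
    else Num.sqrt (a l.2)%:R * kap w' (dn a l.2)
  else 1.

Fixpoint sig (w : word) (a : idx) : idx :=
  if w is l :: w' then sig w' (if l.1 then up a l.2 else dn a l.2) else a.

Lemma actwE (w : word) (f : idx -> R) a : actw w f a = kap w a * f (sig w a).
Proof.
elim: w a => [|[b i] w IH] a /=; first by rewrite mul1r.
by rewrite /act1 /=; case: b; rewrite IH mulrA.
Qed.

Lemma coord_le_wt (a : idx) i : (a i <= wt a)%N.
Proof. by rewrite /wt (bigD1 i isT)/= leq_addr. Qed.

Lemma wt_sig (w : word) a : (wt (sig w a) <= wt a + size w)%N.
Proof.
elim: w a => [|[b i] w IH] a /=; first by rewrite addn0.
apply: leq_trans (IH _) _; rewrite addnS -addSn leq_add2r.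
by case: b => /=; [rewrite wt_up|rewrite leqW// wt_dn_le].
Qed.

Lemma wt_sig_ge (w : word) a : (wt a <= wt (sig w a) + size w)%N.
Proof.
elim: w a => [|[b i] w IH] a /=; first by rewrite addn0.
case: b => /=.
  by have := IH (up a i); rewrite wt_up; lia.
by have := IH (dn a i); have := wt_dn_ge a i; lia.
Qed.

Lemma kap_bound (w : word) (a : idx) : kap w a ^+ 2 <= (wt a + size w)%:R ^+ size w.
Proof.
elim: w a => [|[b i] w IH] a /=; first by rewrite expr1n expr0.
case: b => /=; rewrite exprMn sqr_sqrtr ?ler0n// [leRHS]exprS.
- apply: ler_pM; rewrite ?ler0n ?sqr_ge0 ?ler_nat//.
    by rewrite addnS ltnS (leq_trans (coord_le_wt a i))// leq_addr.
  by apply: (le_trans (IH _)); rewrite wt_up addSnnS.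
- apply: ler_pM; rewrite ?ler0n ?sqr_ge0 ?ler_nat//.
    by rewrite (leq_trans (coord_le_wt a i))// leq_addr.
  apply: (le_trans (IH _)); apply: lerXn2r; rewrite ?nnegrE ?ler0n ?ler_nat//.
  by rewrite leq_add ?wt_dn_le.
Qed.

Lemma kap_abs_bound (w : word) (a : idx) m : (0 < m)%N -> (size w <= m.*2)%N ->
  `|kap w a| <= (wt a + m.*2)%:R ^+ m.
Proof.
move=> m0 sw; have m2 : (0 < m.*2)%N by rewrite double_gt0.
have X1 : (1 : R) <= (wt a + m.*2)%:R by rewrite ler1n addn_gt0 m2 orbT.
rewrite -(@ler_pXn2r _ 2)// ?nnegrE ?exprn_ge0 ?ler0n//.
rewrite real_normK ?num_real// -exprM muln2 (le_trans (kap_bound _ _))//.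
apply: (@le_trans _ _ ((wt a + m.*2)%:R ^+ size w)); last by rewrite ler_weXn2l.
by rewrite lerXn2r ?nnegrE ?ler0n// ler_nat leq_add2l.
Qed.

(** [dn] identifies the values 0 and 1 of a coordinate; a nonzero [kap] rules out the value 0, and
    all the steps of [sig] are then invertible. *)
Lemma sig_inj (w : word) (a b : idx) : kap w a != 0 -> kap w b != 0 ->
  sig w a = sig w b -> a = b.
Proof.
elim: w a b => [//|[[] i] w IH] a b /=; rewrite !mulf_eq0 !negb_or => /andP[a1 a2] /andP[b1 b2] h.
  by have := IH _ _ a2 b2 h => /(congr1 (dn ^~ i)); rewrite !dn_up.
have pos (c : idx) : Num.sqrt (c i)%:R != 0 :> R -> (0 < c i)%N.
  by rewrite lt0n; apply: contra => /eqP ->; rewrite sqrtr0.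
by have := IH _ _ a2 b2 h => /(congr1 (up ^~ i)); rewrite !up_dn ?pos.
Qed.

Lemma Sbox_le N (f g : idx -> R) : (forall a, f a <= g a) -> Sbox N f <= Sbox N g.
Proof. by move=> h; apply: ler_sum => b _. Qed.

Lemma Sbox_ge0 N (f : idx -> R) : (forall a, 0 <= f a) -> 0 <= Sbox N f.
Proof. by move=> h; apply: sumr_ge0 => b _. Qed.

Lemma SboxD N (f g : idx -> R) : Sbox N (fun a => f a + g a) = Sbox N f + Sbox N g.
Proof. exact: big_split. Qed.

Lemma SboxZ N (c : R) (f : idx -> R) : Sbox N (fun a => c * f a) = c * Sbox N f.
Proof. by rewrite /Sbox mulr_sumr. Qed.

Lemma Sbox_inj N M (P : pred idx) (h : idx -> idx) (F : idx -> R) :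
  (forall a, 0 <= F a) -> (forall a b, P a -> P b -> h a = h b -> a = b) ->
  (forall a, P a -> (forall i, a i < N)%N -> forall i, (h a i < M)%N) ->
  Sbox N (fun a => if P a then F (h a) else 0) <= Sbox M F.
Proof.
move=> F0 hinj hM; rewrite /Sbox.
have E (a : {ffun 'I_n -> 'I_N}) : (if P (ofbox a) then F (h (ofbox a)) else 0) =
    \sum_(b : {ffun 'I_n -> 'I_M}) (if P (ofbox a) && (h (ofbox a) == ofbox b) then F (ofbox b) else 0).
  case: ifP => Pa /=; last by rewrite big1.
  have [|b bE] := @ofbox_onto n M (h (ofbox a)).
    by apply: hM => // i; rewrite ffunE.
  rewrite (bigD1 b)//= bE eqxx big1 ?addr0// => c cb.
  by case: eqP => // e; case/eqP: cb; apply: (@ofbox_inj n M); rewrite bE e.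
rewrite (eq_bigr _ (fun a _ => E a)) exchange_big /=; apply: ler_sum => b _.
case: (pickP (fun a : {ffun 'I_n -> 'I_N} => P (ofbox a) && (h (ofbox a) == ofbox b))) => [a|none].
  move=> Pa; rewrite (bigD1 a)//= Pa big1 ?addr0// => c ca.
  case: ifP => // Pc; case/eqP: ca; apply: (@ofbox_inj n N).
  case/andP: Pa => Pa /eqP ha; case/andP: Pc => Pc /eqP hc.
  by apply: hinj => //; rewrite ha hc.
by rewrite big1 ?F0// => a _; rewrite none.
Qed.

Lemma poly_geom_small (rho : R) (m A : nat) (e : R) : 0 < rho < 1 -> 0 < e ->
  exists s : nat, (s + A)%:R ^+ m * rho ^+ s <= e.
Proof.
move=> /andP[r0 r1] e0; pose x := - ln rho.
have x0 : 0 < x by rewrite oppr_gt0 ln_lt0// r0.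
have rE s : rho ^+ s = expR (- (s%:R * x)).
  by rewrite /x mulrN opprK -[LHS](lnK (x := _)) ?posrE ?exprn_gt0// lnXn// mulr_natl.
pose K := (m.+1)`!%:R * expR (A%:R * x) / x ^+ m.+1.
have K0 : 0 < K by rewrite divr_gt0 ?mulr_gt0 ?expR_gt0 ?exprn_gt0 ?ltr0n ?fact_gt0.
pose s := (Num.trunc (K / e)).+1; exists s.
have y0 : (0 : R) < (s + A)%:R by rewrite ltr0n addSn.
have hs : K / e <= (s + A)%:R.
  apply: (@le_trans _ _ s%:R); last by rewrite ler_nat leq_addr.
  by apply: ltW; rewrite /s; apply: truncnS_gt.
have := @exprn_le_fact_expR R m.+1 ((s + A)%:R * x) (mulr_ge0 (ltW y0) (ltW x0)).
rewrite exprMn exprSr natrD mulrDl expRD -natrD => h.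
rewrite rE expRN ler_pdivrMr ?expR_gt0//.
rewrite -(ler_pM2l y0) mulrC (le_trans (y := K * expR (s%:R * x)))//.
  rewrite /K mulrAC ler_pdivlMr ?exprn_gt0// (le_trans h)//.
  by rewrite -!mulrA [expR _ * expR _]mulrC.
by rewrite mulrA ler_wpM2r ?expR_ge0// -ler_pdivrMr.
Qed.

Lemma exp_near1 (e : R) (D : nat) : 0 < e -> exists rho0 : R, [/\ 0 < rho0, rho0 < 1 &
  forall rho, rho0 <= rho -> rho < 1 -> 1 - rho ^+ D <= e * rho ^+ D].
Proof.
move=> e0; pose t := Num.min (1 / 2) (e / (D.+1%:R * (1 + e))) : R.
have e1 : 0 < 1 + e by rewrite addr_gt0.
have t0 : 0 < t by rewrite lt_min divr_gt0// divr_gt0// mulr_gt0.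
have t1 : t <= 1 / 2 by rewrite ge_min lexx.
exists (1 - t); split; first by lra.
  by rewrite ltrBlDr ltrDl.
move=> rho hr r1.
have bern k : 1 - k%:R * t <= (1 - t) ^+ k.
  elim: k => [|k IH]; first by rewrite mul0r subr0 expr0.
  rewrite exprSr; apply: (@le_trans _ _ ((1 - k%:R * t) * (1 - t))); last first.
    by apply: ler_wpM2r => //; lra.
  rewrite mulrBl !mulrBr !mulr1 -natr1 mulrDl mul1r opprD addrA.
  suff : 0 <= k%:R * t * t by lra.
  by rewrite !mulr_ge0 ?ler0n// ltW.
have h1 : 1 - D%:R * t <= rho ^+ D.
  apply: (le_trans (bern D)); rewrite lerXn2r ?nnegrE//; lra.
have h2 : (1 + e) * (D%:R * t) <= e.
  apply: (@le_trans _ _ ((1 + e) * (D.+1%:R * (e / (D.+1%:R * (1 + e)))))).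
    rewrite ler_pM2l// ler_pM ?ler0n ?(ltW t0)// ?ler_nat//.
    by rewrite ge_min lexx orbT.
  by rewrite le_eqVlt; apply/orP; left; apply/eqP; field; rewrite nat1r pnatr_eq0 /= gt_eqF.
nra.
Qed.

Lemma Sbox_leZ N (c d : R) (f g : idx -> R) : (forall a, c * f a <= d * g a) ->
  c * Sbox N f <= d * Sbox N g.
Proof. by move=> h; rewrite -!SboxZ; exact: Sbox_le. Qed.

(** The distance |wt a - K|: one of the two truncated differences is 0. *)
Definition dst (K : nat) (a : idx) : nat := ((wt a - K) + (K - wt a))%N.

Lemma dst_far (a : idx) (D T K k : nat) :
  (k <= wt a + D)%N -> (T < k)%N -> (K + D <= T)%N -> (2 * (T - D - K) <= dst K a + dst K a)%N.
Proof. by rewrite /dst; move: (wt a) => x; lia. Qed.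

Lemma dst_low (a : idx) (K M : nat) : (M <= wt a)%N = false -> (2 * (K - M) <= dst K a * 2)%N.
Proof. by rewrite /dst; move: (wt a) => x; lia. Qed.

Lemma shift_weight_le (x D n' : nat) : (0 < n')%N -> (x + D + D <= D.*2.+1 * (x + n'))%N.
Proof.
move=> n0; rewrite mulSn -addnA addnn; apply: leq_add; first exact: leq_addr.
by rewrite leq_pmulr// addn_gt0 n0 orbT.
Qed.

Section AgmonStep.
Variables (Q : seq (R * word)) (m : nat) (u : idx -> R) (rho Lam : R) (K T : nat).
Hypothesis (m0 : (0 < m)%N) (sQ : all (fun p => size p.2 <= m.*2)%N Q).
Hypothesis (r0 : 0 < rho) (r1 : rho < 1) (u1 : forall N, Sbox N (fun a => u a ^+ 2) <= 1).
Hypothesis (Qu : forall a, actL Q u a = Lam * u a) (KT : (K + m.*2 <= T)%N).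

(** The weight is 1 at the level K of the index to be estimated and decays away from it, instead of
    growing at infinity. Cutting at T makes v finitely supported, as the coercive estimate requires;
    the price is the error [e], exponentially small in T. *)
Let W (a : idx) : R := rho ^+ dst K a.
Let v (a : idx) : R := if (wt a <= T)%N then W a * u a else 0.
Let q : R := \sum_(p <- Q) `|p.1|.
Let D := m.*2.
Let Y (a : idx) : R := (wt a + D + D)%:R ^+ m.
Let e : R := (T + D)%:R ^+ m * rho ^+ (2 * (T - D - K)).
Let dl : R := 1 - rho ^+ D.

(** A word of length at most D moves the level by at most D, hence changes W by a factor between
    rho^D and rho^(-D). Both inequalities are multiplied by rho^D to avoid division. *)
Lemma agmon_weight (p : R * word) (a : idx) : p \in Q ->
  rho ^+ D * W a <= W (sig p.2 a) /\ rho ^+ D * `|W (sig p.2 a) - W a| <= dl * W (sig p.2 a).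
Proof.
move=> pQ; have sp : (size p.2 <= D)%N by exact: (allP sQ).
have h1 := wt_sig p.2 a; have h2 := wt_sig_ge p.2 a.
have d1 : (dst K (sig p.2 a) <= D + dst K a)%N by rewrite /dst; lia.
have d2 : (dst K a <= D + dst K (sig p.2 a))%N by rewrite /dst; lia.
have mono i j : (i <= j)%N -> rho ^+ j <= rho ^+ i.
  by move=> ij; rewrite ler_wiXn2l// ltW.
have b1 : rho ^+ D * W a <= W (sig p.2 a) by rewrite /W -exprD; exact: mono.
have b2 : rho ^+ D * W (sig p.2 a) <= W a by rewrite /W -exprD; exact: mono.
split=> //; have W0 b : 0 <= W b by rewrite exprn_ge0// ltW.
have RD : 0 <= rho ^+ D <= 1 by rewrite exprn_ge0 ?exprn_ile1// ltW.
have := W0 a; have := W0 (sig p.2 a); rewrite /dl.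
set x := W a in b1 b2 *; set y := W _ in b1 b2 *; set s := rho ^+ D in b1 b2 RD * => y0 x0.
case/andP: RD => s0 s1; have [xy|xy] := lerP x y; last by lra.
have k1 : 0 <= s * (x - s * y) by rewrite mulr_ge0// subr_ge0.
have k2 : 0 <= y * (1 - s) ^+ 2 by rewrite mulr_ge0// sqr_ge0.
move: k1 k2; rewrite expr2; lra.
Qed.

(** The commutator of the weight with one word. If the shifted index stays below T, the weights
    differ by a relative amount [dl]. If it leaves, then a lies within D of the cut, where W^2 <=
    rho^(2 (T - D - K)), and the term goes into [e]. *)
Lemma agmon_point (p : R * word) (a : idx) : p \in Q ->
  rho ^+ D * `|v a * (p.1 * (kap p.2 a * (v (sig p.2 a) - W a * u (sig p.2 a))))| <=
  `|p.1| / 2 * (dl * (Y a * v a ^+ 2 + (if kap p.2 a != 0 then Y (sig p.2 a) * v (sig p.2 a) ^+ 2 else 0))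
    + e * (u a ^+ 2 + (if kap p.2 a != 0 then u (sig p.2 a) ^+ 2 else 0))).
Proof.
move=> pQ; have sp : (size p.2 <= D)%N by exact: (allP sQ).
have [wa1 wa2] := agmon_weight a pQ.
have h1 := wt_sig p.2 a; have h2 := wt_sig_ge p.2 a.
have RD : 0 < rho ^+ D <= 1 by rewrite exprn_gt0 ?exprn_ile1// ltW.
have dl0 : 0 <= dl by rewrite subr_ge0; case/andP: RD.
have W0 b : 0 <= W b by rewrite exprn_ge0// ltW.
have Y0 b : 0 <= Y b by rewrite exprn_ge0.
have e0 : 0 <= e by rewrite mulr_ge0// exprn_ge0// ltW.
have [->|ka0] := eqVneq (kap p.2 a) 0.
  rewrite mul0r !mulr0 normr0 mulr0 !addr0 mulr_ge0 ?divr_ge0// addr_ge0// mulr_ge0//.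
    by rewrite mulr_ge0// sqr_ge0.
  by rewrite sqr_ge0.
have kb := kap_abs_bound a m0 sp.
rewrite mulrCA normrM mulrCA -mulrA ler_wpM2l// !normrM.
set s := sig p.2 a in h1 h2 wa1 wa2 *.
have kY : `|kap p.2 a| <= Y a.
  by apply: (le_trans kb); rewrite lerXn2r ?nnegrE// ler_nat leq_addr.
have kYs : `|kap p.2 a| <= Y s.
  apply: (le_trans kb); rewrite lerXn2r ?nnegrE// ler_nat /s.
  by rewrite leq_add2r (leq_trans h2)// leq_add2l.
have [va|va] := boolP (wt a <= T)%N; last first.
  rewrite {1}/v (negbTE va) normr0 mul0r mulr0 mulr_ge0 ?invr_ge0// addr_ge0// mulr_ge0//.
    by rewrite addr_ge0// mulr_ge0// sqr_ge0.
  by rewrite addr_ge0// sqr_ge0.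
have amgm (x y : R) : `|x| * `|y| <= 2^-1 * (x ^+ 2 + y ^+ 2).
  rewrite -(real_normK (num_real x)) -(real_normK (num_real y)).
  have := sqr_ge0 (`|x| - `|y|); lra.
have [vsT|vs] := boolP (wt s <= T)%N.
  apply: (@le_trans _ _ (2^-1 * (dl * (Y a * v a ^+ 2 + Y s * v s ^+ 2)))); last first.
    rewrite ler_wpM2l ?invr_ge0// lerDl mulr_ge0// addr_ge0 ?sqr_ge0//.
  have vs : v s - W a * u s = (W s - W a) * u s by rewrite {1}/v vsT mulrBl.
  have vsE : `|v s| = W s * `|u s| by rewrite /v vsT normrM (ger0_norm (W0 _)).
  rewrite vs normrM.
  apply: (@le_trans _ _ (`|kap p.2 a| * (dl * (`|v a| * `|v s|)))).
    rewrite vsE; have -> : rho ^+ D * (`|v a| * (`|kap p.2 a| * (`|W s - W a| * `|u s|))) =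
      (`|v a| * `|kap p.2 a|) * (rho ^+ D * `|W s - W a| * `|u s|) by ring.
    have -> : `|kap p.2 a| * (dl * (`|v a| * (W s * `|u s|))) =
      (`|v a| * `|kap p.2 a|) * (dl * W s * `|u s|) by ring.
    by apply: ler_wpM2l; rewrite ?mulr_ge0// ler_wpM2r.
  rewrite mulrCA [leRHS]mulrCA ler_wpM2l//.
  apply: (@le_trans _ _ (`|kap p.2 a| * (2^-1 * (v a ^+ 2 + v s ^+ 2)))).
    by rewrite ler_wpM2l.
  have := sqr_ge0 (v a); have := sqr_ge0 (v s); nra.
apply: (@le_trans _ _ (2^-1 * (e * (u a ^+ 2 + u s ^+ 2)))); last first.
  rewrite ler_wpM2l ?invr_ge0// lerDr mulr_ge0// addr_ge0// mulr_ge0// sqr_ge0//.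
rewrite {2}/v (negbTE vs) sub0r normrN normrM {1}/v va normrM !(ger0_norm (W0 a)).
have Wa : W a * W a <= rho ^+ (2 * (T - D - K)).
  rewrite /W -exprD ler_wiXn2l ?(ltW r0) ?(ltW r1)//; rewrite -ltnNge in vs.
  by apply: (@dst_far a D T K (wt s)) => //; rewrite (leq_trans h1)// leq_add2l.
have ka : `|kap p.2 a| <= (T + D)%:R ^+ m.
  apply: (le_trans kb); rewrite lerXn2r ?nnegrE// ler_nat leq_add2r//.
apply: (@le_trans _ _ (e * (`|u a| * `|u s|))); last first.
  by rewrite [leRHS]mulrCA ler_wpM2l.
have -> : rho ^+ D * (W a * `|u a| * (`|kap p.2 a| * (W a * `|u s|))) =
  rho ^+ D * ((`|kap p.2 a| * (W a * W a)) * (`|u a| * `|u s|)) by ring.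
apply: (@le_trans _ _ (1 * ((`|kap p.2 a| * (W a * W a)) * (`|u a| * `|u s|)))).
  by rewrite ler_wpM2r ?(mulr_ge0, normr_ge0)//; case/andP: RD.
by rewrite mul1r ler_wpM2r ?mulr_ge0// /e ler_pM ?mulr_ge0.
Qed.

(** Since Q u = Lam u, the form of Q at v is Lam |v|^2 plus commutators. Terms evaluated at the
    shifted index are summed back to the original ones because the shift is injective where its
    weight does not vanish. *)
Lemma agmon_form N : (forall a : idx, (wt a <= T)%N -> forall i, (a i < N)%N) ->
  rho ^+ D * Sbox N (fun a => v a * actL Q v a) <=
  rho ^+ D * (Lam * Sbox N (fun a => v a ^+ 2)) +
  q * (dl * Sbox N (fun a => Y a * v a ^+ 2) + e).
Proof.
move=> NT; have RD : 0 < rho ^+ D <= 1 by rewrite exprn_gt0 ?exprn_ile1// ltW.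
have dl0 : 0 <= dl by rewrite subr_ge0; case/andP: RD.
have Y0 b : 0 <= Y b by rewrite exprn_ge0.
have e0 : 0 <= e by rewrite mulr_ge0// exprn_ge0// ltW.
have E a : v a * actL Q v a = Lam * v a ^+ 2 +
   \sum_(p <- Q) v a * (p.1 * (kap p.2 a * (v (sig p.2 a) - W a * u (sig p.2 a)))).
  rewrite -mulr_sumr.
  have -> : \sum_(p <- Q) p.1 * (kap p.2 a * (v (sig p.2 a) - W a * u (sig p.2 a))) =
     actL Q v a - W a * actL Q u a.
    rewrite /actL mulr_sumr -sumrB; apply: eq_bigr => p _; rewrite !actwE; ring.
  rewrite Qu mulrBr addrCA [X in _ = _ + X]( _ : _ = 0) ?addr0//.
  by rewrite /v; case: ifP => _; ring.
have -> : Sbox N (fun a => v a * actL Q v a) = Lam * Sbox N (fun a => v a ^+ 2) +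
   \sum_(p <- Q) Sbox N (fun a => v a * (p.1 * (kap p.2 a * (v (sig p.2 a) - W a * u (sig p.2 a))))).
  rewrite -SboxZ /Sbox [X in _ = _ + X]exchange_big -big_split /=.
  by apply: eq_bigr => b _; rewrite E.
rewrite mulrDr lerD2l mulr_sumr /q mulr_suml big_seq [leRHS]big_seq.
apply: ler_sum => p pQ; have sp : (size p.2 <= D)%N by exact: (allP sQ).
rewrite -SboxZ.
apply: (@le_trans _ _ (Sbox N (fun a => `|p.1| / 2 * (dl * (Y a * v a ^+ 2 +
  (if kap p.2 a != 0 then Y (sig p.2 a) * v (sig p.2 a) ^+ 2 else 0))
    + e * (u a ^+ 2 + (if kap p.2 a != 0 then u (sig p.2 a) ^+ 2 else 0)))))).
  apply: Sbox_le => a; apply: le_trans (agmon_point a pQ).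
  by rewrite ler_wpM2l ?ler_norm// ltW//; case/andP: RD.
rewrite SboxZ !(SboxD, SboxZ) -mulrA ler_wpM2l//.
have i1 : Sbox N (fun a => if kap p.2 a != 0 then u (sig p.2 a) ^+ 2 else 0) <= 1.
  apply: (le_trans _ (u1 (n * N + D).+1)).
  apply: (@Sbox_inj N _ (fun a => kap p.2 a != 0) (sig p.2) (fun a => u a ^+ 2)).
  - by move=> a; exact: sqr_ge0.
  - by move=> a b; exact: sig_inj.
  - move=> a _ aN i; rewrite ltnS (leq_trans (coord_le_wt _ i))//.
    rewrite (leq_trans (wt_sig _ _))// leq_add// /wt.
    rewrite (leq_trans (leq_sum _ (fun i _ => ltnW (aN i))))//.
    by rewrite sum_nat_const card_ord.
have i2 : Sbox N (fun a => if kap p.2 a != 0 then Y (sig p.2 a) * v (sig p.2 a) ^+ 2 else 0) <=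
    Sbox N (fun a => Y a * v a ^+ 2).
  pose P a := (kap p.2 a != 0) && (wt (sig p.2 a) <= T)%N.
  apply: (le_trans _ (@Sbox_inj N N P (sig p.2) (fun a => Y a * v a ^+ 2) _ _ _)).
  - apply: Sbox_le => a; rewrite /P; case: (kap p.2 a != 0) => //=.
    by rewrite /v; case: ifP => //; rewrite expr0n mulr0.
  - by move=> a; rewrite mulr_ge0 ?sqr_ge0.
  - by move=> a b /andP[? _] /andP[? _]; exact: sig_inj.
  - by move=> a /andP[_ ?] _ i; exact: NT.
have b1 := ler_wpM2l dl0 i2; have b2 := ler_wpM2l e0 i1; have b3 := ler_wpM2l e0 (u1 N).
by rewrite !mulrDr; lra.
Qed.

End AgmonStep.

(** At levels above M the coercive term exceeds Lam, so the weighted mass above M is bounded by the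
    weighted mass below M. The weight is 1 at the chosen index and at most rho^(K - M) below M,
    which is the claimed decay. [rho0] is chosen before Lam. *)
Theorem eigen_seq_decay (Q : seq (R * word)) (m : nat) (c1 C1 : R) :
  (0 < m)%N -> (0 < n)%N -> 0 < c1 -> 0 <= C1 ->
  all (fun p => size p.2 <= m.*2)%N Q ->
  (forall N (v : idx -> R), (forall a, v a != 0 -> forall i, (a i < N)%N) ->
    c1 * Sbox N (fun a => (wt a + n)%:R ^+ m * v a ^+ 2) <=
    Sbox N (fun a => v a * actL Q v a) + C1 * Sbox N (fun a => v a ^+ 2)) ->
  exists C rho0 : R, [/\ 0 <= C, 0 < rho0, rho0 < 1 &
    forall (rho Lam : R) (M : nat) (u : idx -> R), rho0 <= rho -> rho < 1 -> 0 <= Lam ->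
      C * (1 + Lam) <= M%:R ^+ m ->
      (forall N, Sbox N (fun a => u a ^+ 2) <= 1) ->
      (forall a, actL Q u a = Lam * u a) ->
      forall a, `|u a| <= rho ^+ (wt a - M)].
Proof.
move=> m0 n0 c10 C10 sQ Hc.
pose q : R := \sum_(p <- Q) `|p.1|; have q0 : 0 <= q by rewrite sumr_ge0.
pose D := m.*2; pose A : R := (D.*2.+1)%:R ^+ m.
have A0 : 0 <= A by rewrite exprn_ge0.
(* Chosen so that the commutators, bounded by q A ee, use at most half of the coercivity constant
   c1. *)
pose ee := c1 / (2 * (q * A + 1)).
have qA : 0 < q * A + 1 by rewrite ltr_wpDl// mulr_ge0.
have ee0 : 0 < ee by rewrite divr_gt0// mulr_gt0.
have [rho0 [r00 r01 hr]] := exp_near1 D ee0.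
(* With this constant, c1 / 2 (wt a + n)^m >= 2 (C1 + 1 + Lam) as soon as wt a >= M. *)
exists (4 * (C1 + 1) / c1), rho0; split=> //.
  by rewrite divr_ge0 ?mulr_ge0 ?addr_ge0// ltW.
move=> rho Lam M u rr r1 L0 hM u1 Qu a0.
have r0 : 0 < rho by apply: lt_le_trans rr.
have ua1 a : u a ^+ 2 <= 1.
  have aN : forall i, (a i < (wt a).+1)%N by move=> i; rewrite ltnS coord_le_wt.
  have [b bE] := ofbox_onto aN; apply: (le_trans _ (u1 (wt a).+1)).
  by rewrite /Sbox (bigD1 b)//= bE lerDl sumr_ge0// => *; exact: sqr_ge0.
have [KM|MK] := leqP (wt a0) M.
  have -> : (wt a0 - M = 0)%N by apply/eqP.
  by rewrite expr0 -(@ler_pXn2r _ 2)// ?nnegrE// expr1n real_normK ?num_real.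
(* The truncation error, polynomial times geometric in T, is removed by letting T grow. *)
suff main T : (wt a0 + D <= T)%N -> u a0 ^+ 2 <= rho ^+ (2 * (wt a0 - M)) +
    (q / rho ^+ D) * ((T + D)%:R ^+ m * rho ^+ (2 * (T - D - wt a0))).
  rewrite -(@ler_pXn2r _ 2)// ?nnegrE ?exprn_ge0 ?(ltW r0)// real_normK ?num_real//.
  rewrite -exprM mulnC; apply/ler_addgt0Pr => e e0.
  pose q' := q / rho ^+ D + 1.
  have q'0 : 0 < q' by rewrite ltr_wpDl// divr_ge0// exprn_ge0// ltW.
  have r2 : 0 < rho ^+ 2 < 1 by rewrite exprn_gt0// exprn_ilt1// ltW.
  have [s hs] := poly_geom_small m (D + wt a0 + D) r2 (divr_gt0 e0 q'0).
  have hT : (wt a0 + D <= s + (D + wt a0))%N by rewrite [(D + _)%N]addnC leq_addl.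
  apply: (le_trans (main _ hT)); rewrite -subnDA addnK lerD2l (@le_trans _ _ (q' * (e / q')))//; last by rewrite mulrC divfK ?gt_eqF.
  rewrite ler_pM ?divr_ge0 ?mulr_ge0 ?exprn_ge0 ?(ltW r0)// ?lerDl//.
  by move: hs; rewrite -exprM -!addnA.
move=> TD; set K := wt a0 in MK TD *.
pose v (a : idx) : R := if (wt a <= T)%N then rho ^+ dst K a * u a else 0.
pose N := T.+1.
have NT (a : idx) : (wt a <= T)%N -> forall i, (a i < N)%N.
  by move=> aT i; rewrite ltnS (leq_trans (coord_le_wt a i)).
have vN (a : idx) : v a != 0 -> forall i, (a i < N)%N.
  by rewrite /v; case: ifP => [/NT//|_]; rewrite eqxx.
have h1 := Hc N v vN.
set er := _ * rho ^+ _.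
have h2 : rho ^+ D * Sbox N (fun a => v a * actL Q v a) <=
    rho ^+ D * (Lam * Sbox N (fun a => v a ^+ 2)) +
    q * ((1 - rho ^+ D) * Sbox N (fun a => (wt a + D + D)%:R ^+ m * v a ^+ 2) + er).
  exact: (agmon_form m0 sQ r0 r1 u1 Qu TD NT).
have er0 : 0 <= er by rewrite mulr_ge0 ?exprn_ge0// ltW.
have RD : 0 < rho ^+ D <= 1 by rewrite exprn_gt0 ?exprn_ile1// ltW.
pose Z (a : idx) : R := (wt a + n)%:R ^+ m.
have Y_Z a : (wt a + D + D)%:R ^+ m <= A * Z a.
  rewrite /A /Z -exprMn lerXn2r ?nnegrE ?mulr_ge0// -natrM ler_nat.
  exact: shift_weight_le.
have h3 : Sbox N (fun a => (wt a + D + D)%:R ^+ m * v a ^+ 2) <=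
    A * Sbox N (fun a => Z a * v a ^+ 2).
  rewrite -SboxZ; apply: Sbox_le => a; rewrite mulrA ler_wpM2r ?sqr_ge0//.
set S0 := Sbox N (fun a => v a ^+ 2) in h1 h2.
set SZ := Sbox N (fun a => _) in h1 h3.
set SQ := Sbox N _ in h1 h2.
have SZ0 : 0 <= SZ by apply: Sbox_ge0 => a; rewrite mulr_ge0 ?sqr_ge0 ?exprn_ge0.
pose B := C1 + 1 + Lam; have B1 : 1 <= B by rewrite /B; lra.
have h4 : c1 / 2 * SZ <= B * S0 + q / rho ^+ D * er.
  have dl0 : 0 <= 1 - rho ^+ D by rewrite subr_ge0; case/andP: RD.
  have k1 : q * ((1 - rho ^+ D) * Sbox N (fun a => (wt a + D + D)%:R ^+ m * v a ^+ 2)) <=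
      c1 / 2 * SZ * rho ^+ D.
    apply: (@le_trans _ _ (q * ((1 - rho ^+ D) * (A * SZ)))).
      by rewrite ler_wpM2l// ler_wpM2l.
    apply: (@le_trans _ _ (q * ((ee * rho ^+ D) * (A * SZ)))).
      by rewrite ler_wpM2l// ler_wpM2r ?mulr_ge0// hr.
    have -> : q * (ee * rho ^+ D * (A * SZ)) = (ee * (q * A)) * SZ * rho ^+ D by ring.
    rewrite ler_wpM2r ?ler_wpM2r//; first by case/andP: RD => /ltW.
    apply: (@le_trans _ _ (ee * (q * A + 1))); first by rewrite ler_pM2l// lerDl.
    by rewrite le_eqVlt; apply/orP; left; apply/eqP; rewrite /ee; field; rewrite gt_eqF.
  have S00 : 0 <= S0 by apply: Sbox_ge0 => a; exact: sqr_ge0.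
  have k2 : SQ <= Lam * S0 + c1 / 2 * SZ + q / rho ^+ D * er.
    case/andP: RD => R0 _; rewrite -(ler_pM2l R0) (le_trans h2)// mulrDr mulrDr.
    have -> : rho ^+ D * (q / rho ^+ D * er) = q * er by field; rewrite gt_eqF.
    by lra.
  by move: h1 k2; rewrite /B; lra.
pose S1 := Sbox N (fun a => if (M <= wt a)%N then v a ^+ 2 else 0).
pose S2 := Sbox N (fun a => if (M <= wt a)%N then 0 else v a ^+ 2).
have S12 : S0 = S1 + S2.
  by rewrite /S0 /S1 /S2 -SboxD; apply: eq_bigr => b _; case: ifP => _; rewrite ?addr0 ?add0r.
have h5 : 2 * B * S1 <= c1 / 2 * SZ.
  apply: Sbox_leZ => a; case: ifP => Ma; last first.
    by rewrite mulr0 mulr_ge0 ?divr_ge0 ?(ltW c10)// mulr_ge0 ?sqr_ge0 ?exprn_ge0.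
  rewrite mulrA ler_wpM2r ?sqr_ge0//.
  have : M%:R ^+ m <= Z a.
    by rewrite lerXn2r ?nnegrE// ler_nat (leq_trans Ma)// leq_addr.
  move=> MZ; have := le_trans hM MZ; rewrite mulrAC ler_pdivrMr// -/(Z a) /B.
  by have := mulr_ge0 C10 L0; lra.
have S20 : 0 <= S2 by apply: Sbox_ge0 => a; case: ifP => // _; exact: sqr_ge0.
(* Together the two estimates read 2 B S1 <= B (S1 + S2) + error, with B >= 1. *)
have h6 : S1 <= S2 + q / rho ^+ D * er.
  have t0 : 0 <= q / rho ^+ D * er by rewrite mulr_ge0// divr_ge0// ltW//; case/andP: RD.
  rewrite S12 in h4; nra.
have h7 : S2 <= rho ^+ (2 * (K - M)).
  rewrite -[leRHS]mulr1 (le_trans _ (ler_wpM2l _ (u1 N))) ?exprn_ge0 ?(ltW r0)//.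
  rewrite -SboxZ; apply: Sbox_le => a; case: ifP => Ma.
    by rewrite mulr_ge0 ?sqr_ge0// exprn_ge0// ltW.
  rewrite /v; case: ifP => _; last by rewrite expr0n mulr_ge0 ?sqr_ge0// exprn_ge0// ltW.
  rewrite exprMn ler_wpM2r ?sqr_ge0// -exprM ler_wiXn2l ?(ltW r0) ?(ltW r1)//.
  exact: dst_low.
have h8 : u a0 ^+ 2 <= S1.
  have a0T : (wt a0 <= T)%N by rewrite (leq_trans _ TD)// leq_addr.
  have [b bE] := ofbox_onto (NT _ a0T).
  rewrite /S1 /Sbox (bigD1 b)//= bE (ltnW MK) /v a0T /dst subnn expr0 mul1r lerDl.
  by apply: sumr_ge0 => c _; case: ifP => // _; exact: sqr_ge0.
lra.
Qed.

End Agmon.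

(** * Integration on R^n *)

Section BorelRn.
Context {R : realType} {n : nat}.

(** The Borel sigma-algebra of row vectors, for which continuous functions are measurable by
    construction. *)
Definition rVm : measurableType (sigma_display (@open 'rV[R]_n)) :=
  g_sigma_algebraType (@open 'rV[R]_n).

Lemma open_measurable_rV (U : set 'rV[R]_n) : open U -> measurable (U : set rVm).
Proof. by move=> oU; apply: sub_sigma_algebra. Qed.

Lemma continuous_measurable_rV (f : 'rV[R]_n -> R) :
  continuous f -> measurable_fun [set: rVm] (f : rVm -> R).
Proof.
move=> /continuousP cf; apply: (measurability _ (RGenOpens.measurableE R)).
move=> _ [_ [a [b ->] <-]]; rewrite setTI.
by apply: open_measurable_rV; apply: cf; exact: interval_open.
Qed.

Lemma rupd_rupd (x : 'rV[R]_n) j k s t : j <> k ->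
  rupd (rupd x j s) k t = rupd (rupd x k t) j s.
Proof.
move=> jk; apply/rowP => i; rewrite !mxE.
by case: eqP => // ik; case: eqP => // ij; case: jk; rewrite -ik -ij.
Qed.

Lemma rupd_ball (x y : 'rV[R]_n) k (s t e : R) :
  0 < e -> ball x e y -> ball s e t -> ball (rupd x k s) e (rupd y k t).
Proof.
move=> e0 [_ xy] st; split=> // i j; rewrite !mxE.
by case: eqP => // _; have := xy i j; rewrite (ord1 i).
Qed.

Lemma rat_vec_dense (x : 'rV[R]_n) (e : R) : 0 < e ->
  exists q : 'rV[rat]_n, ball (map_mx ratr q : 'rV[R]_n) e x.
Proof.
move=> e0; have /choice[f hf] : forall j : 'I_n, exists r : rat, `|ratr r - x ord0 j| < e.
  move=> j; have xe : x ord0 j - e < x ord0 j + e by lra.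
  have [r] := rat_in_itvoo xe; rewrite in_itv/= => rx; exists r.
  by rewrite ltr_norml; lra.
exists (\row_j f j); split=> // i j; rewrite !mxE (ord1 i) /ball /=.
exact: hf.
Qed.

Lemma rat_dense (x e : R) : 0 < e -> exists q : rat, ball (ratr q : R) e x.
Proof.
move=> e0; have xe : x - e < x + e by lra.
have [r] := rat_in_itvoo xe; rewrite in_itv/= => rx; exists r.
by rewrite /ball /= ltr_norml; lra.
Qed.

(** Continuity gives open preimages, but measurability is wanted for the product sigma-algebra: each
    such open set is written as a countable union of products of rational balls. *)
Lemma measurable_rupd k :
  measurable_fun [set: rVm * measurableTypeR R] (fun p : rVm * measurableTypeR R => rupd p.1 k p.2 : rVm).
Proof.
apply: (@measurability _ _ _ rVm _ _ (@open 'rV[R]_n)) => // _ [U oU <-]; rewrite setTI.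
set V := (X in measurable X).
pose I := ('rV[rat]_n * rat * nat)%type.
pose B (t : I) : set (rVm * measurableTypeR R) :=
  (ball (map_mx ratr t.1.1 : 'rV[R]_n) t.2.+1%:R^-1 : set rVm) `*` ball (ratr t.1.2 : R) t.2.+1%:R^-1.
have mB t : measurable (B t).
  apply: measurableX.
    by apply: open_measurable_rV; apply: ball_open; rewrite invr_gt0.
  by apply: open_measurable; apply: ball_open; rewrite invr_gt0.
have -> : V = \bigcup_(t in [set: I]) (if `[< B t `<=` V >] then B t else set0).
  apply/seteqP; split => [[x s] /= Vxs|p [t _]]; last by case: asboolP => // h /h.
  have : nbhs (rupd x k s) U by apply: open_nbhs_nbhs.
  rewrite -nbhs_ballE => -[e /= e0 eU].
  pose m := Num.trunc (2 / e).
  have me : m.+1%:R^-1 < e / 2.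
    rewrite -[e / 2]invrK ltf_pV2 ?posrE ?invr_gt0 ?divr_gt0//.
    by rewrite invf_div; exact: truncnS_gt.
  have m0 : 0 < m.+1%:R^-1 :> R by rewrite invr_gt0.
  have [q hq] := rat_vec_dense x m0; have [r hr] := rat_dense s m0.
  exists (q, r, m) => //; case: asboolP => [_|]; first by [].
  case=> -[y t] /= [qy rt]; apply: eU; apply: rupd_ball => //.
    have -> : e = e / 2 + e / 2 by field.
    apply: (@ball_triangle _ _ (map_mx ratr q : 'rV[R]_n)).
      by apply: (@le_ball _ _ _ m.+1%:R^-1); [exact: ltW|exact: ball_sym].
    by apply: (@le_ball _ _ _ m.+1%:R^-1); [exact: ltW|exact: qy].
  have -> : e = e / 2 + e / 2 by field.
  apply: (@ball_triangle _ _ (ratr r : R)).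
    by apply: (@le_ball _ _ _ m.+1%:R^-1); [exact: ltW|exact: ball_sym].
  by apply: (@le_ball _ _ _ m.+1%:R^-1); [exact: ltW|exact: rt].
apply: countable_bigcupT_measurable => [|t]; first exact: countableP.
by case: asboolP.
Qed.

Local Open Scope ereal_scope.
Notation leb := (@lebesgue_measure R).
Notation rVmfun g := (measurable_fun [set: rVm] (g : rVm -> \bar R)).

Lemma eiterint_ge0 k (g : 'rV[R]_n -> \bar R) x : (forall y, 0 <= g y) -> 0 <= eiterint k g x.
Proof.
elim: k x => [|k IH] x g0 //=; apply: integral_ge0 => s _; exact: IH.
Qed.

Lemma measurable_eiterint k (g : 'rV[R]_n -> \bar R) : (forall y, 0 <= g y) ->
  rVmfun g ->
  rVmfun (eiterint k g).
Proof.
move=> g0 mg; elim: k => [//|k IH] /=.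
pose h (p : rVm * measurableTypeR R) := eiterint k g (rupd p.1 k p.2).
have mh : measurable_fun [set: rVm * measurableTypeR R] h.
  exact: (measurableT_comp IH (measurable_rupd k)).
have := @measurable_fun_fubini_tonelli_F _ _ rVm (measurableTypeR R) R leb h mh.
by apply=> p; exact: eiterint_ge0.
Qed.

Lemma eiterint_rupd k j (g : 'rV[R]_n -> \bar R) x s : (k <= j)%N ->
  eiterint k g (rupd x j s) = eiterint k (fun y => g (rupd y j s)) x.
Proof.
elim: k x => [//|k IH] x kj /=; apply: eq_integral => t _.
rewrite rupd_rupd ?IH ?(ltnW kj)//.
by move=> e; rewrite e ltnn in kj.
Qed.

Lemma eiterint_le k (g h : 'rV[R]_n -> \bar R) x : (forall y, 0 <= g y) ->
  rVmfun g ->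
  rVmfun h ->
  (forall y, g y <= h y) -> eiterint k g x <= eiterint k h x.
Proof.
move=> g0 mg mh gh; have h0 y : 0 <= h y by apply: (le_trans (g0 y)).
elim: k x => [//|k IH] x /=.
have ms (f : 'rV[R]_n -> \bar R) : rVmfun f ->
    measurable_fun [set: R] (fun s => f (rupd x k s)).
  move=> mf; apply: (measurableT_comp mf).
  exact: (measurableT_comp (measurable_rupd k) (pair1_measurable (x : rVm))).
apply: ge0_le_integral => //.
- by move=> s _; exact: eiterint_ge0.
- by apply: ms; exact: measurable_eiterint.
- by apply: ms; exact: measurable_eiterint.
Qed.

(* Fubini for products: the integrated coordinates are those below k. *)
Lemma eiterint_prod k (g : 'I_n -> R -> R) (c : 'I_n -> R) (x : 'rV[R]_n) : (k <= n)%N ->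
  (forall i s, (0 <= g i s)%R) -> (forall i, measurable_fun setT (g i : measurableTypeR R -> R)) ->
  (forall i, \int[leb]_s (g i s)%:E = (c i)%:E) ->
  eiterint k (fun y => (\prod_i g i (y ord0 i))%:E) x =
  (\prod_(i < n) (if (i < k)%N then c i else g i (x ord0 i)))%:E.
Proof.
move=> + g0 mg gc.
have c0 i : (0 <= c i)%R by rewrite -lee_fin -gc; apply: integral_ge0 => s _; rewrite lee_fin.
elim: k x => [x _|k IH x kn] /=; first by congr (_%:E); apply: eq_bigr.
under eq_integral do rewrite (IH _ (ltnW kn)).
pose k' := Ordinal kn.
pose P := (\prod_(i < n | i != k') (if (i < k)%N then c i else g i (x ord0 i)))%R.
transitivity (\int[leb]_s (P%:E * (g k' s)%:E)).
  apply: eq_integral => s _; rewrite -EFinM; congr (_%:E).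
  rewrite (bigD1 k' isT) /= ltnn mxE eqxx mulrC; congr (_ * _)%R.
  apply: eq_bigr => i ik; rewrite mxE; case: ifP => // _.
  by case: eqP => // e; case/eqP: ik; apply: val_inj.
rewrite ge0_integralZl_EFin//; last 3 first.
- by move=> s _; rewrite lee_fin.
- by apply/measurable_EFinP; exact: mg.
- by apply: prodr_ge0 => i _; case: ifP.
rewrite gc -EFinM; congr (_%:E); rewrite [RHS](bigD1 k' isT) /= ltnSn mulrC; congr (_ * _)%R.
apply: eq_bigr => i ik; congr (if _ then _ else _).
by rewrite [RHS]ltnS [RHS]leq_eqVlt; case: eqP => // e; case/eqP: ik; apply: val_inj.
Qed.

Definition cube (M : nat) : set 'rV[R]_n := [set x | forall i, (`|x ord0 i| <= M%:R)%R].

Lemma cube_cover x : exists M, cube M x.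
Proof.
exists (\sum_i (Num.trunc `|x ord0 i|).+1)%N => i.
apply: (le_trans (ltW (truncnS_gt _))); rewrite ler_nat.
by rewrite (bigD1 i) //= leq_addr.
Qed.

Lemma measurable_cube M : measurable (cube M : set rVm).
Proof.
rewrite [X in measurable X](_ : _ = \bigcap_(i in [set: 'I_n]) [set x : 'rV[R]_n | (`|x ord0 i| <= M%:R)%R]).
  apply: fin_bigcap_measurable; first exact: finite_finset.
  move=> i _; rewrite -[X in measurable X]setTI.
  have mi : measurable_fun [set: rVm] (fun x : rVm => (`|x ord0 i|)%R).
    apply: continuous_measurable_rV => x; by apply: (@cvg_norm _ R _ (nbhs x)); exact: (@coord_continuous R 1 n ord0 i x).
  by apply: (@measurable_fun_le _ rVm R setT _ (cst M%:R)) => //.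
by apply/seteqP; split => [x h i _|x h i]; [exact: h|exact: (h i I)].
Qed.

Lemma eiterint_cube_lty k M x : (k <= n)%N -> eiterint k (fun y => (\1_(cube M) y)%:E) x < +oo.
Proof.
move=> kn; pose g (i : 'I_n) (s : R) : R := \1_(`[(- M%:R)%R, M%:R%R]%classic) s.
have -> : (fun y => (\1_(cube M) y)%:E) = (fun y : 'rV[R]_n => (\prod_(i < n) g i (y ord0 i))%:E).
  apply/funext => y; congr (_%:E); rewrite indicE; case: (boolP (y \in cube M)).
    rewrite inE => h; rewrite big1// => i _; rewrite /g indicE mem_set//= in_itv/=.
    by rewrite -ler_norml h.
  move=> /negP h; apply/esym/eqP; rewrite prodf_seq_eq0; apply/hasP.
  have [i hi] : exists i, ~ (`|y ord0 i| <= M%:R)%R.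
    by apply/existsNP => h'; apply: h; rewrite inE.
  exists i; first by rewrite mem_index_enum.
  rewrite /= /g indicE memNset//= in_itv/= -ler_norml//.
rewrite (@eiterint_prod _ _ (fun=> (M%:R + M%:R)%R))//; first by rewrite ltry.
  by move=> i; apply: measurable_indic.
move=> i; rewrite /g (@integral_indic _ _ _ leb)// setIT /= lebesgue_measure_itv /= lte_fin.
case: ifP => [_|]; first by rewrite -EFinB opprK.
move/negbT; rewrite -leNgt => h; congr (_%:E); have : (0 <= M%:R :> R)%R by []; lra.
Qed.

(** Starting from the Dirac mass at 0, each step pushes the product with Lebesgue measure forward
    along [rupd], and Tonelli turns the integral into one more iterated integral. Sigma-finiteness,
    needed for the next product, comes from the cubes, whose iterated integrals are finite. *)
Lemma exists_nu k : (k <= n)%N -> exists nu : {sigma_finite_measure set rVm -> \bar R},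
  forall g : 'rV[R]_n -> \bar R, (forall y, 0 <= g y) -> rVmfun g ->
    \int[nu]_x g x = eiterint k g 0%R.
Proof.
elim: k => [_|k IH kn].
  exists (\d_(0%R : rVm) : {sigma_finite_measure set rVm -> \bar R}) => g g0 mg.
  by rewrite integral_dirac//= diracE in_setT mul1e.
have [nu nuE] := IH (ltnW kn).
pose f (p : rVm * measurableTypeR R) : rVm := rupd p.1 k p.2.
have mf : measurable_fun setT f by exact: measurable_rupd.
pose m := pushforward (nu \x leb) f.
have mE g : (forall y, 0 <= g y) -> rVmfun g ->
    \int[m]_x g x = eiterint k.+1 g 0%R.
  move=> g0 mg; rewrite ge0_integral_pushforward//= preimage_setT.
  rewrite fubini_tonelli2//=; last exact: measurableT_comp mg mf.
  apply: eq_integral => s _; rewrite /fubini_G /=.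
  rewrite eiterint_rupd// -nuE//.
  exact: measurableT_comp mg (measurableT_comp mf (pair2_measurable s)).
pose mm : {measure set rVm -> \bar R} :=
  measure_function_pushforward__canonical__measure_function_Measure (nu \x leb) mf.
have sf : sigma_finite setT mm.
  exists (fun M => cube M : set rVm).
    apply/esym/seteqP; split => // x _; have [M hM] := cube_cover x; by exists M.
  move=> M; split; first exact: measurable_cube.
  rewrite -(setIT (cube M)) -(@integral_indic _ _ _ mm)//; last exact: measurable_cube.
  rewrite mE//; first exact: eiterint_cube_lty.
  by apply/measurable_EFinP; apply: measurable_indic; exact: measurable_cube.
pose mx := Measure_isSigmaFinite.Build _ _ _ mm sf.
pose mp : {sigma_finite_measure set rVm -> \bar R} := HB.pack (mm : set rVm -> \bar R) (Measure.class mm) mx.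
by exists mp.
Qed.

End BorelRn.

Lemma continuous_prodr (R : realType) (T : topologicalType) (I : Type) (s : seq I) (P : pred I)
  (F : I -> T -> R) : (forall i, continuous (F i)) -> continuous (fun x => \prod_(i <- s | P i) F i x).
Proof.
move=> cF; elim: s => [|i s IH].
  by rewrite (_ : (fun x => _) = cst 1); [exact: cst_continuous|apply/funext => x; rewrite big_nil].
case: (boolP (P i)) => Pi; last first.
  by rewrite (_ : (fun x => _) = (fun x => \prod_(i <- s | P i) F i x))//;
    apply/funext => x; rewrite big_cons (negbTE Pi).
rewrite (_ : (fun x => _) = (fun x => F i x * \prod_(i <- s | P i) F i x)); last first.
  by apply/funext => x; rewrite big_cons Pi.
by move=> x; apply: cvgM; [exact: cF|exact: IH].
Qed.

(** * Integration against [nu], domination and translation *)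

Section NuIntegral.
Context {R : realType} {n : nat}.
Notation rVm := (@rVm R n).
Notation leb := (@lebesgue_measure R).

Definition nu : {sigma_finite_measure set rVm -> \bar R} := projT1 (cid (exists_nu (leqnn n))).

Lemma nuE (g : 'rV[R]_n -> \bar R) : (forall y, (0 <= g y)%E) ->
  measurable_fun [set: rVm] (g : rVm -> \bar R) -> (\int[nu]_x g x = eiterint n g 0)%E.
Proof. exact: projT2 (cid (exists_nu (leqnn n))) g. Qed.

(** The Cauchy weight, of total mass pi^n: the common integrable majorant in all that follows. *)
Definition Wt (x : 'rV[R]_n) : R := \prod_i (oneDsqr (x ord0 i))^-1.

Lemma Wt_gt0 x : 0 < Wt x.
Proof. by apply: prodr_gt0 => i _; rewrite invr_gt0; apply: lt_le_trans (oneDsqr_ge1 _). Qed.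

Lemma coordn_continuous i : continuous (fun x : 'rV[R]_n => x ord0 i).
Proof. exact: coord_continuous. Qed.

Lemma continuous_Wt : continuous Wt.
Proof.
apply: continuous_prodr => i x.
apply: (@continuous_comp _ _ _ (fun x : 'rV[R]_n => x ord0 i) (fun s => (oneDsqr s)^-1)).
  exact: coordn_continuous.
exact: continuous_oneDsqrV.
Qed.

Lemma integral_oneDsqrV : (\int[leb]_s ((oneDsqr s)^-1)%:E = pi%:E)%E.
Proof.
rewrite ge0_symfun_integralT//.
- rewrite (_ : [set x | _] = `[0, +oo[%classic); last first.
    by apply/seteqP; split => x /=; rewrite in_itv/= andbT.
  rewrite integral0y_oneDsqr -EFinM; congr (_%:E).
  by rewrite mulrC -mulrA mulVf ?mulr1.
- exact: continuous_oneDsqrV.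
- by move=> x; rewrite /= /oneDsqr sqrrN.
Qed.

Lemma eiterint_Wt_lty k x : (k <= n)%N -> (eiterint k (fun y => (Wt y)%:E) x < +oo)%E.
Proof.
move=> kn; rewrite (@eiterint_prod _ _ k (fun i s => (oneDsqr s)^-1) (fun=> pi)) ?ltry//.
- by move=> i; apply: continuous_measurable_fun; exact: continuous_oneDsqrV.
- by move=> i; exact: integral_oneDsqrV.
Qed.

Definition Wdom (g : 'rV[R]_n -> R) : Prop := exists K, forall x, `|g x| <= K * Wt x.

Notation mfun g := (measurable_fun [set: rVm] (g : rVm -> R)).
Notation intg g := (nu.-integrable [set: rVm] (fun x : rVm => (g x)%:E)).
Notation Inu g := (Rintegral nu [set: rVm] (g : rVm -> R)).

Lemma integrable_Wt : intg Wt.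
Proof.
apply/integrableP; split.
  by apply/measurable_EFinP; apply: continuous_measurable_rV; exact: continuous_Wt.
under eq_integral do rewrite abse_EFin ger0_norm ?(ltW (Wt_gt0 _))//.
rewrite nuE ?eiterint_Wt_lty//.
  by move=> y; rewrite lee_fin ltW// Wt_gt0.
by apply/measurable_EFinP; apply: continuous_measurable_rV; exact: continuous_Wt.
Qed.

Lemma integrable_ZWt K : intg (fun x => K * Wt x).
Proof. by under eq_fun do rewrite EFinM; apply: integrableZl => //; exact: integrable_Wt. Qed.

Lemma integrable_Wdom g : mfun g -> Wdom g -> intg g.
Proof.
move=> mg [K gK]; apply: (@le_integrable _ _ _ nu setT _ _ (fun x => (K * Wt x)%:E)) => //.
- exact/measurable_EFinP.
- by move=> x _; rewrite !abse_EFin lee_fin (le_trans (gK x))// ler_norm.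
- exact: integrable_ZWt.
Qed.

Lemma integrable_L2M f g : mfun f -> mfun g ->
  intg (fun x => f x ^+ 2) -> intg (fun x => g x ^+ 2) -> intg (fun x => f x * g x).
Proof.
move=> mf mg f2 g2.
apply: (@le_integrable _ _ _ nu setT _ _ (fun x => (f x ^+ 2)%:E + (g x ^+ 2)%:E)%E) => //.
- by apply/measurable_EFinP; apply: measurable_funM.
- move=> x _; rewrite -EFinD !abse_EFin lee_fin ler_norml (ger0_norm (addr_ge0 (sqr_ge0 (f x)) (sqr_ge0 (g x)))).
  have := sqr_ge0 (f x + g x); have := sqr_ge0 (f x - g x).
  rewrite !expr2; nra.
- exact: integrableD.
Qed.

Lemma measure_shift (h : R) (A : set R) : measurable A ->
  pushforward leb (fun x : measurableTypeR R => x + h : measurableTypeR R) A = leb A.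
Proof.
have mh : measurable_fun setT (fun x : measurableTypeR R => x + h : measurableTypeR R).
  by apply: measurable_funD.
move=> mA; apply/esym.
pose mu : {measure set (measurableTypeR R) -> \bar R} :=
  measure_function_pushforward__canonical__measure_function_Measure leb mh.
apply: (@lebesgue_measure_unique R mu) => //= _ [[a b]] _ <-.
rewrite /mu /= /pushforward.
rewrite [X in _ = leb X](_ : _ = `](a - h), (b - h)]%classic); last first.
  by apply/seteqP; split => x /=; rewrite !in_itv/= ltrBlDr lerBrDr.
rewrite !lebesgue_measure_itv/= !lte_fin ltrD2r; case: ifP => // _.
by rewrite -!EFinB; congr (_%:E); ring.
Qed.

Local Open Scope ereal_scope.

Lemma ge0_integral_shift (h : R) (g : R -> \bar R) :
  measurable_fun setT (g : measurableTypeR R -> \bar R) -> (forall s, 0 <= g s) ->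
  \int[leb]_s g (s + h)%R = \int[leb]_s g s.
Proof.
move=> mg g0.
have mh : measurable_fun setT (fun x : measurableTypeR R => (x + h)%R : measurableTypeR R).
  by apply: measurable_funD.
transitivity (\int[pushforward leb (fun x : measurableTypeR R => (x + h)%R : measurableTypeR R)]_s g s).
  by rewrite ge0_integral_pushforward.
by apply: eq_measure_integral => A mA _; exact: measure_shift.
Qed.

Definition ei (i : 'I_n) : 'rV[R]_n := delta_mx 0%R i.

Lemma rupd_shift x (i : 'I_n) (k : nat) s h : k <> i :> nat -> rupd (x + h *: ei i)%R k s = (rupd x k s + h *: ei i)%R.
Proof.
move=> ki; apply/rowP => j; rewrite !mxE eqxx /=; case: (eqVneq (j : nat) k) => [jk|//].
case: (eqVneq j i) => [ji|_]; last by rewrite mulr0 addr0.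
by case: ki; rewrite -jk ji.
Qed.

Lemma rupd_same x (i : 'I_n) s h : (rupd x i s + h *: ei i)%R = rupd x i (s + h)%R.
Proof.
apply/rowP => j; rewrite !mxE eqxx /=; case: (eqVneq j i) => [->|ji]; first by rewrite eqxx mulr1.
by case: eqP => [e|_]; [case/eqP: ji; exact: val_inj|rewrite mulr0 addr0].
Qed.

Lemma eiterint_shift_out k (i : 'I_n) (g : 'rV[R]_n -> \bar R) h x : (k <= i)%N ->
  eiterint k (fun y => g (y + h *: ei i)%R) x = eiterint k g (x + h *: ei i)%R.
Proof.
elim: k x => [//|k IH] x ki /=; apply: eq_integral => s _.
rewrite (IH _ (ltnW ki)) (@rupd_shift x i k)//.
by move=> e; rewrite e ltnn in ki.
Qed.

Lemma measurable_eiterint_slice k (g : 'rV[R]_n -> \bar R) x j : (forall y, 0 <= g y) ->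
  measurable_fun [set: rVm] (g : rVm -> \bar R) ->
  measurable_fun setT (fun s : measurableTypeR R => eiterint k g (rupd x j s)).
Proof.
move=> g0 mg; apply: (measurableT_comp (measurable_eiterint k g0 mg)).
exact: (measurableT_comp (measurable_rupd j) (pair1_measurable (x : rVm))).
Qed.

Lemma eiterint_shift k (i : 'I_n) (g : 'rV[R]_n -> \bar R) h x : (i < k)%N ->
  (forall y, 0 <= g y) -> measurable_fun [set: rVm] (g : rVm -> \bar R) ->
  eiterint k (fun y => g (y + h *: ei i)%R) x = eiterint k g x.
Proof.
move=> + g0 mg; elim: k x => [//|k IH] x; rewrite ltnS leq_eqVlt => /predU1P[<-|ik] /=; last first.
  by apply: eq_integral => s _; exact: IH.
under eq_integral do rewrite eiterint_shift_out// rupd_same.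
by rewrite (ge0_integral_shift h (measurable_eiterint_slice i x i g0 mg))// => s; exact: eiterint_ge0.
Qed.

Lemma measurable_shift (i : 'I_n) h : measurable_fun [set: rVm] (fun y : rVm => (y + h *: ei i)%R : rVm).
Proof.
apply: (@measurability _ _ _ rVm _ _ (@open 'rV[R]_n)) => // _ [U oU <-]; rewrite setTI.
apply: open_measurable_rV; apply: open_comp oU => x _.
by apply: (@cvgD _ 'rV[R]_n _ (nbhs x)); [exact: cvg_id|exact: cvg_cst].
Qed.

Lemma ge0_integral_nu_shift (i : 'I_n) (g : 'rV[R]_n -> \bar R) h : (forall y, 0 <= g y) ->
  measurable_fun [set: rVm] (g : rVm -> \bar R) ->
  \int[nu]_x g (x + h *: ei i)%R = \int[nu]_x g x.
Proof.
move=> g0 mg; rewrite !nuE ?eiterint_shift//.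
exact: (measurableT_comp mg (measurable_shift i h)).
Qed.

Lemma integral_nu_shift (i : 'I_n) (g : 'rV[R]_n -> R) h : mfun g ->
  Inu (fun x => g (x + h *: ei i)%R) = Inu g.
Proof.
move=> mg; suff E : \int[nu]_x (g (x + h *: ei i)%R)%:E = \int[nu]_x (g x)%:E.
  by rewrite /Rintegral E.
rewrite integralE [RHS]integralE.
have mg' : measurable_fun [set: rVm] (fun x : rVm => (g x)%:E) by apply/measurable_EFinP.
congr (_ - _).
  have E := @ge0_integral_nu_shift i (funepos (fun x => (g x)%:E)) h (fun y => funepos_ge0 _ y) (measurable_funepos mg').
  by apply: (etrans _ E); apply: eq_integral => x _; rewrite !unlock.
have E := @ge0_integral_nu_shift i (funeneg (fun x => (g x)%:E)) h (fun y => funeneg_ge0 _ y) (measurable_funeneg mg').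
by apply: (etrans _ E); apply: eq_integral => x _; rewrite !unlock.
Qed.

Lemma oneDsqr_shift (s h : R) : (`|h| <= 1 -> oneDsqr s <= 3 * oneDsqr (s + h))%R.
Proof.
move=> /[!ler_norml] /andP[h1 h2]; rewrite /oneDsqr; have := sqr_ge0 (2 * s + 3 * h)%R.
have : (h ^+ 2 <= 1)%R by rewrite expr2; nra.
by rewrite !expr2; nra.
Qed.

Local Close Scope ereal_scope.

Lemma Wt_shift x (i : 'I_n) h : `|h| <= 1 -> Wt (x + h *: ei i) <= 3 * Wt x.
Proof.
move=> h1; rewrite /Wt (bigD1 i)//= [in leRHS](bigD1 i)//= mulrA.
rewrite (_ : \prod_(j < n | j != i) _ = \prod_(j < n | j != i) (oneDsqr (x ord0 j))^-1); last first.
  by apply: eq_bigr => j /negbTE ji; rewrite !mxE eqxx ji mulr0 addr0.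
have p0 (s : R) : 0 < oneDsqr s by apply: lt_le_trans (oneDsqr_ge1 _).
apply: ler_wpM2r.
  by apply: prodr_ge0 => j _; rewrite invr_ge0 ltW.
rewrite !mxE !eqxx mulr1 -[leLHS]mul1r ler_pdivrMr// mulrAC ler_pdivlMr// mul1r.
exact: oneDsqr_shift.
Qed.

(** The integral of G (x + h e_i) does not depend on h, by translation invariance; it is
    differentiated under the integral sign at h = 0. For |h| <= 1 a translation costs at most a
    factor 3 in [Wt], which gives the domination. *)
Lemma integral_derive_eq0 (i : 'I_n) (G : 'rV[R]_n -> R) :
  continuous G -> (forall x, derivable G x (ei i)) -> continuous ('D_(ei i) G) ->
  Wdom G -> Wdom ('D_(ei i) G) -> Inu ('D_(ei i) G) = 0.
Proof.
move=> cG dG cdG WG WdG.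
have mG := continuous_measurable_rV cG; have mdG := continuous_measurable_rV cdG.
pose f (h : R) (x : rVm) := G (x + h *: ei i).
have df h x : is_derive (h : R) (1 : R) (f ^~ x : R -> R) ('D_(ei i) G (x + h *: ei i)).
  have E t : (f ^~ x \o shift h) (t *: 1) = (G \o shift (x + h *: ei i)) (t *: ei i).
    by rewrite /= /shift /f -[t%:A]/(t * 1) mulr1 scalerDl addrCA.
  split.
    rewrite /derivable; under eq_fun do rewrite E.
    exact: dG.
  rewrite /derive; under eq_fun do rewrite E.
  by [].
have [K WK] := WdG.
have K0 : 0 <= K.
  have := le_trans (normr_ge0 _) (WK 0); by rewrite pmulr_lge0// Wt_gt0.
have := @differentiation_under_integral R _ rVm nu f setT measurableT 0 (-1) 1 _ _ _ (fun x => 3 * K * Wt x).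
have -> : (fun x' => \int[nu]_(y in setT) f x' y) = cst (Inu G).
  by apply/funext => h; rewrite /f integral_nu_shift.
rewrite derive1_cst.
rewrite (_ : \int[nu]_(y in setT) _ = Inu ('D_(ei i) G)); last first.
  apply: eq_Rintegral => x _; rewrite partial1of2E.
  by have [_ ->] := df 0 x; rewrite scale0r addr0.
have mf h : measurable_fun [set: rVm] (f h) by exact: (measurableT_comp mG (measurable_shift i h)).
have h1 (h : R) : `](-1), 1[%classic h -> `|h| <= 1 by rewrite /= in_itv/= => /andP[? ?]; rewrite ler_norml; apply/andP; split; lra.
move=> H; apply/esym; apply: H.
- by rewrite /= in_itv/= ltrN10 ltr01.
- move=> h hh; apply: integrable_Wdom => //; have [K' WK'] := WG; exists (3 * `|K'|) => x.
  rewrite (le_trans (WK' _))// (le_trans (ler_wpM2r (ltW (Wt_gt0 _)) (ler_norm K')))//.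
  by rewrite mulrAC [leLHS]mulrC ler_wpM2r// Wt_shift ?h1.
- by move=> h x _ _; exact: (@ex_derive _ _ _ _ _ _ _ (df h x)).
- by move=> x; rewrite !mulr_ge0// ltW// Wt_gt0.
- exact: integrable_ZWt.
- move=> h x hh _; rewrite partial1of2E (@derive_val _ _ _ _ _ _ _ (df h x)).
  by rewrite (le_trans (WK _))// [3 * K]mulrC -mulrA ler_wpM2l// Wt_shift//; exact: h1.
Qed.

Local Open Scope ring_scope.

Lemma eiterintZl k (g : 'rV[R]_n -> \bar R) K x : 0 <= K -> (forall y, (0 <= g y)%E) ->
  measurable_fun [set: rVm] (g : rVm -> \bar R) ->
  eiterint k (fun y => K%:E * g y)%E x = (K%:E * eiterint k g x)%E.
Proof.
move=> K0 g0 mg; elim: k x => [//|k IH] x /=.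
under eq_integral do rewrite IH.
rewrite (@ge0_integralZl_EFin _ _ _ leb)//; last 2 first.
- by move=> s _; exact: eiterint_ge0.
- exact: measurable_eiterint_slice.
Qed.

Lemma eiterint_Wdom_fin k (g : 'rV[R]_n -> R) x : (k <= n)%N -> mfun g -> (forall y, 0 <= g y) ->
  Wdom g -> eiterint k (fun y => (g y)%:E) x \is a fin_num.
Proof.
move=> kn mg g0 [K gK]; rewrite ge0_fin_numE; last by apply: eiterint_ge0.
have mW : measurable_fun [set: rVm] (fun y : rVm => (Wt y)%:E).
  by apply/measurable_EFinP; apply: continuous_measurable_rV; exact: continuous_Wt.
apply: (@le_lt_trans _ _ (eiterint k (fun y => (`|K|%R%:E * (Wt y)%:E)%E) x)).
  apply: eiterint_le => //; first exact/measurable_EFinP.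
    exact: measurable_funeM.
  move=> y; rewrite -EFinM lee_fin (le_trans (ler_norm _))// (le_trans (gK y))//.
  by rewrite ler_wpM2r ?ler_norm// ltW// Wt_gt0.
rewrite eiterintZl//; last by move=> y; rewrite lee_fin ltW// Wt_gt0.
by rewrite lte_mul_pinfty ?lee_fin// eiterint_Wt_lty.
Qed.

Let pos (g : 'rV[R]_n -> R) y := Num.max (g y) 0.
Let mpos (g : 'rV[R]_n -> R) : mfun g -> mfun (pos g).
Proof. by move=> mg; apply: measurable_maxr. Qed.
Let pos0 g y : 0 <= pos g y. Proof. by rewrite le_max lexx orbT. Qed.
Let mposE (g : 'rV[R]_n -> R) : mfun g -> measurable_fun [set: rVm] (fun y : rVm => (pos g y)%:E).
Proof. by move=> mg; apply/measurable_EFinP; exact: mpos. Qed.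
Let posW g : Wdom g -> Wdom (pos g).
Proof.
move=> [K gK]; exists K => x; rewrite ger0_norm// /pos ge_max (le_trans (ler_norm _))//=.
by rewrite (le_trans (normr_ge0 _) (gK x)).
Qed.
Let posN g y : g y = pos g y - pos (fun z => - g z) y.
Proof.
rewrite /pos; case: (leP 0 (g y)) => h.
  by rewrite (max_idPr _) ?subr0// oppr_le0.
by rewrite (max_idPl _) ?sub0r ?opprK// oppr_ge0 ltW.
Qed.

(** Every stage of [iterint] is a real integral, which is meaningful only when finite; domination by
    [Wt] makes both the positive and the negative part finite at every stage. *)
Lemma iterint_posneg k (g : 'rV[R]_n -> R) x : (k <= n)%N -> mfun g -> Wdom g ->
  iterint k g x = fine (eiterint k (fun y => (pos g y)%:E) x) -
                  fine (eiterint k (fun y => (pos (fun z => - g z) y)%:E) x).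
Proof.
move=> + mg Wg; elim: k x => [x _|k IH x kn] /=; first exact: posN.
have mg' : mfun (fun z => - g z) by exact: measurable_funN.
have Wg' : Wdom (fun z => - g z) by case: Wg => K gK; exists K => z; rewrite normrN.
have key (f : 'rV[R]_n -> R) : mfun f -> Wdom f -> leb.-integrable setT
    (fun s => (fine (eiterint k (fun y => (pos f y)%:E) (rupd x k s)))%:E).
  move=> mf Wf; have fE s := fineK (eiterint_Wdom_fin (rupd x k s) (ltnW kn) (mpos mf) (pos0 f) (posW Wf)).
  under eq_fun do rewrite fE.
  apply/integrableP; split.
    by apply: measurable_eiterint_slice; [move=> y; rewrite lee_fin|exact (mposE mf)].
  rewrite (_ : (\int[leb]_s _)%E = eiterint k.+1 (fun y => (pos f y)%:E) x); last first.
    by apply: eq_integral => s _; rewrite gee0_abs// eiterint_ge0// => y; rewrite lee_fin.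
  have := eiterint_Wdom_fin x kn (mpos mf) (pos0 f) (posW Wf).
  by rewrite fin_numElt => /andP[].
under eq_Rintegral do rewrite (IH _ (ltnW kn)).
rewrite RintegralB//; [|exact: key|exact: key].
congr (_ - _); rewrite /Rintegral; congr fine; apply: eq_integral => s _;
  by rewrite fineK// eiterint_Wdom_fin//; [exact: ltnW|exact: mpos|exact: posW].
Qed.

Lemma intRn_nu (g : 'rV[R]_n -> R) : mfun g -> Wdom g -> intRn g = Inu g.
Proof.
move=> mg Wg; have mg' : mfun (fun z => - g z) by exact: measurable_funN.
have Wg' : Wdom (fun z => - g z) by case: Wg => K gK; exists K => z; rewrite normrN.
rewrite /intRn iterint_posneg//.
rewrite (_ : Inu g = Inu (fun y => pos g y - pos (fun z => - g z) y)); last first.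
  by apply: eq_Rintegral => y _; exact: posN.
rewrite RintegralB//; [|by apply: integrable_Wdom; [exact: mpos|exact: posW]..].
have p0 (f : 'rV[R]_n -> R) y : (0 <= (pos f y)%:E)%E by rewrite lee_fin.
by congr (fine _ - fine _); [exact: esym (nuE (p0 g) (mposE mg))|exact: esym (nuE (p0 _) (mposE mg'))].
Qed.

Lemma L2norm2_nu (g : 'rV[R]_n -> R[i]) : continuous (cRe g) -> continuous (cIm g) ->
  L2norm2 g = (\int[nu]_x ((cRe g x) ^+ 2 + (cIm g x) ^+ 2)%:E)%E.
Proof.
move=> cr cim; rewrite nuE.
- congr eiterint; apply/funext => x; congr (_%:E).
  by rewrite /cabs sqr_sqrtr// addr_ge0 ?sqr_ge0.
- by move=> y; rewrite lee_fin addr_ge0 ?sqr_ge0.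
- apply/measurable_EFinP; apply: measurable_funD; apply: measurable_funX;
    exact: continuous_measurable_rV.
Qed.

End NuIntegral.

(** * Hermite functions *)

Section Calculus1.
Context {R : realType}.
Implicit Types f df : R -> R.

Definition hasD f df := forall x : R, is_derive x (1 : R) f (df x).

Lemma hasD_eq f df df' : hasD f df -> df =1 df' -> hasD f df'.
Proof. by move=> h e x; rewrite -e. Qed.

Lemma hasD_cont f df : hasD f df -> continuous f.
Proof. by move=> h x; apply: differentiable_continuous; apply/derivable1_diffP; have [] := h x. Qed.

Lemma hasDD f df g dg : hasD f df -> hasD g dg -> hasD (fun x => f x + g x) (fun x => df x + dg x).
Proof. by move=> hf hg x; have := hf x; have := hg x => ? ?; exact: is_deriveD. Qed.

Lemma hasDM f df g dg : hasD f df -> hasD g dg -> hasD (fun x => f x * g x) (fun x => df x * g x + f x * dg x).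
Proof.
move=> hf hg x; have := hf x; have := hg x => ? ?.
by apply: (is_derive_eq (is_deriveM _ _)); rewrite /GRing.scale /= addrC [g x * _]mulrC.
Qed.

Lemma hasD_cst (c : R) : hasD (fun=> c) (fun=> 0).
Proof. by move=> x; exact: is_derive_cst. Qed.

Lemma hasD_id : hasD (fun x => x) (fun=> 1).
Proof. by move=> x; exact: is_derive_id. Qed.

Lemma hasDZ (c : R) f df : hasD f df -> hasD (fun x => c * f x) (fun x => c * df x).
Proof. by move=> hf; apply: hasD_eq (hasDM (hasD_cst c) hf) _ => x; rewrite mul0r add0r. Qed.

Lemma hasDN f df : hasD f df -> hasD (fun x => - f x) (fun x => - df x).
Proof. by move=> hf x; have := hf x => ?; exact: is_deriveN. Qed.

Lemma hasDB f df g dg : hasD f df -> hasD g dg -> hasD (fun x => f x - g x) (fun x => df x - dg x).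
Proof. by move=> hf hg; exact: hasDD hf (hasDN hg). Qed.

Lemma hasD_comp f df g dg : hasD f df -> hasD g dg -> hasD (fun x => f (g x)) (fun x => df (g x) * dg x).
Proof.
move=> hf hg x; have := hf (g x); have := hg x => h1 h2.
exact: is_derive1_comp.
Qed.

Lemma hasD_exp f df : hasD f df -> hasD (fun x => expR (f x)) (fun x => expR (f x) * df x).
Proof. by apply: hasD_comp => x; exact: is_derive_expR. Qed.

Lemma hasD_mvt f df (a b : R) : hasD f df -> a <= b ->
  exists2 c, a <= c <= b & f b - f a = df c * (b - a).
Proof.
move=> hf ab; have [||c cab e] := @MVT_segment _ f df _ _ ab.
- by move=> x _; exact: hf.
- by apply: continuous_subspaceT; exact: hasD_cont hf.
- by exists c => //; rewrite in_itv in cab.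
Qed.

Lemma hasD_nincr f df (a b : R) : hasD f df -> a <= b ->
  (forall x, a <= x <= b -> df x <= 0) -> f b <= f a.
Proof.
move=> hf ab h; have [c cab e] := hasD_mvt hf ab.
by rewrite -subr_le0 e mulr_le0_ge0 ?h ?subr_ge0.
Qed.

Lemma hasD_lip f df (K a b : R) : hasD f df -> a <= b ->
  (forall x, a <= x <= b -> `|df x| <= K) -> `|f b - f a| <= K * (b - a).
Proof.
move=> hf ab h; have [c cab e] := hasD_mvt hf ab.
by rewrite e normrM (ger0_norm (_ : 0 <= b - a)) ?subr_ge0// ler_wpM2r ?subr_ge0 ?h.
Qed.

End Calculus1.

(** * Hermite functions of one variable *)

Section Hermite1.
Context {R : realType}.

(** H_k(x) exp (- x^2 / 2), with H_k the physicists' Hermite polynomials given by their three-term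
    recurrence. *)
Fixpoint hf (k : nat) (x : R) : R :=
  match k with
  | 0 => expR (- (x ^+ 2 / 2))
  | k1.+1 => match k1 with
    | 0 => 2 * x * hf k1 x
    | k2.+1 => 2 * x * hf k1 x - 2 * k1%:R * hf k2 x
    end
  end.

Lemma hfS k x : hf k.+1 x = 2 * x * hf k x - 2 * k%:R * hf k.-1 x.
Proof. by case: k => [|k] //=; rewrite mulr0 mul0r subr0. Qed.

Lemma hasD_hf k : hasD (hf k) (fun x => - x * hf k x + 2 * k%:R * hf k.-1 x).
Proof.
have h0 : hasD (hf 0) (fun x => - x * hf 0 x + 2 * 0%:R * hf 0.-1 x).
  have h2 : hasD (fun x : R => - (x ^+ 2 / 2)) (fun x => - x).
    apply: (hasD_eq (df := fun x => - (2^-1 * (1 * x + x * 1)))).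
      by apply: hasDN; rewrite (_ : (fun x => _) = (fun x : R => 2^-1 * (x * x)));
        [exact: hasDZ (hasDM hasD_id hasD_id)|apply/funext => x; rewrite expr2 mulrC].
    by move=> x; field.
  apply: hasD_eq (hasD_exp h2) _ => x /=; rewrite mulr0 mul0r addr0; ring.
have hS j : hasD (hf j) (fun x => - x * hf j x + 2 * j%:R * hf j.-1 x) ->
    hasD (hf j.-1) (fun x => - x * hf j.-1 x + 2 * j.-1%:R * hf j.-2 x) ->
    hasD (hf j.+1) (fun x => - x * hf j.+1 x + 2 * j.+1%:R * hf j x).
  move=> h1 h2; rewrite (_ : hf j.+1 = fun x => 2 * (x * hf j x) - (2 * j%:R) * hf j.-1 x); last first.
    by apply/funext => x; rewrite hfS mulrA.
  apply: hasD_eq (hasDB (hasDZ 2 (hasDM hasD_id h1)) (hasDZ (2 * j%:R) h2)) _ => x.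
  case: j {h1 h2} => [|j]; first by rewrite /= !mulr0 !mul0r; ring.
  rewrite [j.+1.-1]/= (hfS j x) -[j.+2%:R]natr1; ring.
suff : hasD (hf k) (fun x => - x * hf k x + 2 * k%:R * hf k.-1 x) /\
    hasD (hf k.+1) (fun x => - x * hf k.+1 x + 2 * k.+1%:R * hf k x) by case.
elim: k => [|k [IH1 IH2]]; split=> //; first exact: (hS 0%N).
exact: (hS k.+1).
Qed.

(** The usual normalization without its factor pi^(-1/4), so that [hh 0 0 = 1]; these factors are
    collected in [psic]. *)
Definition hN (k : nat) : R := (Num.sqrt (2 ^+ k * k`!%:R))^-1.
Definition hh k x : R := hN k * hf k x.

Lemma hN_gt0 k : 0 < hN k.
Proof. by rewrite invr_gt0 sqrtr_gt0 mulr_gt0 ?exprn_gt0// ltr0n fact_gt0. Qed.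

Lemma hNS k : hN k = Num.sqrt (2 * k.+1%:R) * hN k.+1.
Proof.
have e : Num.sqrt (2 ^+ k.+1 * (k.+1)`!%:R) = Num.sqrt (2 * k.+1%:R) * Num.sqrt (2 ^+ k * k`!%:R) :> R.
  by rewrite -sqrtrM ?mulr_ge0// factS exprS natrM mulrACA.
by rewrite /hN e invfM mulVKf// gt_eqF// sqrtr_gt0 mulr_gt0.
Qed.

Lemma sqrt_half (k : nat) : Num.sqrt (k%:R / 2) * 2 = Num.sqrt (2 * k%:R) :> R.
Proof.
have {2}-> : 2 = Num.sqrt (2 ^+ 2) :> R by rewrite sqrtr_sqr ger0_norm.
by rewrite -sqrtrM ?divr_ge0//; congr Num.sqrt; field.
Qed.

Lemma hh_x k x : x * hh k x = Num.sqrt (k.+1%:R / 2) * hh k.+1 x + Num.sqrt (k%:R / 2) * hh k.-1 x.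
Proof.
rewrite /hh (hNS k) -sqrt_half hfS.
set s := Num.sqrt (k.+1%:R / 2).
have -> : Num.sqrt (k%:R / 2) * (hN k.-1 * hf k.-1 x) = s * 2 * k%:R * hN k.+1 * hf k.-1 x.
  case: k @s => [|k] s; first by rewrite [0%:R / 2]mul0r sqrtr0 mulr0 !mul0r.
  rewrite [k.+1.-1]/= (hNS k) (hNS k.+1) -!sqrt_half -/s.
  have := sqr_sqrtr (_ : 0 <= k.+1%:R / 2 :> R); rewrite divr_ge0// => /(_ isT) e.
  rewrite -[in RHS](_ : Num.sqrt (k.+1%:R / 2) ^+ 2 * 2 = k.+1%:R :> R); last by rewrite e; field.
  by ring.
by ring.
Qed.

Lemma hasD_hh k : hasD (hh k)
  (fun x => Num.sqrt (k%:R / 2) * hh k.-1 x - Num.sqrt (k.+1%:R / 2) * hh k.+1 x).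
Proof.
apply: hasD_eq (hasDZ (hN k) (hasD_hf k)) _ => x.
have := hh_x k x; case: k => [|k].
  by rewrite !mulr0 !mul0r sqrtr0 !mul0r /hh => e; lra.
rewrite /hh [k.+1.-1]/= (hNS k) -sqrt_half => e.
have e2 := sqr_sqrtr (_ : 0 <= k.+1%:R / 2 :> R).
have := e2 (divr_ge0 (ler0n _ _) (ler0n _ _)); set s := Num.sqrt (k.+1%:R / 2).
move=> {e2} e2; have -> : k.+1%:R = 2 * s ^+ 2 by rewrite e2; field.
rewrite -/s in e.
set t := Num.sqrt (k.+2%:R / 2) in e *; move: e.
set A := hf k x; set B := hf k.+1 x; set C := hf k.+2 x; set D := hN _; set E := hN _ => e.
have -> : D * (- x * B + 2 * (2 * s ^+ 2) * A) = - (x * (D * B)) + 4 * s ^+ 2 * D * A by ring.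
by rewrite e; ring.
Qed.

Lemma hf_decay k p : exists B : R, forall x, `|x| ^+ p * `|hf k x| <= B.
Proof.
have h0 q : exists B : R, forall x, `|x| ^+ q * `|hf 0 x| <= B.
  exists (q`!%:R * expR 2^-1) => x; rewrite /= [`|expR _|]ger0_norm ?expR_ge0//.
  rewrite expRN ler_pdivrMr ?expR_gt0// (le_trans (exprn_le_fact_expR q (normr_ge0 x)))//.
  rewrite -mulrA ler_wpM2l// -expRD ler_expR.
  by have := sqr_ge0 (`|x| - 1); rewrite -(real_normK (num_real x)) !expr2; nra.
have hS j : (forall q, exists B : R, forall x, `|x| ^+ q * `|hf j x| <= B) ->
    (forall q, exists B : R, forall x, `|x| ^+ q * `|hf j.-1 x| <= B) ->
    (forall q, exists B : R, forall x, `|x| ^+ q * `|hf j.+1 x| <= B).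
  move=> h1 h2 q; have [B1 b1] := h1 q.+1; have [B2 b2] := h2 q.
  exists (2 * B1 + 2 * j%:R * B2) => x; rewrite hfS.
  apply: (le_trans (ler_wpM2l _ (ler_normB _ _))); first by rewrite exprn_ge0.
  rewrite mulrDr lerD// !normrM [`|2|]ger0_norm// ?[`|j%:R|]ger0_norm//.
    have := b1 x; rewrite exprS => h; rewrite (_ : _ * _ = 2 * (`|x| * `|x| ^+ q * `|hf j x|)) ?ler_wpM2l//; ring.
  by rewrite mulrCA ler_wpM2l ?mulr_ge0.
suff : (forall q, exists B : R, forall x, `|x| ^+ q * `|hf k x| <= B) /\
    (forall q, exists B : R, forall x, `|x| ^+ q * `|hf k.+1 x| <= B) by case.
elim: k {p} => [|k [IH1 IH2]]; split=> //; first exact: (hS 0%N).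
exact: (hS k.+1).
Qed.

Lemma hh_decay k p : exists B : R, forall x, `|x| ^+ p * `|hh k x| <= B.
Proof.
have [B hB] := hf_decay k p; exists (hN k * B) => x.
by rewrite /hh normrM (ger0_norm (ltW (hN_gt0 k))) mulrCA ler_wpM2l// ltW// hN_gt0.
Qed.

Definition hh' k x := Num.sqrt (k%:R / 2) * hh k.-1 x - Num.sqrt (k.+1%:R / 2) * hh k.+1 x.

Lemma hh'E k x : hh' k x = - x * hh k x + Num.sqrt (2 * k%:R) * hh k.-1 x.
Proof. by rewrite mulNr hh_x /hh' -sqrt_half; ring. Qed.

Lemma hasD_hh' k : hasD (hh' k) (fun x => (x ^+ 2 - (2 * k%:R + 1)) * hh k x).
Proof.
rewrite (_ : hh' k = fun x => - (x * hh k x) + Num.sqrt (2 * k%:R) * hh k.-1 x); last first.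
  by apply/funext => x; rewrite hh'E mulNr.
apply: hasD_eq (hasDD (hasDN (hasDM hasD_id (hasD_hh k))) (hasDZ _ (hasD_hh k.-1))) _ => x.
rewrite -/(hh' k x) -/(hh' k.-1 x) hh'E.
case: k => [|k]; first by rewrite !mulr0 sqrtr0 !mul0r; ring.
rewrite [k.+1.-1]/= /hh' -[k.+1%:R in RHS](_ : Num.sqrt (2 * k.+1%:R) ^+ 2 / 2 = _); last first.
  by rewrite sqr_sqrtr ?mulr_ge0//; field.
have := hh_x k x; rewrite -sqrt_half; set s := Num.sqrt (k.+1%:R / 2); set t := Num.sqrt (k%:R / 2) => e.
have e' : t * hh k.-1 x = x * hh k x - s * hh k.+1 x by rewrite e; ring.
by rewrite e'; field.
Qed.

Lemma hh_opp k x : hh k (- x) = (-1) ^+ k * hh k x.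
Proof.
rewrite /hh [RHS]mulrCA; congr (_ * _).
suff : hf k (- x) = (-1) ^+ k * hf k x /\ hf k.+1 (- x) = (-1) ^+ k.+1 * hf k.+1 x by case.
elim: k => [|k [IH1 IH2]]; split=> //; first by rewrite /= sqrrN mul1r.
  by rewrite /= sqrrN expr1; ring.
by rewrite [LHS]hfS [hf k.+2 x]hfS IH2 [k.+1.-1]/= IH1 !exprS; ring.
Qed.

Lemma hh0_le1 k : `|hh k 0| <= 1.
Proof.
suff : `|hh k 0| <= 1 /\ `|hh k.+1 0| <= 1 by case.
elim: k => [|k [IH1 IH2]]; split=> //.
- by rewrite /hh /hN /= expr0n /= mul0r oppr0 expR0 expr0 mul1r fact0 sqrtr1 invr1 mulr1 normr1.
- by rewrite /hh /= mulr0 mul0r mulr0 normr0.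
have := hh_x k.+1 0; rewrite mul0r [k.+1.-1]/= => /esym/eqP; rewrite addr_eq0 => /eqP e.
have s0 (j : nat) : 0 <= Num.sqrt (j%:R / 2) :> R by exact: sqrtr_ge0.
have : Num.sqrt (k.+2%:R / 2) * `|hh k.+2 0| <= Num.sqrt (k.+2%:R / 2) * 1.
  rewrite -[X in X * `|_|]ger0_norm// -normrM e normrN normrM ger0_norm//.
  by apply: ler_pM => //; rewrite ler_sqrt ?divr_ge0// ler_pM2r// ler_nat.
by rewrite ler_pM2l// sqrtr_gt0 divr_gt0.
Qed.

Lemma hh'0_le k : `|hh' k 0| <= 2 * Num.sqrt k.+1%:R.
Proof.
have h (j : nat) : (j <= k.+1)%N -> Num.sqrt (j%:R / 2) <= Num.sqrt k.+1%:R :> R.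
  move=> jk; rewrite ler_sqrt// ler_pdivrMr// (@le_trans _ _ (k.+1%:R)) ?ler_nat//.
  by rewrite ler_peMr// ler1n.
rewrite /hh'; apply: (le_trans (ler_normB _ _)); rewrite [2 * _]mulr_natl mulr2n lerD// normrM -[leRHS]mulr1 ler_pM ?hh0_le1//.
  by rewrite ger0_norm// h.
by rewrite ger0_norm// h.
Qed.

(** Sonin's energy argument inside the turning point: E = h'^2 + (2k + 1 - y^2) h^2 has derivative -
    2 y h^2 <= 0, so h' is bounded by a multiple of sqrt (k + 1) on an interval whose length is of
    the same order. *)
Lemma hh_le_in k x : 0 <= x -> x ^+ 2 <= 2 * k%:R + 1 -> `|hh k x| <= 6 * k.+1%:R.
Proof.
move=> x0 xk; pose E y := hh' k y ^+ 2 + (2 * k%:R + 1 - y ^+ 2) * hh k y ^+ 2.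
have hE : hasD E (fun y => - 2 * y * hh k y ^+ 2).
  pose E2 y := hh' k y * hh' k y + (2 * k%:R + 1 - y * y) * (hh k y * hh k y).
  rewrite (_ : E = E2); last by apply/funext => y; rewrite /E /E2 !expr2.
  apply: hasD_eq (hasDD (hasDM (hasD_hh' k) (hasD_hh' k)) (hasDM (hasDB (hasD_cst _) (hasDM hasD_id hasD_id)) (hasDM (hasD_hh k) (hasD_hh k)))) _ => y.
  by rewrite -/(hh' k y); ring.
have k1 : 1 <= k.+1%:R :> R by rewrite ler1n.
have kE : k.+1%:R = k%:R + 1 :> R by rewrite -natr1.
have E0 : E 0 <= 6 * k.+1%:R.
  have h1 := hh'0_le k; have h2 := hh0_le1 k; rewrite /E expr0n subr0.
  have h1' : hh' k 0 ^+ 2 <= 4 * k.+1%:R.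
    rewrite -(real_normK (num_real _)) (le_trans (lerXn2r 2 _ _ h1)) ?nnegrE ?mulr_ge0//.
    by rewrite exprMn sqr_sqrtr//; lra.
  have h2' : hh k 0 ^+ 2 <= 1 by rewrite -(real_normK (num_real _)) expr_le1.
  have k0 : 0 <= 2 * k%:R + 1 :> R by rewrite addr_ge0 ?mulr_ge0.
  by have := ler_wpM2l k0 h2'; rewrite kE in h1' *; lra.
have d y : 0 <= y <= x -> `|hh' k y| <= 3 * Num.sqrt k.+1%:R.
  move=> /andP[y0 yx]; have EE : E y <= E 0.
    apply: (hasD_nincr hE y0) => z /andP[z0 _].
    by have := mulr_ge0 z0 (sqr_ge0 (hh k z)); lra.
  have y2 : y ^+ 2 <= 2 * k%:R + 1 by apply: le_trans xk; rewrite lerXn2r ?nnegrE.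
  rewrite -ler_sqr ?nnegrE ?mulr_ge0// (real_normK (num_real _)) exprMn sqr_sqrtr//.
  have : 0 <= (2 * k%:R + 1 - y ^+ 2) * hh k y ^+ 2 by rewrite mulr_ge0 ?sqr_ge0// subr_ge0.
  by move: EE; rewrite {1}/E; lra.
have := hasD_lip (hasD_hh k) x0 d; rewrite subr0 => h.
have xs : x <= Num.sqrt (2 * k.+1%:R).
  by rewrite -ler_sqr ?nnegrE// sqr_sqrtr ?mulr_ge0// kE; lra.
have s2 : Num.sqrt (2 * k.+1%:R) <= 3 / 2 * Num.sqrt k.+1%:R :> R.
  rewrite -ler_sqr ?nnegrE ?mulr_ge0// exprMn !sqr_sqrtr ?mulr_ge0//; lra.
have s1 : Num.sqrt k.+1%:R * Num.sqrt k.+1%:R = k.+1%:R :> R by rewrite -expr2 sqr_sqrtr.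
have := hh0_le1 k; have := ler_normD (hh k x - hh k 0) (hh k 0); rewrite subrK.
have := ler_wpM2l (_ : 0 <= 3 * Num.sqrt k.+1%:R) (le_trans xs s2).
rewrite mulr_ge0// => /(_ isT).
set t := Num.sqrt k.+1%:R in h s1 *.
rewrite (_ : 3 * t * (3 / 2 * t) = 9 / 2 * (t * t)); last by field.
rewrite s1; by lra.
Qed.

(** Beyond the turning point h^2 is convex, since h'' = (x^2 - 2k - 1) h. A bounded convex function
    on a half line cannot increase, so the maximum is reached inside. A polynomial bound in k
    suffices, because the coefficients will decay geometrically. *)
Lemma hh_le k x : `|hh k x| <= 6 * k.+1%:R.
Proof.
wlog x0 : x / 0 <= x.
  move=> H; case: (leP 0 x) => [/H//|x0].
  by have := H (- x); rewrite hh_opp normrM normrX normrN1 expr1n mul1r; apply; lra.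
have k1 : 1 <= k.+1%:R :> R by rewrite ler1n.
case: (leP (x ^+ 2) (2 * k%:R + 1)) => [h|h].
  exact: hh_le_in.
pose x1 := Num.sqrt (2 * k%:R + 1) : R.
have k0 : 0 <= 2 * k%:R + 1 :> R by rewrite addr_ge0 ?mulr_ge0.
have x1x : x1 <= x by rewrite -ler_sqr ?nnegrE ?sqrtr_ge0// sqr_sqrtr// ltW.
pose g y := hh k y * hh k y.
pose g' y := hh' k y * hh k y + hh k y * hh' k y.
have hg : hasD g g' by exact: hasDM (hasD_hh k) (hasD_hh k).
have hg' := hasDD (hasDM (hasD_hh' k) (hasD_hh k)) (hasDM (hasD_hh k) (hasD_hh' k)).
have gnd a b : x1 <= a -> a <= b -> g' a <= g' b.
  move=> x1a ab; rewrite -lerN2; apply: (hasD_nincr (hasDN hg') ab) => y /andP[ay _].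
  rewrite oppr_le0 -/(hh' k y).
  have y2 : 2 * k%:R + 1 <= y ^+ 2.
    rewrite -[leLHS]sqr_sqrtr// -/x1 lerXn2r ?nnegrE ?sqrtr_ge0//; last exact: le_trans ay.
    by apply: le_trans (le_trans x1a ay); exact: sqrtr_ge0.
  have : 0 <= (y ^+ 2 - (2 * k%:R + 1)) * (hh k y * hh k y).
    by rewrite mulr_ge0 ?subr_ge0// -expr2 sqr_ge0.
  by have := sqr_ge0 (hh' k y); rewrite expr2; lra.
have gneg a : x1 <= a -> g' a <= 0.
  move=> x1a; rewrite leNgt; apply/negP => ga.
  have [B hB] := hh_decay k 0; have B0 : 0 <= B := le_trans (mulr_ge0 (exprn_ge0 _ (normr_ge0 0)) (normr_ge0 _)) (hB 0).
  pose b := a + (B * B + 1) / g' a.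
  have ab : a <= b by rewrite lerDl divr_ge0 ?(ltW ga)// addr_ge0 ?mulr_ge0.
  have [c /andP[ac cb] e] := hasD_mvt hg ab.
  have : B * B + 1 <= g b - g a.
    have ba : b - a = (B * B + 1) / g' a by rewrite /b addrC addKr.
    rewrite e ba -[leLHS](divfK (lt0r_neq0 ga)) [leLHS]mulrC.
    by rewrite ler_wpM2r ?gnd// divr_ge0 ?(ltW ga)// addr_ge0 ?mulr_ge0.
  have : g b <= B * B.
    rewrite /g (le_trans (ler_norm _))// normrM.
    by have := hB b; rewrite expr0 mul1r => hb; rewrite ler_pM.
  by have := sqr_ge0 (hh k a); rewrite expr2 /g; lra.
have gx : g x <= g x1 by apply: (hasD_nincr hg x1x) => y /andP[xy _]; exact: gneg.
have := @hh_le_in k x1 (sqrtr_ge0 _); rewrite sqr_sqrtr// lexx => /(_ isT) h1.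
rewrite (@le_trans _ _ `|hh k x1|)//.
by rewrite -ler_sqr ?nnegrE// !(real_normK (num_real _)) !expr2.
Qed.

End Hermite1.

(** * Continuity rules and derivatives along lines *)

Section ContRules.
Context {R : realType} {T : topologicalType}.
Implicit Types f g : T -> R.

Lemma cM f g : continuous f -> continuous g -> continuous (fun x => f x * g x).
Proof. by move=> cf cg x; apply: cvgM; [exact: cf|exact: cg]. Qed.

Lemma cD f g : continuous f -> continuous g -> continuous (fun x => f x + g x).
Proof. by move=> cf cg x; apply: cvgD; [exact: cf|exact: cg]. Qed.

Lemma cB f g : continuous f -> continuous g -> continuous (fun x => f x - g x).
Proof. by move=> cf cg x; apply: cvgB; [exact: cf|exact: cg]. Qed.

Lemma cZ (c : R) f : continuous f -> continuous (fun x => c * f x).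
Proof. by move=> cf x; apply: cvgM; [exact: cvg_cst|exact: cf]. Qed.

End ContRules.

Section Lines.
Context {R : realType} {V : normedModType R}.

Lemma is_derive_line (f : V -> R) (x v : V) (d : R) :
  is_derive (0 : R) (1 : R) (fun t : R => f (x + t *: v)) d <-> is_derive x v f d.
Proof.
pose F := fun t : R => f (x + t *: v).
have E h : (F \o shift 0) (h *: 1) - F 0 = (f \o shift x) (h *: v) - f x.
  by rewrite /F /shift /= !addr0 scale0r addr0 -[h%:A]/(h * 1) mulr1 [h *: v + x]addrC.
have E' : (fun h => h^-1 *: ((F \o shift 0) (h *: 1) - F 0)) =
          (fun h => h^-1 *: ((f \o shift x) (h *: v) - f x)).
  by apply/funext => h; rewrite E.
by split=> -[h1 h2]; split; move: h1 h2; rewrite /derivable /derive E'.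
Qed.

Lemma is_derive_pt (f : V -> R) (x v : V) : derivable f x v -> is_derive x v f ('D_v f x).
Proof. by move=> h; split. Qed.

Lemma is_deriveMr (f g : V -> R) (x v : V) (df dg : R) : is_derive x v f df -> is_derive x v g dg ->
  is_derive x v (fun y => f y * g y) (df * g x + f x * dg).
Proof.
by move=> hf hg; apply: (is_derive_eq (is_deriveM hf hg)); rewrite /GRing.scale /= addrC [g x * _]mulrC.
Qed.

End Lines.

(** * Hermite functions on R^n and their orthonormality *)

Section HermiteN.
Context {R : realType} {n : nat}.
Notation rVm := (@rVm R n).
Notation ei := (@ei R n).
Notation Inu g := (Rintegral (@nu R n) [set: rVm] (g : rVm -> R)).
Notation idx := (@idx n).

Definition tens (g : 'I_n -> R -> R) (x : 'rV[R]_n) : R := \prod_i g i (x ord0 i).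

Lemma tensD1 (g : 'I_n -> R -> R) i x :
  tens g x = g i (x ord0 i) * \prod_(j | j != i) g j (x ord0 j).
Proof. by rewrite /tens (bigD1 i). Qed.

Definition gset (g : 'I_n -> R -> R) (i : 'I_n) (f : R -> R) : 'I_n -> R -> R :=
  fun j => if j == i then f else g j.

Lemma tens_gset (g : 'I_n -> R -> R) i f x :
  tens (gset g i f) x = f (x ord0 i) * \prod_(j | j != i) g j (x ord0 j).
Proof.
rewrite (tensD1 _ i) /gset eqxx; congr (_ * _).
by apply: eq_bigr => j /negbTE ->.
Qed.

Lemma line_coord (x : 'rV[R]_n) i t j : (x + t *: ei i) ord0 j = x ord0 j + t * (j == i)%:R.
Proof. by rewrite !mxE eqxx. Qed.

Lemma tens_derive (g : 'I_n -> R -> R) i (g' : R -> R) x : hasD (g i) g' ->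
  is_derive x (ei i) (tens g) (tens (gset g i g') x).
Proof.
move=> hg; apply/is_derive_line; rewrite tens_gset.
set C := \prod_(_ | _) _.
rewrite (_ : (fun t => _) = fun t => C * g i (x ord0 i + t)); last first.
  apply/funext => t; rewrite (tensD1 _ i) line_coord eqxx mulr1 mulrC; congr (_ * _).
  by apply: eq_bigr => j /negbTE ji; rewrite line_coord ji mulr0 addr0.
have h := hasDZ C (hasD_comp hg (hasDD (hasD_cst (x ord0 i)) hasD_id)).
by apply: (is_derive_eq (h 0)); rewrite add0r mulr1 addr0 mulrC.
Qed.

Lemma continuous_tens (g : 'I_n -> R -> R) : (forall i, continuous (g i)) -> continuous (tens g).
Proof.
move=> cg; apply: continuous_prodr => i x.
apply: (@continuous_comp _ _ _ (fun x : 'rV[R]_n => x ord0 i) (g i)); last exact: cg.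
exact: coordn_continuous.
Qed.

(* Bounded after multiplication by 1 + s^2: such factors make a tensor product integrable. *)
Definition sqdom (f : R -> R) := exists B, forall s, `|f s| <= B * (oneDsqr s)^-1.

Lemma sqdomW (g : 'I_n -> R -> R) : (forall i, sqdom (g i)) -> Wdom (tens g).
Proof.
move=> /choice[B hB]; exists (\prod_i B i) => x.
rewrite /tens /Wt normr_prod -big_split /=.
by apply: ler_prod => i _; rewrite normr_ge0 hB.
Qed.

Definition bounded1 (f : R -> R) := exists B, forall s, `|f s| <= B.

Lemma oneDsqr_gt0 (s : R) : 0 < oneDsqr s. Proof. exact: lt_le_trans (oneDsqr_ge1 _). Qed.

Lemma hh_sqdom k p : sqdom (fun s => s ^+ p * hh k s).
Proof.
have [B0 h0] := @hh_decay R k p; have [B2 h2] := @hh_decay R k p.+2.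
exists (B0 + B2) => s; rewrite ler_pdivlMr ?oneDsqr_gt0// /oneDsqr mulrDr mulr1 normrM normrX.
rewrite lerD// -(real_normK (num_real s)) mulrAC -exprD addn2; exact: h2.
Qed.

Lemma hh_sqdom0 k : sqdom (@hh R k).
Proof.
have [B hB] := hh_sqdom k 0; exists B => s; apply: le_trans (hB s).
by rewrite expr0 mul1r.
Qed.

Lemma hh_cont k : continuous (@hh R k). Proof. exact: hasD_cont (hasD_hh k). Qed.

(** pi^(n/2), the squared norm of the Gaussian exp (- |x|^2 / 2); hence [psic] is pi^(-n/4). *)
Definition psiZ : R := Num.sqrt pi ^+ n.
Definition psic : R := (Num.sqrt psiZ)^-1.
Definition htens (a : idx) : 'I_n -> R -> R := fun i => hh (a i).
Definition psi (a : idx) (x : 'rV[R]_n) : R := psic * tens (htens a) x.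

Lemma psiZ_gt0 : 0 < psiZ. Proof. by rewrite exprn_gt0// sqrtr_gt0 pi_gt0. Qed.

Lemma psi_x (a : idx) (i : 'I_n) (x : 'rV[R]_n) : x ord0 i * psi a x =
  Num.sqrt ((a i).+1%:R / 2) * psi (up a i) x + Num.sqrt ((a i)%:R / 2) * psi (dn a i) x.
Proof.
rewrite /psi !(tensD1 _ i) /htens !ffunE eqxx addn1 subn1.
have e (b : idx) : (forall j, j != i -> b j = a j) ->
    \prod_(j | j != i) hh (b j) (x ord0 j) = \prod_(j | j != i) hh (a j) (x ord0 j).
  by move=> h; apply: eq_bigr => j ji; rewrite h.
rewrite (e (up a i)); last by move=> j /negbTE ji; rewrite ffunE ji addn0.
rewrite (e (dn a i)); last by move=> j /negbTE ji; rewrite ffunE ji subn0.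
have := hh_x (a i) (x ord0 i); set P := \prod_(_ | _) _ => h.
rewrite mulrCA [x ord0 i * _]mulrA h; ring.
Qed.

Definition dpsi (a : idx) i x : R :=
  Num.sqrt ((a i)%:R / 2) * psi (dn a i) x - Num.sqrt ((a i).+1%:R / 2) * psi (up a i) x.

Lemma psi_derive (a : idx) (i : 'I_n) (x : 'rV[R]_n) : is_derive x (ei i) (psi a) (dpsi a i x).
Proof.
have h := tens_derive x (hasD_hh (a i) : hasD (htens a i) _).
apply: (is_derive_eq (is_deriveZ psic h)).
rewrite /dpsi /psi tens_gset !(tensD1 _ i) /htens !ffunE eqxx addn1 subn1.
have e (b : idx) : (forall j, j != i -> b j = a j) ->
    \prod_(j | j != i) hh (b j) (x ord0 j) = \prod_(j | j != i) hh (a j) (x ord0 j).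
  by move=> h'; apply: eq_bigr => j ji; rewrite h'.
rewrite (e (up a i)); last by move=> j /negbTE ji; rewrite ffunE ji addn0.
rewrite (e (dn a i)); last by move=> j /negbTE ji; rewrite ffunE ji subn0.
rewrite /GRing.scale /=; ring.
Qed.

Lemma psi_cont a : continuous (psi a).
Proof.
by apply: cZ; apply: continuous_tens => i; exact: hh_cont.
Qed.

Lemma psi2_cont a b : continuous (fun x : 'rV[R]_n => psi a x * psi b x).
Proof. by apply: cM; exact: psi_cont. Qed.

Lemma psi_Wdom a : Wdom (psi a).
Proof.
have [K hK] := @sqdomW (htens a) (fun i => hh_sqdom0 (a i)).
exists (`|psic| * K) => x; rewrite normrM -mulrA ler_wpM2l//.
Qed.

Lemma psi_bounded a : exists B, forall x, `|psi a x| <= B.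
Proof.
exists (`|psic| * \prod_i (6 * (a i).+1%:R)) => x; rewrite normrM ler_wpM2l//.
by rewrite /tens normr_prod; apply: ler_prod => i _; rewrite normr_ge0 hh_le.
Qed.

Lemma WdomM f g : @Wdom R n f -> (exists B, forall x, `|g x| <= B) -> Wdom (fun x => f x * g x).
Proof.
move=> [K hK] [B hB]; exists (K * B) => x; rewrite normrM mulrAC ler_pM//.
Qed.

Lemma WdomD f g : @Wdom R n f -> Wdom g -> Wdom (fun x => f x + g x).
Proof.
move=> [K hK] [B hB]; exists (K + B) => x.
by rewrite mulrDl (le_trans (ler_normD _ _))// lerD.
Qed.

Lemma WdomZ f c : @Wdom R n f -> Wdom (fun x => c * f x).
Proof.
by move=> [K hK]; exists (`|c| * K) => x; rewrite normrM -mulrA ler_wpM2l.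
Qed.

Lemma WdomB f g : @Wdom R n f -> Wdom g -> Wdom (fun x => f x - g x).
Proof.
by move=> [K hK] [B hB]; exists (K + B) => x; rewrite mulrDl (le_trans (ler_normB _ _))// lerD.
Qed.

Definition ip (f g : 'rV[R]_n -> R) : R := Inu (fun x => f x * g x).

Lemma integrable_psi2 a b : (@nu R n).-integrable [set: rVm] (fun x => (psi a x * psi b x)%:E).
Proof.
apply: integrable_Wdom; last exact: WdomM (psi_Wdom a) (psi_bounded b).
by apply: continuous_measurable_rV; exact: psi2_cont.
Qed.

Lemma ip_psi0 : ip (psi (@zidx n)) (psi (@zidx n)) = 1.
Proof.
rewrite /ip /Rintegral.
have E : forall x, psi (@zidx n) x * psi (@zidx n) x =
    psic ^+ 2 * \prod_i (expR (- (x ord0 i) ^+ 2)).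
  move=> x; rewrite /psi mulrACA -expr2; congr (_ * _); rewrite /tens -big_split /=.
  apply: eq_bigr => i _; rewrite /htens /hh /hN ffunE /= expr0 mul1r fact0 sqrtr1 invr1 !mul1r -expRD.
  by congr expR; field.
rewrite nuE; last 2 first.
- by move=> y; rewrite lee_fin -expr2 sqr_ge0.
- by apply/measurable_EFinP; apply: continuous_measurable_rV; exact: psi2_cont.
have -> : (fun x : 'rV[R]_n => (psi (@zidx n) x * psi (@zidx n) x)%:E) =
    (fun x : 'rV[R]_n => ((psic ^+ 2)%:E * (\prod_i (expR (- (x ord0 i) ^+ 2)))%:E)%E).
  by apply/funext => x; rewrite E EFinM.
have cg : continuous (fun s : R => expR (- s ^+ 2)) by exact: continuous_gauss_fun.
rewrite eiterintZl ?sqr_ge0//; last 2 first.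
- by move=> y; rewrite lee_fin prodr_ge0// => i _; rewrite expR_ge0.
- apply/measurable_EFinP; apply: continuous_measurable_rV.
  exact: (@continuous_tens (fun i s => expR (- s ^+ 2))).
rewrite (@eiterint_prod _ _ n (fun i s => expR (- s ^+ 2)) (fun=> Num.sqrt pi))//; last 2 first.
- by move=> i; exact: continuous_measurable_fun.
- by move=> i; exact: integralT_gauss.
rewrite -EFinM /= (eq_bigr (fun=> Num.sqrt pi)); last by move=> i _; rewrite ltn_ord.
rewrite prodr_const card_ord -/psiZ /psic exprVn sqr_sqrtr ?(ltW psiZ_gt0)//.
by rewrite mulVf// gt_eqF// psiZ_gt0.
Qed.

Lemma sqrtS_neq0 (k : nat) : Num.sqrt k.+1%:R != 0 :> R.
Proof. by rewrite gt_eqF// sqrtr_gt0. Qed.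

(** The derivative of psi_a psi_b along e_i has integral 0. Writing one factor's derivative as x_i
    psi_a minus a raising term, and the other's as - x_i psi_b plus a lowering term, the terms in
    x_i cancel. *)
Lemma ip_ladder (a b : idx) (i : 'I_n) : Num.sqrt (a i).+1%:R * ip (psi (up a i)) (psi b) =
  Num.sqrt (b i)%:R * ip (psi a) (psi (dn b i)).
Proof.
pose G x := psi a x * psi b x.
have hG x : is_derive x (ei i) G (dpsi a i x * psi b x + psi a x * dpsi b i x).
  exact: is_deriveMr (psi_derive a i x) (psi_derive b i x).
pose DG x := Num.sqrt 2 * (Num.sqrt (b i)%:R * (psi a x * psi (dn b i) x) - Num.sqrt (a i).+1%:R * (psi (up a i) x * psi b x)).
have E : 'D_(ei i) G = DG.
  apply/funext => x; rewrite derive_val /DG.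
  have e1 : dpsi a i x = x ord0 i * psi a x - Num.sqrt 2 * Num.sqrt (a i).+1%:R * psi (up a i) x.
    rewrite psi_x /dpsi -sqrtrM// -sqrt_half; ring.
  have e2 : dpsi b i x = - (x ord0 i * psi b x) + Num.sqrt 2 * Num.sqrt (b i)%:R * psi (dn b i) x.
    rewrite psi_x /dpsi -sqrtrM// -sqrt_half; ring.
  by rewrite e1 e2; ring.
have WDG : Wdom DG.
  apply: WdomZ; apply: WdomB; apply: WdomZ; exact: WdomM (psi_Wdom _) (psi_bounded _).
have cDG : continuous DG.
  by apply: cZ; apply: cB; apply: cZ; exact: psi2_cont.
have : Inu ('D_(ei i) G) = 0.
  apply: integral_derive_eq0.
  - exact: psi2_cont.
  - by move=> x; have [] := hG x.
  - by rewrite E.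
  - exact: WdomM (psi_Wdom _) (psi_bounded _).
  - by rewrite E.
rewrite E /DG RintegralZl//=; last first.
  apply: integrable_Wdom.
    by apply: continuous_measurable_rV; apply: cB; apply: cZ; exact: psi2_cont.
  by apply: WdomB; apply: WdomZ; exact: WdomM (psi_Wdom _) (psi_bounded _).
have iZ (c : R) a' b' : (@nu R n).-integrable [set: rVm] (fun x => (c * (psi a' x * psi b' x))%:E).
  apply: integrable_Wdom.
    by apply: continuous_measurable_rV; apply: cZ; exact: psi2_cont.
  by apply: WdomZ; exact: WdomM (psi_Wdom _) (psi_bounded _).
move=> /eqP; rewrite mulf_eq0 (negbTE (sqrtS_neq0 1)) /= => /eqP.
rewrite RintegralB//; [|exact: iZ|exact: iZ].
rewrite !RintegralZl//; [|exact: integrable_psi2|exact: integrable_psi2].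
by move=> /eqP; rewrite subr_eq0 => /eqP ->.
Qed.

Lemma wt_eq0 (a : idx) : wt a = 0%N -> a = @zidx n.
Proof.
move=> /eqP; rewrite /wt sum_nat_eq0 => /forallP h; apply/ffunP => i; rewrite ffunE.
by apply/eqP; exact: implyP (h i) isT.
Qed.

(** Induction on the level of b: the ladder identity lowers both indices at once and ends at the
    ground state, where the Gaussian integral is explicit. *)
Lemma ip_psi a b : ip (psi a) (psi b) = (a == b)%:R.
Proof.
move: {2}(wt b) (erefl (wt b)) => N; elim: N a b => [|N IH] a b.
  move=> /wt_eq0 ->; case: (eqVneq a (@zidx n)) => [->|a0]; first exact: ip_psi0.
  have [i ai] : exists i, (0 < a i)%N.
    apply/existsP; apply: contraNT a0; rewrite negb_exists => /forallP h.
    by apply/eqP/ffunP => i; rewrite ffunE; apply/eqP; have := h i; rewrite lt0n negbK.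
  have := ip_ladder (dn a i) (@zidx n) i; rewrite up_dn// [zidx i]ffunE sqrtr0 mul0r => /eqP.
  by rewrite mulf_eq0 (negbTE (sqrtS_neq0 _)) => /eqP.
move=> bN; have [i bi] : exists i, (0 < b i)%N.
  apply/existsP; apply: contraPT bN; rewrite negb_exists => /forallP h.
  by rewrite /wt big1// => i _; apply/eqP; have := h i; rewrite lt0n negbK.
have sym f g : ip f g = ip g f by rewrite /ip; apply: eq_Rintegral => x _; rewrite mulrC.
have wb : wt (dn b i) = N by have := wt_dn bi; rewrite bN => -[].
have := ip_ladder (dn b i) a i; rewrite up_dn// sym (sym _ (psi (dn a i))) (IH _ _ wb).
have -> : (dn b i i).+1 = b i by rewrite ffunE eqxx subn1 prednK.
case: (posnP (a i)) => [ai|ai].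
  rewrite ai sqrtr0 mul0r => /eqP; rewrite mulf_eq0 -(prednK bi) (negbTE (sqrtS_neq0 _)) /= => /eqP ->.
  by case: eqP => // e; rewrite -e ai in bi.
have -> : (dn a i == dn b i) = (a == b).
  by apply/eqP/eqP => [e|->//]; rewrite -(up_dn ai) -(up_dn bi) e.
case: eqP => [<-|_]; last by rewrite mulr0 => /eqP; rewrite mulf_eq0 -(prednK bi) (negbTE (sqrtS_neq0 _)) /= => /eqP.
by rewrite mulr1 -[RHS in _ = RHS -> _]mulr1 => /mulfI; apply; rewrite -(prednK ai) sqrtS_neq0.
Qed.

End HermiteN.

(** * Gevrey bump functions *)

Section Bump.
Context {R : realType}.

(* Flat functions y^-i exp(-1/y), extended by 0 to y <= 0. *)
Definition flat (i : nat) (y : R) : R := if 0 < y then y^-1 ^+ i * expR (- y^-1) else 0.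

Lemma flat_le0 i y : y <= 0 -> flat i y = 0.
Proof. by move=> y0; rewrite /flat ltNge y0. Qed.

Lemma flat_gt0 i y : 0 < y -> 0 < flat i y.
Proof. by move=> y0; rewrite /flat y0 mulr_gt0 ?expR_gt0// exprn_gt0// invr_gt0. Qed.

Lemma flat_ge0 i y : 0 <= flat i y.
Proof. by case: (leP y 0) => [/flat_le0->//|/flat_gt0/ltW->]. Qed.

Lemma flat_le i y : flat i y <= i`!%:R.
Proof.
case: (leP y 0) => [/flat_le0->//|y0]; rewrite /flat y0 expRN ler_pdivrMr ?expR_gt0//.
by rewrite exprn_le_fact_expR// invr_ge0 ltW.
Qed.

Lemma flatS i y : flat i y = y * flat i.+1 y.
Proof.
rewrite /flat; case: ifP => [y0|_]; last by rewrite mulr0.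
by rewrite exprS !mulrA mulfV ?mul1r// gt_eqF.
Qed.

Lemma flat_small i y : `|flat i y| <= `|y| * i.+1`!%:R.
Proof. by rewrite flatS normrM ler_wpM2l// ger0_norm ?flat_ge0// flat_le. Qed.

Lemma is_derive_quad (f : R -> R) (x d K : R) :
  (forall y, `|f y - f x - d * (y - x)| <= K * `|y - x| ^+ 2) -> is_derive x 1 f d.
Proof.
move=> h; have K0 : 0 <= K.
  have := h (x + 1); rewrite (_ : x + 1 - x = 1) ?normr1; last by rewrite addrAC subrr add0r.
  by rewrite expr1n !mulr1; apply: le_trans.
suff H : (fun t => t^-1 *: ((f \o shift x) (t *: 1) - f x)) t @[t --> 0^'] --> d.
  by split; [apply/cvg_ex; exists d|rewrite /derive; apply/cvg_lim].
apply/cvgrPdist_le => e e0; near=> t.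
have t0 : t != 0 by near: t; exact: nbhs_dnbhs_neq.
rewrite /shift /= -[t%:A]/(t * 1) mulr1 -[_ *: _]/(_ * _).
have := h (t + x); rewrite addrK => ht.
rewrite distrC -[X in `|X|](_ : t^-1 * (f (t + x) - f x - d * t) = _); last first.
  by rewrite mulrBr mulrCA mulVf// mulr1.
rewrite normrM normfV ler_pdivrMl ?normr_gt0// (le_trans ht)//.
rewrite expr2 mulrCA ler_wpM2l//.
have te : `|t| <= e / (K + 1) by near: t; apply: dnbhs0_le; rewrite divr_gt0// ltr_wpDl.
rewrite (le_trans (ler_wpM2l K0 te))// mulrCA -ler_pdivlMl// mulVf ?gt_eqF//.
by rewrite ler_pdivrMr ?ltr_wpDl// mul1r lerDl.
Unshelve. all: by end_near. Qed.

Lemma is_deriveXr (V : normedModType R) (f : V -> R) (x v : V) (df : R) k : is_derive x v f df ->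
  is_derive x v (fun y => f y ^+ k) (k%:R * df * f x ^+ k.-1).
Proof.
move=> hf; elim: k => [|k IH].
  by apply: (is_derive_eq (is_derive_cst (1 : R) x v)); rewrite !mul0r.
rewrite (_ : (fun s => _) = fun s => f s * f s ^+ k); last by apply/funext => s; rewrite exprS.
apply: (is_derive_eq (is_deriveMr hf IH)); case: k {IH} => [|k]; first by rewrite expr0 /=; ring.
by rewrite /= -[k.+2%:R]natr1 exprS; ring.
Qed.

Lemma hasD_flat i : hasD (flat i) (fun y => flat i.+2 y - i%:R * flat i.+1 y).
Proof.
move=> y; case: (ltgtP y 0) => [y0|y0|->].
- rewrite !flat_le0 ?(ltW y0)// mulr0 subr0.
  apply: (near_eq_is_derive _ (hasD_cst 0 y)).
  near=> z; rewrite flat_le0// ltW//; near: z; exact: lt_nbhsl.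
- have hI : is_derive y (1 : R) (fun z : R => z^-1) (- y^-1 ^+ 2).
    have y1 : y != 0 by rewrite gt_eqF.
    apply: (is_derive_eq (is_deriveV (f := fun z => z) y1 (hasD_id y))).
    by rewrite /GRing.scale /= mulr1 exprVn.
  have hE : is_derive y (1 : R) (fun z : R => expR (- z^-1)) (expR (- y^-1) * y^-1 ^+ 2).
    apply: (is_derive_eq (is_derive1_comp (is_derive_expR _) (is_deriveN hI))).
    by rewrite opprK.
  have hP : is_derive y (1 : R) (fun z : R => z^-1 ^+ i) (- i%:R * y^-1 ^+ i.+1).
    apply: (is_derive_eq (is_deriveXr i hI)).
    by case: i => [|i]; rewrite ?mulr0n ?oppr0 ?mul0r// [i.+1.-1]/= !exprS; ring.
  apply: (near_eq_is_derive (f := fun z : R => z^-1 ^+ i * expR (- z^-1))).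
    near=> z; have z0 : 0 < z by near: z; exact: lt_nbhsr.
    by rewrite /flat z0.
  apply: (is_derive_eq (is_deriveMr hP hE)).
  by rewrite /flat y0 /GRing.scale /= !exprS; ring.
(* At 0 the difference is quadratic, since flat_i(z) = z^2 flat_(i+2)(z) with a bounded last
   factor. *)
rewrite !flat_le0// mulr0 subr0; apply: (@is_derive_quad _ _ _ i.+2`!%:R) => z.
rewrite (flat_le0 i (lexx 0)) mul0r !subr0 flatS normrM expr2 mulrCA ler_wpM2l//.
by rewrite (le_trans (flat_small _ _))// mulrC.
Unshelve. all: by end_near. Qed.

End Bump.

(* A term (c, (i, (j, l))) stands for c * flat_i(p) * A^j * B^l. *)
Section BumpTerms.
Context {R : realType}.
(** A closed differential system with two uses: p = 1 - s^2, A = 1, B = s for (al, be) = (2, 0), and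
    p = cos - cos e, A = cos, B = sin for (1, 1). *)
Variables (al be : R) (p A B : R -> R).
Hypothesis hp : hasD p (fun s => - al * B s).
Hypothesis hA : hasD A (fun s => - be * B s).
Hypothesis hB : hasD B A.

Definition bterm := (R * (nat * (nat * nat)))%type.
Definition evt (t : bterm) (s : R) : R := t.1 * (flat t.2.1 (p s) * (A s ^+ t.2.2.1 * B s ^+ t.2.2.2)).
Definition evts (L : seq bterm) (s : R) : R := \sum_(t <- L) evt t s.
Definition dterm (t : bterm) : seq bterm :=
  let: (c, (i, (j, l))) := t in
  [:: (al * c * i%:R, (i.+1, (j, l.+1))); (- al * c, (i.+2, (j, l.+1)));
      (- be * c * j%:R, (i, (j.-1, l.+1))); (c * l%:R, (i, (j.+1, l.-1)))].
Definition dterms (L : seq bterm) : seq bterm := flatten [seq dterm t | t <- L].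

Lemma hasDX (f df : R -> R) k : hasD f df -> hasD (fun s => f s ^+ k) (fun s => k%:R * df s * f s ^+ k.-1).
Proof. by move=> hf s; exact: is_deriveXr. Qed.

Lemma hasD_evt t : hasD (evt t) (evts (dterm t)).
Proof.
case: t => c [i [j l]].
apply: hasD_eq (hasDZ c (hasDM (hasD_comp (hasD_flat i) hp) (hasDM (hasDX j hA) (hasDX l hB)))) _ => s.
rewrite /evts /dterm !big_cons big_nil /evt /=.
case: j => [|j]; case: l => [|l] /=; rewrite ?exprS; ring.
Qed.

Lemma hasD_evts L : hasD (evts L) (evts (dterms L)).
Proof.
elim: L => [|t L IH].
  by apply: (hasD_eq (df := fun=> 0)) => [s|s]; rewrite /evts /= ?big_nil// (_ : (fun s => _) = cst 0);
    [exact: is_derive_cst|apply/funext => z; rewrite big_nil].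
rewrite (_ : evts (t :: L) = fun s => evt t s + evts L s); last by apply/funext => s; rewrite /evts big_cons.
by apply: hasD_eq (hasDD (hasD_evt t) IH) _ => s; rewrite /evts /dterms /= big_cat.
Qed.

Definition bump0 : seq bterm := [:: (1, (0%N, (0%N, 0%N)))].
Definition bump k : R -> R := evts (iter k dterms bump0).

Lemma bump0E s : bump 0 s = flat 0 (p s).
Proof. by rewrite /bump /evts big_seq1 /evt /= !mulr1 mul1r. Qed.

Lemma hasD_bump k : hasD (bump k) (bump k.+1).
Proof. exact: hasD_evts. Qed.

Lemma bump_out k s : p s <= 0 -> bump k s = 0.
Proof.
by move=> ps; rewrite /bump /evts big1// => t _; rewrite /evt flat_le0// mul0r mulr0.
Qed.

Definition tnorm (L : seq bterm) : R := \sum_(t <- L) `|t.1|.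

Hypothesis al1 : `|al| <= 1.
Hypothesis be1 : `|be| <= 1.

Definition tsize (N : nat) (L : seq bterm) :=
  all (fun t : bterm => (t.2.1 <= N.*2) && (t.2.2.1 + t.2.2.2 <= N))%N L.

Lemma tsize_dterms N L : tsize N L -> tsize N.+1 (dterms L).
Proof.
elim: L => [//|[c [i [j l]]] L IH] /= /andP[/andP[/= h1 h2] h3].
rewrite /dterms /= -/(dterms L) IH// !andbT doubleS.
have [e1 e2] : ((j.-1 + l.+1 <= N.+1) /\ (j.+1 + l.-1 <= N.+1))%N by split; lia.
by rewrite e1 e2 addnS !ltnS h2 h1 !(leqW _).
Qed.

Lemma tnorm_dterms N L : tsize N L -> tnorm (dterms L) <= (3 * N.+1)%:R * tnorm L.
Proof.
elim: L => [_|[c [i [j l]]] L IH] /=; first by rewrite /tnorm !big_nil mulr0.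
move=> /andP[/andP[/= h1 h2] h3]; rewrite /tnorm /dterms /= !big_cons -/(dterms L) -!/(tnorm _).
rewrite mulrDr !addrA lerD ?IH// !normrM !normrN /= !normr_nat.
have := @ler_nat R (i + 1 + j + l) (3 * N.+1); rewrite (_ : (_ <= _)%N = true); last by apply/idP; lia.
rewrite !natrD => hN.
have c0 := normr_ge0 c; have i0 : 0 <= i%:R :> R by []. have j0 : 0 <= j%:R :> R by [].
have e1 : `|al| * `|c| * i%:R <= `|c| * i%:R by rewrite ler_wpM2r// ler_piMl.
have e2 : `|al| * `|c| <= `|c| by rewrite ler_piMl.
have e3 : `|be| * `|c| * j%:R <= `|c| * j%:R by rewrite ler_wpM2r// ler_piMl.
have := ler_wpM2r c0 hN; rewrite !mulrDl mul1r ![_%:R * `|c|]mulrC; lra.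
Qed.

Hypothesis A1 : forall s, `|A s| <= 1.
Hypothesis B1 : forall s, `|B s| <= 1.

Lemma evts_le N L s : tsize N L -> `|evts L s| <= tnorm L * (N.*2)`!%:R.
Proof.
elim: L => [_|t L IH] /=; first by rewrite /evts /tnorm !big_nil normr0 mul0r.
move=> /andP[/andP[h1 _] h3]; rewrite /evts /tnorm !big_cons mulrDl (le_trans (ler_normD _ _))// lerD ?IH//.
rewrite /evt normrM ler_wpM2l// normrM -[leRHS]mulr1 ler_pM//.
  rewrite ger0_norm ?flat_ge0// (le_trans (flat_le _ _))// ler_nat; by rewrite leq_fact.
by rewrite normrM !normrX mulr_ile1// exprn_ile1.
Qed.

Lemma tsize_iter k : tsize k (iter k dterms bump0).
Proof. by elim: k => [|k IH] //=; exact: tsize_dterms. Qed.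

Lemma tnorm_iter k : tnorm (iter k dterms bump0) <= (3 ^ k * k`!)%:R.
Proof.
elim: k => [|k IH]; first by rewrite /tnorm /= big_seq1 normr1.
rewrite iterS (le_trans (tnorm_dterms (tsize_iter k)))// (le_trans (ler_wpM2l _ IH))//.
by rewrite -natrM ler_nat expnS factS; apply/eq_leq; ring.
Qed.

Lemma fact_double_le k : ((k.*2)`! <= 4 ^ k * k`! ^ 2)%N.
Proof.
elim: k => [//|k IH]; rewrite doubleS !factS expnS expnMn.
apply: (@leq_trans (2 * k.+1 * (2 * k.+1 * (4 ^ k * k`! ^ 2)))%N); last by apply/eq_leq; ring.
apply: leq_mul; first by rewrite -addnn; lia.
by apply: leq_mul => //; rewrite -addnn; lia.
Qed.

(** Gevrey order 3: the k-fold derivative has coefficients of total size at most 3^k k!, and the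
    flat functions occurring in it are bounded by (2k)! <= 4^k k!^2. *)
Lemma bump_le k s : `|bump k s| <= (12 ^ k * k`! ^ 3)%:R.
Proof.
rewrite (le_trans (evts_le s (tsize_iter k)))// (le_trans (ler_wpM2r _ (tnorm_iter k)))//.
rewrite -natrM ler_nat (leq_trans (leq_mul (leqnn _) (fact_double_le k)))//.
by apply/eq_leq; rewrite (_ : 12 = 3 * 4)%N// expnMn; ring.
Qed.

End BumpTerms.

(** * Smooth functions and their Hermite coefficients *)

Section SmoothRules.
Context {R : realType} {X : normedModType R}.
Implicit Types f g : X -> R.

Lemma iD_rcons (ds : seq X) v f : iD (rcons ds v) f = iD ds ('D_v f).
Proof. by rewrite /iD -cats1 foldr_cat. Qed.

Lemma rsmooth_D f v : rsmooth f -> rsmooth ('D_v f).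
Proof. by move=> sf ds; rewrite -iD_rcons; exact: sf. Qed.

Lemma rsmooth_iD f ds : rsmooth f -> rsmooth (iD ds f).
Proof. by elim: ds => [//|v ds IH] sf; apply: rsmooth_D; exact: IH. Qed.

Lemma rsmooth_cont f : rsmooth f -> continuous f.
Proof. by move=> sf; have [] := sf [::]. Qed.

Lemma rsmooth_derivable f x v : rsmooth f -> derivable f x v.
Proof. by move=> sf; have [_ ] := sf [::]; exact. Qed.

Lemma rsmooth_is_derive f x v : rsmooth f -> is_derive x v f ('D_v f x).
Proof. by move=> sf; apply: is_derive_pt; exact: rsmooth_derivable. Qed.

(** Smoothness by coinduction: a class of continuous functions closed under directional derivatives
    contains only smooth functions. The list of directions is peeled from its end, where the
    direction applied first stands. *)
Lemma rsmooth_coind (P : (X -> R) -> Prop) :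
  (forall f, P f -> continuous f) ->
  (forall f v, P f -> exists2 g, P g & forall x, is_derive x v f (g x)) ->
  forall f, P f -> rsmooth f.
Proof.
move=> Pc Pd f Pf ds; elim/last_ind: ds f Pf => [|ds v IH] f Pf.
  by split=> [|x v]; [exact: Pc|have [g _ h] := Pd f v Pf; have [] := h x].
rewrite iD_rcons; have [g Pg h] := Pd f v Pf.
by rewrite (_ : 'D_v f = g); [exact: IH|apply/funext => x; have [_ ->] := h x].
Qed.

Lemma rsmooth_cst (c : R) : rsmooth (fun _ : X => c).
Proof.
apply: (@rsmooth_coind (fun f => exists c, f = fun=> c)); last by exists c.
  by move=> _ [d ->]; exact: cst_continuous.
by move=> _ v [d ->]; exists (fun=> 0); [exists 0|move=> x; exact: is_derive_cst].
Qed.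

(** A product is not of the same form after differentiation; a finite sum of products is, by the
    Leibniz rule. *)
Lemma rsmooth_sumM (s : seq ((X -> R) * (X -> R))) :
  (forall p, List.In p s -> rsmooth p.1 /\ rsmooth p.2) ->
  rsmooth (fun x => \sum_(p <- s) p.1 x * p.2 x).
Proof.
move=> hs; apply: (@rsmooth_coind (fun f => exists2 s : seq ((X -> R) * (X -> R)),
    (forall p, List.In p s -> rsmooth p.1 /\ rsmooth p.2) & f = fun x => \sum_(p <- s) p.1 x * p.2 x));
  last by exists s.
  move=> _ {hs}[{}s hs ->]; elim: s hs => [|p s IH] hs.
    by rewrite (_ : (fun x => _) = cst 0); [exact: cst_continuous|apply/funext => x; rewrite big_nil].
  rewrite (_ : (fun x => _) = fun x => p.1 x * p.2 x + \sum_(p <- s) p.1 x * p.2 x); last first.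
    by apply/funext => x; rewrite big_cons.
  have [s1 s2] := hs p (or_introl erefl).
  apply: cD; first by apply: cM; exact: rsmooth_cont.
  by apply: IH => q qs; apply: hs; right.
move=> _ v {hs}[{}s hs ->].
exists (fun x => \sum_(p <- flatten [seq [:: ('D_v p.1, p.2); (p.1, 'D_v p.2)] | p <- s]) p.1 x * p.2 x).
  eexists; last reflexivity.
  elim: s hs => [//|p s IH] hs q /=; have [s1 s2] := hs p (or_introl erefl).
  case=> [<-|[<-|]]; [split; [exact: (rsmooth_D v s1)|exact: s2]|split; [exact: s1|exact: (rsmooth_D v s2)]|].
  by apply: IH => r rs; apply: hs; right.
move=> x; elim: s hs => [|p s IH] hs.
  rewrite big_nil (_ : (fun x => _) = cst 0); first exact: is_derive_cst.
  by apply/funext => y; rewrite big_nil.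
rewrite /= !big_cons.
rewrite (_ : (fun x => _) = fun x => p.1 x * p.2 x + \sum_(p <- s) p.1 x * p.2 x); last first.
  by apply/funext => y; rewrite big_cons.
have [s1 s2] := hs p (or_introl erefl).
have h1 := is_deriveMr (rsmooth_is_derive x v s1) (rsmooth_is_derive x v s2).
have h2 := IH (fun r rs => hs r (or_intror rs)).
by apply: (is_derive_eq (is_deriveD h1 h2)); rewrite addrA.
Qed.

Lemma rsmoothM f g : rsmooth f -> rsmooth g -> rsmooth (fun x => f x * g x).
Proof.
move=> sf sg; rewrite (_ : (fun x => _) = fun x => \sum_(p <- [:: (f, g)]) p.1 x * p.2 x).
  by apply: rsmooth_sumM => p /= [<-|[]]; split; [exact: sf|exact: sg].
by apply/funext => x; rewrite big_seq1.
Qed.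

Lemma rsmoothD f g : rsmooth f -> rsmooth g -> rsmooth (fun x => f x + g x).
Proof.
move=> sf sg.
rewrite (_ : (fun x => _) = fun x => \sum_(p <- [:: (f, fun=> 1); (g, fun=> 1)]) p.1 x * p.2 x).
  apply: rsmooth_sumM => p /= [<-|[<-|[]]].
  - by split; [exact: sf|exact: rsmooth_cst].
  - by split; [exact: sg|exact: rsmooth_cst].
by apply/funext => x; rewrite big_cons big_seq1 !mulr1.
Qed.

Lemma rsmoothZ (c : R) f : rsmooth f -> rsmooth (fun x => c * f x).
Proof. by apply: rsmoothM; exact: rsmooth_cst. Qed.

Lemma rsmooth_prod (I : Type) (s : seq I) (P : pred I) (F : I -> X -> R) :
  (forall i, rsmooth (F i)) -> rsmooth (fun x => \prod_(i <- s | P i) F i x).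
Proof.
move=> sF; elim: s => [|i s IH].
  by rewrite (_ : (fun x => _) = cst 1); [exact: rsmooth_cst|apply/funext => x; rewrite big_nil].
case: (boolP (P i)) => Pi.
  rewrite (_ : (fun x => _) = fun x => F i x * \prod_(i <- s | P i) F i x); last first.
    by apply/funext => x; rewrite big_cons Pi.
  by apply: rsmoothM; [exact: sF|exact: IH].
by rewrite (_ : (fun x => _) = fun x => \prod_(i <- s | P i) F i x)//;
  apply/funext => x; rewrite big_cons (negbTE Pi).
Qed.

End SmoothRules.

Section OpWords.
Context {R : realType} {n : nat}.
Notation rVm := (@rVm R n).
Notation ei := (@ei R n).
Notation nun := (@nu R n).
Notation Inu g := (Rintegral (@nu R n) [set: rVm] (g : rVm -> R)).
Notation idx := (@idx n).

Lemma rsmooth_coord i : rsmooth (fun x : 'rV[R]_n => x ord0 i).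
Proof.
apply: (@rsmooth_coind _ _ (fun f => exists c d : R, f = fun x : 'rV[R]_n => c * x ord0 i + d)).
- by move=> _ [c [d ->]]; apply: cD; [apply: cZ; exact: coordn_continuous|exact: cst_continuous].
- move=> _ v [c [d ->]]; exists (fun=> c * v ord0 i).
    by exists 0, (c * v ord0 i); apply/funext => x; rewrite mul0r add0r.
  move=> x; apply/is_derive_line.
  rewrite (_ : (fun t => _) = fun t => (c * v ord0 i) * t + (c * x ord0 i + d)); last first.
    by apply/funext => t; rewrite !mxE; ring.
  have h := hasDD (hasDZ (c * v ord0 i) (@hasD_id R)) (hasD_cst (c * x ord0 i + d)).
  by apply: (is_derive_eq (h 0)); rewrite mulr1 addr0.
- by exists 1, 0; apply/funext => x; rewrite mul1r addr0.
Qed.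

Lemma rsmooth_mpow (be : 'I_n -> nat) : rsmooth (fun x : 'rV[R]_n => mpow x be).
Proof.
apply: rsmooth_prod => i; elim: (be i) => [|k IH]; first exact: rsmooth_cst.
rewrite (_ : (fun x => _) = fun x : 'rV[R]_n => x ord0 i * x ord0 i ^+ k).
  by apply: rsmoothM; [exact: rsmooth_coord|exact: IH].
by apply/funext => x; rewrite exprS.
Qed.

(* Words in the letters x_i (false) and d_i (true), the head being applied last. *)
Definition oword := seq (bool * 'I_n).
Definition op1 (l : bool * 'I_n) (F : 'rV[R]_n -> R) : 'rV[R]_n -> R :=
  if l.1 then 'D_(ei l.2) F else fun x => x ord0 l.2 * F x.
Definition opw (w : oword) (F : 'rV[R]_n -> R) : 'rV[R]_n -> R := foldr op1 F w.

Lemma opw_smooth w F : rsmooth F -> rsmooth (opw w F).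
Proof.
elim: w => [//|[[] i] w IH] sF; rewrite /opw /= -/(opw w F); first exact: rsmooth_D (IH sF).
by apply: rsmoothM; [exact: rsmooth_coord|exact: IH].
Qed.

Definition ltr (l : bool * 'I_n) : seq (R * word) :=
  [:: (Num.sqrt 2^-1, [:: (true, l.2)]); ((-1) ^+ l.1 * Num.sqrt 2^-1, [:: (false, l.2)])].
Definition ows (w : oword) : seq (R * word) := foldr (fun l L => mulL (ltr l) L) [:: (1, [::])] w.

Lemma actL_nil (f : idx -> R) a : actL [:: (1, [::])] f a = f a.
Proof. by rewrite /actL big_seq1 mul1r. Qed.

Lemma actL_ltr l (f : idx -> R) a : actL (ltr l) f a =
  Num.sqrt ((a l.2).+1%:R / 2) * f (up a l.2) + (-1) ^+ l.1 * (Num.sqrt ((a l.2)%:R / 2) * f (dn a l.2)).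
Proof.
rewrite /actL /ltr big_cons big_seq1 /actw /= /act1 /= !sqrtrM//; ring.
Qed.

End OpWords.

Lemma cV (R : realType) (T : topologicalType) (f : T -> R) :
  continuous f -> (forall x, f x != 0) -> continuous (fun x => (f x)^-1).
Proof. by move=> cf f0 x; apply: cvgV; [exact: f0|exact: cf]. Qed.

(** * Cutoffs and the transfer of differential operators to Hermite coefficients *)

Section Cutoff.
Context {R : realType} {n : nat}.
Notation rVm := (@rVm R n).
Notation ei := (@ei R n).
Notation nun := (@nu R n).
Notation Inu g := (Rintegral (@nu R n) [set: rVm] (g : rVm -> R)).
Notation idx := (@idx n).

(* Smooth cutoff supported in [-1, 1], together with its derivatives. *)
Definition theta k (s : R) : R := bump (2 : R) 0 (fun s => 1 - s * s) (fun=> 1) (fun s => s) k s.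

Lemma hasD_theta k : hasD (theta k) (theta k.+1).
Proof.
apply: hasD_bump.
- by apply: hasD_eq (hasDB (hasD_cst 1) (hasDM (@hasD_id R) (@hasD_id R))) _ => s; ring.
- by apply: hasD_eq (hasD_cst 1) _ => s; rewrite oppr0 mul0r.
- exact: hasD_id.
Qed.

Lemma theta_out k s : 1 <= `|s| -> theta k s = 0.
Proof.
move=> s1; apply: bump_out; rewrite subr_le0 -expr2 -(real_normK (num_real s)).
by rewrite expr_ge1.
Qed.

Lemma theta00 : theta 0 0 != 0.
Proof. by rewrite /theta bump0E mulr0 subr0 gt_eqF// flat_gt0. Qed.

Lemma theta_bounded k : bounded1 (theta k).
Proof.
have H (L : seq (@bterm R)) : exists B, forall s, `|s| <= 1 ->
    `|evts (fun s : R => 1 - s * s) (fun=> 1) (fun s => s) L s| <= B.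
  elim: L => [|t L [B hB]]; first by exists 0 => s _; rewrite /evts big_nil normr0.
  exists (`|t.1| * (t.2.1)`!%:R + B) => s s1; rewrite /evts big_cons (le_trans (ler_normD _ _))//.
  rewrite lerD ?hB// /evt normrM ler_wpM2l// normrM -[leRHS]mulr1 ler_pM//.
    by rewrite ger0_norm ?flat_ge0// flat_le.
  by rewrite expr1n mul1r normrX exprn_ile1.
have [B hB] := H (iter k (dterms 2 0) (@bump0 R)); exists B => s.
case: (leP 1 `|s|) => [/theta_out->|/ltW s1]; last exact: hB.
by rewrite normr0; apply: le_trans (hB 0 _) => //; rewrite normr0.
Qed.

(** [k] counts, coordinate by coordinate, the derivatives that have fallen on the cutoff; each of
    them costs a factor 1 / (N + 1). *)
Definition cutf (N : nat) (k a : idx) (i : 'I_n) (s : R) : R := theta (k i) (N.+1%:R^-1 * s) * hh (a i) s.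
Definition cut (N : nat) (k a : idx) (x : 'rV[R]_n) : R := psic (R := R) (n := n) * tens (cutf N k a) x.

Lemma cutf_cont N k a i : continuous (cutf N k a i).
Proof.
apply: cM; last exact: hh_cont.
exact: hasD_cont (hasD_comp (hasD_theta (k i)) (hasDZ N.+1%:R^-1 (@hasD_id R))).
Qed.

Lemma cut_cont N k a : continuous (cut N k a).
Proof. by apply: cZ; apply: continuous_tens => i; exact: cutf_cont. Qed.

Lemma cut_dom k a : exists2 B, 0 <= B & forall N x, `|cut N k a x| <= B * `|psi a x|.
Proof.
have /choice[B hB] := fun i => theta_bounded (k i).
have B0 i : 0 <= B i by apply: le_trans (hB i 0).
exists (\prod_i B i); first exact: prodr_ge0.
move=> N x; rewrite /psi !normrM mulrCA ler_wpM2l// !normr_prod -big_split /=.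
by apply: ler_prod => i _; rewrite normr_ge0 normrM ler_wpM2r.
Qed.

Lemma cut_out N k a x : ~ cube N.+1 x -> cut N k a x = 0.
Proof.
move=> /existsNP[i /negP]; rewrite -ltNge => h; rewrite /cut (tensD1 _ i) /cutf theta_out ?mul0r ?mulr0//.
by rewrite normrM normfV normr_nat ler_pdivlMl// mulr1 ltW.
Qed.

Lemma compact_cube M : compact (@cube R n M).
Proof.
rewrite (_ : cube M = [set v : 'rV[R]_n | forall i, `[(- M%:R), M%:R]%classic (v ord0 i)]).
  by apply: (@rV_compact R n (fun=> `[(- M%:R), M%:R]%classic)) => i; exact: segment_compact.
by apply/seteqP; split => v h i; have := h i; rewrite /= in_itv/= ler_norml.
Qed.

Lemma Wdom_cube (G : 'rV[R]_n -> R) M : continuous G -> (forall x, ~ cube M x -> G x = 0) -> Wdom G.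
Proof.
move=> cG hG.
have cH : continuous (fun x : 'rV[R]_n => G x * (Wt x)^-1).
  apply: cM => //; apply: cV; [exact: continuous_Wt|move=> x; exact: lt0r_neq0 (Wt_gt0 x)].
have /compact_bounded[K [_ hK]] : compact ((fun x : 'rV[R]_n => G x * (Wt x)^-1) @` cube M).
  by apply: continuous_compact; [apply: continuous_subspaceT|exact: compact_cube].
exists (`|K| + 1) => x; case: (pselect (cube M x)) => [cx|/hG->]; last first.
  by rewrite normr0 mulr_ge0 ?addr_ge0// ltW// Wt_gt0.
have := hK (`|K| + 1); rewrite ltr_pwDr ?ler_norm// => /(_ isT) /(_ _ (ex_intro2 _ _ x cx erefl)).
by move=> /=; rewrite normrM normfV [`|Wt x|]gtr0_norm ?Wt_gt0// ler_pdivrMr ?Wt_gt0.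
Qed.

Lemma Wdom_cut (F : 'rV[R]_n -> R) N k a : continuous F -> Wdom (fun x => F x * cut N k a x).
Proof.
move=> cF; apply: (@Wdom_cube _ N.+1); first by apply: cM => //; exact: cut_cont.
by move=> x /cut_out->; rewrite mulr0.
Qed.

Lemma intcut (F : 'rV[R]_n -> R) N k a : continuous F ->
  nun.-integrable [set: rVm] (fun x => (F x * cut N k a x)%:E).
Proof.
move=> cF; apply: integrable_Wdom; last exact: Wdom_cut.
by apply: continuous_measurable_rV; apply: cM => //; exact: cut_cont.
Qed.

Lemma cut_x N (k a : idx) (i : 'I_n) (x : 'rV[R]_n) : x ord0 i * cut N k a x =
  Num.sqrt ((a i).+1%:R / 2) * cut N k (up a i) x + Num.sqrt ((a i)%:R / 2) * cut N k (dn a i) x.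
Proof.
rewrite /cut !(tensD1 _ i) /cutf !ffunE eqxx addn1 subn1.
have e (b : idx) : (forall j, j != i -> b j = a j) ->
    \prod_(j | j != i) (theta (k j) (N.+1%:R^-1 * x ord0 j) * hh (b j) (x ord0 j)) =
    \prod_(j | j != i) (theta (k j) (N.+1%:R^-1 * x ord0 j) * hh (a j) (x ord0 j)).
  by move=> h; apply: eq_bigr => j ji; rewrite h.
rewrite (e (up a i)); last by move=> j /negbTE ji; rewrite ffunE ji addn0.
rewrite (e (dn a i)); last by move=> j /negbTE ji; rewrite ffunE ji subn0.
have := hh_x (a i) (x ord0 i); set P := \prod_(_ | _) _; set T := theta _ _ => h.
set pc := psic.
rewrite (_ : x ord0 i * _ = pc * (T * (x ord0 i * hh (a i) (x ord0 i)) * P)); last by ring.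
by rewrite h; ring.
Qed.

Lemma cut_derive N (k a : idx) (i : 'I_n) x : is_derive x (ei i) (cut N k a)
  (N.+1%:R^-1 * cut N (up k i) a x +
   (Num.sqrt ((a i)%:R / 2) * cut N k (dn a i) x - Num.sqrt ((a i).+1%:R / 2) * cut N k (up a i) x)).
Proof.
have hd := hasDM (hasD_comp (hasD_theta (k i)) (hasDZ N.+1%:R^-1 (@hasD_id R))) (hasD_hh (a i)).
have h := tens_derive x (hd : hasD (cutf N k a i) _).
apply: (is_derive_eq (is_deriveZ (psic (R := R) (n := n)) h)).
rewrite /cut tens_gset !(tensD1 _ i) /cutf !ffunE eqxx !addn1 subn1.
have e (l b : idx) : (forall j, j != i -> b j = a j) -> (forall j, j != i -> l j = k j) ->
    \prod_(j | j != i) (theta (l j) (N.+1%:R^-1 * x ord0 j) * hh (b j) (x ord0 j)) =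
    \prod_(j | j != i) (theta (k j) (N.+1%:R^-1 * x ord0 j) * hh (a j) (x ord0 j)).
  by move=> h1 h2; apply: eq_bigr => j ji; rewrite h1 ?h2.
rewrite (e k (up a i))//; last by move=> j /negbTE ji; rewrite ffunE ji addn0.
rewrite (e k (dn a i))//; last by move=> j /negbTE ji; rewrite ffunE ji subn0.
rewrite (e (up k i) a)//; last by move=> j /negbTE ji; rewrite ffunE ji addn0.
rewrite /GRing.scale /=; ring.
Qed.

Lemma nu_dct (F : nat -> 'rV[R]_n -> R) (f g : 'rV[R]_n -> R) :
  (forall N, measurable_fun [set: rVm] (F N : rVm -> R)) -> measurable_fun [set: rVm] (f : rVm -> R) ->
  (forall x, F N x @[N --> \oo] --> f x) ->
  nun.-integrable [set: rVm] (fun x => (g x)%:E) -> (forall N x, `|F N x| <= g x) ->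
  nun.-integrable [set: rVm] (fun x => (f x)%:E) /\ Inu (F N) @[N --> \oo] --> Inu f.
Proof.
move=> mF mf Ff ig Fg.
have [||||| if_ _ h] := @dominated_convergence _ _ _ nun setT measurableT
  (fun N x => (F N x)%:E) (fun x => (f x)%:E) (fun x => (g x)%:E).
- by move=> N; exact/measurable_EFinP.
- exact/measurable_EFinP.
- by apply: aeW => x _; apply: cvg_EFin; [near=> N|exact: Ff].
- exact: ig.
- by apply: aeW => x N _; rewrite lee_fin.
by split=> //; apply: fine_cvg; rewrite fineK//; exact: integrable_fin_num.
Unshelve. all: by end_near. Qed.

Definition J (N : nat) (F : 'rV[R]_n -> R) (k a : idx) : R := Inu (fun x => F x * cut N k a x).

Lemma J_lin N (F : 'rV[R]_n -> R) (k a b : idx) (c c' : R) : continuous F ->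
  Inu (fun x => c * (F x * cut N k a x) + c' * (F x * cut N k b x)) = c * J N F k a + c' * J N F k b.
Proof.
move=> cF; have iZ d e : nun.-integrable [set: rVm] (fun x => (d * (F x * cut N k e x))%:E).
  by under eq_fun do rewrite EFinM; apply: integrableZl => //; exact: intcut.
rewrite RintegralD//; [|exact: iZ|exact: iZ].
by rewrite !RintegralZl//; exact: intcut.
Qed.

Lemma J_x N (F : 'rV[R]_n -> R) (k a : idx) (i : 'I_n) : continuous F ->
  J N (fun x => x ord0 i * F x) k a =
  Num.sqrt ((a i).+1%:R / 2) * J N F k (up a i) + Num.sqrt ((a i)%:R / 2) * J N F k (dn a i).
Proof.
move=> cF; rewrite -J_lin//; apply: eq_Rintegral => x _.
by rewrite mulrAC cut_x; ring.
Qed.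

Lemma J_D N (F : 'rV[R]_n -> R) (k a : idx) (i : 'I_n) : rsmooth F ->
  J N ('D_(ei i) F) k a = Num.sqrt ((a i).+1%:R / 2) * J N F k (up a i) -
    Num.sqrt ((a i)%:R / 2) * J N F k (dn a i) - N.+1%:R^-1 * J N F (up k i) a.
Proof.
move=> sF; have cF := rsmooth_cont sF; have sDF := rsmooth_D (ei i) sF; have cDF := rsmooth_cont sDF.
pose c x := N.+1%:R^-1 * cut N (up k i) a x +
   (Num.sqrt ((a i)%:R / 2) * cut N k (dn a i) x - Num.sqrt ((a i).+1%:R / 2) * cut N k (up a i) x).
pose G x := F x * cut N k a x.
have hG x : is_derive x (ei i) G ('D_(ei i) F x * cut N k a x + F x * c x).
  exact: is_deriveMr (rsmooth_is_derive x (ei i) sF) (cut_derive N k a i x).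
have E : 'D_(ei i) G = fun x => 'D_(ei i) F x * cut N k a x + F x * c x.
  by apply/funext => x; rewrite derive_val.
have cc : continuous c.
  by apply: cD; [apply: cZ; exact: cut_cont|apply: cB; apply: cZ; exact: cut_cont].
have WFc : Wdom (fun x => F x * c x).
  rewrite (_ : (fun x => _) = fun x => N.+1%:R^-1 * (F x * cut N (up k i) a x) +
    (Num.sqrt ((a i)%:R / 2) * (F x * cut N k (dn a i) x) - Num.sqrt ((a i).+1%:R / 2) * (F x * cut N k (up a i) x))).
    by apply: WdomD; [|apply: WdomB]; apply: WdomZ; exact: Wdom_cut.
  by apply/funext => x; rewrite /c; ring.
have cDG : continuous (fun x => 'D_(ei i) F x * cut N k a x + F x * c x).
  by apply: cD; apply: cM => //; exact: cut_cont.
have : Inu ('D_(ei i) G) = 0.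
  apply: integral_derive_eq0.
  - by apply: cM => //; exact: cut_cont.
  - by move=> x; have [] := hG x.
  - by rewrite E.
  - exact: Wdom_cut.
  - by rewrite E; apply: WdomD => //; exact: Wdom_cut.
rewrite E RintegralD//; [|exact: intcut|]; last first.
  by apply: integrable_Wdom => //; apply: continuous_measurable_rV; apply: cM.
move=> /eqP; rewrite addr_eq0 => /eqP; rewrite -/(J N _ k a) => ->.
have iZ d l e : nun.-integrable [set: rVm] (fun x => (d * (F x * cut N l e x))%:E).
  by under eq_fun do rewrite EFinM; apply: integrableZl => //; exact: intcut.
rewrite (_ : Inu (fun x => F x * c x) = N.+1%:R^-1 * J N F (up k i) a +
   (Num.sqrt ((a i)%:R / 2) * J N F k (dn a i) + - Num.sqrt ((a i).+1%:R / 2) * J N F k (up a i))); first by ring.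
rewrite -J_lin// -RintegralZl//; last exact: intcut.
rewrite -RintegralD//; [|exact: iZ|]; last first.
  exact: (integrableD measurableT (iZ _ _ _) (iZ _ _ _)).
by apply: eq_Rintegral => x _; rewrite /c; ring.
Qed.

Definition hcoef (G : 'rV[R]_n -> R) (a : idx) : R := Inu (fun x => G x * psi a x).

Definition L2 (G : 'rV[R]_n -> R) := nun.-integrable [set: rVm] (fun x => (G x ^+ 2)%:E).

Lemma psi_L2 a : L2 (psi a).
Proof.
have := @integrable_psi2 R n a a; by apply: eq_integrable => // x _; rewrite expr2.
Qed.

Definition theta0 (k : idx) : R := \prod_i theta (k i) 0.

Lemma J_lim (G : 'rV[R]_n -> R) k a : continuous G -> L2 G -> J N G k a @[N --> \oo] --> theta0 k * hcoef G a.
Proof.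
move=> cG LG.
have mG := continuous_measurable_rV cG; have mpsi := continuous_measurable_rV (@psi_cont R n a).
have iGp : nun.-integrable [set: rVm] (fun x => (G x * psi a x)%:E).
  by apply: integrable_L2M => //; exact: psi_L2.
have [B B0 hB] := cut_dom k a.
have cvx x : (G x * cut N k a x) @[N --> \oo] --> theta0 k * (G x * psi a x).
  rewrite mulrCA; apply: cvgM; first exact: cvg_cst.
  rewrite /cut /psi mulrCA; apply: cvgM; first exact: cvg_cst.
  rewrite /tens /cutf /theta0 -big_split /=.
  apply: cvg_big => [|i _]; first exact: mul_continuous.
  apply: cvgM; last exact: cvg_cst.
  have cth := hasD_cont (hasD_theta (k i)).
  rewrite -[X in theta _ X](mul0r (x ord0 i)).
  apply: (cvg_comp _ _ (_ : N.+1%:R^-1 * x ord0 i @[N --> \oo] --> 0 * x ord0 i) (cth _)).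
  by apply: cvgM; [exact: cvg_harmonic|exact: cvg_cst].
rewrite /hcoef -RintegralZl//.
apply: (@nu_dct _ _ (fun x => B * `|G x * psi a x|) _ _ _ _ _).2 => //.
- by move=> N; apply: continuous_measurable_rV; apply: cM => //; exact: cut_cont.
- apply: continuous_measurable_rV; apply: cZ; apply: cM => //; exact: psi_cont.
- by under eq_fun do rewrite EFinM; apply: integrableZl => //; exact: integrable_norm.
- by move=> N x; rewrite [`|G x * cut _ _ _ _|]normrM [`|G x * psi _ _|]normrM mulrCA ler_wpM2l.
Qed.

(** The whole word is moved onto the compactly supported test function before N grows, so that the
    limit only involves the square integrable G. Each derivative of the cutoff carries 1 / (N + 1)
    times a convergent quantity; as such terms raise [k], the induction needs every [k]. *)
Lemma J_limw (w : oword (n:=n)) (G : 'rV[R]_n -> R) k a : rsmooth G -> L2 G ->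
  J N (opw w G) k a @[N --> \oo] --> theta0 k * actL (ows w) (hcoef G) a.
Proof.
move=> sG LG; elim: w k a => [|[[] i] w IH] k a.
- by rewrite actL_nil; apply: J_lim => //; exact: rsmooth_cont.
- rewrite /opw /ows /= -/(opw w G) -/(ows w) actL_mul actL_ltr /= mulN1r.
  under eq_fun do rewrite (J_D _ _ _ _ (opw_smooth w sG)).
  rewrite (_ : theta0 k * _ = Num.sqrt ((a i).+1%:R / 2) * (theta0 k * actL (ows w) (hcoef G) (up a i)) -
    Num.sqrt ((a i)%:R / 2) * (theta0 k * actL (ows w) (hcoef G) (dn a i)) -
    0 * (theta0 (up k i) * actL (ows w) (hcoef G) a)); last by ring.
  apply: cvgB; last by apply: cvgM; [exact: cvg_harmonic|exact: IH].
  by apply: cvgB; apply: cvgM; [exact: cvg_cst|exact: IH|exact: cvg_cst|exact: IH].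
rewrite /opw /ows /= -/(opw w G) -/(ows w) actL_mul actL_ltr /= mul1r.
under eq_fun do rewrite (J_x _ _ _ _ (rsmooth_cont (opw_smooth w sG))).
rewrite (_ : theta0 k * _ = Num.sqrt ((a i).+1%:R / 2) * (theta0 k * actL (ows w) (hcoef G) (up a i)) +
    Num.sqrt ((a i)%:R / 2) * (theta0 k * actL (ows w) (hcoef G) (dn a i))); last by ring.
by apply: cvgD; apply: cvgM; [exact: cvg_cst|exact: IH|exact: cvg_cst|exact: IH].
Qed.

Definition opL (L : seq (R * oword (n:=n))) (F : 'rV[R]_n -> R) x : R := \sum_(p <- L) p.1 * opw p.2 F x.
Definition osL (L : seq (R * oword (n:=n))) : seq (R * word) :=
  flatten [seq [seq (p.1 * q.1, q.2) | q : R * word <- ows p.2] | p : R * oword (n:=n) <- L].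

Lemma actL_osL L (f : idx -> R) a : actL (osL L) f a = \sum_(p <- L) p.1 * actL (ows p.2) f a.
Proof.
rewrite /osL /actL big_flatten big_map; apply: eq_bigr => p _.
by rewrite big_map big_distrr; apply: eq_bigr => q _; rewrite /= mulrA.
Qed.

(* An eigenfunction identity transfers to Hermite coefficients, with no a priori decay. *)
Lemma hcoef_eigen L (G : 'rV[R]_n -> R) c a : rsmooth G -> L2 G -> (forall x, opL L G x = c * G x) ->
  actL (osL L) (hcoef G) a = c * hcoef G a.
Proof.
move=> sG LG eL; pose z : idx := @zidx n.
have tz : theta0 z != 0.
  by rewrite /theta0; apply/prodf_neq0 => i _; rewrite ffunE theta00.
apply: (mulfI tz); rewrite mulrCA.
have h1 : J N (opL L G) z a @[N --> \oo] --> theta0 z * actL (osL L) (hcoef G) a.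
  rewrite actL_osL big_distrr /=.
  rewrite (_ : (fun N => _) = fun N => \sum_(p <- L) p.1 * J N (opw p.2 G) z a); last first.
    apply/funext => N; have iw w : nun.-integrable [set: rVm] (fun x => (opw w G x * cut N z a x)%:E).
      by apply: intcut; apply: rsmooth_cont; exact: opw_smooth.
    have iZ d w : nun.-integrable [set: rVm] (fun x => (d * (opw w G x * cut N z a x))%:E).
      by under eq_fun do rewrite EFinM; apply: integrableZl => //; exact: iw.
    have H : nun.-integrable [set: rVm] (fun x => (opL L G x * cut N z a x)%:E) /\
        J N (opL L G) z a = \sum_(p <- L) p.1 * J N (opw p.2 G) z a.
      elim: L {eL} => [|p L [IH1 IH2]].
        have E : (fun x : 'rV[R]_n => opL [::] G x * cut N z a x) = cst 0.
          by apply/funext => x; rewrite /opL big_nil mul0r.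
        split; last by rewrite /J E big_nil Rintegral_cst// mul0r.
        by rewrite (_ : (fun x => _) = cst 0%E); [exact: integrable0|apply/funext => x; rewrite /opL big_nil mul0r].
      have E : (fun x : 'rV[R]_n => opL (p :: L) G x * cut N z a x) =
          fun x => p.1 * (opw p.2 G x * cut N z a x) + opL L G x * cut N z a x.
        by apply/funext => x; rewrite /opL big_cons; ring.
      have Ex x : opL (p :: L) G x * cut N z a x = p.1 * (opw p.2 G x * cut N z a x) + opL L G x * cut N z a x.
        by rewrite /opL big_cons; ring.
      split.
        rewrite (_ : (fun x => _) = fun x => ((p.1 * (opw p.2 G x * cut N z a x))%:E + (opL L G x * cut N z a x)%:E)%E).
          by apply: integrableD => //; exact: iZ.
        by apply/funext => x; rewrite Ex EFinD.
      rewrite /J E big_cons RintegralD//; last exact: iZ.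
      by rewrite RintegralZl//; [congr (_ + _); exact: IH2|exact: iw].
    by have [] := H.
  rewrite (eq_bigr (fun p => p.1 * (theta0 z * actL (ows p.2) (hcoef G) a))); last by move=> p _; ring.
  apply: cvg_big => [|p _]; first exact: add_continuous.
  by apply: cvgM; [exact: cvg_cst|exact: J_limw].
have h2 : J N (opL L G) z a @[N --> \oo] --> c * (theta0 z * hcoef G a).
  rewrite (_ : (fun N => _) = fun N => c * J N G z a).
    by apply: cvgM; [exact: cvg_cst|apply: J_lim => //; exact: rsmooth_cont].
  apply/funext => N; rewrite /J -RintegralZl//; last by apply: intcut; exact: rsmooth_cont.
  by apply: eq_Rintegral => x _; rewrite eL mulrA.
exact: cvg_unique h1 h2.
Qed.

End Cutoff.

(** * The principal symbol of P^* P and its lower bound *)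

Section Symbol.
Context {R : realType} {n m : nat} (cP : midx n m -> midx n m -> R).
Local Open Scope complex_scope.
Notation rVm := (@rVm R n).
Notation ei := (@ei R n).
Notation nun := (@nu R n).
Notation idx := (@idx n).
Notation C := R[i].
Notation word := (@word n).

Definition PopR (G : 'rV[R]_n -> R) (x : 'rV[R]_n) : R :=
  \sum_(al : midx n m) \sum_(be : midx n m | (mabs (mi al) + mabs (mi be) <= m)%N)
     cP al be * mpow x (mi be) * iD (mdirs (mi al)) G x.

Definition PstarR (G : 'rV[R]_n -> R) (x : 'rV[R]_n) : R :=
  \sum_(al : midx n m) \sum_(be : midx n m | (mabs (mi al) + mabs (mi be) <= m)%N)
     cP al be * (-1) ^+ mabs (mi al) * iD (mdirs (mi al)) (fun y => mpow y (mi be) * G y) x.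

Definition wlet (b : bool) (al : 'I_n -> nat) : oword (n:=n) :=
  flatten [seq nseq (al i) (b, i) | i <- enum 'I_n].

Lemma opw_cat (w1 w2 : oword (n:=n)) (F : 'rV[R]_n -> R) : opw (w1 ++ w2) F = opw w1 (opw w2 F).
Proof. by rewrite /opw foldr_cat. Qed.

Lemma opw_wD al (F : 'rV[R]_n -> R) : opw (wlet true al) F = iD (mdirs al) F.
Proof.
have E (w : oword (n:=n)) : all (fun l => l.1) w -> opw w F = iD [seq ei l.2 | l <- w] F.
  by elim: w => [//|[b i] w IH] /= /andP[-> /IH]; rewrite /opw /iD /= /op1 /= => ->.
rewrite E; last by apply/allP => l /flatten_mapP[i _ /nseqP[-> _]].
rewrite /wlet /mdirs map_flatten -map_comp; congr iD; congr flatten; apply: eq_map => i.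
by rewrite /= map_nseq.
Qed.

Lemma big_wlet (T : comPzRingType) b al (F : bool * 'I_n -> T) :
  \prod_(l <- wlet b al) F l = \prod_i F (b, i) ^+ al i.
Proof.
rewrite /wlet big_flatten big_map big_enum /=; apply: eq_bigr => i _.
by rewrite big_nseq iter_mulr_1.
Qed.

Lemma opw_wX al (F : 'rV[R]_n -> R) x : opw (wlet false al) F x = mpow x al * F x.
Proof.
have E (w : oword (n:=n)) : all (fun l => ~~ l.1) w -> opw w F x = (\prod_(l <- w) x ord0 l.2) * F x.
  elim: w => [|[b i] w IH] /=; first by rewrite big_nil mul1r.
  by case: b => //= /IH; rewrite /opw /= /op1 /= big_cons -mulrA => ->.
rewrite E; last by apply/allP => l /flatten_mapP[i _ /nseqP[-> _]].
by rewrite (big_wlet _ _ (fun l => x ord0 l.2)).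
Qed.

Lemma size_wlet b al : size (wlet b al) = mabs al.
Proof.
rewrite /wlet size_flatten /shape -map_comp /mabs sumnE big_map big_enum /=.
by apply: eq_bigr => i _; rewrite size_nseq.
Qed.

Definition ab : seq (midx n m * midx n m) :=
  enum [pred p : midx n m * midx n m | (mabs (mi p.1) + mabs (mi p.2) <= m)%N].

Definition PL : seq (R * oword (n:=n)) :=
  [seq (cP p.1 p.2, wlet false (mi p.2) ++ wlet true (mi p.1)) | p <- ab].
Definition PsL : seq (R * oword (n:=n)) :=
  [seq (cP p.1 p.2 * (-1) ^+ mabs (mi p.1), wlet true (mi p.1) ++ wlet false (mi p.2)) | p <- ab].

Lemma opL_PL G x : opL PL G x = PopR G x.
Proof.
rewrite /PopR /opL /PL big_map /ab big_enum pair_big_dep /=.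
by apply: eq_bigr => p _; rewrite opw_cat opw_wX opw_wD mulrA.
Qed.

Lemma opL_PsL G x : opL PsL G x = PstarR G x.
Proof.
rewrite /PstarR /opL /PsL big_map /ab big_enum pair_big_dep /=.
apply: eq_bigr => p _; rewrite opw_cat opw_wD; congr (_ * iD _ _ _).
by apply/funext => y; rewrite opw_wX.
Qed.

Definition symb (z : 'I_n -> C) (l : bool * 'I_n) : C :=
  (Num.sqrt 2^-1)%:C * (conjc (z l.2) + (-1) ^+ l.1 * z l.2).

Lemma topL1 z : topL 0 z ([:: (1, [::])] : seq (R * word)) = 1.
Proof. by rewrite /topL big_seq1 /= /tops big_nil mulr1. Qed.

Lemma topL_ltr z l : topL 1 z (@ltr R n l) = symb z l.
Proof.
rewrite /topL /ltr big_cons big_seq1 /= /tops !big_seq1 /= /symb mulrDr; congr (_ + _).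
by rewrite rmorphM rmorphXn rmorphN1 mulrA [_ * (Num.sqrt _)%:C]mulrC.
Qed.

Lemma size_ows w : all (fun p : R * word => size p.2 == size w) (ows w).
Proof.
elim: w => [//|l w /allP IH] /=; apply/allP => q /allpairsP[[p r] /= [hp hr ->]] /=.
rewrite size_cat; have /eqP -> := IH _ hr.
by move: hp; rewrite !inE => /orP[] /eqP ->.
Qed.

Lemma topL_ows D z (w : oword (n:=n)) :
  topL D z (@ows R n w) = if size w == D then \prod_(l <- w) symb z l else 0.
Proof.
case: eqP => [<-|sD].
  elim: w => [|l w IH]; first by rewrite big_nil topL1.
  rewrite /= -/(ows w) -[(size w).+1]add1n topL_mul ?IH ?big_cons ?topL_ltr//.
  by apply: sub_all (size_ows w) => p /eqP ->.
rewrite /topL big_seq big1// => p /(allP (size_ows w))/eqP ->.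
by case: eqP.
Qed.

Lemma topL_osL D z (L : seq (R * oword (n:=n))) :
  topL D z (osL L) = \sum_(p <- L) p.1%:C * topL D z (ows p.2).
Proof.
rewrite /osL /topL big_flatten big_map; apply: eq_bigr => p _.
rewrite big_map big_distrr; apply: eq_bigr => q _ /=.
by case: ifP => _; rewrite ?mulr0// rmorphM mulrA.
Qed.

Definition pm (x xi : 'rV[R]_n) : C :=
  \sum_(al : midx n m) \sum_(be : midx n m | (mabs (mi al) + mabs (mi be) == m)%N)
       (cP al be * mpow x (mi be) * mpow xi (mi al))%:C * ci ^+ mabs (mi al).

(** Phase space coordinates with conj z = (x + i xi) / sqrt 2, because a_i has symbol conj z_i; the
    letters x_i and d_i then have symbols x_i and i xi_i. *)
Definition zx (z : 'I_n -> C) : 'rV[R]_n := \row_i (Num.sqrt 2 * complex.Re (z i)).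
Definition zxi (z : 'I_n -> C) : 'rV[R]_n := \row_i (- Num.sqrt 2 * complex.Im (z i)).

Lemma sqrt2V : Num.sqrt 2^-1 * 2 = Num.sqrt 2 :> R.
Proof. by have := @sqrt_half R 1; rewrite div1r mulr1. Qed.

Lemma symbX z i : symb z (false, i) = (zx z ord0 i)%:C.
Proof.
rewrite /symb mxE expr0 mul1r -sqrt2V /=; case: (z i) => a b.
by apply/eqP; rewrite eq_complex /=; apply/andP; split; apply/eqP; ring.
Qed.

Lemma symbD z i : symb z (true, i) = ci * (zxi z ord0 i)%:C.
Proof.
rewrite /symb mxE expr1 mulN1r -sqrt2V /=; case: (z i) => a b.
by apply/eqP; rewrite eq_complex /=; apply/andP; split; apply/eqP; ring.
Qed.

Lemma prod_symbX z al : \prod_(l <- wlet false al) symb z l = (mpow (zx z) al)%:C.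
Proof.
rewrite big_wlet /mpow rmorph_prod; apply: eq_bigr => i _.
by rewrite symbX rmorphXn.
Qed.

Lemma prod_symbD z al : \prod_(l <- wlet true al) symb z l = (mpow (zxi z) al)%:C * ci ^+ mabs al.
Proof.
rewrite big_wlet /mpow rmorph_prod /mabs -prodrXr -big_split /=; apply: eq_bigr => i _.
by rewrite symbD exprMn rmorphXn mulrC.
Qed.

Lemma sum_ab (F : midx n m * midx n m -> C) :
  \sum_(p <- ab) (if (mabs (mi p.1) + mabs (mi p.2) == m)%N then F p else 0) =
  \sum_(al : midx n m) \sum_(be : midx n m | (mabs (mi al) + mabs (mi be) == m)%N) F (al, be).
Proof.
rewrite /ab big_enum_cond pair_big_dep /= -big_mkcondr /=.
by apply: eq_big => [[a b]|[a b] _ //]; rewrite /= inE /= andbT andb_idl// => /eqP ->.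
Qed.

Lemma topL_PL z : topL m z (osL PL) = pm (zx z) (zxi z).
Proof.
rewrite topL_osL /PL big_map /pm -(sum_ab (fun p => (cP p.1 p.2 * mpow (zx z) (mi p.2) * mpow (zxi z) (mi p.1))%:C * ci ^+ mabs (mi p.1))); apply: eq_bigr => p _ /=.
rewrite topL_ows size_cat !size_wlet addnC; case: ifP => _; last by rewrite mulr0.
by rewrite big_cat /= prod_symbX prod_symbD !rmorphM /= !mulrA.
Qed.

Lemma conjc_ciX (c : R) k : conjc (c%:C * ci ^+ k) = c%:C * (- ci) ^+ k.
Proof.
elim: k => [|k IH]; first by rewrite !expr0 !mulr1 conjc_real.
rewrite !exprSr !mulrA -IH; case: (c%:C * _) => a b.
by apply/eqP; rewrite eq_complex /=; apply/andP; split; apply/eqP; ring.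
Qed.

Lemma topL_PsL z : topL m z (osL PsL) = conjc (pm (zx z) (zxi z)).
Proof.
rewrite topL_osL /PsL big_map /pm -(sum_ab (fun p => (cP p.1 p.2 * mpow (zx z) (mi p.2) * mpow (zxi z) (mi p.1))%:C * ci ^+ mabs (mi p.1))).
rewrite (rmorph_sum (@conjc R)); apply: eq_bigr => p _ /=.
rewrite topL_ows size_cat !size_wlet; case: ifP => _; last by rewrite mulr0 (rmorph0 (@conjc R)).
rewrite conjc_ciX big_cat /= prod_symbX prod_symbD.
by rewrite [(- ci) ^+ _]exprNn !rmorphM rmorphXn rmorphN1 /=; ring.
Qed.

Lemma size_osL (L : seq (R * oword (n:=n))) D : all (fun p => size p.2 <= D)%N L ->
  all (fun p : R * word => size p.2 <= D)%N (osL L).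
Proof.
move=> /allP h; apply/allP => q /flatten_mapP[p /h pD /mapP[r rp ->]] /=.
by rewrite (eqP (allP (size_ows p.2) r rp)).
Qed.

Lemma size_PL : all (fun p => size p.2 <= m)%N PL.
Proof.
apply/allP => q /mapP[p]; rewrite mem_enum inE => h ->.
by rewrite size_cat !size_wlet addnC.
Qed.

Lemma size_PsL : all (fun p => size p.2 <= m)%N PsL.
Proof.
apply/allP => q /mapP[p]; rewrite mem_enum inE => h ->.
by rewrite size_cat !size_wlet.
Qed.

(** The first factor comes from the formal adjoint, whose principal symbol is visibly the conjugate
    of that of P; so the principal symbol here is |p_m|^2. *)
Definition QL : seq (R * word) := mulL (osL PsL) (osL PL).

Lemma size_QL : all (fun p : R * word => size p.2 <= m.*2)%N QL.
Proof.
rewrite -addnn; apply: size_mulL; apply: size_osL; [exact: size_PsL|exact: size_PL].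
Qed.

Lemma topL_QL z : complex.Re (topL m.*2 z QL) =
  complex.Re (pm (zx z) (zxi z)) ^+ 2 + complex.Im (pm (zx z) (zxi z)) ^+ 2.
Proof.
rewrite -addnn topL_mul; [|exact: size_osL size_PsL|exact: size_osL size_PL].
rewrite topL_PL topL_PsL; case: (pm _ _) => a b.
by rewrite /GRing.mul /= !expr2; ring.
Qed.

Lemma coord_le_norm (x : 'rV[R]_n) i : `|x ord0 i| <= `|x|.
Proof. by rewrite [leRHS]mx_normrE; apply: le_trans (le_bigmax _ _ (ord0, i)). Qed.

Lemma zrad_le z : zrad z ^+ m.*2 <= n%:R ^+ m * `|(zx z, zxi z)| ^+ m.*2.
Proof.
rewrite -!mul2n !exprM -exprMn lerXn2r ?nnegrE ?mulr_ge0 ?sqr_ge0 ?zrad_ge0//.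
rewrite /zrad sqr_sqrtr ?sumr_ge0// => [|i _]; last exact: sqr_ge0.
have -> : n%:R * `|(zx z, zxi z)| ^+ 2 = \sum_(i < n) `|(zx z, zxi z)| ^+ 2 :> R.
  by rewrite sumr_const card_ord mulr_natl.
apply: ler_sum => i _; rewrite normc_sqr prod_normE /=.
have s2 : Num.sqrt 2 ^+ 2 = 2 :> R by rewrite sqr_sqrtr.
have h1 := coord_le_norm (zx z) i; have h2 := coord_le_norm (zxi z) i.
set M := Num.max _ _.
have h1' : zx z ord0 i ^+ 2 <= M ^+ 2.
  by rewrite -(real_normK (num_real _)) lerXn2r ?nnegrE// ?le_max ?h1 ?normr_ge0.
have h2' : zxi z ord0 i ^+ 2 <= M ^+ 2.
  by rewrite -(real_normK (num_real _)) lerXn2r ?nnegrE// ?le_max ?h2 ?normr_ge0 ?orbT.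
by move: h1' h2'; rewrite !mxE !exprMn sqrrN s2; lra.
Qed.

Hypothesis ell : P_globally_elliptic cP.

Definition pm2 (w : 'rV[R]_n * 'rV[R]_n) : R :=
  complex.Re (pm w.1 w.2) ^+ 2 + complex.Im (pm w.1 w.2) ^+ 2.

Lemma mpowZ (c : R) (x : 'rV[R]_n) al : mpow (c *: x) al = c ^+ mabs al * mpow x al.
Proof.
by rewrite /mpow /mabs -prodrXr -big_split; apply: eq_bigr => i _; rewrite mxE exprMn.
Qed.

Lemma pmZ (c : R) x xi : pm (c *: x) (c *: xi) = (c ^+ m)%:C * pm x xi.
Proof.
rewrite /pm big_distrr; apply: eq_bigr => al _; rewrite big_distrr; apply: eq_bigr => be /eqP e.
have e' : c ^+ m = c ^+ mabs (mi al) * c ^+ mabs (mi be) by rewrite -exprD e.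
rewrite !mpowZ e' !rmorphM /=; ring.
Qed.

Lemma pm2Z (c : R) w : pm2 (c *: w) = c ^+ m.*2 * pm2 w.
Proof.
case: w => x xi; rewrite /pm2 /= pmZ; case: (pm x xi) => a b /=.
by rewrite -addnn exprD; ring.
Qed.

Lemma pm2_gt0 w : w != 0 -> 0 < pm2 w.
Proof.
case: w => x xi w0; have := @ell x xi; rewrite -/(pm x xi) /pm2 /=.
have -> : ~~ ((x == 0) && (xi == 0)) by move: w0; rewrite -[(x, xi) == 0]/((x == 0) && (xi == 0)).
move=> /(_ isT); case: (pm x xi) => a b; rewrite eq_complex /= => h.
rewrite lt_neqAle addr_ge0 ?sqr_ge0// andbT eq_sym paddr_eq0 ?sqr_ge0//.
by rewrite !sqrf_eq0.
Qed.

Lemma continuous_sumr (T : topologicalType) (I : Type) (s : seq I) (P : pred I)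
  (F : I -> T -> R) : (forall i, continuous (F i)) -> continuous (fun x => \sum_(i <- s | P i) F i x).
Proof.
move=> cF; elim: s => [|i s IH].
  by rewrite (_ : (fun x => _) = cst 0); [exact: cst_continuous|apply/funext => x; rewrite big_nil].
case: (boolP (P i)) => Pi; last first.
  by rewrite (_ : (fun x => _) = (fun x => \sum_(i <- s | P i) F i x))//;
    apply/funext => x; rewrite big_cons (negbTE Pi).
rewrite (_ : (fun x => _) = (fun x => F i x + \sum_(i <- s | P i) F i x)); last first.
  by apply/funext => x; rewrite big_cons Pi.
by apply: cD; [exact: cF|exact: IH].
Qed.

Lemma mpow_cont al : continuous (fun x : 'rV[R]_n => mpow x al).
Proof. exact: rsmooth_cont (rsmooth_mpow al). Qed.

Lemma pm2_cont : continuous pm2.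
Proof.
have cg : continuous (fun w : 'rV[R]_n * 'rV[R]_n => w.1) by move=> w; exact: cvg_fst.
have ch : continuous (fun w : 'rV[R]_n * 'rV[R]_n => w.2) by move=> w; exact: cvg_snd.
have key (F : C -> R) : F 0 = 0 -> {morph F : x y / x + y} -> (forall (a : R) z, F (a%:C * z) = a * F z) ->
    continuous (fun w => F (pm w.1 w.2)).
  move=> F0 FD FZ.
  rewrite (_ : (fun w => _) = fun w : 'rV[R]_n * 'rV[R]_n => \sum_(al : midx n m)
    \sum_(be : midx n m | (mabs (mi al) + mabs (mi be) == m)%N)
       (cP al be * mpow w.1 (mi be) * mpow w.2 (mi al)) * F (ci ^+ mabs (mi al))); last first.
    apply/funext => w; rewrite /pm (big_morph F FD F0); apply: eq_bigr => al _.
    by rewrite (big_morph F FD F0); apply: eq_bigr => be _; rewrite FZ.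
  apply: continuous_sumr => al; apply: continuous_sumr => be.
  apply: cM; last exact: cst_continuous.
  apply: cM; first apply: cZ.
    by move=> w; apply: (@continuous_comp _ _ _ fst (fun x => mpow x (mi be))); [exact: cg|exact: mpow_cont].
  by move=> w; apply: (@continuous_comp _ _ _ snd (fun x => mpow x (mi al))); [exact: ch|exact: mpow_cont].
have cRe : continuous (fun w : 'rV[R]_n * 'rV[R]_n => complex.Re (pm w.1 w.2)).
  by apply: key => // [[a b] [c d]|a [c d]] //=; ring.
have cIm : continuous (fun w : 'rV[R]_n * 'rV[R]_n => complex.Im (pm w.1 w.2)).
  by apply: key => // [[a b] [c d]|a [c d]] //=; ring.
by apply: cD; apply: cM.
Qed.

(** Compactness of the unit sphere and homogeneity of degree 2m; the lower bound is read off from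
    the boundedness of the reciprocal. *)
Lemma pm2_lb : (0 < m)%N -> exists2 c : R, 0 < c & forall w, c * `|w| ^+ m.*2 <= pm2 w.
Proof.
move=> m0; pose S : set ('rV[R]_n * 'rV[R]_n) := [set w | `|w| = 1].
have cS : compact S.
  apply: (@subclosed_compact _ S (cube 1 `*` cube 1)).
  - apply: (@closed_comp _ _ (fun w : 'rV[R]_n * 'rV[R]_n => `|w|) [set 1]).
      by move=> w _; exact: norm_continuous.
    exact: closed_eq.
  - by apply: compact_setX; exact: compact_cube.
  - move=> [x xi]; rewrite /S /= prod_normE /= => h; split=> i; rewrite -h le_max coord_le_norm ?orbT//.
have Sw0 w : S w -> w != 0.
  by move=> Sw; apply/eqP => w0; move: Sw; rewrite /S /= w0 normr0 => /esym/eqP; rewrite oner_eq0.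
have Sn w : S w -> pm2 w != 0 by move=> /Sw0/pm2_gt0/lt0r_neq0.
have : compact ((fun w => (pm2 w)^-1) @` S).
  apply: continuous_compact => //; apply: continuous_in_subspaceT => w /set_mem Sw.
  by apply: cvgV; [exact: Sn|exact: pm2_cont].
move=> /compact_bounded[K [_ hK]].
pose K' := `|K| + 1; have K0 : 0 < K' by rewrite ltr_wpDl.
have lb w : S w -> K'^-1 <= pm2 w.
  move=> Sw; have w0 := Sw0 w Sw.
  have p0 := pm2_gt0 w0.
  have := hK K'; rewrite /K' ltr_pwDr ?ler_norm// => /(_ isT) /(_ _ (ex_intro2 _ _ w Sw erefl)) /=.
  rewrite normfV gtr0_norm// => h.
  by rewrite -[leRHS]invrK lef_pV2 ?posrE ?invr_gt0.
exists K'^-1; first by rewrite invr_gt0.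
move=> w; case: (eqVneq w 0) => [->|w0].
  by rewrite normr0 expr0n double_eq0 (gtn_eqF m0) mulr0 addr_ge0 ?sqr_ge0.
have n0 : 0 < `|w| by rewrite normr_gt0.
have := lb (`|w|^-1 *: w); rewrite /S /= normrZ normfV normr_id mulVf ?gt_eqF// => /(_ erefl).
by rewrite pm2Z exprVn ler_pdivlMl ?exprn_gt0// mulrC.
Qed.

Lemma Re_bigsum (I : Type) (s : seq I) (P : pred I) (F : I -> C) :
  complex.Re (\sum_(i <- s | P i) F i) = \sum_(i <- s | P i) complex.Re (F i).
Proof. by apply: (big_morph (@complex.Re R)) => // -[a b] [c d]. Qed.

Lemma Im_bigsum (I : Type) (s : seq I) (P : pred I) (F : I -> C) :
  complex.Im (\sum_(i <- s | P i) F i) = \sum_(i <- s | P i) complex.Im (F i).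
Proof. by apply: (big_morph (@complex.Im R)) => // -[a b] [c d]. Qed.

Lemma Re_rM (c : R) (z : C) : complex.Re (c%:C * z) = c * complex.Re z.
Proof. by case: z => a b /=; ring. Qed.

Lemma Im_rM (c : R) (z : C) : complex.Im (c%:C * z) = c * complex.Im z.
Proof. by case: z => a b /=; ring. Qed.

Lemma Re_Pop (u : 'rV[R]_n -> C) x : complex.Re (Pop cP u x) = PopR (cRe u) x.
Proof.
rewrite /Pop Re_bigsum; apply: eq_bigr => al _; rewrite Re_bigsum; apply: eq_bigr => be _.
by rewrite Re_rM.
Qed.

Lemma Im_Pop (u : 'rV[R]_n -> C) x : complex.Im (Pop cP u x) = PopR (cIm u) x.
Proof.
rewrite /Pop Im_bigsum; apply: eq_bigr => al _; rewrite Im_bigsum; apply: eq_bigr => be _.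
by rewrite Im_rM.
Qed.

Lemma Re_Pstar (u : 'rV[R]_n -> C) x : complex.Re (Pstar cP u x) = PstarR (cRe u) x.
Proof.
rewrite /Pstar Re_bigsum; apply: eq_bigr => al _; rewrite Re_bigsum; apply: eq_bigr => be _.
rewrite Re_rM /ciD /=; congr (_ * iD _ _ _).
by apply/funext => y; rewrite /cRe Re_rM.
Qed.

Hypothesis selfadj : P_selfadjoint cP.

Lemma PstarR_PopR G x : rsmooth G -> PstarR G x = PopR G x.
Proof.
move=> sG; pose u : 'rV[R]_n -> C := fun y => (G y)%:C.
have su : csmooth u by split; [exact: sG|exact: rsmooth_cst].
by have := congr1 (@complex.Re R) (selfadj su x); rewrite Re_Pop Re_Pstar => ->.
Qed.

End Symbol.

(** * Bessel's inequality for Hermite coefficients *)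

Section Bessel.
Context {R : realType} {n : nat}.
Notation rVm := (@rVm R n).
Notation nun := (@nu R n).
Notation Inu g := (Rintegral (@nu R n) [set: rVm] (g : rVm -> R)).
Notation idx := (@idx n).
Notation intg g := (nun.-integrable [set: rVm] (fun x : rVm => (g x)%:E)).

Lemma intgZ (c : R) (f : 'rV[R]_n -> R) : intg f -> intg (fun x => c * f x).
Proof. by move=> h; under eq_fun do rewrite EFinM; apply: integrableZl. Qed.

Lemma intgD (f g : 'rV[R]_n -> R) : intg f -> intg g -> intg (fun x => f x + g x).
Proof. by move=> hf hg; under eq_fun do rewrite EFinD; apply: integrableD. Qed.

Lemma InuD (f g : 'rV[R]_n -> R) : intg f -> intg g ->
  Inu (fun x => f x + g x) = Inu f + Inu g.
Proof. by move=> hf hg; apply: RintegralD. Qed.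

Lemma InuZ (c : R) (f : 'rV[R]_n -> R) : intg f -> Inu (fun x => c * f x) = c * Inu f.
Proof. by move=> hf; apply: RintegralZl. Qed.

Lemma Inu_sum (I : Type) (s : seq I) (c : I -> R) (f : I -> 'rV[R]_n -> R) :
  (forall i, intg (f i)) -> intg (fun x => \sum_(i <- s) c i * f i x) /\
  Inu (fun x => \sum_(i <- s) c i * f i x) = \sum_(i <- s) c i * Inu (f i).
Proof.
move=> hf; elim: s => [|i s [IH1 IH2]].
  have E : (fun x : 'rV[R]_n => \sum_(i <- [::]) c i * f i x) = cst 0.
    by apply/funext => x; rewrite big_nil.
  split; last by rewrite E big_nil Rintegral_cst// mul0r.
  by rewrite (_ : (fun x => _) = cst 0%E); [exact: integrable0|apply/funext => x; rewrite big_nil].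
have E : (fun x : 'rV[R]_n => \sum_(i <- i :: s) c i * f i x) = fun x => c i * f i x + \sum_(i <- s) c i * f i x.
  by apply/funext => x; rewrite big_cons.
have iZ := intgZ (c i) (hf i).
split.
  rewrite (_ : (fun x => _) = fun x => (c i * f i x + \sum_(i <- s) c i * f i x)%:E); first exact: intgD.
  by apply/funext => x; rewrite big_cons.
transitivity (Inu (fun x => c i * f i x + \sum_(i <- s) c i * f i x)).
  by apply: eq_Rintegral => x _; rewrite big_cons.
by rewrite (InuD iZ IH1) (InuZ _ (hf i)) IH2 big_cons.
Qed.

Lemma hcoef_int (G : 'rV[R]_n -> R) a : continuous G -> L2 G -> intg (fun x => G x * psi a x).
Proof.
move=> cG LG; apply: integrable_L2M => //; try exact: continuous_measurable_rV.
  by apply: continuous_measurable_rV; exact: psi_cont.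
exact: psi_L2.
Qed.

Lemma actLZ (L : seq (R * word (n:=n))) (c : R) (f : idx -> R) b :
  actL L (fun a => c * f a) b = c * actL L f b.
Proof.
rewrite /actL mulr_sumr; apply: eq_bigr => p _.
have := actw_lin p.2 [:: tt] (fun=> c) (fun=> f) b; rewrite big_seq1.
rewrite (_ : (fun a => \sum_(i <- [:: tt]) c * f a) = fun a => c * f a); last first.
  by apply/funext => a; rewrite big_seq1.
by move=> ->; rewrite mulrCA.
Qed.

Lemma bessel (s : seq idx) (G : 'rV[R]_n -> R) : uniq s -> continuous G -> L2 G ->
  \sum_(a <- s) hcoef G a ^+ 2 <= Inu (fun x => G x ^+ 2).
Proof.
move=> us cG LG; pose S := \sum_(a <- s) hcoef G a ^+ 2.
pose F x := \sum_(a <- s) hcoef G a * psi a x.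
have [i1 e1] := Inu_sum s (hcoef G) (fun a => hcoef_int a cG LG).
have eGF : Inu (fun x => G x * F x) = S.
  rewrite -[RHS](eq_bigr _ (fun a _ => esym (expr2 (hcoef G a)))) -e1.
  by apply: eq_Rintegral => x _; rewrite /F mulr_sumr; apply: eq_bigr => a _; rewrite mulrCA.
have iGF : intg (fun x => G x * F x).
  move: i1; apply: eq_integrable => // x _; congr (_%:E).
  by rewrite /F mulr_sumr; apply: eq_bigr => a _; rewrite mulrCA.
have hF a : intg (fun x => F x * psi a x) /\ (a \in s -> Inu (fun x => F x * psi a x) = hcoef G a).
  have [i2 e2] := Inu_sum s (hcoef G) (fun b => integrable_psi2 b a).
  have E x : F x * psi a x = \sum_(b <- s) hcoef G b * (psi b x * psi a x).
    by rewrite /F mulr_suml; apply: eq_bigr => b _; rewrite mulrA.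
  split; first by move: i2; apply: eq_integrable => // x _; rewrite E.
  move=> as_; transitivity (Inu (fun x => \sum_(b <- s) hcoef G b * (psi b x * psi a x))).
    by apply: eq_Rintegral => x _; exact: E.
  rewrite e2.
  rewrite (bigD1_seq a)//= -/(ip _ _) ip_psi eqxx mulr1 big1 ?addr0// => b /negbTE ba.
  by rewrite -/(ip _ _) ip_psi ba mulr0.
have [i3 e3] := Inu_sum s (hcoef G) (fun a => (hF a).1).
have eFF : Inu (fun x => F x * F x) = S.
  rewrite (_ : S = \sum_(a <- s) hcoef G a * Inu (fun x => F x * psi a x)).
    by rewrite -e3; apply: eq_Rintegral => x _; rewrite {2}/F mulr_sumr; apply: eq_bigr => a _; rewrite mulrCA.
  by rewrite /S big_seq [RHS]big_seq; apply: eq_bigr => a /(hF a).2 ->; rewrite expr2.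
have iFF : intg (fun x => F x * F x).
  move: i3; apply: eq_integrable => // x _; congr (_%:E).
  by rewrite {3}/F mulr_sumr; apply: eq_bigr => a _; rewrite mulrCA.
have : 0 <= Inu (fun x => (G x - F x) ^+ 2) by apply: Rintegral_ge0 => x _; exact: sqr_ge0.
rewrite (_ : Inu (fun x => (G x - F x) ^+ 2) = Inu (fun x => G x ^+ 2 + (- 2 * (G x * F x) + F x * F x))); last first.
  by apply: eq_Rintegral => x _; ring.
rewrite RintegralD//; last by apply: intgD => //; exact: intgZ.
rewrite RintegralD//; last exact: intgZ.
by rewrite RintegralZl// eGF eFF -/S; lra.
Qed.

Lemma hcoef_Sbox (G : 'rV[R]_n -> R) N : continuous G -> L2 G ->
  Sbox N (fun a => hcoef G a ^+ 2) <= Inu (fun x => G x ^+ 2).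
Proof.
move=> cG LG; rewrite /Sbox -(big_map (@ofbox n N) predT (fun a => hcoef G a ^+ 2)).
apply: bessel => //; rewrite map_inj_uniq ?index_enum_uniq//.
exact: ofbox_inj.
Qed.

End Bessel.

(** * Decay of the Hermite coefficients of eigenfunctions *)

Section Decay.
Context {R : realType} {n m : nat} (cP : midx n m -> midx n m -> R).
Notation rVm := (@rVm R n).
Notation Inu g := (Rintegral (@nu R n) [set: rVm] (g : rVm -> R)).

(** On the coefficient side P and its formal adjoint both act as multiplication by l, so the
    coefficients form an eigensequence of [QL cP] with Lam = l^2. *)
Theorem eigen_coef_decay : (0 < n)%N -> (0 < m)%N -> P_selfadjoint cP -> P_globally_elliptic cP ->
  exists C rho0 : R, [/\ 0 <= C, 0 < rho0, rho0 < 1 &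
    forall (rho l : R) (M : nat) (G : 'rV[R]_n -> R), rho0 <= rho -> rho < 1 ->
      C * (1 + l ^+ 2) <= M%:R ^+ m -> rsmooth G -> L2 G -> Inu (fun x => G x ^+ 2) <= 1 ->
      (forall x, PopR cP G x = l * G x) -> forall a, `|hcoef G a| <= rho ^+ (wt a - M)].
Proof.
move=> n0 m0 sa el.
have [c c0 hc] := pm2_lb el m0.
have nm0 : 0 < n%:R ^+ m :> R by rewrite exprn_gt0// ltr0n.
have [z|c1 [C1 [c10 C10 co]]] := @coercive_form R n (QL cP) m (c / n%:R ^+ m) m0 (divr_gt0 c0 nm0) (size_QL cP).
  rewrite topL_QL; apply: le_trans (hc (zx z, zxi z)).
  by rewrite -mulrA ler_wpM2l ?(ltW c0)// ler_pdivrMl// zrad_le.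
have [C [rho0 [C0 r0 r1 H]]] := eigen_seq_decay m0 n0 c10 C10 (size_QL cP) co.
exists C, rho0; split=> // rho l M G rr r1' hM sG LG nG eG a.
have cG := rsmooth_cont sG.
apply: (H rho (l ^+ 2) M (hcoef G)) => //; first exact: sqr_ge0.
  by move=> N; apply: le_trans (hcoef_Sbox N cG LG) nG.
move=> b; rewrite /QL actL_mul.
have e1 d : actL (osL (PL cP)) (hcoef G) d = l * hcoef G d.
  by apply: hcoef_eigen => // x; rewrite opL_PL eG.
have e2 d : actL (osL (PsL cP)) (hcoef G) d = l * hcoef G d.
  by apply: hcoef_eigen => // x; rewrite opL_PsL PstarR_PopR.
rewrite (_ : actL (osL (PL cP)) (hcoef G) = fun d => l * hcoef G d); last exact/funext.
by rewrite actLZ e2 mulrA expr2.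
Qed.

End Decay.

(** * Completeness of the Hermite functions *)

Lemma cN (R : realType) (T : topologicalType) (f : T -> R) : continuous f -> continuous (fun x => `|f x|).
Proof. by move=> cf x; apply: cvg_norm; exact: cf. Qed.

Section Completeness.
Context {R : realType} {n : nat}.
Notation rVm := (@rVm R n).
Notation nun := (@nu R n).
Notation Inu g := (Rintegral (@nu R n) [set: rVm] (g : rVm -> R)).
Notation idx := (@idx n).
Notation intg g := (nun.-integrable [set: rVm] (fun x : rVm => (g x)%:E)).
Notation z0 := (@zidx n).
Notation psi0 := (@psi R n (@zidx n)).

Inductive pol : ('rV[R]_n -> R) -> Prop :=
| pol_cst c : pol (fun=> c)
| pol_add p q : pol p -> pol q -> pol (fun x => p x + q x)
| pol_X (i : 'I_n) p : pol p -> pol (fun x => x ord0 i * p x).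

Lemma pol_mul p q : pol p -> pol q -> pol (fun x => p x * q x).
Proof.
move=> hp hq; elim: hp => [c|p1 p2 _ h1 _ h2|i p1 _ h1].
- elim: hq => [d|q1 q2 _ h1 _ h2|i q1 _ h1].
  + exact: (pol_cst (c * d)).
  + rewrite (_ : (fun x => _) = fun x => c * q1 x + c * q2 x); first exact: pol_add.
    by apply/funext => x; rewrite mulrDr.
  + rewrite (_ : (fun x => _) = fun x : 'rV[R]_n => x ord0 i * (c * q1 x)); first exact: pol_X.
    by apply/funext => x; rewrite mulrCA.
- rewrite (_ : (fun x => _) = fun x => p1 x * q x + p2 x * q x); first exact: pol_add.
  by apply/funext => x; rewrite mulrDl.
- rewrite (_ : (fun x => _) = fun x : 'rV[R]_n => x ord0 i * (p1 x * q x)); first exact: pol_X.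
  by apply/funext => x; rewrite mulrA.
Qed.

Lemma pol_sum (I : Type) (s : seq I) (F : I -> 'rV[R]_n -> R) : (forall i, pol (F i)) ->
  pol (fun x => \sum_(i <- s) F i x).
Proof.
move=> hF; elim: s => [|i s IH].
  by rewrite (_ : (fun x => _) = fun=> 0); [exact: pol_cst|apply/funext => x; rewrite big_nil].
rewrite (_ : (fun x => _) = fun x => F i x + \sum_(i <- s) F i x); first exact: pol_add.
by apply/funext => x; rewrite big_cons.
Qed.

Lemma pol_exp p k : pol p -> pol (fun x => p x ^+ k).
Proof.
move=> hp; elim: k => [|k IH]; first exact: (pol_cst 1).
rewrite (_ : (fun x => _) = fun x => p x * p x ^+ k); first exact: pol_mul.
by apply/funext => x; rewrite exprS.
Qed.

Lemma pol_cont p : pol p -> continuous p.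
Proof.
elim=> [c|p1 p2 _ h1 _ h2|i p1 _ h1]; [exact: cst_continuous|exact: cD|apply: cM => //].
exact: coordn_continuous.
Qed.

Definition sq (x : 'rV[R]_n) : R := \sum_i x ord0 i ^+ 2.

Lemma sq_ge0 x : 0 <= sq x. Proof. by apply: sumr_ge0 => i _; exact: sqr_ge0. Qed.

Lemma coord_sq (x : 'rV[R]_n) i : x ord0 i ^+ 2 <= sq x.
Proof. by rewrite /sq (bigD1 i)//= lerDl sumr_ge0// => j _; exact: sqr_ge0. Qed.

Lemma pol_growth p (e : R) : pol p -> 0 < e -> exists2 K, 0 <= K & forall x, `|p x| <= K * expR (e * sq x).
Proof.
move=> hp; elim: hp e => [c|p1 p2 _ h1 _ h2|i p1 _ h1] e e0.
- exists `|c| => // x; rewrite ler_peMr// -expR0 ler_expR mulr_ge0 ?sq_ge0//; exact: ltW.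
- have [K1 k1 b1] := h1 e e0; have [K2 k2 b2] := h2 e e0.
  exists (K1 + K2) => [|x]; first exact: addr_ge0.
  by rewrite mulrDl (le_trans (ler_normD _ _))// lerD.
- have e2 : 0 < e / 2 by rewrite divr_gt0.
  have [K1 k1 b1] := h1 _ e2; exists ((1 + 2 / e) * K1) => [|x].
    by rewrite mulr_ge0// addr_ge0// divr_ge0// ltW.
  have -> : e * sq x = e / 2 * sq x + e / 2 * sq x by field.
  rewrite normrM expRD mulrACA ler_pM//.
  have h := expR_ge1Dx (e / 2 * sq x).
  have u0 := sq_ge0 x; set u := sq x in h u0 *.
  have hx : `|x ord0 i| <= 1 + u.
    have := coord_sq x i; rewrite -/u -(real_normK (num_real _)) => hu.
    by have := sqr_ge0 (`|x ord0 i| - 1); have := normr_ge0 (x ord0 i); rewrite !expr2 in hu *; nra.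
  rewrite (le_trans hx)// (@le_trans _ _ ((1 + 2 / e) * (1 + e / 2 * u)))//.
    have -> : (1 + 2 / e) * (1 + e / 2 * u) = 1 + u + (2 / e + e / 2 * u) by field; rewrite gt_eqF.
    have e1 : 0 <= 2 / e by rewrite divr_ge0// ltW.
    have e3 : 0 <= e / 2 * u by rewrite mulr_ge0// ltW.
    lra.
  by rewrite ler_wpM2l// addr_ge0// divr_ge0// ltW.
Qed.

Variables (G : 'rV[R]_n -> R) (y : 'rV[R]_n).
Hypothesis cG : continuous G.
Hypothesis LG : L2 G.
Hypothesis orthG : forall a, hcoef G a = 0.

(** Exponent of a Gaussian centred at y, the point where G is to be shown to vanish. *)
Definition wq (x : 'rV[R]_n) : R := - (2^-1 * sq (x - y)).

Lemma wq_le0 x : wq x <= 0.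
Proof. by rewrite oppr_le0 mulr_ge0 ?sq_ge0. Qed.

Lemma pol_wq : pol wq.
Proof.
rewrite (_ : wq = fun x => (- 2^-1) * \sum_i (x ord0 i * (x ord0 i * 1) + (x ord0 i * (- 2 * y ord0 i) + y ord0 i ^+ 2))).
  apply: pol_mul; first exact: pol_cst.
  apply: pol_sum => i; apply: pol_add; first by do 2 apply: pol_X; exact: pol_cst.
  by apply: pol_add; [apply: pol_X|]; exact: pol_cst.
by apply/funext => x; rewrite /wq /sq mulNr; congr (- (_ * _)); apply: eq_bigr => i _; rewrite !mxE; ring.
Qed.

Lemma psi0E x : psi0 x = psic (R := R) (n := n) * expR (- (2^-1 * sq x)).
Proof.
rewrite /psi /tens; congr (_ * _); rewrite /sq mulr_sumr -sumrN expR_sum; apply: eq_bigr => i _.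
by rewrite /htens /hh /hN ffunE /= expr0 mul1r fact0 sqrtr1 invr1 mul1r; congr expR; field.
Qed.

Lemma psic_gt0 : 0 < psic (R := R) (n := n).
Proof. by rewrite /psic invr_gt0 sqrtr_gt0 psiZ_gt0. Qed.

Lemma psi0_gt0 x : 0 < psi0 x.
Proof. by rewrite psi0E mulr_gt0 ?expR_gt0// psic_gt0. Qed.

Lemma expsq_Wt x : expR (- (4^-1 * sq x)) <= 4 ^+ n * Wt x.
Proof.
rewrite /sq mulr_sumr -sumrN expR_sum /Wt.
have -> : 4 ^+ n = \prod_(i < n) 4 :> R by rewrite prodr_const card_ord.
rewrite -big_split /=; apply: ler_prod => i _; rewrite expR_ge0 /= expRN.
rewrite -[leRHS]invrK lef_pV2 ?posrE ?expR_gt0 ?invr_gt0 ?mulr_gt0 ?invr_gt0 ?oneDsqr_gt0//.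
rewrite invfM invrK; have := expR_ge1Dx (4^-1 * x ord0 i ^+ 2); rewrite /oneDsqr; lra.
Qed.

Lemma wq_norm x : `|wq x| <= sq x + sq y.
Proof.
rewrite ler0_norm ?wq_le0// /wq opprK /sq mulr_sumr -big_split; apply: ler_sum => i _ /=.
by rewrite !mxE; have := sqr_ge0 (x ord0 i + y ord0 i); rewrite !expr2; lra.
Qed.

(** psi0 decays like exp (- |x|^2 / 2). The polynomial and exp (|wq| / 8) cost exp (|x|^2 / 8) each,
    which leaves exp (- |x|^2 / 4). *)
Lemma dom_L2 p : pol p -> L2 (fun x => p x * expR (8^-1 * `|wq x|) * psi0 x).
Proof.
move=> hp; have e8 : 0 < 8^-1 :> R by rewrite invr_gt0.
have [K K0 hK] := pol_growth hp e8.
have cw := pol_cont pol_wq.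
have cq : continuous (fun x => p x * expR (8^-1 * `|wq x|) * psi0 x).
  apply: cM; last exact: psi_cont.
  apply: cM; first exact: pol_cont.
  move=> x; apply: (@continuous_comp _ _ _ (fun x => 8^-1 * `|wq x|) expR); last exact: continuous_expR.
  by apply: cZ; exact: cN.
pose D := K * expR (8^-1 * sq y) * psic (R := R) (n := n).
have D0 : 0 <= D by rewrite !mulr_ge0 ?expR_ge0// ltW// psic_gt0.
have hq x : `|p x * expR (8^-1 * `|wq x|) * psi0 x| <= D * expR (- (4^-1 * sq x)).
  rewrite (normrM _ (psi0 x)) (normrM (p x)) [`|expR _|]ger0_norm ?expR_ge0// [`|psi0 x|]gtr0_norm ?psi0_gt0//.
  have h1 : expR (8^-1 * `|wq x|) <= expR (8^-1 * sq x) * expR (8^-1 * sq y).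
    by rewrite -expRD ler_expR -mulrDr ler_wpM2l// wq_norm.
  apply: (le_trans (ler_wpM2r (ltW (psi0_gt0 x)) (ler_pM (normr_ge0 _) (expR_ge0 _) (hK x) h1))).
  rewrite psi0E /D.
  have -> : - (4^-1 * sq x) = 8^-1 * sq x + 8^-1 * sq x + - (2^-1 * sq x) by field.
  by rewrite !expRD le_eqVlt; apply/orP; left; apply/eqP; ring.
move: D D0 hq => D D0 hq.
apply: integrable_Wdom.
  by apply: measurable_funX; exact: continuous_measurable_rV.
exists (D ^+ 2 * 4 ^+ n) => x; rewrite normrX.
have e1 : expR (- (4^-1 * sq x)) <= 1 by rewrite -expR0 ler_expR oppr_le0 mulr_ge0 ?sq_ge0.
have := hq x; have := normr_ge0 (p x * expR (8^-1 * `|wq x|) * psi0 x); set q := `|_| => q0 h.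
apply: (@le_trans _ _ ((D * expR (- (4^-1 * sq x))) ^+ 2)).
  have De : 0 <= D * expR (- (4^-1 * sq x)) by rewrite mulr_ge0// expR_ge0.
  by rewrite ler_sqr ?nnegrE.
have E0 := expR_ge0 (- (4^-1 * sq x)); have := expsq_Wt x.
move: (expR _) E0 e1 => E E0 e1 h3.
have -> : (D * E) ^+ 2 = D ^+ 2 * (E * E) by ring.
rewrite -[leRHS]mulrA; apply: ler_wpM2l; first exact: sqr_ge0.
apply: le_trans h3.
by rewrite -[leRHS]mulr1 ler_pM.
Qed.

(** Orthogonality of G to all polynomials times exp (t wq) psi0. It holds at t = 0 by the
    orthogonality to Hermite functions and is propagated by steps of 1/8; for large t the Gaussian
    concentrates at y. *)
Definition Azero (t : R) := forall p, pol p ->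
  intg (fun x => G x * (p x * expR (t * wq x) * psi0 x)) /\
  Inu (fun x => G x * (p x * expR (t * wq x) * psi0 x)) = 0.

Lemma Azero0 : Azero 0.
Proof.
move=> p hp.
suff H : forall a, intg (fun x => G x * (p x * psi a x)) /\ Inu (fun x => G x * (p x * psi a x)) = 0.
  by under eq_fun do rewrite mul0r expR0 mulr1; under eq_Rintegral do rewrite mul0r expR0 mulr1.
elim: hp => [c|p1 p2 _ h1 _ h2|i p1 _ h1] a.
- have i1 := hcoef_int a cG LG.
  by split; [under eq_fun do rewrite mulrCA|under eq_Rintegral do rewrite mulrCA];
    [exact: intgZ|rewrite (InuZ _ i1) -/(hcoef G a) orthG mulr0].
- have [i1 e1] := h1 a; have [i2 e2] := h2 a.
  split; [under eq_fun do rewrite mulrDl mulrDr|under eq_Rintegral do rewrite mulrDl mulrDr].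
    exact: intgD.
  by rewrite (InuD i1 i2) e1 e2 addr0.
- have [i1 e1] := h1 (up a i); have [i2 e2] := h1 (dn a i).
  have E x : G x * (x ord0 i * p1 x * psi a x) = Num.sqrt ((a i).+1%:R / 2) * (G x * (p1 x * psi (up a i) x)) +
      Num.sqrt ((a i)%:R / 2) * (G x * (p1 x * psi (dn a i) x)).
    by rewrite [x ord0 i * _]mulrC -[p1 x * _ * _]mulrA psi_x; ring.
  split; [under eq_fun do rewrite E|under eq_Rintegral do rewrite E].
    by apply: intgD; exact: intgZ.
  by rewrite (InuD (intgZ _ i1) (intgZ _ i2)) (InuZ _ i1) (InuZ _ i2) e1 e2 !mulr0 addr0.
Qed.

Lemma exp_partial_le (z : R) N : `|series (exp_coeff z) N| <= expR `|z|.
Proof.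
apply: (@le_trans _ _ (series (exp_coeff `|z|) N)).
  rewrite /series /= (le_trans (ler_norm_sum _ _ _))//; apply: ler_sum => i _.
  by rewrite /exp_coeff /= normrM normrX normfV normr_nat.
apply: nondecreasing_cvgn_le; last exact: is_cvg_series_exp_coeff.
by apply: nondecreasing_series => i _ _; rewrite /exp_coeff /= divr_ge0// exprn_ge0.
Qed.

Lemma prod_dom (g p s e t X : R) : `|s| <= X -> 0 <= e <= 1 ->
  `|g * (p * s * e * t)| <= `|g * (p * X * t)|.
Proof.
move=> sX /andP[e0 e1]; rewrite !normrM (ger0_norm e0).
rewrite (ger0_norm (le_trans (normr_ge0 s) sX)) ler_wpM2l// ler_wpM2r//.
by rewrite -mulrA ler_wpM2l// -[leRHS]mulr1 ler_pM.
Qed.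

Lemma pol_partial N : pol (fun x => series (exp_coeff (8^-1 * wq x)) N).
Proof.
rewrite (_ : (fun x => _) = fun x => \sum_(k <- index_iota 0 N) ((8^-1) ^+ k / k`!%:R) * wq x ^+ k).
  by apply: pol_sum => k; apply: pol_mul; [exact: pol_cst|apply: pol_exp; exact: pol_wq].
by apply/funext => x; rewrite /series /=; apply: eq_bigr => k _; rewrite /exp_coeff /= exprMn; ring.
Qed.

(** The partial sums of exp (wq / 8) are polynomials, to which [Azero t] applies; the limit is
    dominated by means of exp (|wq| / 8). A longer step would not be square integrable against psi0
    with this method of bounding. *)
Lemma AzeroS t : 0 <= t -> Azero t -> Azero (t + 8^-1).
Proof.
move=> t0 At p hp.
pose f x := G x * (p x * expR ((t + 8^-1) * wq x) * psi0 x).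
pose F N x := G x * ((p x * series (exp_coeff (8^-1 * wq x)) N) * expR (t * wq x) * psi0 x).
pose g x := `|G x * (p x * expR (8^-1 * `|wq x|) * psi0 x)|.
have cp := pol_cont hp; have cw := pol_cont pol_wq; have cpsi := @psi_cont R n z0.
have cexp (h : 'rV[R]_n -> R) : continuous h -> continuous (fun x => expR (h x)).
  by move=> ch x; apply: (@continuous_comp _ _ _ h expR); [exact: ch|exact: continuous_expR].
have cf : continuous f by apply: cM => //; apply: cM => //; apply: cM => //; apply: cexp; exact: cZ.
have cF N : continuous (F N).
  apply: cM => //; apply: cM => //; apply: cM; last by apply: cexp; exact: cZ.
  by apply: cM => //; apply: pol_cont; exact: pol_partial.
have cq : continuous (fun x => p x * expR (8^-1 * `|wq x|) * psi0 x).
  apply: cM => //; apply: cM => //; apply: cexp; apply: cZ; exact: cN.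
have ig : intg g.
  have : intg (fun x => G x * (p x * expR (8^-1 * `|wq x|) * psi0 x)).
    apply: integrable_L2M => //; try exact: continuous_measurable_rV.
    exact: dom_L2.
  exact: integrable_norm.
have Fg N x : `|F N x| <= g x.
  apply: prod_dom.
    by rewrite (le_trans (exp_partial_le _ _))// normrM [`|8^-1|]ger0_norm.
  by rewrite expR_ge0 -expR0 ler_expR mulr_ge0_le0// wq_le0.
have Ff x : F N x @[N --> \oo] --> f x.
  rewrite (_ : f x = G x * (p x * expR (8^-1 * wq x) * expR (t * wq x) * psi0 x)); last first.
    by rewrite /f mulrDl expRD; ring.
  apply: cvgM; first exact: cvg_cst.
  apply: cvgM; last exact: cvg_cst.
  apply: cvgM; last exact: cvg_cst.
  apply: cvgM; first exact: cvg_cst.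
  exact: is_cvg_series_exp_coeff.
have [If] := @nu_dct R n F f g (fun N => continuous_measurable_rV (cF N)) (continuous_measurable_rV cf) Ff ig Fg.
move=> cvI; split=> //; move: cvI.
rewrite (_ : (fun N => _) = cst 0).
  by move=> /(cvg_unique _ (cvg_cst _)) => /(_ (@norm_hausdorff _ _)) ->.
by apply/funext => N; have [_ ->] := At _ (pol_mul hp (pol_partial N)).
Qed.

Lemma Azero_nat k : Azero (k%:R / 8).
Proof.
elim: k => [|k IH]; first by rewrite mul0r; exact: Azero0.
by rewrite -natr1 mulrDl mul1r; apply: AzeroS => //; rewrite divr_ge0.
Qed.

Definition box (r : R) : set 'rV[R]_n := [set x | forall i, `|x ord0 i - y ord0 i| <= r].

Lemma box_indic r x : (\1_(box r) x : R) = \prod_i \1_(`[y ord0 i - r, y ord0 i + r]%classic) (x ord0 i).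
Proof.
have e i : (`|x ord0 i - y ord0 i| <= r) = (x ord0 i \in `[y ord0 i - r, y ord0 i + r]%R).
  by rewrite in_itv/= ler_norml; congr (_ && _); apply/idP/idP; lra.
case: (pselect (box r x)) => hx.
  by rewrite indicE mem_set// big1// => i _; rewrite indicE mem_set//= -e.
rewrite indicE memNset//; apply/esym/eqP; rewrite prodf_seq_eq0; apply/hasP.
have [i hi] : exists i, ~ (`|x ord0 i - y ord0 i| <= r) by apply/existsNP.
by exists i; [rewrite mem_index_enum|rewrite /= indicE memNset//= -e].
Qed.

Lemma box_measurable r : measurable_fun [set: rVm] (\1_(box r) : rVm -> R).
Proof.
rewrite (_ : \1_(box r) = fun x : rVm => \prod_i \1_(`[y ord0 i - r, y ord0 i + r]%classic) (x ord0 i)); last first.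
  by apply/funext => x; exact: box_indic.
apply: measurable_prod => i _.
apply: (@measurableT_comp _ _ _ rVm (measurableTypeR R) _ (\1_(`[y ord0 i - r, y ord0 i + r]%classic) : R -> R)).
  exact: measurable_indic.
by apply: continuous_measurable_rV; exact: coordn_continuous.
Qed.

Lemma box_int r : 0 < r -> (\int[nun]_x (\1_(box r) x)%:E = ((r + r) ^+ n)%:E)%E.
Proof.
move=> r0; rewrite nuE//; last by apply/measurable_EFinP; exact: box_measurable.
have -> : (fun x : 'rV[R]_n => (\1_(box r) x : R)%:E) =
    (fun x : 'rV[R]_n => (\prod_i \1_(`[y ord0 i - r, y ord0 i + r]%classic) (x ord0 i))%:E).
  by apply/funext => x; rewrite box_indic.
rewrite (@eiterint_prod _ _ n (fun i => \1_(`[y ord0 i - r, y ord0 i + r]%classic)) (fun=> r + r))//.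
- by congr (_%:E); rewrite (eq_bigr (fun=> r + r)) ?prodr_const ?card_ord// => i _; rewrite ltn_ord.
- move=> i; rewrite (@integral_indic _ _ _ lebesgue_measure)// setIT /= lebesgue_measure_itv /= lte_fin.
  rewrite ifT; last by lra.
  by rewrite -EFinB; congr (_%:E); ring.
Qed.

(** If G y were positive, the Gaussian mass near y would be at least a multiple of exp (- t d^2 /
    8), while the rest of the vanishing integral is at most a multiple of exp (- t d^2 / 2); a large
    t contradicts this. The opposite sign is obtained from - G. *)
Lemma G_le0 : G y <= 0.
Proof.
rewrite leNgt; apply/negP => Gy.
pose g x := G x * psi0 x; pose eta := g y / 2.
have gy : 0 < g y by rewrite mulr_gt0// psi0_gt0.
have eta0 : 0 < eta by rewrite divr_gt0.
have cg : continuous g by apply: cM => //; exact: psi_cont.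
have [d d0 hd] : exists2 d : R, 0 < d & forall x, box d x -> eta <= g x.
  have /cvgrPdist_lt /(_ _ eta0) := cg y.
  rewrite -nbhs_ballE => -[d /= d0 hd]; exists (d / 2); first by rewrite divr_gt0.
  move=> x bx; have : ball y d x.
    split=> // i j; rewrite (ord1 i) /ball /= distrC (le_lt_trans (bx j))//.
    by rewrite ltr_pdivrMr// ltr_pMr// ltr1n.
  by move/hd; rewrite /= ltr_norml /eta; lra.
(* On the box of half side r one has |x - y|^2 <= n r^2 <= d^2 / 4, hence wq >= - d^2 / 8. *)
pose r := d / (2 * n.+1%:R).
have r0 : 0 < r by rewrite divr_gt0// mulr_gt0.
have n1 : 0 < n.+1%:R :> R by [].
pose e1 (t : R) := expR (- (t * (d ^+ 2 / 8))); pose e2 (t : R) := expR (- (t * (d ^+ 2 / 2))).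
have key t x : 0 <= t -> eta * e1 t * \1_(box r) x <= G x * (1 * expR (t * wq x) * psi0 x) + e2 t * `|g x|.
  move=> t0; rewrite mul1r (_ : G x * _ = g x * expR (t * wq x)); last by rewrite /g; ring.
  have E0 := expR_ge0 (t * wq x); have e20 : 0 <= e2 t := expR_ge0 _.
  case: (pselect (box r x)) => bx.
    rewrite indicE mem_set// mulr1.
    have bd : box d x.
      move=> i; rewrite (le_trans (bx i))// ler_pdivrMr ?mulr_gt0// ler_peMr ?ltW//.
      have : 1 <= n.+1%:R :> R by rewrite ler1n.
      lra.
    have h := hd x bd.
    have hw : e1 t <= expR (t * wq x).
      rewrite /e1 ler_expR -mulrN ler_wpM2l// /wq lerN2.
      have : sq (x - y) <= n%:R * r ^+ 2.
        rewrite /sq mulr_natl -[n in _ *+ n]card_ord -sumr_const; apply: ler_sum => i _.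
        by rewrite !mxE -(real_normK (num_real _)) lerXn2r ?nnegrE ?(ltW r0)//; exact: bx.
      have : n%:R * r ^+ 2 <= d ^+ 2 / 4.
        have rN : r * n.+1%:R = d / 2 by rewrite /r; field; rewrite gt_eqF.
        have -> : d ^+ 2 / 4 = (r * n.+1%:R) ^+ 2 by rewrite rN; field.
        rewrite [leRHS]exprMn [leLHS]mulrC; apply: ler_wpM2l; first exact: sqr_ge0.
        rewrite -natrX ler_nat.
        exact: leq_trans (leqnSn n) (leq_pmulr _ (ltn0Sn _)).
      lra.
    apply: (@le_trans _ _ (g x * expR (t * wq x))).
      by apply: ler_pM => //; [exact: ltW|exact: expR_ge0].
    by rewrite lerDl mulr_ge0.
  rewrite indicE memNset// mulr0.
  case: (pselect (box d x)) => bd.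
    have gx0 : 0 <= g x := le_trans (ltW eta0) (hd x bd).
    exact: addr_ge0 (mulr_ge0 gx0 E0) (mulr_ge0 e20 (normr_ge0 _)).
  have hw : expR (t * wq x) <= e2 t.
    rewrite /e2 ler_expR -mulrN ler_wpM2l// /wq lerN2 mulrC ler_wpM2l//.
    have [i /negP] := (existsNP _).2 bd; rewrite -ltNge => hi.
    have := coord_sq (x - y) i; apply: le_trans.
    by rewrite !mxE -(real_normK (num_real (x ord0 i - y ord0 i))) lerXn2r ?nnegrE ?(ltW d0)// ltW.
  have := ler_norm (- g x); rewrite normrN => hg.
  have := ler_wpM2r (normr_ge0 (g x)) hw; have := ler_wpM2r E0 hg; lra.
have ig : intg (fun x => `|g x|) by apply: integrable_norm; exact: hcoef_int.
pose V := (r + r) ^+ n; pose N1 := Inu (fun x => `|g x|).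
have V0 : 0 < V by rewrite exprn_gt0// addr_gt0.
have main k : eta * e1 (k%:R / 8) * V <= e2 (k%:R / 8) * N1.
  have t0 : 0 <= k%:R / 8 :> R by rewrite divr_ge0.
  have [i1 z1] := Azero_nat k (pol_cst 1).
  have ib : intg (\1_(box r)).
    apply/integrableP; split; first by apply/measurable_EFinP; exact: box_measurable.
    under eq_integral do rewrite abse_EFin ger0_norm//.
    by rewrite box_int// ltry.
  have := @le_Rintegral _ _ _ nun setT _ _ measurableT (intgZ (eta * e1 (k%:R / 8)) ib) (intgD i1 (intgZ (e2 (k%:R / 8)) ig)) (fun x _ => key _ x t0).
  rewrite (InuZ _ ib) (InuD i1 (intgZ _ ig)) z1 add0r (InuZ _ ig) -/N1.
  by rewrite {1}/Rintegral box_int.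
have N10 : 0 <= N1 by apply: Rintegral_ge0.
(* At t = k / 8 the two exponents differ by (k / 8) (d^2 / 2 - d^2 / 8) = 3 k d^2 / 64. *)
pose k := (Num.trunc (N1 / (eta * V) * (64 / (3 * d ^+ 2)))).+1.
have d2 : 0 < d ^+ 2 by rewrite exprn_gt0.
have := main k; rewrite /e2 (_ : - (k%:R / 8 * (d ^+ 2 / 2)) = - (k%:R / 8 * (d ^+ 2 / 8)) - k%:R * (3 * d ^+ 2 / 64)); last by field.
rewrite expRD -/(e1 _) [eta * _]mulrC -[leLHS]mulrA -[leRHS]mulrA ler_pM2l ?expR_gt0//.
rewrite expRN leNgt => /negP; apply.
rewrite ltr_pdivrMl ?expR_gt0// -ltr_pdivrMr; last exact: mulr_gt0 eta0 V0.
apply: (lt_le_trans _ (expR_ge1Dx _)).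
have : N1 / (eta * V) * (64 / (3 * d ^+ 2)) < k%:R by exact: truncnS_gt.
rewrite -ltr_pdivlMr ?divr_gt0 ?mulr_gt0// invf_div => h.
by rewrite (lt_le_trans h)// lerDr.
Qed.

End Completeness.

Lemma hermite_complete (R : realType) (n : nat) (G : 'rV[R]_n -> R) :
  continuous G -> L2 G -> (forall a, hcoef G a = 0) -> forall y, G y = 0.
Proof.
move=> cG LG oG y; apply/eqP; rewrite eq_le (G_le0 y cG LG oG) /= -oppr_le0 -mulN1r.
apply: (@G_le0 R n (fun x => -1 * G x) y).
- exact: cZ.
- by move: LG; apply: eq_integrable => // x _; rewrite mulN1r sqrrN.
- move=> a; have := @InuZ R n (-1) _ (hcoef_int a cG LG); rewrite -/(hcoef G a) oG mulr0 => e.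
  by rewrite -[RHS]e; apply: eq_Rintegral => x _; rewrite mulrA.
Qed.

(** * Hermite expansions of eigenfunctions *)

Section CountableSums.
Context {R : realType}.
Notation cnt := (@counting nat R).
Notation cint f := (cnt.-integrable [set: nat] (fun m : nat => (f m)%:E)).

(* Integrals for the counting measure, so that dominated convergence and differentiation under the sum are available. *)
Definition csum (f : nat -> R) : R := Rintegral cnt [set: nat] f.

Lemma cint_dom (f M : nat -> R) : (forall m, `|f m| <= M m) -> cint M -> cint f.
Proof.
move=> fM; apply: le_integrable => // m _.
by rewrite !abse_EFin lee_fin (le_trans (fM m))// ler_norm.
Qed.

Lemma cint_bounded (M : nat -> R) B : (forall m, 0 <= M m) ->
  (forall N, \sum_(0 <= m < N) M m <= B) -> cint M.
Proof.
move=> M0 MB; apply/integrableP; split => //.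
under eq_integral do rewrite abse_EFin ger0_norm//.
rewrite ge0_integral_count; last by move=> k; rewrite lee_fin.
apply: (@le_lt_trans _ _ B%:E); last exact: ltry.
apply: lime_le; first by apply: is_cvg_nneseries => k _ _; rewrite lee_fin.
by near=> N; rewrite sumEFin lee_fin.
Unshelve. all: by end_near. Qed.

Lemma csumD f g : cint f -> cint g -> csum (fun m => f m + g m) = csum f + csum g.
Proof. by move=> hf hg; apply: RintegralD. Qed.

Lemma csumB f g : cint f -> cint g -> csum (fun m => f m - g m) = csum f - csum g.
Proof. by move=> hf hg; apply: RintegralB. Qed.

Lemma csumZ c f : cint f -> csum (fun m => c * f m) = c * csum f.
Proof. by move=> hf; apply: RintegralZl. Qed.

Lemma cintZ c (f : nat -> R) : cint f -> cint (fun m => c * f m).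
Proof. by move=> h; under eq_fun do rewrite EFinM; apply: integrableZl. Qed.

Lemma cintB (f g : nat -> R) : cint f -> cint g -> cint (fun m => f m - g m).
Proof. by move=> hf hg; under eq_fun do rewrite EFinB; apply: integrableB. Qed.

Lemma csum_ge0 f : (forall m, 0 <= f m) -> 0 <= csum f.
Proof. by move=> f0; apply: Rintegral_ge0. Qed.

Lemma csum_norm_le f M : (forall m, `|f m| <= M m) -> cint M -> `|csum f| <= csum M.
Proof.
move=> fM iM; have if_ := cint_dom fM iM.
apply: (@le_trans _ _ (csum (fun m => `|f m|))); first exact: le_normr_Rintegral.
by apply: le_Rintegral => //; exact: (integrable_norm if_).
Qed.

Definition point (k : nat) (c : R) : nat -> R := fun m => if m == k then c else 0.

Lemma csum_point k c : cint (point k c) /\ csum (point k c) = c.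
Proof.
have E : point k c = fun m => c * \1_[set k] m.
  apply/funext => m; rewrite /point indicE; case: eqP => mk; [rewrite mem_set ?mulr1//|rewrite memNset ?mulr0//].
have c1 : cnt [set k] = 1%E by rewrite /counting asboolT// fset_set1 finmap.cardfs1.
have i1 : cint (\1_[set k]).
  apply/integrableP; split => //; under eq_integral do rewrite abse_EFin ger0_norm//.
  by rewrite integral_indic// setIT [X in (X < _)%E]c1 ltry.
rewrite E; split; first exact: cintZ.
by rewrite csumZ// /csum /Rintegral integral_indic// setIT [X in fine X]c1 mulr1.
Qed.

Lemma csum_dct (F : nat -> nat -> R) f g : (forall m, F N m @[N --> \oo] --> f m) ->
  cint g -> (forall N m, `|F N m| <= g m) -> csum (F N) @[N --> \oo] --> csum f.
Proof.
move=> Ff ig Fg.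
have [||||| if_ _ h] := @dominated_convergence _ _ _ cnt setT measurableT
  (fun N x => (F N x)%:E) (fun x => (f x)%:E) (fun x => (g x)%:E).
- by [].
- by [].
- by apply: aeW => x _; apply: cvg_EFin; [near=> N|exact: Ff].
- exact: ig.
- by apply: aeW => x N _; rewrite lee_fin.
by apply: fine_cvg; rewrite fineK//; exact: integrable_fin_num.
Unshelve. all: by end_near. Qed.

Definition trunc N (f : nat -> R) : nat -> R := fun m => if (m < N)%N then f m else 0.

Lemma csum_trunc N f : cint (trunc N f) /\ csum (trunc N f) = \sum_(0 <= m < N) f m.
Proof.
elim: N => [|N [IH1 IH2]].
  have E : trunc 0 f = point 0 0 by apply/funext => m; rewrite /trunc /point ltn0; case: eqP.
  by rewrite E big_nil; exact: csum_point.
have E : trunc N.+1 f = fun m => trunc N f m + point N (f N) m.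
  apply/funext => m; rewrite /trunc /point ltnS leq_eqVlt.
  by case: eqP => [->|_] /=; [rewrite ltnn add0r|rewrite addr0].
have [i1 e1] := csum_point N (f N).
rewrite E big_nat_recr//=; split; last by rewrite csumD// IH2 e1.
by under eq_fun do rewrite EFinD; apply: integrableD.
Qed.

Lemma csum_partial f : cint f -> (\sum_(0 <= m < N) f m) @[N --> \oo] --> csum f.
Proof.
move=> if_; have -> : (fun N => \sum_(0 <= m < N) f m) = fun N => csum (trunc N f).
  by apply/funext => N; have [_ ->] := csum_trunc N f.
apply: (@csum_dct _ _ (fun m => `|f m|)).
- move=> m; apply: (@cvg_near_cst _ _ _ _ _) => //.
  by near=> N; rewrite /trunc ifT//; near: N; exact: nbhs_infty_gt.
- exact: (integrable_norm if_).
- by move=> N m; rewrite /trunc; case: ifP => // _; rewrite normr0.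
Unshelve. all: by end_near. Qed.

Lemma csum_tail f M N : (forall m, `|f m| <= M m) -> cint M ->
  `|csum f - \sum_(0 <= m < N) f m| <= csum M - \sum_(0 <= m < N) M m.
Proof.
move=> fM iM; have if_ := cint_dom fM iM.
have [i1 <-] := csum_trunc N f; have [i2 <-] := csum_trunc N M.
rewrite -!csumB//; apply: csum_norm_le; last exact: cintB.
by move=> m; rewrite /trunc; case: ifP => _; rewrite ?subrr ?normr0// !subr0.
Qed.

Lemma csum_cont (X : topologicalType) (f : nat -> X -> R) M :
  (forall m, continuous (f m)) -> (forall m x, `|f m x| <= M m) -> cint M ->
  continuous (fun x => csum (f^~ x)).
Proof.
move=> cf fM iM x; apply/cvgrPdist_lt => e e0.
have e3 : 0 < e / 3 by rewrite divr_gt0.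
have /cvgrPdist_lt /(_ _ e3) [N _ hN] := csum_partial iM.
have tail z : `|csum (f^~ z) - \sum_(0 <= m < N) f m z| < e / 3.
  apply: (le_lt_trans (csum_tail N (fun m => fM m z) iM)).
  by apply: le_lt_trans (hN N (leqnn N)); rewrite ler_norm.
have cS : continuous (fun z => \sum_(0 <= m < N) f m z) by exact: continuous_sumr.
have /cvgrPdist_lt /(_ _ e3) h := cS x.
near=> z; have hz : `|\sum_(0 <= m < N) f m x - \sum_(0 <= m < N) f m z| < e / 3 by near: z.
have := tail x; have := tail z; move: hz; rewrite !ltr_norml; lra.
Unshelve. all: by end_near. Qed.

Lemma csum_derive (f df : nat -> R -> R) M (t : R) : (forall m s, is_derive s (1 : R) (f m) (df m s)) ->
  (forall s, cint (f^~ s)) -> (forall m s, `|s - t| < 1 -> `|df m s| <= M m) -> cint M ->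
  is_derive t (1 : R) (fun s => csum (f^~ s)) (csum (df^~ t)).
Proof.
move=> hf if_ hM iM.
have It : `](t - 1), (t + 1)[%classic t by rewrite /= in_itv/=; apply/andP; split; lra.
have iI (s : R) : `](t - 1), (t + 1)[%classic s -> `|s - t| < 1.
  by rewrite /= in_itv/= => /andP[? ?]; rewrite ltr_norml; apply/andP; split; lra.
have M0 m : 0 <= M m by apply: le_trans (hM m t _); rewrite ?normr_ge0// subrr normr0.
have H1 : forall x, `](t - 1), (t + 1)[%classic x -> cnt.-integrable [set: nat] (EFin \o (fun m => f m x)).
  by move=> s _; exact: if_.
have H2 : forall (x : R) (m : nat), `](t - 1), (t + 1)[%classic x -> [set: nat] m -> derivable (f m) x 1.
  by move=> s m _ _; have [] := hf m s.
have H3 : forall (x : R) (m : nat), `](t - 1), (t + 1)[%classic x -> [set: nat] m ->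
    `|partial1of2 (fun s m => f m s) x m| <= M m.
  by move=> s m /iI hs _; rewrite partial1of2E (@derive_val _ _ _ _ _ _ _ (hf m s)) hM.
have := @derivable_under_integral R _ nat cnt (fun s m => f m s) setT measurableT t _ _ It H1 H2 M M0 iM H3.
have := @differentiation_under_integral R _ nat cnt (fun s m => f m s) setT measurableT t _ _ It H1 H2 M M0 iM H3.
rewrite derive1E => e d; split=> //; rewrite [LHS]e.
by apply: eq_Rintegral => m _; rewrite partial1of2E (@derive_val _ _ _ _ _ _ _ (hf m t)).
Qed.

End CountableSums.

(** * Sums over multi-indices *)

Section IndexSums.
Context {R : realType} {n : nat}.
Notation cnt := (@counting nat R).
Notation cint f := (cnt.-integrable [set: nat] (fun m : nat => (f m)%:E)).
Notation idx := (@idx n).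
Notation rVm := (@rVm R n).
Notation nun := (@nu R n).
Notation Inu g := (Rintegral (@nu R n) [set: rVm] (g : rVm -> R)).
Notation intg g := (nun.-integrable [set: rVm] (fun x : rVm => (g x)%:E)).

(** Transports a family on N^n to the naturals through the canonical coding; numbers that code no
    multi-index contribute 0. *)
Definition enum_idx (f : idx -> R) : nat -> R := fun m => if pickle_inv m is Some a then f a else 0.

Lemma geom_le (r : R) N : 0 <= r -> r < 1 -> \sum_(k < N) r ^+ k <= (1 - r)^-1.
Proof.
move=> r0 r1; have h : 0 < 1 - r by rewrite subr_gt0.
rewrite -[leRHS]mul1r ler_pdivlMr// mulrC.
have -> : (1 - r) * \sum_(k < N) r ^+ k = 1 - r ^+ N.
  by rewrite -[RHS]opprB subrX1 -mulNr opprB.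
by rewrite lerBlDr lerDl exprn_ge0.
Qed.

Lemma Sbox_geom (r : R) N : 0 <= r -> r < 1 -> Sbox N (fun a : idx => r ^+ wt a) <= (1 - r)^-1 ^+ n.
Proof.
move=> r0 r1; rewrite /Sbox.
rewrite (_ : \sum_(b : _) _ = \prod_(i < n) \sum_(k < N) r ^+ k); last first.
  rewrite bigA_distr_bigA /=; apply: eq_bigr => b _; rewrite /wt -prodrXr.
  by apply: eq_bigr => i _; rewrite ffunE.
have -> : (1 - r)^-1 ^+ n = \prod_(i < n) (1 - r)^-1 by rewrite prodr_const card_ord.
apply: ler_prod => i _; rewrite geom_le// andbT; apply: sumr_ge0 => k _; exact: exprn_ge0.
Qed.

Lemma sum_idx_le (s : seq idx) (r : R) : uniq s -> 0 <= r -> r < 1 ->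
  \sum_(a <- s) r ^+ wt a <= (1 - r)^-1 ^+ n.
Proof.
move=> us r0 r1; pose N := (\sum_(a <- s) wt a).+1.
have sN a i : a \in s -> (a i < N)%N.
  move=> as_; rewrite ltnS (leq_trans (coord_le_wt a i))// (bigD1_seq a)//= leq_addr//.
apply: le_trans (Sbox_geom N r0 r1); rewrite /Sbox.
rewrite -(big_map (@ofbox n N) predT (fun a : idx => r ^+ wt a)).
set B := [seq ofbox b | b <- _].
have uB : uniq B by rewrite map_inj_uniq ?index_enum_uniq//; exact: ofbox_inj.
have sB : {subset s <= B}.
  move=> a as_; have [b <-] := ofbox_onto (fun i => sN a i as_).
  by apply: map_f; rewrite mem_index_enum.
rewrite [leRHS](bigID (mem s)) /= -[leLHS]addr0 lerD ?sumr_ge0// => [|a _]; last exact: exprn_ge0.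
rewrite -[leRHS]big_filter le_eqVlt; apply/orP; left; apply/eqP; apply: perm_big.
apply: uniq_perm => //; first exact: filter_uniq.
by move=> a; rewrite mem_filter; case: (boolP (a \in s)) => //= /sB ->.
Qed.

Lemma cint_idx (f : idx -> R) (K r : R) : 0 <= K -> 0 <= r -> r < 1 ->
  (forall a, `|f a| <= K * r ^+ wt a) -> cint (enum_idx f) /\ `|csum (enum_idx f)| <= K * (1 - r)^-1 ^+ n.
Proof.
move=> K0 r0 r1 hf; pose M := enum_idx (fun a : idx => r ^+ wt a).
have M0 m : 0 <= M m by rewrite /M /enum_idx; case: pickle_inv => // a; exact: exprn_ge0.
have MB N : \sum_(0 <= m < N) M m <= (1 - r)^-1 ^+ n.
  rewrite (_ : \sum_(0 <= m < N) M m = \sum_(a <- pmap (@pickle_inv idx) (iota 0 N)) r ^+ wt a).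
    apply: sum_idx_le => //; apply: (pmap_uniq (@pickle_invK idx)); exact: iota_uniq.
  rewrite /index_iota subn0; elim: (iota 0 N) => [|m s IH]; first by rewrite !big_nil.
  by rewrite big_cons /= /M /enum_idx; case: pickle_inv => [a|] /=; rewrite ?big_cons ?add0r -IH.
have iM := cint_bounded M0 MB.
have dom m : `|enum_idx f m| <= K * M m.
  by rewrite /enum_idx /M /enum_idx; case: pickle_inv => [a|]; rewrite ?normr0 ?mulr0.
split; first exact: cint_dom dom (cintZ K iM).
rewrite (le_trans (csum_norm_le dom (cintZ K iM)))// csumZ// ler_wpM2l//.
have := csum_partial iM => cv; apply: (cvgr_to_le cv).
by near=> N; exact: MB.
Unshelve. all: by end_near. Qed.

Lemma enum_idxZ (c : R) (f : idx -> R) m : enum_idx (fun a => c * f a) m = c * enum_idx f m.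
Proof. by rewrite /enum_idx; case: pickle_inv => //; rewrite mulr0. Qed.

Lemma csum_idx_delta (f : idx -> R) b : (forall a, a != b -> f a = 0) -> csum (enum_idx f) = f b.
Proof.
move=> hf; rewrite (_ : enum_idx f = point (pickle b) (f b)); first by have [] := csum_point (pickle b) (f b).
apply/funext => m; rewrite /enum_idx /point.
have := @pickle_invK idx m; case E : (pickle_inv m) => [a|] /=.
  by move=> <-; case: eqP => [/(pcan_inj (@pickleK _))->//|ab]; rewrite hf//; apply/eqP => e; case: ab; rewrite e.
by move=> _; case: eqP => // e; move: E; rewrite e pickleK_inv.
Qed.

Lemma Inu_csum (f : nat -> 'rV[R]_n -> R) (M : nat -> R) :
  (forall m, continuous (f m)) -> (forall m x, `|f m x| <= M m * Wt x) -> cint M ->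
  continuous (fun x => csum (f^~ x)) ->
  cint (fun m => Inu (f m)) /\ Inu (fun x => csum (f^~ x)) = csum (fun m => Inu (f m)).
Proof.
move=> cf fM iM cF.
have Wf m : Wdom (f m) by exists (M m) => x; exact: fM.
have intf m : intg (f m) by apply: integrable_Wdom => //; exact: continuous_measurable_rV.
have M0 m : 0 <= M m.
  by have := le_trans (normr_ge0 _) (fM m 0); rewrite pmulr_lge0// Wt_gt0.
have IfM m : `|Inu (f m)| <= Inu Wt * M m.
  apply: (@le_trans _ _ (Inu (fun x => `|f m x|))); first exact: (le_normr_Rintegral measurableT (intf m)).
  rewrite mulrC -(InuZ _ (@integrable_Wt R n)); apply: le_Rintegral => //.
  - exact: integrable_norm (intf m).
  - exact: intgZ (@integrable_Wt R n).
have iI : cint (fun m => Inu (f m)) by exact: cint_dom IfM (cintZ _ iM).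
split=> //.
have ifx x : cint (f^~ x).
  by apply: (@cint_dom _ _ (fun m => Wt x * M m)); [move=> m; rewrite mulrC|exact: cintZ].
have M0' : forall m, 0 <= M m by [].
have SE (x : 'rV[R]_n) N : \sum_(0 <= m < N) f m x = \sum_(m <- index_iota 0 N) 1 * f m x.
  by apply: eq_bigr => m _; rewrite mul1r.
have [] := @nu_dct R n (fun N x => \sum_(0 <= m < N) f m x) (fun x => csum (f^~ x))
  (fun x => csum M * Wt x).
- by move=> N; apply: continuous_measurable_rV; apply: continuous_sumr.
- exact: continuous_measurable_rV.
- by move=> x; exact: csum_partial.
- exact: intgZ (@integrable_Wt R n).
- move=> N x; have [_ <-] := csum_trunc N (f^~ x).
  have -> : csum M * Wt x = csum (fun m => Wt x * M m) by rewrite csumZ// mulrC.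
  apply: csum_norm_le; last exact: cintZ.
  move=> m; rewrite /trunc mulrC; case: ifP => // _; rewrite normr0 mulr_ge0// ltW// Wt_gt0//.
move=> _ cv; apply: (cvg_unique _ cv) => //.
have -> : (fun N => Inu (fun x => \sum_(0 <= m < N) f m x)) = (fun N => \sum_(0 <= m < N) Inu (f m)).
  apply/funext => N; have [_] := @Inu_sum R n _ (index_iota 0 N) (fun=> 1) f intf.
  under [in X in _ = X]eq_bigr do rewrite mul1r.
  by move=> <-; apply: eq_Rintegral => x _; rewrite SE.
exact: csum_partial.
Qed.

End IndexSums.

(** * Smoothness from derivatives along a basis *)

Section BasisDerivatives.
Context {R : realType} {X : normedModType R}.

(** The increment along v + c e is the increment along v followed by one along e. The second is
    handled by the mean value theorem on the line in direction e and by continuity of [dG], so no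
    joint differentiability is assumed. *)
Lemma is_derive_add (G dG : X -> R) (x v e : X) (c d : R) : is_derive x v G d ->
  (forall y, is_derive y e G (dG y)) -> continuous dG ->
  is_derive x (v + c *: e) G (d + c * dG x).
Proof.
move=> hv he cd; apply/is_derive_line.
have h1 : is_derive (0 : R) (1 : R) (fun t => G (x + t *: v)) d by apply/is_derive_line.
pose Q t := G (x + t *: (v + c *: e)) - G (x + t *: v).
suff h2 : is_derive (0 : R) (1 : R) Q (c * dG x).
  rewrite (_ : (fun t => _) = fun t => G (x + t *: v) + Q t); first exact: is_deriveD h1 h2.
  by apply/funext => t; rewrite /Q [RHS]addrC subrK.
have hline (y : X) : hasD (fun s : R => G (y + s *: e)) (fun s => dG (y + s *: e)).
  move=> s; apply/is_derive_line.
  rewrite (_ : (fun t => _) = fun t : R => G ((y + s *: e) + t *: e)); first by apply/is_derive_line.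
  by apply/funext => t; rewrite -addrA -scalerDl /GRing.scale /= mulr1.
suff H : h^-1 *: ((Q \o shift 0) (h *: 1) - Q 0) @[h --> 0^'] --> c * dG x.
  by split; [exact: cvgP H|exact: cvg_lim H].
apply/cvgrPdist_le => eps eps0.
have c1 : 0 < `|c| + 1 by rewrite ltr_wpDl.
have /cvgrPdist_le /(_ _ (divr_gt0 eps0 c1)) := cd x.
rewrite -nbhs_ballE => -[del /= del0 hdel].
pose K := `|v| + `|c| * `|e| + 1.
have K0 : 0 < K by rewrite ltr_wpDl// addr_ge0// mulr_ge0.
near=> h.
have h0 : h != 0 by near: h; exact: nbhs_dnbhs_neq.
have hK : `|h| * K < del.
  rewrite -ltr_pdivlMr//; near: h; apply: dnbhs0_lt; exact: divr_gt0.
have eQ : (Q \o shift 0) (h *: 1) - Q 0 = G (x + h *: v + (h * c) *: e) - G (x + h *: v + 0 *: e).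
  rewrite /Q /= !addr0 !scale0r !addr0 subrr subr0 [h *: 1]mulr1.
  by rewrite scalerDr scalerA addrA.
rewrite eQ.
have bd (s : R) : `|s| <= `|h * c| -> `|dG x - dG (x + h *: v + s *: e)| <= eps / (`|c| + 1).
  move=> hs; apply: hdel; rewrite -ball_normE /ball_ /= opprD addrA.
  rewrite opprD addrA subrr add0r (le_lt_trans _ hK)// -opprD normrN.
  apply: (le_trans (ler_normD _ _)); rewrite !normrZ.
  have : `|s| * `|e| <= `|h| * (`|c| * `|e|) by rewrite mulrA -normrM ler_wpM2r.
  by rewrite /K; have := normr_ge0 h; nra.
have [xi hxi ->] : exists2 xi, `|xi| <= `|h * c| &
   G (x + h *: v + (h * c) *: e) - G (x + h *: v + 0 *: e) = dG (x + h *: v + xi *: e) * (h * c).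
  have [hc0|hc0] := leP 0 (h * c).
    have [xi] := hasD_mvt (hline (x + h *: v)) hc0.
    move=> /andP[x0 xc] ->; exists xi; last by rewrite subr0.
    by rewrite !ger0_norm.
  have [xi] := hasD_mvt (hline (x + h *: v)) (ltW hc0).
  move=> /andP[x0 xc] E; exists xi.
    by rewrite !ler0_norm ?lerN2// ltW.
  by rewrite -[LHS]opprB E; ring.
rewrite [_ *: _](_ : _ = c * dG (x + h *: v + xi *: e)); last first.
  by set d' := dG _; rewrite -[LHS]/(h^-1 * (d' * (h * c))); field.
rewrite -mulrBr normrM (le_trans (ler_wpM2l _ (bd _ hxi)))//.
rewrite mulrCA ger_pMr// ler_pdivrMr// mul1r lerDl//.
Unshelve. all: by end_near. Qed.

Lemma is_derive_sum (I : Type) (s : seq I) (e : I -> X) (c : I -> R) (G : X -> R) (dG : I -> X -> R) x :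
  (forall i y, is_derive y (e i) G (dG i y)) -> (forall i, continuous (dG i)) ->
  is_derive x (\sum_(i <- s) c i *: e i) G (\sum_(i <- s) c i * dG i x).
Proof.
move=> he cd; elim: s => [|i s IH].
  rewrite !big_nil; apply/is_derive_line.
  rewrite (_ : (fun t => _) = cst (G x)); first exact: is_derive_cst.
  by apply/funext => t; rewrite scaler0 addr0.
by rewrite !big_cons addrC [X in is_derive _ _ _ X]addrC; apply: is_derive_add.
Qed.

(** [rsmooth] quantifies over all directions, while series are naturally differentiated along
    coordinates; linear combinations supply the other directions. *)
Lemma rsmooth_basis (I : finType) (e : I -> X) (P : (X -> R) -> Prop) :
  (forall v, exists c : I -> R, v = \sum_i c i *: e i) ->
  P (fun=> 0) -> (forall (c : R) f g, P f -> P g -> P (fun x => c * f x + g x)) ->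
  (forall f, P f -> continuous f) ->
  (forall f i, P f -> exists2 g, P g & forall x, is_derive x (e i) f (g x)) ->
  forall f, P f -> rsmooth f.
Proof.
move=> sp P0 PD Pc Pd; apply: rsmooth_coind => // f v Pf; have [c ->] := sp v.
have [g hg] := choice (fun i => let: ex_intro2 g a b := Pd f i Pf in ex_intro _ g (conj a b)).
exists (fun x => \sum_i c i * g i x).
  elim: (index_enum I) => [|i s IH].
    by rewrite (_ : (fun x => _) = fun=> 0)//; apply/funext => x; rewrite big_nil.
  rewrite (_ : (fun x => _) = fun x => c i * g i x + \sum_(i <- s) c i * g i x).
    by apply: PD => //; have [] := hg i.
  by apply/funext => x; rewrite big_cons.
by move=> x; apply: is_derive_sum => i; [have [] := hg i|apply: Pc; have [] := hg i].
Qed.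

End BasisDerivatives.

(** * Uniform bounds for words applied to Hermite functions *)

Section PsiSup.
Context {R : realType} {n : nat}.
Notation idx := (@idx n).
Notation ei := (@ei R n).
Notation psi := (@psi R n).
Notation oword := (@oword n).
Notation rVm := (@rVm R n).

Lemma row_basis (v : 'rV[R]_n) : exists c : 'I_n -> R, v = \sum_i c i *: ei i.
Proof. by exists (fun i => v ord0 i); rewrite {1}[v]row_sum_delta. Qed.

Lemma psi_smooth a : rsmooth (psi a).
Proof.
apply: (@rsmooth_basis R _ _ ei (fun f => exists L : seq (R * idx), f = fun x => \sum_(p <- L) p.1 * psi p.2 x)).
- exact: row_basis.
- by exists [::]; apply/funext => x; rewrite big_nil.
- move=> c _ _ [L1 ->] [L2 ->]; exists ([seq (c * p.1, p.2) | p <- L1] ++ L2); apply/funext => x.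
  by rewrite big_cat big_map mulr_sumr /=; congr (_ + _); apply: eq_bigr => p _; rewrite mulrA.
- by move=> _ [L ->]; apply: continuous_sumr => p; apply: cZ; exact: psi_cont.
- move=> _ i [L ->].
  exists (fun x => \sum_(p <- flatten [seq [:: (p.1 * Num.sqrt (((p.2 : idx) i)%:R / 2), dn p.2 i);
     (- (p.1 * Num.sqrt ((p.2 i).+1%:R / 2)), up p.2 i)] | p : R * idx <- L]) p.1 * psi p.2 x).
    by eexists; reflexivity.
  move=> x; elim: L => [|p L IH].
    rewrite big_nil (_ : (fun x => _) = cst 0); first exact: is_derive_cst.
    by apply/funext => y; rewrite big_nil.
  rewrite (_ : (fun x => _) = fun x => p.1 * psi p.2 x + \sum_(p <- L) p.1 * psi p.2 x); last first.
    by apply/funext => y; rewrite big_cons.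
  apply: (is_derive_eq (is_deriveD (is_deriveZ p.1 (psi_derive p.2 i x)) IH)).
  rewrite /= !big_cons addrA; congr (_ + _); rewrite /dpsi /GRing.scale /=; ring.
by exists [:: (1, a)]; apply/funext => x; rewrite big_seq1 mul1r.
Qed.

Lemma opw_rcons (w : oword) l (F : 'rV[R]_n -> R) : opw (rcons w l) F = opw w (op1 l F).
Proof. by rewrite /opw -cats1 foldr_cat. Qed.

Lemma opw_lin2 (w : oword) (c d : R) (f g : 'rV[R]_n -> R) x : rsmooth f -> rsmooth g ->
  opw w (fun x => c * f x + d * g x) x = c * opw w f x + d * opw w g x.
Proof.
move=> sf sg; elim: w x => [//|[[] i] w IH] x; rewrite /opw /= -!/(opw w _) /op1 /=.
  rewrite (_ : opw w _ = fun x => c * opw w f x + d * opw w g x); last exact/funext.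
  have hf := rsmooth_is_derive x (ei i) (opw_smooth w sf).
  have hg := rsmooth_is_derive x (ei i) (opw_smooth w sg).
  by have [_ ->] := is_deriveD (is_deriveZ c hf) (is_deriveZ d hg).
by rewrite IH; ring.
Qed.

Lemma op1_psi (l : bool * 'I_n) a x : op1 l (psi a) x =
  (-1) ^+ l.1 * Num.sqrt ((a l.2).+1%:R / 2) * psi (up a l.2) x + Num.sqrt ((a l.2)%:R / 2) * psi (dn a l.2) x.
Proof.
case: l => [[] i] /=; rewrite /op1 /=.
  by have [_ ->] := psi_derive a i x; rewrite /dpsi expr1; ring.
by rewrite psi_x expr0 mul1r.
Qed.

(** A letter costs at most sqrt 2 sqrt (k + 1) and raises the level by at most one, whence sqrt ((k
    + N)! / k!) after N letters; the power of 6 (k + N + 1) bounds the Hermite functions that are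
    reached. *)
Definition tbound (N k : nat) : R :=
  psic (R := R) (n := n) * (6 * (k + N).+1%:R) ^+ n * Num.sqrt 2 ^+ N * Num.sqrt ((k + N)`!%:R / k`!%:R).

Lemma tbound_ge0 N k : 0 <= tbound N k.
Proof. by rewrite !mulr_ge0 ?sqrtr_ge0 ?exprn_ge0 ?mulr_ge0 ?sqrtr_ge0// ltW// psic_gt0. Qed.

Lemma tboundS N k : tbound N.+1 k = Num.sqrt 2 * Num.sqrt k.+1%:R * tbound N k.+1.
Proof.
rewrite /tbound addnS addSn exprS.
suff -> : Num.sqrt ((k + N).+1`!%:R / k`!%:R) =
  Num.sqrt k.+1%:R * Num.sqrt ((k + N).+1`!%:R / k.+1`!%:R) :> R.
  by set A := Num.sqrt (_ / _); set B := Num.sqrt k.+1%:R; ring.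
rewrite -sqrtrM//; congr Num.sqrt; rewrite [k.+1`!]factS natrM.
have : (k`!)%:R != 0 :> R by rewrite pnatr_eq0 -lt0n fact_gt0.
have : k.+1%:R != 0 :> R by rewrite pnatr_eq0.
by move=> h1 h2; field; rewrite h2 [1 + _]addrC -[X in X + 1]/(k%:R) natr1 h1.
Qed.

Lemma tbound_mono N k l : (k <= l)%N -> tbound N k <= tbound N l.
Proof.
move=> kl; elim: N k l kl => [|N IH] k l kl.
  rewrite /tbound !addn0 !expr0 !mulr1 !divff ?pnatr_eq0 -?lt0n ?fact_gt0// sqrtr1 !mulr1.
  rewrite ler_wpM2l ?(ltW psic_gt0)// lerXn2r ?nnegrE ?mulr_ge0// ler_wpM2l// ler_nat//.
rewrite !tboundS ler_pM ?tbound_ge0 ?mulr_ge0 ?sqrtr_ge0 ?IH//.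
by rewrite ler_wpM2l ?sqrtr_ge0// ler_sqrt ?ler0n// ler_nat.
Qed.

Lemma psi_sup0 a x : `|psi a x| <= psic (R := R) (n := n) * (6 * (wt a).+1%:R) ^+ n.
Proof.
rewrite normrM (gtr0_norm psic_gt0) ler_wpM2l ?(ltW psic_gt0)//.
have -> : (6 * (wt a).+1%:R) ^+ n = \prod_(i < n) (6 * (wt a).+1%:R) :> R by rewrite prodr_const card_ord.
rewrite /tens normr_prod; apply: ler_prod => i _; rewrite normr_ge0 /=.
by rewrite (le_trans (hh_le _ _))// ler_wpM2l// ler_nat ltnS coord_le_wt.
Qed.

Lemma psi_sup (w : oword) a x : `|opw w (psi a) x| <= tbound (size w) (wt a).
Proof.
elim/last_ind: w a x => [|w l IH] a x.
  rewrite /tbound addn0 expr0 mulr1 divff ?pnatr_eq0 -?lt0n ?fact_gt0// sqrtr1 mulr1.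
  exact: psi_sup0.
rewrite opw_rcons size_rcons.
rewrite (_ : op1 l (psi a) = fun x => (-1) ^+ l.1 * Num.sqrt ((a l.2).+1%:R / 2) * psi (up a l.2) x
   + Num.sqrt ((a l.2)%:R / 2) * psi (dn a l.2) x); last by apply/funext => y; exact: op1_psi.
rewrite opw_lin2; [|exact: psi_smooth|exact: psi_smooth].
apply: (le_trans (ler_normD _ _)); rewrite !normrM normr_sign mul1r !(ger0_norm (sqrtr_ge0 _)).
have E (A : R) (k : nat) : (k <= (wt a).+1)%N -> 0 <= A -> A <= tbound (size w) (wt a).+1 ->
   Num.sqrt (k%:R / 2) * A <= (Num.sqrt 2 * Num.sqrt (wt a).+1%:R * tbound (size w) (wt a).+1) / 2.
  move=> hk A0 hA.
  have -> : Num.sqrt 2 * Num.sqrt (wt a).+1%:R * tbound (size w) (wt a).+1 / 2 =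
     Num.sqrt ((wt a).+1%:R / 2) * tbound (size w) (wt a).+1.
    by rewrite -sqrtrM// -sqrt_half; field.
  by rewrite ler_pM ?sqrtr_ge0// ler_sqrt ?mulr_ge0 ?invr_ge0// ler_wpM2r ?invr_ge0// ler_nat.
rewrite tboundS [leRHS]splitr lerD//; apply: E => //.
- by rewrite ltnS coord_le_wt.
- by rewrite -(wt_up a l.2) IH.
- by rewrite (leq_trans (coord_le_wt _ _))// leqnSn.
- apply: (le_trans (IH _ _)); apply: tbound_mono; rewrite (leq_trans (wt_dn_le _ _))//.
Qed.

End PsiSup.

(** * Convergence of Hermite series and Parseval's identity *)

Section HermiteExpansion.
Context {R : realType} {n : nat}.
Notation cnt := (@counting nat R).
Notation cint f := (cnt.-integrable [set: nat] (fun m : nat => (f m)%:E)).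
Notation idx := (@idx n).
Notation ei := (@ei R n).
Notation psi := (@psi R n).
Notation oword := (@oword n).
Notation rVm := (@rVm R n).
Notation nun := (@nu R n).
Notation Inu g := (Rintegral (@nu R n) [set: rVm] (g : rVm -> R)).
Notation intg g := (nun.-integrable [set: rVm] (fun x : rVm => (g x)%:E)).

Lemma csum_dirderive (X : normedModType R) (f df : nat -> X -> R) M x v :
  (forall m y, is_derive y v (f m) (df m y)) -> (forall y, cint (f^~ y)) ->
  (forall m y, `|df m y| <= M m) -> cint M -> is_derive x v (fun y => csum (f^~ y)) (csum (df^~ x)).
Proof.
move=> hf if_ hM iM; apply/is_derive_line.
have E : df^~ x = (fun m => df m (x + 0 *: v)) by apply/funext => m; rewrite scale0r addr0.
rewrite E; apply: (@csum_derive R (fun m s => f m (x + s *: v)) (fun m s => df m (x + s *: v)) M 0).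
- move=> m s; apply/is_derive_line.
  rewrite (_ : (fun t => _) = fun t : R => f m ((x + s *: v) + t *: v)); first by apply/is_derive_line.
  by apply/funext => t; rewrite -addrA -scalerDl; congr (f m (_ + (_ + _) *: _)); exact: mulr1.
- by move=> s; exact: if_.
- by move=> m s _; exact: hM.
- exact: iM.
Qed.

Lemma sqrt_leN (k : nat) : Num.sqrt k%:R <= k%:R :> R.
Proof.
case: k => [|k]; first by rewrite sqrtr0.
rewrite -{2}(sqr_sqrtr (ler0n R k.+1)) expr2 ler_peMr ?sqrtr_ge0//.
by rewrite -{1}(sqrtr1 R) ler_sqrt// ler1n.
Qed.

(** A single term of the binomial expansion of (1 + d)^(k + N). *)
Lemma bin_le_exp (d : R) (k N : nat) : 0 < d -> 'C(k + N, N)%:R <= (1 + d) ^+ k * ((1 + d) / d) ^+ N.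
Proof.
move=> d0; rewrite expr_div_n mulrA -exprD ler_pdivlMr ?exprn_gt0// exprDn.
have hN : (N < (k + N).+1)%N by rewrite ltnS leq_addl.
rewrite (bigD1 (Ordinal hN)) //= expr1n mul1r mulr_natl lerDl.
by apply: sumr_ge0 => i _; rewrite expr1n mul1r mulrn_wge0// exprn_ge0// ltW.
Qed.

(** The growth in the level k is made slower than any prescribed exponential, at the cost of a
    larger geometric constant in the number N of letters; only sqrt (N!) remains, which is the
    source of the exponent 1/2. *)
Lemma tbound_le (d : R) : 0 < d -> exists K C : R, [/\ 0 <= K, 1 <= C &
  forall N k, @tbound R n N k <= K * C ^+ N * Num.sqrt N`!%:R * expR (2 * d) ^+ k].
Proof.
move=> d0; pose p := psic (R := R) (n := n).
have p0 : 0 < p := psic_gt0.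
pose C1 := expR d * Num.sqrt 2 * ((1 + d) / d).
have C10 : 0 <= C1 by rewrite !mulr_ge0 ?expR_ge0 ?sqrtr_ge0 ?invr_ge0 ?addr_ge0// ltW.
exists (p * (6 / d) ^+ n * n`!%:R * expR d), (1 + C1); split.
- by rewrite !mulr_ge0 ?expR_ge0 ?exprn_ge0 ?mulr_ge0 ?invr_ge0// ltW.
- by rewrite lerDl.
move=> N k.
have h1 : (k + N).+1%:R ^+ n <= d^-1 ^+ n * (n`!%:R * (expR d * expR d ^+ k * expR d ^+ N)).
  have := exprn_le_fact_expR n (_ : 0 <= d * (k + N).+1%:R).
  rewrite mulr_ge0 ?(ltW d0)// => /(_ isT).
  rewrite exprMn -ler_pdivlMl ?exprn_gt0// => /le_trans; apply.
  rewrite exprVn ler_wpM2l ?invr_ge0 ?exprn_ge0 ?(ltW d0)// ler_wpM2l//.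
  by rewrite -mulrA -exprD -exprS -expRM_natr mulrC.
have h2 : Num.sqrt ((k + N)`!%:R / k`!%:R) <= expR d ^+ k * ((1 + d) / d) ^+ N * Num.sqrt N`!%:R.
  have -> : (k + N)`!%:R / k`!%:R = 'C(k + N, N)%:R * N`!%:R :> R.
    rewrite -(bin_fact (leq_addl k N)) addnK !natrM; field.
    by rewrite pnatr_eq0 -lt0n fact_gt0.
  rewrite sqrtrM// ler_wpM2r ?sqrtr_ge0// (le_trans (sqrt_leN _))//.
  apply: (le_trans (bin_le_exp _ _ d0)); rewrite ler_wpM2r ?exprn_ge0 ?divr_ge0 ?addr_ge0// ?(ltW d0)//.
  by rewrite lerXn2r ?nnegrE ?expR_ge0 ?addr_ge0 ?(ltW d0)// expR_ge1Dx.
have h3 : C1 ^+ N <= (1 + C1) ^+ N by rewrite lerXn2r ?nnegrE ?addr_ge0// lerDr.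
rewrite /tbound -/p exprMn.
apply: (@le_trans _ _ (p * (6 ^+ n * (d^-1 ^+ n * (n`!%:R * (expR d * expR d ^+ k * expR d ^+ N)))) * Num.sqrt 2 ^+ N *
   (expR d ^+ k * ((1 + d) / d) ^+ N * Num.sqrt N`!%:R))).
  rewrite ler_pM ?sqrtr_ge0//.
    by rewrite !mulr_ge0 ?exprn_ge0 ?sqrtr_ge0// ltW.
  by rewrite ler_wpM2r ?exprn_ge0 ?sqrtr_ge0// ler_wpM2l ?(ltW p0)// ler_wpM2l ?exprn_ge0.
have -> : expR (2 * d) ^+ k = expR d ^+ k * expR d ^+ k.
  by rewrite -exprMn -expRD; congr (expR _ ^+ _); ring.
rewrite [X in X <= _](_ : _ = p * (6 / d) ^+ n * n`!%:R * expR d * C1 ^+ N * Num.sqrt N`!%:R * (expR d ^+ k * expR d ^+ k)).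
  rewrite ler_wpM2r ?mulr_ge0 ?exprn_ge0 ?expR_ge0// ler_wpM2r ?sqrtr_ge0// ler_wpM2l//.
  by rewrite !mulr_ge0 ?exprn_ge0 ?expR_ge0 ?mulr_ge0 ?invr_ge0// ltW.
by rewrite /C1 !exprMn; ring.
Qed.

(** Spatial decay from sup bounds on longer words: expanding the product of the 1 + x_i^2 gives 2^n
    words, each with at most 2n additional letters. *)
Lemma Wt_opw (B : nat -> R) (F : 'rV[R]_n -> R) : {homo B : i j / (i <= j)%N >-> i <= j} ->
  (forall w x, `|opw w F x| <= B (size w)) ->
  forall (w : oword) x, `|opw w F x| <= 2 ^+ n * B (size w + 2 * n)%N * Wt x.
Proof.
move=> mB hF w x.
suff H (s : seq 'I_n) (w' : oword) : \prod_(i <- s) oneDsqr (x ord0 i) * `|opw w' F x| <= 2 ^+ size s * B (size w' + 2 * size s)%N.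
  rewrite /Wt prodfV ler_pdivlMr; last by apply: prodr_gt0 => i _; exact: oneDsqr_gt0.
  by have := H (index_enum 'I_n) w; rewrite mulrC -[index_enum _]enumT size_enum_ord.
elim: s w' => [|i s IH] w'; first by rewrite big_nil mul1r expr0 mul1r addn0.
rewrite big_cons /= [X in X * _ * _]/oneDsqr.
have -> : (1 + x ord0 i ^+ 2) * \prod_(j <- s) oneDsqr (x ord0 j) * `|opw w' F x| =
  \prod_(j <- s) oneDsqr (x ord0 j) * `|opw w' F x| +
  \prod_(j <- s) oneDsqr (x ord0 j) * `|opw ((false, i) :: (false, i) :: w') F x|.
  rewrite /opw /= -/(opw w' F) /op1 /= !normrM -[x ord0 i ^+ 2]ger0_norm ?sqr_ge0// normrX; ring.
apply: (le_trans (lerD (IH _) (IH _))); rewrite -mulrDr exprS [2 * 2 ^+ _]mulrC -mulrA.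
rewrite ler_wpM2l ?exprn_ge0// mulr2n mulrDl mul1r lerD// mB//= ?leq_add2l ?leq_mul2l ?leqnSn//.
by rewrite mulnS addnA addn2.
Qed.

Lemma psi_opw_le (d : R) : 0 < d -> exists K C : R, [/\ 0 <= K, 1 <= C &
  forall (w : oword) a x, `|opw w (psi a) x| <=
    K * C ^+ size w * Num.sqrt (size w)`!%:R * expR (2 * d) ^+ wt a * Wt x].
Proof.
move=> d0; have [K [C [K0 C1 H]]] := tbound_le d0.
have C0 : 0 <= C by rewrite (le_trans _ C1).
exists (2 ^+ n * K * (C * 2) ^+ (2 * n) * Num.sqrt (2 * n)`!%:R), (C * 2); split.
- by rewrite !mulr_ge0 ?exprn_ge0 ?sqrtr_ge0// mulr_ge0.
- by lra.
move=> w a x; pose B N := K * C ^+ N * Num.sqrt N`!%:R * expR (2 * d) ^+ wt a.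
have mB : {homo B : i j / (i <= j)%N >-> i <= j}.
  move=> i j ij; rewrite /B ler_wpM2r ?exprn_ge0 ?expR_ge0// ler_pM ?mulr_ge0 ?exprn_ge0 ?sqrtr_ge0//.
    by rewrite ler_wpM2l// ler_weXn2l.
  by rewrite ler_sqrt ?ler0n// ler_nat leq_fact.
apply: (le_trans (Wt_opw mB (fun w x => le_trans (psi_sup w a x) (H _ _)) w x)).
rewrite ler_wpM2r ?(ltW (Wt_gt0 _))// /B; set N := size w; set k := (2 * n)%N.
have hf : Num.sqrt (N + k)`!%:R <= 2 ^+ N * 2 ^+ k * Num.sqrt k`!%:R * Num.sqrt N`!%:R :> R.
  have -> : (N + k)`!%:R = 'C(N + k, k)%:R * k`!%:R * N`!%:R :> R.
    by rewrite -(bin_fact (leq_addl N k)) addnK !natrM mulrA.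
  rewrite !sqrtrM ?mulr_ge0// ler_wpM2r ?sqrtr_ge0// ler_wpM2r ?sqrtr_ge0// (le_trans (sqrt_leN _))//.
  rewrite -exprD -natrX ler_nat; have := Pascal 1 1 (N + k); rewrite (_ : 1 + 1 = 2)%N// => ->.
  have hk : (k < (N + k).+1)%N by rewrite ltnS leq_addl.
  by rewrite (bigD1 (Ordinal hk)) //= !exp1n !muln1 leq_addr.
rewrite [leRHS](_ : _ = 2 ^+ n * (K * C ^+ (N + k) * (2 ^+ N * 2 ^+ k * Num.sqrt k`!%:R * Num.sqrt N`!%:R) * expR (2 * d) ^+ wt a)).
  rewrite ler_wpM2l ?exprn_ge0// ler_wpM2r ?exprn_ge0 ?expR_ge0// ler_wpM2l// mulr_ge0// exprn_ge0//.
by rewrite !exprMn [C ^+ (N + k)]exprD; ring.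
Qed.

Lemma Wt_le1 (x : 'rV[R]_n) : Wt x <= 1.
Proof.
apply: prodr_ile1 => i; rewrite invr_ge0 ltW ?oneDsqr_gt0//=.
by rewrite invf_le1 ?oneDsqr_gt0// oneDsqr_ge1.
Qed.

(** Coefficients of rate exp (- 4d) beat the growth exp (2d) of the Hermite bounds and leave a
    summable exp (- 2d). The series S is continuous and square integrable with the coefficients of
    G, so completeness gives G = S; the series is then differentiated termwise, and pairing it with
    G gives Parseval. *)
Lemma hermite_expansion_le (d : R) : 0 < d -> exists K C : R, [/\ 0 <= K, 1 <= C &
  forall (G : 'rV[R]_n -> R) (E : R), rsmooth G -> L2 G -> 0 <= E ->
    (forall a, `|hcoef G a| <= E * expR (- (4 * d)) ^+ wt a) ->
    Inu (fun x => G x ^+ 2) = csum (enum_idx (fun a => hcoef G a ^+ 2)) /\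
    forall (w : oword) x, `|opw w G x| <= E * K * C ^+ size w * Num.sqrt (size w)`!%:R * Wt x].
Proof.
move=> d0; have [K [C [K0 C1 H]]] := psi_opw_le d0.
have C0 : 0 <= C by rewrite (le_trans _ C1).
pose r := expR (- (2 * d)).
have r0 : 0 <= r := expR_ge0 _.
have r1 : r < 1 by rewrite -expR0 ltr_expR oppr_lt0 mulr_gt0.
exists (K * (1 - r)^-1 ^+ n), C; split=> //.
  by rewrite mulr_ge0// exprn_ge0// invr_ge0 subr_ge0 ltW.
move=> G E sG LG E0 hG.
pose f (w : oword) (a : idx) x := hcoef G a * opw w (psi a) x.
pose Bw (w : oword) := E * K * C ^+ size w * Num.sqrt (size w)`!%:R.
have Bw0 w : 0 <= Bw w by rewrite !mulr_ge0 ?exprn_ge0 ?sqrtr_ge0.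
have fle w a x : `|f w a x| <= Bw w * Wt x * r ^+ wt a.
  rewrite /f normrM; apply: (le_trans (ler_pM _ _ (hG a) (H w a x))) => //.
  rewrite [leRHS](_ : _ = E * (K * C ^+ size w * Num.sqrt (size w)`!%:R * r ^+ wt a * Wt x)); last by rewrite /Bw; ring.
  rewrite -[leLHS]mulrA; apply: ler_wpM2l => //.
  rewrite [leLHS](_ : _ = K * C ^+ size w * Num.sqrt (size w)`!%:R * (expR (- (4 * d)) ^+ wt a * expR (2 * d) ^+ wt a) * Wt x); last by ring.
  by rewrite -exprMn -expRD (_ : - (4 * d) + 2 * d = - (2 * d))//; ring.
pose S w x := csum (enum_idx (fun a => f w a x)).
have WB w (x : 'rV[R]_n) : 0 <= Bw w * Wt x by rewrite mulr_ge0// ltW// Wt_gt0.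
have cS w (x : 'rV[R]_n) := cint_idx (WB w x) r0 r1 (fun a => fle w a x).
have SW w x : `|S w x| <= Bw w * (1 - r)^-1 ^+ n * Wt x.
  by have [_] := cS w x; rewrite mulrAC.
have Wt1 (x : 'rV[R]_n) : Wt x <= 1 := Wt_le1 x.
pose M w := enum_idx (fun a : idx => Bw w * r ^+ wt a).
have iM w : cint (M w).
  apply: (proj1 (@cint_idx R n _ (Bw w) r (Bw0 w) r0 r1 _)) => a.
  by rewrite ger0_norm// mulr_ge0// exprn_ge0.
have fM w m x : `|enum_idx (fun a => f w a x) m| <= M w m.
  rewrite /M /enum_idx; case: pickle_inv => [a|]; last by rewrite normr0.
  apply: (le_trans (fle w a x)); rewrite ler_wpM2r ?exprn_ge0// ler_piMr//.
have fS w m : continuous (fun x => enum_idx (fun a => f w a x) m).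
  rewrite /enum_idx; case: pickle_inv => [a|]; last exact: cst_continuous.
  by apply: cZ; apply: rsmooth_cont; apply: opw_smooth; exact: psi_smooth.
have contS w : continuous (S w) := csum_cont (fS w) (fM w) (iM w).
have pairS (H' : 'rV[R]_n -> R) Bb : continuous H' -> (forall x, `|H' x| <= Bb) ->
    Inu (fun x => S [::] x * H' x) = csum (enum_idx (fun a => hcoef G a * Inu (fun x => psi a x * H' x))).
  move=> cH hBb; have Bb0 : 0 <= Bb := le_trans (normr_ge0 _) (hBb 0).
  pose g m x := H' x * enum_idx (fun a => f [::] a x) m.
  have csg x : csum (g^~ x) = S [::] x * H' x.
    by rewrite [RHS]mulrC; exact: (csumZ (H' x) (proj1 (cS [::] x))).
  have [] := @Inu_csum R n g (fun m => Bb * M [::] m).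
  - by move=> m; apply: cM; [exact: cH|exact: fS].
  - move=> m y; rewrite /g normrM -mulrA ler_pM//.
    rewrite /M /enum_idx; case: pickle_inv => [a|]; last by rewrite normr0 mul0r.
    by apply: (le_trans (fle [::] a y)); rewrite mulrAC.
  - exact: cintZ.
  - rewrite (_ : (fun x => _) = fun x => S [::] x * H' x); last by apply/funext.
    by apply: cM; [exact: contS|exact: cH].
  move=> _; rewrite (_ : Inu _ = Inu (fun x => S [::] x * H' x)); last first.
    by apply: eq_Rintegral => y _; exact: csg.
  move=> ->.
  congr csum; apply/funext => m; rewrite /g /enum_idx; case: pickle_inv => [a|].
    rewrite -InuZ; last first.
      apply: integrable_Wdom; last by apply: WdomM; [exact: psi_Wdom|exists Bb].
      by apply: continuous_measurable_rV; apply: cM => //; exact: psi_cont.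
    by apply: eq_Rintegral => y _; rewrite /f /opw /=; ring.
  transitivity (Inu (fun=> 0)); first by apply: eq_Rintegral => y _; rewrite mulr0.
  by rewrite Rintegral_cst// mul0r.
have GS : G = S [::].
  have L2S : L2 (S [::]).
    apply: integrable_Wdom; first by apply: continuous_measurable_rV; apply: cM; exact: contS.
    exists ((Bw [::] * (1 - r)^-1 ^+ n) ^+ 2) => x; have := SW [::] x; set B := Bw _ * _ => hS.
    have W0 := Wt_gt0 x.
    rewrite normrX; apply: (@le_trans _ _ ((B * Wt x) ^+ 2)); first by rewrite lerXn2r ?nnegrE// (le_trans _ hS).
    by rewrite exprMn ler_wpM2l ?sqr_ge0// expr2 ler_piMl// ltW.
  have cG := rsmooth_cont sG.
  apply/funext => x; apply/eqP; rewrite -subr_eq0; apply/eqP.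
  apply: (@hermite_complete R n (fun x => G x - S [::] x)).
  - by apply: cB => //; exact: contS.
  - have i2 := intgD (intgZ 2 LG) (intgZ 2 L2S).
    apply: le_integrable i2 => //.
      apply: measurableT_comp => //; apply: continuous_measurable_rV.
      by apply: cM; apply: cB => //; exact: contS.
    move=> y _; rewrite !abse_EFin lee_fin !ger0_norm ?sqr_ge0//; last first.
      by rewrite addr_ge0// mulr_ge0// sqr_ge0.
    by have := sqr_ge0 (G y + S [::] y); rewrite sqrrB sqrrD; lra.
  move=> b {x}.
  have e0 : hcoef (S [::]) b = hcoef G b.
    have [Bb hBb] := @psi_bounded R n b.
    rewrite /hcoef (pairS _ Bb (@psi_cont R n b) hBb) (@csum_idx_delta _ _ _ b).
      by rewrite -/(ip _ _) ip_psi eqxx mulr1.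
    by move=> a /negbTE ab; rewrite -/(ip _ _) ip_psi ab mulr0.
  rewrite /hcoef (_ : Inu _ = Inu (fun y => G y * psi b y + (-1) * (S [::] y * psi b y))).
    rewrite InuD ?InuZ; [|exact: hcoef_int|exact: hcoef_int|apply: intgZ; exact: hcoef_int].
    by rewrite -/(hcoef (S _) b) e0 /hcoef mulN1r subrr.
  by apply: eq_Rintegral => y _; ring.
split.
  have GB x : `|G x| <= Bw [::] * (1 - r)^-1 ^+ n.
    by rewrite GS (le_trans (SW _ _))// ler_piMr// mulr_ge0// exprn_ge0// invr_ge0 subr_ge0 ltW.
  transitivity (Inu (fun x => S [::] x * G x)).
    by apply: eq_Rintegral => y _; rewrite -GS expr2.
  rewrite (pairS G _ (rsmooth_cont sG) GB); congr csum; congr enum_idx; apply/funext => a.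
  by rewrite expr2; congr (_ * _); apply: eq_Rintegral => y _; rewrite mulrC.
have opS w : opw w G = S w.
  elim: w => [|[[] i] w IH]; first by [].
    rewrite /opw /= -/(opw w G) IH /op1 /=; apply/funext => x.
    suff [_ ->] : is_derive x (ei i) (S w) (S ((true, i) :: w) x) by [].
    apply: (@csum_dirderive _ (fun m x => enum_idx (fun a => f w a x) m)
       (fun m x => enum_idx (fun a => f ((true, i) :: w) a x) m) (M ((true, i) :: w)) x (ei i)).
    - move=> m y; rewrite /enum_idx; case: pickle_inv => [a|]; last exact: is_derive_cst.
      apply: is_deriveZ; apply: rsmooth_is_derive; apply: opw_smooth; exact: psi_smooth.
    - by move=> y; have [] := cS w y.
    - by move=> m y; exact: fM.
    - exact: iM.
  rewrite /opw /= -/(opw w G) IH /op1 /=; apply/funext => x.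
  rewrite /S -csumZ; last by have [] := cS w x.
  congr csum; apply/funext => m; rewrite -enum_idxZ; congr enum_idx; apply/funext => a.
  by rewrite /f mulrCA.
by move=> w x; rewrite opS (le_trans (SW w x))// /Bw le_eqVlt; apply/orP; left; apply/eqP; ring.
Qed.

End HermiteExpansion.

(** * Bounds for the eigenfunctions and unboundedness of the eigenvalues *)

Section EigenfunctionBounds.
Context {R : realType} {n m : nat} (cP : midx n m -> midx n m -> R).
Notation cnt := (@counting nat R).
Notation cint f := (cnt.-integrable [set: nat] (fun m : nat => (f m)%:E)).
Notation idx := (@idx n).
Notation oword := (@oword n).
Notation rVm := (@rVm R n).
Notation nun := (@nu R n).
Notation Inu g := (Rintegral (@nu R n) [set: rVm] (g : rVm -> R)).
Notation intg g := (nun.-integrable [set: rVm] (fun x : rVm => (g x)%:E)).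

(** As k >= 2, M^k >= M^2 >= c^2 (1 + |l|)^2 >= A (1 + l^2) for an M that is only linear in |l|.
    This linearity produces losses of the form exp (eta |l|). *)
Lemma nat_window (A c l : R) (k : nat) : (2 <= k)%N -> 1 <= c -> A <= c ^+ 2 -> 0 <= A ->
  exists2 M : nat, A * (1 + l ^+ 2) <= M%:R ^+ k & M%:R <= c * (1 + `|l|) + 1.
Proof.
move=> k2 c1 Ac A0; pose y := c * (1 + `|l|).
have y1 : 1 <= y by rewrite /y; have := normr_ge0 l; nra.
have y0 : 0 <= y by lra.
exists (Num.truncn y).+1; last first.
  by rewrite -natr1 lerD2r; have /andP[] := truncn_itv y0.
have hy : y <= (Num.truncn y).+1%:R by have /andP[_ /ltW] := truncn_itv y0.
apply: (@le_trans _ _ (y ^+ 2)).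
  rewrite /y exprMn ler_pM//; first by rewrite addr_ge0// sqr_ge0.
  by rewrite sqrrD expr1n mul1r real_normK ?num_real//; have := normr_ge0 l; lra.
apply: (@le_trans _ _ ((Num.truncn y).+1%:R ^+ 2)); first by rewrite lerXn2r ?nnegrE.
by apply: ler_weXn2l => //; lra.
Qed.

Hypotheses (n0 : (0 < n)%N) (m2 : (2 <= m)%N) (sa : P_selfadjoint cP) (el : P_globally_elliptic cP).

(** Norm at most 1 rather than equal to 1, so that the real and the imaginary part of a normalized
    complex eigenfunction both qualify. *)
Definition unit_eigfun (l : R) (G : 'rV[R]_n -> R) :=
  [/\ rsmooth G, L2 G, Inu (fun x => G x ^+ 2) <= 1 & forall x, PopR cP G x = l * G x].

Lemma eigfun_coef (eta : R) : 0 < eta -> exists d K : R, [/\ 0 < d, 0 <= K &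
  forall l G, unit_eigfun l G -> forall a, `|hcoef G a| <= K * expR (eta * `|l|) * expR (- (4 * d)) ^+ wt a].
Proof.
move=> e0; have [A [r [A0 r0 r1 H]]] := eigen_coef_decay n0 (ltnW m2) sa el.
pose c := 1 + A; have c1 : 1 <= c by rewrite lerDl.
have Ac : A <= c ^+ 2 by rewrite /c; nra.
have c0 : 0 < c by lra.
(* The first bound turns the loss exp (4 d M) into a multiple of exp (eta |l|); the second keeps exp
   (- 4 d) at or above the threshold for Agmon's rate. *)
pose d := Num.min (eta / (4 * c)) (- ln r / 4).
have d0 : 0 < d.
  rewrite /d lt_min; apply/andP; split; apply: divr_gt0 => //; first exact: mulr_gt0.
  by rewrite oppr_gt0 ln_lt0// r0 r1.
have dr : r <= expR (- (4 * d)).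
  rewrite -[leLHS](lnK r0) ler_expR.
  have : d <= - ln r / 4 by rewrite ge_min lexx orbT.
  lra.
have de : 4 * d * c <= eta.
  have : d <= eta / (4 * c) by rewrite ge_min lexx.
  by rewrite ler_pdivlMr ?mulr_gt0//; lra.
exists d, (expR (4 * d * (c + 1))); split; [exact: d0|exact: expR_ge0|].
move=> l G [sG LG nG eG] a.
have [M hM Mc] := nat_window l m2 c1 Ac A0.
have r1' : expR (- (4 * d)) < 1 by rewrite -expR0 ltr_expR oppr_lt0 mulr_gt0.
apply: (le_trans (H _ _ M G dr r1' hM sG LG nG eG a)).
rewrite -expRD -!expRM_natr -expRD ler_expR.
have h1 : (wt a)%:R <= (wt a - M)%N%:R + M%:R :> R by rewrite -natrD ler_nat addnC -leq_subLR.
have h2 : 4 * d * M%:R <= 4 * d * (c * (1 + `|l|) + 1) by rewrite ler_wpM2l// mulr_ge0// ltW.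
have h3 : 4 * d * c * `|l| <= eta * `|l| by rewrite ler_wpM2r.
have h4 : 4 * d * (wt a)%:R <= 4 * d * ((wt a - M)%N%:R + M%:R) by rewrite ler_wpM2l// mulr_ge0// ltW.
lra.
Qed.

Lemma eigfun_bound (eta : R) : 0 < eta -> exists K C : R, [/\ 0 <= K, 1 <= C &
  forall l G, unit_eigfun l G -> forall (w : oword) x,
    `|opw w G x| <= K * expR (eta * `|l|) * C ^+ size w * Num.sqrt (size w)`!%:R * Wt x].
Proof.
move=> e0; have [d [K [d0 K0 H]]] := eigfun_coef e0.
have [K' [C [K'0 C1 H']]] := @hermite_expansion_le R n d d0.
exists (K * K'), C; split=> //; first exact: mulr_ge0.
move=> l G uG w x; have [sG LG _ _] := uG.
have E0 : 0 <= K * expR (eta * `|l|) by rewrite mulr_ge0 ?expR_ge0.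
have [_ h] := H' G _ sG LG E0 (H l G uG).
by apply: (le_trans (h w x)); rewrite le_eqVlt; apply/orP; left; apply/eqP; ring.
Qed.

Lemma unit_eigfun_Wdom l G : unit_eigfun l G -> Wdom G.
Proof.
by move=> uG; have [K [C [_ _ H]]] := @eigfun_bound 1 ltr01; eexists => x; exact: H uG [::] x.
Qed.

(** The summable majorant depends only on L: all eigenfunctions with |l| <= L have uniformly small
    tails of Hermite coefficients. *)
Lemma eigfun_parseval (L : R) : exists2 M : nat -> R, cint M & (forall m, 0 <= M m) /\
  forall l G, unit_eigfun l G -> `|l| <= L ->
   [/\ Inu (fun x => G x ^+ 2) = csum (enum_idx (fun a => hcoef G a ^+ 2)) &
     forall k, `|enum_idx (fun a => hcoef G a ^+ 2) k| <= M k].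
Proof.
have [d [K [d0 K0 H]]] := eigfun_coef ltr01.
have [K' [C [K'0 C1 H']]] := @hermite_expansion_le R n d d0.
pose r := expR (- (4 * d)).
have r0 : 0 <= r := expR_ge0 _.
have r1 : r < 1 by rewrite -expR0 ltr_expR oppr_lt0 mulr_gt0.
pose B := (K * expR L) ^+ 2.
have B0 : 0 <= B := sqr_ge0 _.
exists (enum_idx (fun a : idx => B * r ^+ wt a)).
  apply: (proj1 (@cint_idx R n _ B r B0 r0 r1 _)) => a.
  by rewrite ger0_norm// mulr_ge0// exprn_ge0.
split=> [k|l G uG lL].
  by rewrite /enum_idx; case: pickle_inv => // a; rewrite mulr_ge0// exprn_ge0.
have [sG LG _ _] := uG.
have E0 : 0 <= K * expR (1 * `|l|) by rewrite mulr_ge0 ?expR_ge0.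
have [-> _] := H' G _ sG LG E0 (H l G uG); split=> // k.
rewrite /enum_idx; case: pickle_inv => [a|]; last by rewrite normr0.
rewrite normrX; apply: (@le_trans _ _ ((K * expR L * r ^+ wt a) ^+ 2)).
  rewrite lerXn2r ?nnegrE ?mulr_ge0 ?expR_ge0 ?exprn_ge0//.
  apply: (le_trans (H l G uG a)); rewrite ler_wpM2r ?exprn_ge0// ler_wpM2l// ler_expR mul1r//.
rewrite exprMn ler_wpM2l// expr2 ler_piMr ?exprn_ge0// exprn_ile1//; exact: ltW.
Qed.

Lemma intWW (f g : 'rV[R]_n -> R) : continuous f -> continuous g -> Wdom f -> Wdom g -> intg (fun x => f x * g x).
Proof.
move=> cf cg Wf [K hK]; apply: integrable_Wdom.
  by apply: continuous_measurable_rV; apply: cM.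
have K0 : 0 <= K by have := le_trans (normr_ge0 _) (hK 0); rewrite pmulr_lge0// Wt_gt0.
by apply: WdomM => //; exists K => x; rewrite (le_trans (hK x))// ler_piMr// Wt_le1.
Qed.

(** Bessel's inequality for complex functions A_j + i B_j regarded as pairs in a real Hilbert space
    and tested against the real unit vector (ps, 0). *)
Lemma bessel_pair (s : seq nat) (A B : nat -> 'rV[R]_n -> R) (ps : 'rV[R]_n -> R) :
  (forall j, continuous (A j)) -> (forall j, continuous (B j)) -> continuous ps ->
  (forall j, Wdom (A j)) -> (forall j, Wdom (B j)) -> Wdom ps -> uniq s ->
  Inu (fun x => ps x * ps x) = 1 ->
  (forall j k, Inu (fun x => A j x * A k x + B j x * B k x) = (j == k)%:R) ->
  \sum_(j <- s) Inu (fun x => A j x * ps x) ^+ 2 <= 1.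
Proof.
move=> cA cB' cp WA WB Wp us p1 orth; pose al j := Inu (fun x => A j x * ps x).
rewrite -/(al _); pose S := \sum_(j <- s) al j ^+ 2.
pose F x := \sum_(j <- s) al j * A j x; pose H x := \sum_(j <- s) al j * B j x.
have [i1 e1] := Inu_sum s al (fun j => intWW (cA j) cp (WA j) Wp).
have EF x : F x * ps x = \sum_(j <- s) al j * (A j x * ps x).
  by rewrite /F mulr_suml; apply: eq_bigr => j _; rewrite mulrA.
have eF : Inu (fun x => F x * ps x) = S.
  rewrite /S -[RHS](eq_bigr _ (fun a _ => esym (expr2 (al a)))) -e1.
  by apply: eq_Rintegral => x _; exact: EF.
have iF : intg (fun x => F x * ps x) by move: i1; apply: eq_integrable => // x _; rewrite EF.
have iAB j k : intg (fun x => A j x * A k x + B j x * B k x) by apply: intgD; apply: intWW.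
have hG j : intg (fun x => A j x * F x + B j x * H x) /\
    (j \in s -> Inu (fun x => A j x * F x + B j x * H x) = al j).
  have [i2 e2] := Inu_sum s al (fun k => iAB j k).
  have E x : A j x * F x + B j x * H x = \sum_(k <- s) al k * (A j x * A k x + B j x * B k x).
    rewrite /F /H !mulr_sumr -big_split /=; apply: eq_bigr => k _; ring.
  split; first by move: i2; apply: eq_integrable => // x _; rewrite E.
  move=> js; transitivity (Inu (fun x => \sum_(k <- s) al k * (A j x * A k x + B j x * B k x))).
    by apply: eq_Rintegral => x _; exact: E.
  rewrite e2 (bigD1_seq j)//= orth eqxx mulr1 big1 ?addr0// => k kj.
  by rewrite orth eq_sym (negbTE kj) mulr0.
have [i3 e3] := Inu_sum s al (fun j => (hG j).1).
have EFH x : F x * F x + H x * H x = \sum_(j <- s) al j * (A j x * F x + B j x * H x).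
  rewrite {1}/F {1}/H !mulr_suml -big_split /=; apply: eq_bigr => k _; ring.
have eFH : Inu (fun x => F x * F x + H x * H x) = S.
  rewrite (_ : S = \sum_(j <- s) al j * Inu (fun x => A j x * F x + B j x * H x)).
    by rewrite -e3; apply: eq_Rintegral => x _; exact: EFH.
  by rewrite /S big_seq [RHS]big_seq; apply: eq_bigr => j /(hG j).2 ->; rewrite expr2.
have iFH : intg (fun x => F x * F x + H x * H x).
  by move: i3; apply: eq_integrable => // x _; rewrite EFH.
have : 0 <= Inu (fun x => (ps x - F x) ^+ 2 + H x ^+ 2).
  by apply: Rintegral_ge0 => x _; rewrite addr_ge0// sqr_ge0.
rewrite (_ : Inu _ = Inu (fun x => ps x * ps x + (- 2 * (F x * ps x) + (F x * F x + H x * H x)))); last first.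
  by apply: eq_Rintegral => x _; ring.
rewrite InuD; [|exact: intWW|by apply: intgD => //; exact: intgZ].
by rewrite InuD//; [rewrite InuZ// eF eFH p1 -/S; lra|exact: intgZ].
Qed.

Context (lam : nat -> R) (phi : nat -> 'rV[R]_n -> R[i]).
Hypothesis es : eigen_system cP lam phi.

Lemma phi_norm j : intg (fun x => cRe (phi j) x ^+ 2 + cIm (phi j) x ^+ 2) /\
  Inu (fun x => cRe (phi j) x ^+ 2 + cIm (phi j) x ^+ 2) = 1.
Proof.
have [sm _ nrm _ _] := es; have [sR sI] := sm j.
have h := nrm j; rewrite (L2norm2_nu (rsmooth_cont sR) (rsmooth_cont sI)) in h.
have mm : measurable_fun [set: rVm] (fun x : rVm => cRe (phi j) x ^+ 2 + cIm (phi j) x ^+ 2).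
  have cR := rsmooth_cont sR; have cI := rsmooth_cont sI.
  by apply: continuous_measurable_rV; apply: cD; apply: cM.
split; last by rewrite /Rintegral h.
apply/integrableP; split; first exact/measurable_EFinP.
under eq_integral do rewrite abse_EFin ger0_norm ?addr_ge0 ?sqr_ge0//.
by rewrite h ltry.
Qed.

Lemma phi_unit j : unit_eigfun (lam j) (cRe (phi j)) /\ unit_eigfun (lam j) (cIm (phi j)).
Proof.
have [sm eg _ _ _] := es; have [sR sI] := sm j; have [ij e1] := phi_norm j.
have ee x : PopR cP (cRe (phi j)) x = lam j * cRe (phi j) x /\ PopR cP (cIm (phi j)) x = lam j * cIm (phi j) x.
  by rewrite -Re_Pop -Im_Pop eg Re_rM Im_rM.
have part (f g : 'rV[R]_n -> R) : rsmooth f -> intg (fun x => f x ^+ 2 + g x ^+ 2) ->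
    Inu (fun x => f x ^+ 2 + g x ^+ 2) = 1 -> L2 f /\ Inu (fun x => f x ^+ 2) <= 1.
  move=> sf ig e; have Lf : L2 f.
    apply: le_integrable ig => //.
      by apply/measurable_EFinP; apply: continuous_measurable_rV; apply: cM; exact: rsmooth_cont.
    by move=> x _; rewrite !abse_EFin lee_fin !ger0_norm ?addr_ge0 ?sqr_ge0// lerDl sqr_ge0.
  split=> //; rewrite -e; apply: le_Rintegral => // x _; by rewrite lerDl sqr_ge0.
have [L1 n1] := part _ _ sR ij e1.
have [L2 n2] : L2 (cIm (phi j)) /\ Inu (fun x => cIm (phi j) x ^+ 2) <= 1.
  apply: (part _ (cRe (phi j)) sI).
    by move: ij; apply: eq_integrable => // x _; rewrite addrC.
  by rewrite -e1; apply: eq_Rintegral => x _; rewrite addrC.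
by split; [exact: And4 sR L1 n1 (fun x => (ee x).1)|exact: And4 sI L2 n2 (fun x => (ee x).2)].
Qed.

Lemma phi_Wdom j : Wdom (cRe (phi j)) /\ Wdom (cIm (phi j)).
Proof. by have [/unit_eigfun_Wdom h1 /unit_eigfun_Wdom h2] := phi_unit j. Qed.

Lemma phi_cont j : continuous (cRe (phi j)) /\ continuous (cIm (phi j)).
Proof. by have [sm _ _ _ _] := es; have [/rsmooth_cont h1 /rsmooth_cont h2] := sm j. Qed.

Lemma phi_orth j k :
  Inu (fun x => cRe (phi j) x * cRe (phi k) x + cIm (phi j) x * cIm (phi k) x) = (j == k)%:R /\
  Inu (fun x => cIm (phi j) x * cRe (phi k) x - cRe (phi j) x * cIm (phi k) x) = 0.
Proof.
have [c1 c2] := phi_cont j; have [c3 c4] := phi_cont k.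
have [w1 w2] := phi_Wdom j; have [w3 w4] := phi_Wdom k.
have b f : Wdom f -> exists B, forall x : 'rV[R]_n, `|f x| <= B.
  move=> [K hK]; exists K => x; have K0 : 0 <= K by have := le_trans (normr_ge0 _) (hK 0); rewrite pmulr_lge0// Wt_gt0.
  by rewrite (le_trans (hK x))// ler_piMr// Wt_le1.
have [->|jk] := eqVneq j k.
  split; last by transitivity (Inu (fun=> 0)); [apply: eq_Rintegral => x _; ring|rewrite Rintegral_cst// mul0r].
  by have [_ <-] := phi_norm k; apply: eq_Rintegral => x _; rewrite !expr2.
have [_ _ _ orth _] := es; have := orth j k (elimN eqP jk) => -[].
rewrite (_ : cRe (fun x => phi j x * cconj (phi k x)) = fun x => cRe (phi j) x * cRe (phi k) x + cIm (phi j) x * cIm (phi k) x); last first.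
  by apply/funext => x; rewrite /cRe /cIm /cconj; case: (phi j x) (phi k x) => [? ?] [? ?] /=; ring.
rewrite (_ : cIm (fun x => phi j x * cconj (phi k x)) = fun x => cIm (phi j) x * cRe (phi k) x - cRe (phi j) x * cIm (phi k) x); last first.
  by apply/funext => x; rewrite /cRe /cIm /cconj; case: (phi j x) (phi k x) => [? ?] [? ?] /=; ring.
rewrite !intRn_nu//.
- by apply: continuous_measurable_rV; apply: cB; apply: cM.
- by apply: WdomB; apply: WdomM => //; exact: b.
- by apply: continuous_measurable_rV; apply: cD; apply: cM.
- by apply: WdomD; apply: WdomM => //; exact: b.
Qed.

(** If |lam| stayed below L on an infinite set, a common N would leave at least half of the mass of
    each eigenfunction in its first N Hermite coefficients. By Bessel each of these N coefficients
    carries total mass at most 2 over all eigenfunctions, so at most 4N eigenfunctions would fit. *)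
Lemma lam_unbounded (S : set nat) (L : R) : infinite_set S -> exists2 j, S j & L < `|lam j|.
Proof.
move=> iS; apply: contrapT => nS.
have SL j : S j -> `|lam j| <= L by move=> Sj; rewrite leNgt; apply/negP => h; apply: nS; exists j.
have [M iM [M0 H]] := eigfun_parseval L.
have /cvgrPdist_lt /(_ 4^-1 (ltac:(by rewrite invr_gt0))) [N _ hN] := csum_partial iM.
have {hN} := hN N (leqnn N); rewrite ltr_norml => /andP[_ hN].
(* One element more than the 4N that can be accommodated. *)
have [B BS cB'] := infinite_set_fset (4 * N + 1) iS.
pose s := finmap.enum_fset B.
have us : uniq s := finmap.fset_uniq B.
have sS j : j \in s -> S j by move=> js; apply: BS.
pose ea (G : nat -> 'rV[R]_n -> R) j := enum_idx (fun a : idx => hcoef (G j) a ^+ 2).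
pose A j := cRe (phi j); pose B' j := cIm (phi j).
have tail (G : nat -> 'rV[R]_n -> R) j : unit_eigfun (lam j) (G j) -> S j ->
    Inu (fun x => G j x ^+ 2) <= \sum_(0 <= k < N) ea G j k + 4^-1.
  move=> uG Sj; have [-> h] := H _ _ uG (SL j Sj).
  have := csum_tail N h iM; rewrite ler_norml => /andP[_ ht].
  by rewrite -lerBlDl (le_trans ht)// ltW.
have one j : j \in s -> 2^-1 <= \sum_(0 <= k < N) (ea A j k + ea B' j k).
  move=> /sS Sj; have [uA uB] := phi_unit j.
  have [_ e1] := phi_norm j; have h1 := tail A j uA Sj; have h2 := tail B' j uB Sj.
  have : Inu (fun x => A j x ^+ 2) + Inu (fun x => B' j x ^+ 2) = 1.
    by rewrite -InuD; [rewrite -[RHS]e1|have [_ []] := uA|have [_ []] := uB].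
  by rewrite big_split /=; move: h1 h2; set a1 := \sum_(_ <= _ < _) _; set a2 := \sum_(_ <= _ < _) _; lra.
have two (G G' : nat -> 'rV[R]_n -> R) k : (forall j, continuous (G j)) -> (forall j, continuous (G' j)) ->
    (forall j, Wdom (G j)) -> (forall j, Wdom (G' j)) ->
    (forall j k, Inu (fun x => G j x * G k x + G' j x * G' k x) = (j == k)%:R) ->
    \sum_(j <- s) ea G j k <= 1.
  move=> c1 c2 w1 w2 o; rewrite /ea /enum_idx; case: pickle_inv => [a|]; last by rewrite big1.
  apply: (@bessel_pair s G G' (psi a)) => //; [exact: psi_cont|exact: psi_Wdom|].
  by rewrite -/(ip _ _) ip_psi eqxx.
have twoA k : \sum_(j <- s) ea A j k <= 1.
  apply: (two A B') => // j; try exact: (phi_cont j).1; try exact: (phi_cont j).2;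
    try exact: (phi_Wdom j).1; try exact: (phi_Wdom j).2.
  by move=> l; have [] := phi_orth j l.
have twoB k : \sum_(j <- s) ea B' j k <= 1.
  apply: (two B' A) => // j; try exact: (phi_cont j).1; try exact: (phi_cont j).2;
    try exact: (phi_Wdom j).1; try exact: (phi_Wdom j).2.
  move=> l; have [<- _] := phi_orth j l.
  by apply: eq_Rintegral => x _; rewrite addrC.
have : (size s)%:R * 2^-1 <= N%:R * 2 :> R.
  apply: (@le_trans _ _ (\sum_(j <- s) \sum_(0 <= k < N) (ea A j k + ea B' j k))).
    have -> : (size s)%:R * 2^-1 = \sum_(j <- s) (2^-1 : R).
      by rewrite big_const_seq count_predT iter_addr_0 mulr_natl.
    by rewrite big_seq [leRHS]big_seq; apply: ler_sum => j js; exact: one.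
  rewrite exchange_big /=.
  have -> : N%:R * 2 = \sum_(0 <= k < N) (2 : R) by rewrite big_const_nat subn0 iter_addr_0 mulr_natl.
  apply: ler_sum => k _; rewrite big_split /=; have := twoA k; have := twoB k.
  by set a1 := \sum_(_ <- _) _; set a2 := \sum_(_ <- _) _; lra.
have : (4 * N + 1)%:R <= (size s)%:R :> R by rewrite ler_nat.
by rewrite natrD natrM; lra.
Qed.

End EigenfunctionBounds.

(** * Gevrey functions of time and the sign-alternating points *)

Section Jets.
Context {R : realType}.
Implicit Types (f g : R -> R).

Definition smooth1 f := @rsmooth R R^o f.
Definition Dk (k : nat) f : R -> R := @iD R R^o (nseq k (1 : R)) f.

Lemma Dk_hasD k f : smooth1 f -> hasD (Dk k f) (Dk k.+1 f).
Proof. by move=> sf x; exact: (@rsmooth_is_derive R R^o (Dk k f) x 1 (rsmooth_iD _ sf)). Qed.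

Lemma hasD_unique f g h : hasD f g -> hasD f h -> g = h.
Proof. by move=> fg fh; apply/funext => x; have [_ <-] := fg x; have [_ <-] := fh x. Qed.

Lemma Dk_jet (F : nat -> R -> R) : (forall k, hasD (F k) (F k.+1)) -> forall k, Dk k (F 0%N) = F k.
Proof.
move=> hF; elim=> [//|k IH]; rewrite /Dk /= -/(Dk k _) IH.
by apply/funext => x; have [_ ->] := hF k x.
Qed.

Lemma is_derive_dir f (x d v : R) : is_derive x (1 : R) f d -> @is_derive R R^o R^o x v f (v * d).
Proof.
move=> h; have /is_derive_line h0 := h.
have h2 := @hasD_comp R.
apply/(@is_derive_line R R^o).
have hl : is_derive (0 : R) (1 : R) (fun t : R => t * v) v.
  apply: (is_derive_eq ((hasDM hasD_id (hasD_cst v)) 0)); rewrite mul0r addr0 mul1r//.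
have h3 : is_derive (0 * v) (1 : R) (fun t : R => f (x + t *: (1 : R^o))) d by rewrite mul0r.
have := @is_derive1_comp R (fun t : R => f (x + t *: (1 : R^o))) (fun t : R => t * v) 0 d v h3 hl.
rewrite /GRing.scale /= mulrC => h4.
by rewrite (_ : (fun t => _) = ((fun t : R => f (x + t * 1)) \o (fun t : R => t * v)))//; apply/funext => t /=; rewrite mulr1.
Qed.

Lemma jet_smooth1 (F : nat -> R -> R) : (forall k, hasD (F k) (F k.+1)) -> smooth1 (F 0%N).
Proof.
move=> hF; apply: (@rsmooth_coind R R^o (fun f => exists c k, f = fun x => c * F k x)).
- by move=> _ [c [k ->]] x; apply: (@cZ R R^o c (F k)) => y; exact: (hasD_cont (hF k)).
- move=> _ v [c [k ->]]; exists (fun x => (v * c) * F k.+1 x); first by exists (v * c), k.+1.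
  by move=> x; rewrite -mulrA; apply: is_derive_dir; exact: (hasDZ c (hF k)).
by exists 1, 0%N; apply/funext => x; rewrite mul1r.
Qed.

Lemma hasD_sum (I : Type) (s : seq I) (F dF : I -> R -> R) : (forall i, hasD (F i) (dF i)) ->
  hasD (fun x => \sum_(i <- s) F i x) (fun x => \sum_(i <- s) dF i x).
Proof.
move=> h; elim: s => [|i s IH] x.
  by under eq_fun do rewrite big_nil; rewrite big_nil; exact: hasD_cst.
rewrite big_cons (_ : (fun x => _) = fun x => F i x + \sum_(j <- s) F j x).
  exact: (hasDD (h i) IH).
by apply/funext => y; rewrite big_cons.
Qed.

Definition jmul (f g : nat -> R -> R) (k : nat) (x : R) : R :=
  \sum_(i < k.+1) 'C(k, i)%:R * (f i x * g (k - i)%N x).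

Lemma hasD_jmul (f g : nat -> R -> R) k : (forall k, hasD (f k) (f k.+1)) -> (forall k, hasD (g k) (g k.+1)) ->
  hasD (jmul f g k) (jmul f g k.+1).
Proof.
move=> hf hg.
apply: (@hasD_eq _ _ (fun x => \sum_(i < k.+1) 'C(k, i)%:R * (f i.+1 x * g (k - i)%N x + f i x * g (k - i).+1 x))).
  by apply: hasD_sum => i; apply: hasDZ; exact: hasDM.
move=> x; rewrite /jmul [RHS]big_ord_recl bin0 mul1r subn0 /=.
under [in RHS]eq_bigr => i _ do rewrite /fintype.bump /= add1n binS natrD mulrDl subSS.
rewrite big_split /= addrA [RHS]addrC.
under eq_bigr => i _ do rewrite mulrDr.
rewrite big_split /=; congr (_ + _).
rewrite [LHS]big_ord_recl /= bin0 mul1r subn0; congr (_ + _).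
rewrite [RHS]big_ord_recr /= bin_small// mul0r addr0.
by apply: eq_bigr => i _; rewrite /fintype.bump /= add1n subnSK.
Qed.

Lemma Dk_mul f g k : smooth1 f -> smooth1 g ->
  Dk k (fun x => f x * g x) = jmul (Dk^~ f) (Dk^~ g) k.
Proof.
move=> sf sg; rewrite -(@Dk_jet (jmul (Dk^~ f) (Dk^~ g))).
  by congr Dk; apply/funext => x; rewrite /jmul big_ord1 bin0 mul1r.
by move=> j; apply: hasD_jmul => i; exact: Dk_hasD.
Qed.

Lemma DkD f g k : smooth1 f -> smooth1 g -> Dk k (fun x => f x + g x) = fun x => Dk k f x + Dk k g x.
Proof.
by move=> sf sg; rewrite -(@Dk_jet (fun k x => Dk k f x + Dk k g x))// => j; apply: hasDD; exact: Dk_hasD.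
Qed.

Lemma DkZ (c : R) f k : smooth1 f -> Dk k (fun x => c * f x) = fun x => c * Dk k f x.
Proof.
by move=> sf; rewrite -(@Dk_jet (fun k x => c * Dk k f x))// => j; apply: hasDZ; exact: Dk_hasD.
Qed.

(** For S = 1 this is an equality; larger S only help, the binomial coefficient being at least 1.
    This is why Gevrey bounds survive the Leibniz rule. *)
Lemma fact_pow_le (S i j : nat) : (0 < S)%N ->
  'C(i + j, i)%:R * (i`!%:R ^+ S * j`!%:R ^+ S) <= (i + j)`!%:R ^+ S :> R.
Proof.
case: S => // S _; rewrite -!natrX -!natrM ler_nat.
rewrite -(bin_fact (leq_addr j i)) addKn [leqRHS]expnMn [((_ * _) ^ _)%N]expnMn.
by rewrite leq_mul// -{1}['C(_, _)]expn1 leq_pexp2l ?bin_gt0 ?leq_addr.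
Qed.

Lemma jmul_le (f g : nat -> R -> R) (S k : nat) (K K' C D x : R) : (0 < S)%N ->
  0 <= K -> 0 <= K' -> 0 <= C -> 0 <= D ->
  (forall i, (i <= k)%N -> `|f i x| <= K * C ^+ i * i`!%:R ^+ S) ->
  (forall i, (i <= k)%N -> `|g i x| <= K' * D ^+ i * i`!%:R ^+ S) ->
  `|jmul f g k x| <= K * K' * k`!%:R ^+ S * \sum_(i < k.+1) C ^+ i * D ^+ (k - i).
Proof.
move=> S0 K0 K'0 C0 D0 hf hg; rewrite /jmul; apply: (le_trans (ler_norm_sum _ _ _)).
rewrite mulr_sumr; apply: ler_sum => i _; rewrite !normrM ger0_norm//.
have ik : (i <= k)%N by rewrite -ltnS.
apply: (@le_trans _ _ ('C(k, i)%:R * ((K * C ^+ i * i`!%:R ^+ S) * (K' * D ^+ (k - i) * (k - i)`!%:R ^+ S)))).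
  by rewrite ler_wpM2l// ler_pM// ?hf ?hg// leq_subr.
have := fact_pow_le i (k - i) S0; rewrite subnKC// => h.
rewrite [leLHS](_ : _ = K * K' * (C ^+ i * D ^+ (k - i)) * ('C(k, i)%:R * (i`!%:R ^+ S * (k - i)`!%:R ^+ S))); last by ring.
rewrite [leRHS](_ : _ = K * K' * (C ^+ i * D ^+ (k - i)) * k`!%:R ^+ S); last by ring.
by rewrite ler_wpM2l// !mulr_ge0// exprn_ge0.
Qed.

(** The subtracted C^k makes the induction close; what matters is the bound 2 D^k, without a factor
    k + 1. *)
Lemma geom_mix (C D : R) k : 0 <= C -> 2 * C <= D ->
  \sum_(i < k.+1) C ^+ i * D ^+ (k - i) <= 2 * D ^+ k - C ^+ k.
Proof.
move=> C0 CD; have D0 : 0 <= D by lra.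
elim: k => [|k IH]; first by rewrite big_ord1 !expr0; lra.
rewrite big_ord_recr /= subnn expr0 mulr1.
have -> : \sum_(i < k.+1) C ^+ i * D ^+ (k.+1 - i) = D * \sum_(i < k.+1) C ^+ i * D ^+ (k - i).
  rewrite mulr_sumr; apply: eq_bigr => i _; have ik : (i <= k)%N by rewrite -ltnS.
  by rewrite (subSn ik) exprS mulrCA.
have := ler_wpM2l D0 IH; rewrite !exprS; set Sm := \sum_(_ < _) _.
have := ler_wpM2r (exprn_ge0 k C0) CD; set c := C ^+ k; set d := D ^+ k; lra.
Qed.

(* Derivatives of the real and imaginary parts of an exponential whose logarithmic derivative is u + i v. *)
Lemma exp_jet_le (x y u v : R -> R) (S : nat) (K C X t : R) : (0 < S)%N -> 0 <= K -> 0 <= C -> 0 <= X ->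
  smooth1 x -> smooth1 y -> smooth1 u -> smooth1 v ->
  hasD x (fun s => u s * x s + - 1 * (v s * y s)) -> hasD y (fun s => u s * y s + v s * x s) ->
  (forall k, `|Dk k u t| <= K * C ^+ k * k`!%:R ^+ S) ->
  (forall k, `|Dk k v t| <= K * C ^+ k * k`!%:R ^+ S) ->
  `|x t| <= X -> `|y t| <= X ->
  forall k, `|Dk k x t| <= X * (2 * C + 4 * K) ^+ k * k`!%:R ^+ S /\
            `|Dk k y t| <= X * (2 * C + 4 * K) ^+ k * k`!%:R ^+ S.
Proof.
move=> S0 K0 C0 X0 sx sy su sv hx hy bu bv xX yX k.
(* 2 C makes the mixed geometric sum at most 2 D^k; 4 K pays for the two products in each equation,
   each costing 2 K. *)
pose D := 2 * C + 4 * K; have D0 : 0 <= D by rewrite /D; lra.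
rewrite -/D; have [j] := ubnP k; elim: j k => // j IH [|k] kj.
  by rewrite !expr0 fact0 expr1n !mulr1.
have pre f df : smooth1 f -> hasD f df -> Dk k.+1 f = Dk k df.
  move=> sf hf; rewrite /Dk (_ : nseq k.+1 _ = rcons (nseq k (1 : R)) 1); last by rewrite -cats1 -(addn1 k) nseqD.
  by rewrite iD_rcons; congr iD; apply: (@hasD_unique f) => //; exact: (@Dk_hasD 0 f).
have sM f g : smooth1 f -> smooth1 g -> smooth1 (fun s => f s * g s) by exact: (@rsmoothM R R^o).
have gm := geom_mix k C0 (_ : 2 * C <= D).
have {gm}gm : \sum_(i < k.+1) C ^+ i * D ^+ (k - i) <= 2 * D ^+ k.
  by apply: (le_trans (gm _)); [rewrite /D; lra|rewrite gerBl exprn_ge0].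
have bnd f g : (forall k, `|Dk k f t| <= K * C ^+ k * k`!%:R ^+ S) ->
    (forall i, (i <= k)%N -> `|Dk i g t| <= X * D ^+ i * i`!%:R ^+ S) ->
    `|jmul (Dk^~ f) (Dk^~ g) k t| <= 2 * K * (X * D ^+ k * k.+1`!%:R ^+ S).
  move=> bf bg; apply: (le_trans (jmul_le S0 K0 X0 C0 D0 (fun i _ => bf i) bg)).
  rewrite [leRHS](_ : _ = K * X * k.+1`!%:R ^+ S * (2 * D ^+ k)); last by ring.
  rewrite ler_pM ?mulr_ge0 ?exprn_ge0//.
    by apply: sumr_ge0 => i _; rewrite mulr_ge0// exprn_ge0.
  by rewrite ler_wpM2l ?mulr_ge0// lerXn2r ?nnegrE// ler_nat leq_fact.
have fin (z : R) : `|z| <= 2 * K * (X * D ^+ k * k.+1`!%:R ^+ S) + 2 * K * (X * D ^+ k * k.+1`!%:R ^+ S) ->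
    `|z| <= X * D ^+ k.+1 * k.+1`!%:R ^+ S.
  move=> /le_trans; apply; rewrite exprS.
  rewrite [leLHS](_ : _ = 4 * K * (X * D ^+ k * k.+1`!%:R ^+ S)); last by ring.
  rewrite [leRHS](_ : _ = D * (X * D ^+ k * k.+1`!%:R ^+ S)); last by ring.
  by rewrite ler_wpM2r ?mulr_ge0 ?exprn_ge0// /D; lra.
have IHx i : (i <= k)%N -> `|Dk i x t| <= X * D ^+ i * i`!%:R ^+ S.
  by move=> ik; have [] := IH i (leq_ltn_trans ik kj).
have IHy i : (i <= k)%N -> `|Dk i y t| <= X * D ^+ i * i`!%:R ^+ S.
  by move=> ik; have [] := IH i (leq_ltn_trans ik kj).
split; apply: fin.
- rewrite (pre _ _ sx hx) DkD; [|exact: sM|by apply: (@rsmoothZ R R^o); exact: sM].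
  rewrite DkZ; last exact: sM.
  rewrite !Dk_mul// mulN1r (le_trans (ler_normB _ _))// lerD// bnd//.
- rewrite (pre _ _ sy hy) DkD; [|exact: sM|exact: sM].
  by rewrite !Dk_mul// (le_trans (ler_normD _ _))// lerD// bnd.
Qed.

End Jets.

(** * Antiderivatives and periodic bumps *)

Section Antiderivatives.
Context {R : realType}.
Implicit Types (f F : R -> R).
Notation leb := (@lebesgue_measure R).

Lemma Rint_hasD F f (a b : R) : hasD F f -> continuous f -> a <= b ->
  Rintegral leb `[a, b] f = F b - F a.
Proof.
move=> hF cf; rewrite le_eqVlt => /orP[/eqP <-|ab]; first by rewrite set_itv1 Rintegral_set1 subrr.
have cF := hasD_cont hF.
rewrite /Rintegral (@continuous_FTC2 R f F a b ab)//.
- exact: continuous_subspaceT.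
- split.
  + by move=> x _; have [] := hF x.
  + by apply: cvg_at_right_filter; exact: cF.
  + by apply: cvg_at_left_filter; exact: cF.
- by move=> x _; rewrite derive1E; have [_ ->] := hF x.
Qed.

(** F(t) is the integral of t f (t s) over s in [0, 1], which makes sense for negative t as well.
    Differentiating under the integral gives the derivative in s of s f (t s), whose integral over
    [0, 1] is f t. *)
Lemma antiderivative f df (K : R) : hasD f df -> continuous df ->
  (forall x, `|f x| <= K) -> (forall x, `|df x| <= K) -> exists2 F, F 0 = 0 & hasD F f.
Proof.
move=> hf cdf fK dfK; have cf := hasD_cont hf.
have K0 : 0 <= K by rewrite (le_trans _ (fK 0)).
pose g (t s : R) := t * f (t * s).
pose dg (t s : R) := f (t * s) + s * (t * df (t * s)).
have hg t s : is_derive t (1 : R) (g^~ s) (dg t s).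
  have h := hasDM hasD_id (hasD_comp hf (hasDM hasD_id (hasD_cst s))).
  by apply: (is_derive_eq (h t)); rewrite /dg; ring.
have hs t : hasD (fun s => s * f (t * s)) (dg t).
  have h := hasDM hasD_id (hasD_comp hf (hasDM (hasD_cst t) hasD_id)).
  by apply: (hasD_eq h) => s; rewrite /dg; ring.
have cM1 t : continuous (fun s : R => t * s) by apply: cZ => x; exact: cvg_id.
have cg t : continuous (g t) by apply: cZ => s; apply: continuous_comp; [exact: cM1|exact: cf].
have cdg t : continuous (dg t).
  apply: cD; first by move=> s; apply: continuous_comp; [exact: cM1|exact: cf].
  apply: cM; first by move=> x; exact: cvg_id.
  by apply: cZ => s; apply: continuous_comp; [exact: cM1|exact: cdf].
exists (fun t => Rintegral leb `[0, 1] (g t)).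
  rewrite (_ : g 0 = fun=> 0); last by apply/funext => s; rewrite /g mul0r.
  by rewrite Rintegral_cst// mul0r.
move=> t.
have E t' : Rintegral leb `[0, 1] (dg t') = f t'.
  by rewrite (Rint_hasD (hs t') (cdg t')) ?ler01// mul1r mulr1 mul0r subr0.
have mI : measurable (`[0, 1]%classic : set (measurableTypeR R)) by exact: measurable_itv.
have int01 (h : R -> R) : continuous h -> leb.-integrable `[0, 1] (EFin \o h).
  by move=> ch; apply: continuous_compact_integrable; [exact: segment_compact|exact: continuous_subspaceT].
have It : `](t - 1), (t + 1)[%classic t by rewrite /= in_itv/=; apply/andP; split; lra.
have H1 : forall x, `](t - 1), (t + 1)[%classic x -> leb.-integrable `[0, 1] (EFin \o (fun s => g x s)).
  by move=> x _; exact: int01.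
have H2 : forall (x : R) (s : R), `](t - 1), (t + 1)[%classic x -> `[0, 1]%classic s -> derivable (g^~ s) x 1.
  by move=> x s _ _; have [] := hg x s.
pose B := K + (`|t| + 1) * K.
have B0 : 0 <= B by rewrite addr_ge0// mulr_ge0// addr_ge0.
have H3 : forall (x : R) (s : R), `](t - 1), (t + 1)[%classic x -> `[0, 1]%classic s ->
    `|partial1of2 (fun t s => g t s) x s| <= B.
  move=> x s; rewrite /= !in_itv/= => /andP[x1 x2] /andP[s0 s1].
  rewrite partial1of2E (@derive_val _ _ _ _ _ _ _ (hg x s)) /dg (le_trans (ler_normD _ _))// lerD// !normrM.
  have hx : `|x| <= `|t| + 1.
    by rewrite -[x](subrK t) addrC (le_trans (ler_normD _ _))// lerD2l ler_norml; apply/andP; split; lra.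
  rewrite -[leRHS]mul1r ler_pM ?mulr_ge0//; first by rewrite ger0_norm.
  by rewrite ler_pM.
have iB : leb.-integrable `[0, 1] (EFin \o (fun=> B)) by apply: int01; exact: cst_continuous.
have d := @derivable_under_integral R _ (measurableTypeR R) leb (fun t s => g t s) `[0, 1] mI t _ _ It H1 H2 (fun=> B) (fun=> B0) iB H3.
have e := @differentiation_under_integral R _ (measurableTypeR R) leb (fun t s => g t s) `[0, 1] mI t _ _ It H1 H2 (fun=> B) (fun=> B0) iB H3.
split; first exact: d.
rewrite -derive1E [LHS]e -E; apply: eq_Rintegral => s _.
by rewrite partial1of2E (@derive_val _ _ _ _ _ _ _ (hg t s)).
Qed.

Lemma hasD0_cst F : hasD F (fun=> 0) -> forall x y, F x = F y.
Proof.
move=> hF x y; wlog xy : x y / x <= y.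
  by move=> h; case: (leP x y) => [|/ltW] xy; [|symmetry]; exact: h.
have [c _] := hasD_mvt hF xy; rewrite mul0r => /eqP; rewrite subr_eq0 => /eqP -> //.
Qed.

Lemma hasD_shift F f (p : R) : hasD F f -> hasD (fun t => F (t + p)) (fun t => f (t + p)).
Proof.
move=> hF; have h := hasD_comp hF (hasDD hasD_id (hasD_cst p)).
by apply: (hasD_eq h) => x; rewrite addr0 mulr1.
Qed.

Lemma periodic_antiderivative F f t : hasD F f -> periodic2pi f -> F (t + 2 * pi) = F t + (F (2 * pi) - F 0).
Proof.
move=> hF pf.
have h : hasD (fun t => F (t + 2 * pi) - F t) (fun=> 0).
  by apply: (hasD_eq (hasDB (hasD_shift (2 * pi) hF) hF)) => x; rewrite pf subrr.
have h0 := hasD0_cst h t 0; rewrite add0r in h0; rewrite -h0; ring.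
Qed.

Lemma periodic_int (T : Type) (f : R -> T) (k : int) t : periodic2pi f -> f (t + k%:~R * (2 * pi)) = f t.
Proof.
move=> pf; have P n s : f (s + n%:R * (2 * pi)) = f s.
  by elim: n s => [|n IH] s; [rewrite mul0r addr0|rewrite -natr1 mulrDl mul1r addrA pf].
case: k => n; first exact: P.
by rewrite NegzE mulrNz mulNr -(P n.+1 (t - _)) subrK.
Qed.

Lemma periodic_reduce (c t : R) : exists k : int, c - pi <= t + k%:~R * (2 * pi) <= c + pi.
Proof.
have p0 : 0 < 2 * pi :> R by rewrite mulr_gt0// pi_gt0.
exists (- Num.floor ((t - (c - pi)) / (2 * pi))).
set y := (t - (c - pi)) / (2 * pi).
have := floor_itv y; rewrite intrD => /andP[y1 y2].
have ty : t = c - pi + y * (2 * pi) by rewrite /y divfK ?gt_eqF// addrC subrK.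
rewrite mulrNz mulNr.
have h1 : (Num.floor y)%:~R * (2 * pi) <= y * (2 * pi) by rewrite ler_wpM2r// ltW.
have h2 : y * (2 * pi) <= ((Num.floor y)%:~R + 1) * (2 * pi) by rewrite ler_wpM2r// ltW.
by apply/andP; split; lra.
Qed.

Lemma cos_le_out (e s : R) : 0 < e -> e <= pi -> e <= `|s| -> `|s| <= 2 * pi - e -> cos s <= cos e.
Proof.
move=> e0 ep es se.
have cn : cos s = cos `|s| by case: (leP 0 s) => [/ger0_norm ->//|/ltr0_norm ->]; rewrite cosN.
rewrite cn; have [sp|sp] := leP `|s| pi.
  by rewrite leNgt ltr_cos -?leNgt// in_itv/= ?normr_ge0// ltW//.
have -> : cos `|s| = cos (2 * pi - `|s|).
  by rewrite -(cosN (2 * pi - _)) opprB -(cosD2pi (_ - _)) mulr_natl subrK.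
rewrite leNgt ltr_cos -?leNgt ?in_itv/=; last 2 first.
- by apply/andP; split; lra.
- by apply/andP; split; lra.
by lra.
Qed.

Lemma cos_gt_in (e s : R) : 0 < e -> e <= pi -> `|s| < e -> cos e < cos s.
Proof.
move=> e0 ep es.
have cn : cos s = cos `|s| by case: (leP 0 s) => [/ger0_norm ->//|/ltr0_norm ->]; rewrite cosN.
by rewrite cn ltr_cos ?in_itv/= ?normr_ge0/= ?(ltW (lt_le_trans es ep)) ?ep ?(ltW e0).
Qed.

(* The bump cosbump q e is supported near q modulo 2 pi, where cos (t - q) > cos e. *)
Definition cosbump (q e : R) (k : nat) (t : R) : R :=
  bump 1 1 (fun s => cos (s - q) - cos e) (fun s => cos (s - q)) (fun s => sin (s - q)) k t.

Lemma cosbump_hasD q e k : hasD (cosbump q e k) (cosbump q e k.+1).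
Proof.
have hsub : hasD (fun s : R => s - q) (fun=> 1 - 0) by apply: hasDB; [exact: hasD_id|exact: hasD_cst].
have hc : hasD (fun s => cos (s - q)) (fun s => - (1 * sin (s - q))).
  have h : hasD (@cos R) (fun x => - sin x) by move=> x; exact: is_derive_cos.
  by apply: (hasD_eq (hasD_comp h hsub)) => x; rewrite subr0 mulr1 mul1r.
apply: hasD_bump.
- by apply: (hasD_eq (hasDB hc (hasD_cst (cos e)))) => x; rewrite subr0 mulNr.
- by apply: (hasD_eq hc) => x; rewrite mulNr.
- have h : hasD (@sin R) (@cos R) by move=> x; exact: is_derive_sin.
  by apply: (hasD_eq (hasD_comp h hsub)) => x; rewrite subr0 mulr1.
Qed.

Lemma cosbump_periodic q e k : periodic2pi (cosbump q e k).
Proof.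
move=> t; pose F k t := cosbump q e k (t + 2 * pi).
rewrite -/(F k t) -(@Dk_jet _ F) => [|j]; last by apply: hasD_shift; exact: cosbump_hasD.
rewrite (_ : F 0%N = cosbump q e 0%N) ?Dk_jet//; first by move=> j; exact: cosbump_hasD.
by apply/funext => s; rewrite /F /cosbump !bump0E addrAC mulr_natl cosD2pi.
Qed.

Lemma cosbump_le q e k t : `|cosbump q e k t| <= (12 ^ k * k`! ^ 3)%:R.
Proof.
apply: bump_le; rewrite ?normr1// => s.
- by rewrite ler_norml cos_geN1 cos_le1.
- by rewrite ler_norml sin_geN1 sin_le1.
Qed.

Lemma cosbump_out q e k t : cos (t - q) <= cos e -> cosbump q e k t = 0.
Proof. by move=> h; apply: bump_out; rewrite subr_le0. Qed.

Lemma cosbump_ge0 q e t : 0 <= cosbump q e 0 t.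
Proof. by rewrite /cosbump bump0E flat_ge0. Qed.

Lemma cosbump_gt0 q e t : cos e < cos (t - q) -> 0 < cosbump q e 0 t.
Proof. by move=> h; rewrite /cosbump bump0E flat_gt0// subr_gt0. Qed.

Lemma cosbump_antiderivative q e : exists F, hasD F (cosbump q e 0).
Proof.
have b0 t : `|cosbump q e 0 t| <= 12 by rewrite (le_trans (cosbump_le q e 0 t))// ler_nat.
have b1 t : `|cosbump q e 1 t| <= 12 by rewrite (le_trans (cosbump_le q e 1 t))// ler_nat.
have [F _ hF] := antiderivative (cosbump_hasD q e 0) (hasD_cont (cosbump_hasD q e 1)) b0 b1.
by exists F.
Qed.

Lemma cosbump_int_gt0 q e F (p p' : R) : hasD F (cosbump q e 0) -> 0 < e -> e <= pi -> p <= q -> q < p' -> F p < F p'.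
Proof.
move=> hF e0 ep pq qp.
have mono x y : x <= y -> F x <= F y.
  move=> xy; have [c _ h] := hasD_mvt hF xy.
  by rewrite -subr_ge0 h mulr_ge0 ?cosbump_ge0// subr_ge0.
pose r := Num.min (q + e / 2) p'.
have qr : q < r by rewrite lt_min qp andbT ltrDl divr_gt0.
have [c /andP[qc cr] h] := hasD_mvt hF (ltW qr).
apply: (le_lt_trans (mono _ _ pq)); apply: (@lt_le_trans _ _ (F r)); last first.
  by apply: mono; rewrite ge_min lexx orbT.
rewrite -subr_gt0 h mulr_gt0 ?subr_gt0// cosbump_gt0// cos_gt_in//.
have : r <= q + e / 2 by rewrite ge_min lexx.
by move=> hr; rewrite ger0_norm ?subr_ge0//; lra.
Qed.

Lemma cosbump_supp q e k t : 0 < e -> e <= pi -> cosbump q e k t != 0 -> exists z : int, `|t + z%:~R * (2 * pi) - q| < e.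
Proof.
move=> e0 ep; have [z /andP[h1 h2]] := periodic_reduce q t.
rewrite -(periodic_int z t (cosbump_periodic q e k)) => nz; exists z.
rewrite ltNge; apply: contra nz => h; apply/eqP; apply: cosbump_out; apply: cos_le_out => //.
have : `|t + z%:~R * (2 * pi) - q| <= pi by rewrite ler_norml; apply/andP; split; lra.
by lra.
Qed.

(* A combination of two bumps with total mean zero that carries mass between P1 and P2. *)
Lemma kappa_exists (P1 Q1 P2 Q2 d : R) : 0 <= P1 -> P1 < Q1 -> Q1 < P2 -> P2 < 2 * pi -> 0 <= Q2 -> Q2 < 2 * pi ->
  Q2 < P1 \/ P2 < Q2 -> 0 < d ->
  exists (kp : nat -> R -> R) (Kp : R -> R) (K : R),
   [/\ (forall k, hasD (kp k) (kp k.+1)) /\ hasD Kp (kp 0%N), forall k, periodic2pi (kp k),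
       0 <= K /\ forall k t, `|kp k t| <= K * 12 ^+ k * k`!%:R ^+ 3,
       Kp (2 * pi) = Kp 0 /\ Kp P1 < Kp P2 &
       forall k t, kp k t != 0 -> exists z : int,
         `|t + z%:~R * (2 * pi) - Q1| < d \/ `|t + z%:~R * (2 * pi) - Q2| < d].
Proof.
move=> P10 PQ QP P22 Q20 Q22 Qo d0.
(* On [P1, P2] the point Q2 stays at distance at least e1 modulo 2 pi, so a bump at Q2 of width e <=
   e1 vanishes there. *)
have [e1 e10 he1] : exists2 e1, 0 < e1 & forall t, P1 <= t <= P2 -> e1 <= `|t - Q2| /\ `|t - Q2| <= 2 * pi - e1.
  case: Qo => h.
    exists (Num.min (P1 - Q2) (2 * pi - (P2 - Q2))); first by rewrite lt_min; apply/andP; split; lra.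
    move=> t /andP[t1 t2]; rewrite ger0_norm; last by lra.
    have : Num.min (P1 - Q2) (2 * pi - (P2 - Q2)) <= P1 - Q2 by rewrite ge_min lexx.
    have : Num.min (P1 - Q2) (2 * pi - (P2 - Q2)) <= 2 * pi - (P2 - Q2) by rewrite ge_min lexx orbT.
    by set x := Num.min _ _; split; lra.
  exists (Num.min (Q2 - P2) (2 * pi - (Q2 - P1))); first by rewrite lt_min; apply/andP; split; lra.
  move=> t /andP[t1 t2]; rewrite ler0_norm; last by lra.
  have : Num.min (Q2 - P2) (2 * pi - (Q2 - P1)) <= Q2 - P2 by rewrite ge_min lexx.
  have : Num.min (Q2 - P2) (2 * pi - (Q2 - P1)) <= 2 * pi - (Q2 - P1) by rewrite ge_min lexx orbT.
  by set x := Num.min _ _; split; lra.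
pose e := Num.min d (Num.min e1 1).
have ed : e <= d by rewrite ge_min lexx.
have ee1 : e <= e1 by rewrite /e !ge_min lexx !orbT.
have ep : e <= pi.
  by have := pi_ge2 R; have : e <= 1; [rewrite /e !ge_min lexx !orbT|lra].
have e0 : 0 < e by rewrite /e !lt_min d0 e10 ltr01.
have [F1 hF1] := cosbump_antiderivative Q1 e; have [F2 hF2] := cosbump_antiderivative Q2 e.
(* Each bump is multiplied by the integral of the other, with opposite signs: the total mean is
   zero. *)
pose a1 := F2 (2 * pi) - F2 0; pose a2 := F1 (2 * pi) - F1 0.
have a10 : 0 < a1 by rewrite subr_gt0; apply: (cosbump_int_gt0 hF2).
have a20 : 0 <= a2.
  by rewrite subr_ge0 ltW//; apply: (cosbump_int_gt0 hF1) => //; lra.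
exists (fun k t => a1 * cosbump Q1 e k t - a2 * cosbump Q2 e k t), (fun t => a1 * F1 t - a2 * F2 t), (a1 + a2).
split.
- split; first by move=> k; apply: hasDB; apply: hasDZ; exact: cosbump_hasD.
  by apply: hasDB; apply: hasDZ.
- by move=> k t; rewrite !cosbump_periodic.
- split; first by rewrite addr_ge0// ltW.
  move=> k t; rewrite -mulrA.
  have b q : `|cosbump q e k t| <= 12 ^+ k * k`!%:R ^+ 3 by rewrite (le_trans (cosbump_le _ _ _ _))// natrM !natrX.
  rewrite (le_trans (ler_normB _ _))// !normrM (gtr0_norm a10) (ger0_norm a20) [leRHS]mulrDl.
  by rewrite lerD// ler_wpM2l// ltW.
- split; first by rewrite /a1 /a2; ring.
  rewrite (_ : F2 P2 = F2 P1); first by rewrite ltrD2r ltr_pM2l//; apply: (cosbump_int_gt0 hF1) => //; lra.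
  have P12 : P1 <= P2 by lra.
  have [c cP] := hasD_mvt hF2 P12; have [h1 h2] := he1 c cP.
  rewrite cosbump_out ?mul0r; first by move/eqP; rewrite subr_eq0 => /eqP.
  by apply: cos_le_out => //; lra.
move=> k t; have [->|nz1 _] := eqVneq (cosbump Q1 e k t) 0.
  have [->|nz2 _] := eqVneq (cosbump Q2 e k t) 0; first by rewrite !mulr0 subrr eqxx.
  by have [z hz] := cosbump_supp e0 ep nz2; exists z; right; exact: lt_le_trans hz ed.
by have [z hz] := cosbump_supp e0 ep nz1; exists z; left; exact: lt_le_trans hz ed.
Qed.

End Antiderivatives.

(** * Alternating points on the circle *)

Section Configuration.
Context {R : realType}.

Lemma circle_connected (I : set R) (A : set (R * R)) : is_interval I ->
  A = (fun t : R => (cos t, sin t)) @` I -> connected A.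
Proof.
move=> /connected_intervalP cI ->; apply: connected_continuous_connected => //.
apply: continuous_subspaceT => t.
by apply: (@cvg_pair _ _ _ (nbhs t) (nbhs (cos t)) (nbhs (sin t)) _ _ _ (@cos R) (@sin R)); [exact: continuous_cos|exact: continuous_sin].
Qed.

Lemma not_interval (I : set R) : ~ is_interval I -> exists x y z, [/\ I x, I y, x < z, z < y & ~ I z].
Proof.
move=> nI; apply: contrapT => h; apply: nI => x y Ix Iy z /andP[xz zy].
rewrite le_eqVlt in xz; rewrite le_eqVlt in zy.
case/orP: xz => [/eqP <-//|xz]; case/orP: zy => [/eqP ->//|zy].
by apply: contrapT => nz; apply: h; exists x, y, z.
Qed.

(** If the part of [0, 2 pi) above the level r, or its complement there, were an interval, Omega
    would be an arc and hence connected. So neither is an interval, and the two failures supply the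
    high and low points to be combined. *)
Lemma alternating (b : R -> R) (r : R) : ~ connected (Omega b r) ->
  exists p1 q1 p2 q2 : R, [/\ [/\ 0 <= p1, p1 < q1, q1 < p2 & p2 < 2 * pi], 0 <= q2 < 2 * pi,
    q2 < p1 \/ p2 < q2 & [/\ r < prim b p1, r < prim b p2, prim b q1 <= r & prim b q2 <= r]].
Proof.
rewrite /Omega; move: (prim b) => g; have [T TE] : exists T : R, T = 2 * pi by exists (2 * pi).
have cT t : cos (t + T) = cos t by rewrite TE mulr_natl cosD2pi.
have sT t : sin (t + T) = sin t by rewrite TE mulr_natl sinD2pi.
rewrite -TE => nc; pose I := [set t : R | (0 <= t < T) /\ r < g t].
pose J := [set t : R | (0 <= t < T) /\ g t <= r].
have [|p1 [p2 [q1 [[p10 rp1] [p22 rp2] pq qp nq1]]]] := @not_interval I.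
  by move=> iI; apply: nc; exact: (circle_connected iI).
have in02 (x y z : R) : 0 <= x < T -> 0 <= y < T -> x < z -> z < y -> 0 <= z < T.
  by move=> /andP[? ?] /andP[? ?] ? ?; apply/andP; split; lra.
have q10 := in02 _ _ _ p10 p22 pq qp.
have rq1 : g q1 <= r by rewrite leNgt; apply/negP => h; apply: nq1.
have [|x [y [s [[x0 rx] [y0 ry] xs sy ns]]]] := @not_interval J.
  (* The complement of an arc is an arc: unwrap the circle at the gap J. *)
  move=> iJ; apply: nc.
  pose I' := [set t : R | [\/ (0 <= t < q1) /\ r < g t | (t < 0) /\ (q1 < t + T /\ r < g (t + T))]].
  have low t : 0 <= t < q1 -> r < g t -> forall t', 0 <= t' <= t -> r < g t'.
    move=> /andP[t0 tq] rt t' /andP[t'0 t't]; rewrite ltNge; apply/negP => ht'.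
    have Jt' : J t' by split=> //; move: q10 => /andP[? ?]; apply/andP; split; lra.
    have Jq : J q1 by split.
    have [_] : J t by apply: (iJ t' q1) => //; rewrite t't ltW.
    by rewrite leNgt rt.
  have high t : q1 < t < T -> r < g t -> forall t', t <= t' < T -> r < g t'.
    move=> /andP[t0 tq] rt t' /andP[t't t'2]; rewrite ltNge; apply/negP => ht'.
    have Jt' : J t' by split=> //; move: q10 => /andP[? ?]; apply/andP; split; lra.
    have Jq : J q1 by split.
    have [_] : J t by apply: (iJ q1 t') => //; rewrite t't ltW.
    by rewrite leNgt rt.
  have z0 : r < g 0 by apply: (low p1) => //; [move: p10 => /andP[? ?]; apply/andP; split|move: p10 => /andP[-> _]; rewrite lexx].
  apply: (@circle_connected I').
    move=> u v Iu Iv w /andP[uw wv]; have [w0|w0] := leP 0 w.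
      left; case: Iv => -[]; last by move=> v0; lra.
      move=> hv rv; split; first by move: hv => /andP[? ?]; apply/andP; split; lra.
      by apply: (low v) => //; rewrite w0.
    right; case: Iu => -[]; first by move=> /andP[? ?]; lra.
    move=> u0 [qu ru]; split=> //; split; first by lra.
    by apply: (high (u + T)) => //; apply/andP; split; lra.
  apply/seteqP; split => [_ [t [t02 rt] <-]|_ [t It <-]].
    have [tq|tq] := ltP t q1.
      by exists t => //; left; split=> //; move: t02 => /andP[-> _].
    have tq' : q1 < t.
      by rewrite lt_neqAle tq andbT; apply/eqP => e; move: rt; rewrite -e ltNge rq1.
    exists (t - T).
      right; rewrite subrK; split; last by split.
      by move: t02 => /andP[_]; rewrite subr_lt0.
    by rewrite -[in RHS](subrK T t) cT sT.
  case: It => -[].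
    move=> /andP[t0 tq] rt; exists t => //; split=> //.
    by rewrite t0/= (lt_trans tq)//; move: q10 => /andP[].
  move=> t0 [qt rt]; exists (t + T); last by rewrite cT sT.
  by split=> //; move: q10 => /andP[? ?]; apply/andP; split; lra.
have rs : r < g s.
  by rewrite ltNge; apply/negP => h; apply: ns; split=> //; exact: in02 x0 y0 xs sy.
(* The second low point must lie outside the interval between the two high points. If x or y lies
   outside [p1, p2] it serves; otherwise p1 < x < s < y already alternate. *)
have [h|h] := ltP x p1.
  exists p1, q1, p2, x; split=> //; [split=> //; [by move: p10 => /andP[]|by move: p22 => /andP[]]|by left].
have [h'|h'] := ltP p2 y.
  exists p1, q1, p2, y; split=> //; [split=> //; [by move: p10 => /andP[]|by move: p22 => /andP[]]|by right].
have h1 : p1 < x.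
  by rewrite lt_neqAle h andbT; apply/eqP => e; move: rp1; rewrite e ltNge rx.
exists p1, x, s, y; split=> //; last by right.
by split=> //; [move: p10 => /andP[]|have /andP[] := in02 _ _ _ x0 y0 xs sy].
Qed.

(* The roles of the p's and of the q's are exchanged when the eigenvalues are negative. *)
Lemma alternating_sign (b : R -> R) (r ep : R) : ~ connected (Omega b r) -> ep = 1 \/ ep = -1 ->
  exists P1 Q1 P2 Q2 rho eta : R, [/\ [/\ 0 <= P1, P1 < Q1, Q1 < P2 & P2 < 2 * pi], 0 <= Q2 < 2 * pi,
    Q2 < P1 \/ P2 < Q2, 0 < eta & [/\ rho + eta <= ep * prim b P1, rho + eta <= ep * prim b P2,
      ep * prim b Q1 <= rho - eta & ep * prim b Q2 <= rho - eta]].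
Proof.
move=> /alternating [p1 [q1 [p2 [q2 [[p10 pq qp p22] /andP[q20 q22] out [b1 b2 b3 b4]]]]]].
move: (prim b) (2 * pi : R) b1 b2 b3 b4 p22 q22 => g T b1 b2 b3 b4 p22 q22.
(* The new level is the midpoint of r and the lower of the two high values, and eta is half their
   gap; this makes the inequalities strict on both sides. *)
pose top := Num.min (g p1) (g p2).
have rt : r < top by rewrite lt_min b1.
have t1 : top <= g p1 by rewrite ge_min lexx.
have t2 : top <= g p2 by rewrite ge_min lexx orbT.
case=> ->.
  exists p1, q1, p2, q2, ((r + top) / 2), ((top - r) / 2); split=> //; first by rewrite q20.
    by lra.
  by rewrite !mul1r; split; lra.
case: out => out.
  exists q2, p1, q1, p2, (- ((r + top) / 2)), ((top - r) / 2); split.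
  - by split=> //; lra.
  - by apply/andP; split; lra.
  - by right.
  - by lra.
  - by rewrite !mulN1r; split; lra.
exists q1, p2, q2, p1, (- ((r + top) / 2)), ((top - r) / 2); split.
- by split=> //; lra.
- by apply/andP; split; lra.
- by left.
- by lra.
- by rewrite !mulN1r; split; lra.
Qed.

End Configuration.

(** * Time coefficients of the right-hand side *)

Section PhaseJets.
Context {R : realType}.
Implicit Types (f F : R -> R).

(** The real Gevrey exponent is raised to an integer at least 3, the order of the bumps. Quantifying
    over S' lets a and b share one exponent. *)
Lemma gevrey_nat f : gevrey_T f -> exists (S : nat) (K C : R), [/\ (2 < S)%N, 0 <= K, 0 <= C, smooth1 f &
  forall S', (S <= S')%N -> forall k t, `|Dk k f t| <= K * C ^+ k * k`!%:R ^+ S'].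
Proof.
move=> [_ sf [s [s1 [C [K [C0 H]]]]]].
exists (maxn 3 (Num.truncn s).+1), `|K|, C; split=> //; [by rewrite leq_max|exact: ltW|].
move=> S' hS' k t; apply: (le_trans (H k t)).
have f1 : 1 <= k`!%:R :> R by rewrite ler1n fact_gt0.
have pq : k`!%:R `^ s <= k`!%:R ^+ S' :> R.
  rewrite -powR_mulrn//; apply: ler_powR => //.
  have /andP[_ /ltW h] := truncn_itv (le_trans ler01 s1).
  by rewrite (le_trans h)// ler_nat (leq_trans _ hS')// leq_max leqnn orbT.
have C0' : 0 <= C ^+ k by rewrite exprn_ge0// ltW.
apply: (@le_trans _ _ (`|K| * C ^+ k * k`!%:R `^ s)).
  by rewrite ler_wpM2r ?powR_ge0// ler_wpM2r// ler_norm.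
by rewrite ler_wpM2l// mulr_ge0.
Qed.

(** Combinations p x + q y with smooth p and q are closed under differentiation, by the linear
    system that x and y satisfy. *)
Lemma exp_pair_smooth (x y u v : R -> R) : smooth1 u -> smooth1 v ->
  hasD x (fun s => u s * x s + - 1 * (v s * y s)) -> hasD y (fun s => u s * y s + v s * x s) ->
  smooth1 x /\ smooth1 y.
Proof.
move=> su sv hx hy.
have sM f g : smooth1 f -> smooth1 g -> smooth1 (fun s => f s * g s) by exact: (@rsmoothM R R^o).
have sD f g : smooth1 f -> smooth1 g -> smooth1 (fun s => f s + g s) by exact: (@rsmoothD R R^o).
have sZ c f : smooth1 f -> smooth1 (fun s => c * f s) by exact: (@rsmoothZ R R^o c f).
have sC (c : R) : smooth1 (fun=> c) by exact: (@rsmooth_cst R R^o c).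
pose P (f : R -> R) := exists p q : R -> R, [/\ smooth1 p, smooth1 q & f = fun s => p s * x s + q s * y s].
have H f : P f -> smooth1 f.
  apply: (@rsmooth_coind R R^o P) => [_ [p [q [sp sq ->]]]|_ w [p [q [sp sq ->]]]].
    have h : hasD (fun s => p s * x s + q s * y s) _ := hasDD (hasDM (Dk_hasD 0%N sp) hx) (hasDM (Dk_hasD 0%N sq) hy).
    have hc := hasD_cont h; by move=> s; exact: hc.
  pose p' s := Dk 1%N p s + (p s * u s + q s * v s).
  pose q' s := Dk 1%N q s + (q s * u s + - 1 * (p s * v s)).
  have s1 (g : R -> R) : smooth1 g -> smooth1 (Dk 1%N g) by move=> sg; exact: (@jet_smooth1 R (fun j => Dk j.+1 g) (fun j => Dk_hasD j.+1 sg)).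
  exists (fun s => (w * p' s) * x s + (w * q' s) * y s).
    exists (fun s => w * p' s), (fun s => w * q' s); split.
    - by apply: sZ; apply: (sD _ _ (s1 _ sp)); apply: sD; exact: sM.
    - by apply: (sZ w); apply: (sD _ _ (s1 _ sq)); apply: (sD _ _ (sM _ _ sq su)); apply: (sZ (-1)); exact: sM.
    - by [].
  move=> s; rewrite (_ : w * p' s * x s + w * q' s * y s = w * (p' s * x s + q' s * y s)); last by ring.
  apply: is_derive_dir; have h := hasDD (hasDM (Dk_hasD 0%N sp) hx) (hasDM (Dk_hasD 0%N sq) hy).
  apply: (is_derive_eq (h s)); rewrite -[Dk 0%N p s]/(p s) -[Dk 0%N q s]/(q s) /p' /q'.
  by move: (Dk 1%N p s) (Dk 1%N q s) => d1 d2; ring.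
split; apply: H.
  by exists (fun=> 1), (fun=> 0); split; [exact: sC|exact: sC|apply/funext => s; ring].
by exists (fun=> 0), (fun=> 1); split; [exact: sC|exact: sC|apply/funext => s; ring].
Qed.

Context (A B a b : R -> R) (rho ep : R) (kp : nat -> R -> R).
Hypotheses (hA : hasD A a) (hB : hasD B b) (sa : smooth1 a) (sb : smooth1 b).
Hypothesis hkp : forall k, hasD (kp k) (kp k.+1).

(* Real and imaginary parts of exp (- mu rho - i l (A + i B)), where mu = ep * l = |l|. *)
Definition cxp (l t : R) : R := expR (l * B t - ep * l * rho) * cos (l * A t).
Definition cyp (l t : R) : R := - (expR (l * B t - ep * l * rho) * sin (l * A t)).

Lemma cxp_hasD l : hasD (cxp l) (fun s => (l * b s) * cxp l s + - 1 * ((- l * a s) * cyp l s)) /\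
  hasD (cyp l) (fun s => (l * b s) * cyp l s + (- l * a s) * cxp l s).
Proof.
have hE : hasD (fun s => expR (l * B s - ep * l * rho)) (fun s => expR (l * B s - ep * l * rho) * (l * b s - 0)).
  by apply: hasD_exp; apply: hasDB; [exact: hasDZ|exact: hasD_cst].
have hc : hasD (@cos R) (fun x => - sin x) by move=> x; exact: is_derive_cos.
have hs : hasD (@sin R) (@cos R) by move=> x; exact: is_derive_sin.
split.
  by apply: (hasD_eq (hasDM hE (hasD_comp hc (hasDZ l hA)))) => s; rewrite /cxp /cyp; ring.
by apply: (hasD_eq (hasDN (hasDM hE (hasD_comp hs (hasDZ l hA))))) => s; rewrite /cxp /cyp; ring.
Qed.

Lemma cxp_smooth l : smooth1 (cxp l) /\ smooth1 (cyp l).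
Proof.
have [h1 h2] := cxp_hasD l; apply: (exp_pair_smooth _ _ h1 h2); [exact: (@rsmoothZ R R^o l b sb)|exact: (@rsmoothZ R R^o (- l) a sa)].
Qed.

Definition cre (l t : R) : R := kp 0 t * cxp l t.
Definition cim (l t : R) : R := kp 0 t * cyp l t.

Lemma cre_smooth l : smooth1 (cre l) /\ smooth1 (cim l).
Proof.
have [h1 h2] := cxp_smooth l; have h := jet_smooth1 hkp.
by split; [exact: (@rsmoothM R R^o _ _ h h1)|exact: (@rsmoothM R R^o _ _ h h2)].
Qed.

(** Where some derivative of kappa is nonzero, the exponential has size at most exp (- 2 th |l|).
    Its j-th derivative brings powers of 1 + |l|, and (th (1 + |l|))^j <= j! exp (th (1 + |l|))
    trades them for one more factorial, whence S + 1, and for half of the decay. *)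
Lemma cre_bound (S : nat) (K C K' th : R) : (2 < S)%N -> 0 <= K -> 0 <= C -> 0 <= K' -> 0 < th ->
  (forall k t, `|Dk k a t| <= K * C ^+ k * k`!%:R ^+ S) ->
  (forall k t, `|Dk k b t| <= K * C ^+ k * k`!%:R ^+ S) ->
  (forall k t, `|kp k t| <= K' * 12 ^+ k * k`!%:R ^+ 3) ->
  (forall k t, kp k t != 0 -> ep * B t <= rho - 2 * th) -> ep = 1 \/ ep = -1 ->
  exists2 D : R, 0 <= D & forall l, 0 <= ep * l -> forall k t,
    `|Dk k (cre l) t| <= 2 * K' * expR th * expR (- th * (ep * l)) * D ^+ k * k`!%:R ^+ S.+1 /\
    `|Dk k (cim l) t| <= 2 * K' * expR th * expR (- th * (ep * l)) * D ^+ k * k`!%:R ^+ S.+1.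
Proof.
move=> S2 K0 C0 K'0 th0 ba bb bk supp epE.
have S0 : (0 < S)%N by apply: leq_trans S2.
(* D0 th (1 + |l|) dominates the constant of [exp_jet_le] for the data scaled by |l|; the summand 24
   is twice the geometric constant 12 of kappa. *)
pose D0 := (2 * C + 4 * K) / th; pose D := 24 + D0.
have D00 : 0 <= D0 by rewrite divr_ge0 ?addr_ge0 ?mulr_ge0// ltW.
have Dge : 0 <= D by rewrite addr_ge0.
exists D => // l l0 k t.
pose mu := ep * l; have mu0 : 0 <= mu by [].
have lmu : `|l| = mu.
  by rewrite /mu; move: l0; case: epE => ->; rewrite ?mul1r ?mulN1r => l0; [rewrite ger0_norm|rewrite ler0_norm// -oppr_ge0].
have lep : l = ep * mu.
  by rewrite /mu mulrA; case: epE => ->; rewrite ?mulrNN !mul1r.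
have [hx hy] := cxp_hasD l; have [sx sy] := cxp_smooth l.
have sl c f : smooth1 f -> smooth1 (fun s => c * f s) by exact: (@rsmoothZ R R^o c f).
pose X := expR (l * B t - ep * l * rho).
have X0 : 0 <= X := expR_ge0 _.
have bl c f j : `|c| = mu -> smooth1 f -> (forall k t, `|Dk k f t| <= K * C ^+ k * k`!%:R ^+ S) ->
    `|Dk j (fun s => c * f s) t| <= (mu * K) * C ^+ j * j`!%:R ^+ S.
  move=> cm sf bf; rewrite DkZ// normrM cm.
    rewrite [leRHS](_ : _ = mu * (K * C ^+ j * j`!%:R ^+ S)); last by ring.
    by rewrite ler_wpM2l.
have mK : 0 <= mu * K by rewrite mulr_ge0.
have xX : `|cxp l t| <= X by rewrite /cxp normrM ger0_norm// ler_piMr// ler_norml cos_geN1 cos_le1.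
have yX : `|cyp l t| <= X by rewrite /cyp normrN normrM ger0_norm// ler_piMr// ler_norml sin_geN1 sin_le1.
have nl : `|- l| = mu by rewrite normrN.
have jets := exp_jet_le S0 mK C0 X0 sx sy (sl l b sb) (sl (- l) a sa) hx hy
  (fun j => bl l b j lmu sb bb) (fun j => bl (- l) a j nl sa ba) xX yX.
pose Y := X * expR (th * (1 + mu)).
have Y0 : 0 <= Y by rewrite mulr_ge0// expR_ge0.
have up j : X * (2 * C + 4 * (mu * K)) ^+ j * j`!%:R ^+ S <= Y * D0 ^+ j * j`!%:R ^+ S.+1.
  have h1 : (2 * C + 4 * (mu * K)) ^+ j <= (D0 * (th * (1 + mu))) ^+ j.
    have g0 : 0 <= 2 * C + 4 * (mu * K) by apply: addr_ge0; apply: mulr_ge0.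
    have g1 : 2 * C + 4 * (mu * K) <= D0 * (th * (1 + mu)).
      have -> : D0 * (th * (1 + mu)) = (2 * C + 4 * K) * (1 + mu).
        by rewrite /D0; field; rewrite gt_eqF.
      have : 0 <= 4 * K + 2 * (C * mu) by apply: addr_ge0; apply: mulr_ge0 => //; exact: mulr_ge0.
      by lra.
    by rewrite lerXn2r// nnegrE// (le_trans g0).
  have h2 := @exprn_le_fact_expR R j (th * (1 + mu)) (mulr_ge0 (ltW th0) (addr_ge0 ler01 mu0)).
  rewrite exprMn in h1.
  have h3 : (2 * C + 4 * (mu * K)) ^+ j <= D0 ^+ j * (j`!%:R * expR (th * (1 + mu))).
    by apply: (le_trans h1); rewrite ler_wpM2l// exprn_ge0.
  rewrite exprS.
  rewrite [leRHS](_ : _ = X * (D0 ^+ j * (j`!%:R * expR (th * (1 + mu)))) * j`!%:R ^+ S); last by rewrite /Y; ring.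
  by rewrite ler_wpM2r ?exprn_ge0// ler_wpM2l.
have main z : smooth1 z -> (forall j, `|Dk j z t| <= X * (2 * C + 4 * (mu * K)) ^+ j * j`!%:R ^+ S) ->
    `|Dk k (fun s => kp 0 s * z s) t| <= 2 * K' * expR th * expR (- th * mu) * D ^+ k * k`!%:R ^+ S.+1.
  move=> sz bz; rewrite Dk_mul; [|exact: (jet_smooth1 hkp)|exact: sz].
  have [[j nz]|z0] := pselect (exists j, kp j t != 0); last first.
    rewrite /jmul big1 ?normr0; first by rewrite !mulr_ge0 ?exprn_ge0 ?expR_ge0.
    move=> i _; rewrite (Dk_jet hkp) (_ : kp i t = 0) ?mul0r ?mulr0//.
    by apply/eqP; apply: contrapT => /negP h; apply: z0; exists i.
  have hX : Y <= expR th * expR (- th * mu).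
    rewrite /Y /X -!expRD ler_expR lep.
    have := ler_wpM2l mu0 (supp j t nz); rewrite mulrBr.
    have e2 : ep * (ep * mu) = mu by rewrite mulrA; case: epE => ->; rewrite ?mulrNN !mul1r.
    rewrite e2 (_ : ep * mu * B t = mu * (ep * B t)); last by ring.
    set w := mu * (ep * B t); lra.
  have h1 i : (i <= k)%N -> `|Dk i (kp 0%N) t| <= K' * 12 ^+ i * i`!%:R ^+ S.+1.
    move=> _; rewrite (Dk_jet hkp) (le_trans (bk i t))// ler_wpM2l ?mulr_ge0 ?exprn_ge0//.
    by apply: ler_weXn2l; [rewrite ler1n fact_gt0|exact: leqW].
  have h2 i : (i <= k)%N -> `|Dk i z t| <= Y * D ^+ i * i`!%:R ^+ S.+1.
    move=> _; apply: (le_trans (bz i)); apply: (le_trans (up i)).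
    by rewrite ler_wpM2r ?exprn_ge0// ler_wpM2l// lerXn2r ?nnegrE// lerDr.
  apply: (le_trans (jmul_le (ltn0Sn S) K'0 Y0 _ Dge h1 h2)) => //.
  have : \sum_(i < k.+1) (12 : R) ^+ i * D ^+ (k - i) <= 2 * D ^+ k.
    by apply: (le_trans (geom_mix k _ _)); rewrite /D ?gerBl ?exprn_ge0//; lra.
  move=> g; rewrite [leRHS](_ : _ = K' * (expR th * expR (- th * mu)) * k`!%:R ^+ S.+1 * (2 * D ^+ k)); last by ring.
  apply: ler_pM => //; first by rewrite !mulr_ge0 ?exprn_ge0.
    by apply: sumr_ge0 => i _; rewrite mulr_ge0// exprn_ge0.
  by rewrite ler_wpM2r ?exprn_ge0// ler_wpM2l.
by split; apply: main => // j; have [] := jets j.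
Qed.

(** Over one period the phase l A advances by an integer multiple of 2 pi, which is what membership
    in [Zset] provides. *)
Lemma cre_periodic l (z : int) : periodic2pi (kp 0%N) -> (forall t, B (t + 2 * pi) = B t) ->
  (forall t, A (t + 2 * pi) = A t + A (2 * pi)) -> l * A (2 * pi) = z%:~R * (2 * pi) ->
  periodic2pi (cre l) /\ periodic2pi (cim l).
Proof.
move=> pk pB pA lz.
have pc : periodic2pi (@cos R) by move=> t; rewrite mulr_natl cosD2pi.
have ps : periodic2pi (@sin R) by move=> t; rewrite mulr_natl sinD2pi.
have e t : l * A (t + 2 * pi) = l * A t + z%:~R * (2 * pi) by rewrite pA mulrDr lz.
by split=> t; rewrite /cre /cim /cxp /cyp pk pB e (periodic_int _ _ pc, periodic_int _ _ ps).
Qed.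

End PhaseJets.

(** * Separated series and the equation for the coefficients *)

Section SeparatedSeries.
Context {R : realType} {n : nat}.
Notation cnt := (@counting nat R).
Notation cint f := (cnt.-integrable [set: nat] (fun m : nat => (f m)%:E)).
Notation oword := (@oword n).
Notation ei := (@ei R n).

Definition letters (be : 'I_n -> nat) : seq 'I_n := flatten [seq nseq (be i) i | i <- enum 'I_n].

Lemma mdirs_letters (be : 'I_n -> nat) : mdirs be = [seq ei i | i <- letters be].
Proof.
rewrite /mdirs /letters map_flatten -map_comp; congr flatten; apply: eq_map => i.
by rewrite /= map_nseq.
Qed.

Lemma wlet_letters b (be : 'I_n -> nat) : wlet b be = [seq (b, i) | i <- letters be].
Proof.
rewrite /wlet /letters map_flatten -map_comp; congr flatten; apply: eq_map => i.
by rewrite /= map_nseq.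
Qed.

Definition tdir (o : option 'I_n) : R * 'rV[R]_n := if o is Some i then (0, ei i) else (1, 0).

Lemma tdir_basis (v : R * 'rV[R]_n) : exists c : option 'I_n -> R, v = \sum_o c o *: tdir o.
Proof.
exists (fun o => if o is Some i then v.2 ord0 i else v.1).
rewrite (bigD1 None)//= (reindex_omap (op := GRing.add) Some id); last by case.
rewrite (eq_bigl xpredT); last by move=> i; rewrite eqxx.
case: v => s y /=; rewrite (eq_bigr (fun i => (0, y ord0 i *: ei i) : R * 'rV[R]_n)); last first.
  by move=> i _; congr (_, _); rewrite /= scaler0.
have -> : \sum_(i < n) ((0, y ord0 i *: ei i) : R * 'rV[R]_n) = (0, \sum_(i < n) y ord0 i *: ei i).
  elim/big_rec2: _ => [//|i y1 y2 _ ->]; congr (_, _); exact: addr0.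
have -> : s *: ((1, 0) : R * 'rV[R]_n) = (s, 0) by congr (_, _); [exact: mulr1|exact: scaler0].
by rewrite {1}[y]row_sum_delta; congr (_, _); rewrite ?addr0 ?add0r.
Qed.

Context (c : nat -> R -> R) (ph : nat -> 'rV[R]_n -> R) (M : nat -> R) (Bd : nat -> nat -> R).
Hypotheses (sc : forall k, smooth1 (c k)) (sp : forall k, rsmooth (ph k)).
Hypotheses (iM : cint M) (Bd0 : forall g k, 0 <= Bd g k) (M0 : forall k, 0 <= M k).
(** One separated bound with three roles: [M] sums over k, [Wt] integrates over x, and [Bd] records
    the growth in the numbers of time derivatives and of letters. *)
Hypothesis bnd : forall g (w : oword) k t x, `|Dk g (c k) t * opw w (ph k) x| <= Bd g (size w) * M k * Wt x.

Definition term g (w : oword) k (p : R * 'rV[R]_n) : R := Dk g (c k) p.1 * opw w (ph k) p.2.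
Definition ser g (w : oword) (p : R * 'rV[R]_n) : R := csum (fun k => term g w k p).

Lemma term_le g w k p : `|term g w k p| <= Bd g (size w) * M k.
Proof.
apply: (le_trans (bnd _ _ _ _ _)); rewrite ler_piMr ?mulr_ge0// Wt_le1//.
Qed.

Lemma ser_cint g w p : cint (fun k => term g w k p).
Proof. exact: (cint_dom (fun k => term_le g w k p) (cintZ _ iM)). Qed.

Lemma ser_le g w t x : `|ser g w (t, x)| <= Bd g (size w) * csum M * Wt x.
Proof.
have -> : Bd g (size w) * csum M * Wt x = csum (fun k => (Bd g (size w) * Wt x) * M k).
  by rewrite csumZ//; ring.
apply: csum_norm_le; last exact: cintZ.
by move=> k; rewrite mulrAC; exact: bnd.
Qed.

Lemma term_cont g w k : continuous (term g w k).
Proof.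
apply: cM => p; apply: continuous_comp; first exact: cvg_fst.
- exact: (hasD_cont (Dk_hasD g (sc k))).
- exact: cvg_snd.
- exact: (rsmooth_cont (opw_smooth w (sp k))).
Qed.

Lemma ser_cont g w : continuous (ser g w).
Proof.
have iB := cintZ (Bd g (size w)) iM.
by have h := @csum_cont R _ (term g w) _ (fun k => @term_cont g w k) (term_le g w) iB; move=> p; exact: h.
Qed.

Lemma ser_dt g w p : is_derive p ((1, 0) : R * 'rV[R]_n) (ser g w) (ser g.+1 w p).
Proof.
apply: (csum_dirderive p _ (ser_cint g w) (term_le g.+1 w) (cintZ _ iM)) => k y.
apply/is_derive_line.
rewrite (_ : (fun t => _) = fun t => Dk g (c k) (t + y.1) * opw w (ph k) y.2); last first.
  by apply/funext => t; rewrite /term /= scaler0 addr0 addrC [_ *: _]mulr1.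
have h := hasDM (hasD_shift y.1 (Dk_hasD g (sc k))) (hasD_cst (opw w (ph k) y.2)).
by apply: (is_derive_eq (h 0)); rewrite mulr0 addr0 add0r.
Qed.

Lemma ser_dx g w i p : is_derive p ((0, ei i) : R * 'rV[R]_n) (ser g w) (ser g ((true, i) :: w) p).
Proof.
apply: (csum_dirderive p _ (ser_cint g w) (term_le g ((true, i) :: w)) (cintZ _ iM)) => k y.
apply/is_derive_line.
rewrite (_ : (fun t => _) = fun t => Dk g (c k) y.1 * opw w (ph k) (y.2 + t *: ei i)); last first.
  by apply/funext => t; rewrite /term /= scaler0 addr0.
apply: is_deriveZ; apply/is_derive_line.
exact: rsmooth_is_derive (opw_smooth w (sp k)).
Qed.

Lemma ser_smooth g w : rsmooth (ser g w).
Proof.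
apply: (@rsmooth_basis R _ _ tdir (fun f => exists L : seq (R * (nat * oword)),
  f = fun p => \sum_(q <- L) q.1 * ser q.2.1 q.2.2 p)).
- exact: tdir_basis.
- by exists [::]; apply/funext => x; rewrite big_nil.
- move=> d _ _ [L1 ->] [L2 ->]; exists ([seq (d * p.1, p.2) | p <- L1] ++ L2); apply/funext => x.
  by rewrite big_cat big_map mulr_sumr /=; congr (_ + _); apply: eq_bigr => p _; rewrite mulrA.
- by move=> _ [L ->]; apply: continuous_sumr => p; apply: cZ; exact: ser_cont.
- move=> _ o [L ->].
  pose dq (q : R * (nat * oword)) : R * (nat * oword) :=
    (q.1, if o is Some i then (q.2.1, (true, i) :: q.2.2) else (q.2.1.+1, q.2.2)).
  exists (fun x => \sum_(q <- [seq dq q | q <- L]) q.1 * ser q.2.1 q.2.2 x); first by eexists; reflexivity.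
  move=> x; elim: L => [|p L IH].
    rewrite big_nil (_ : (fun x => _) = cst 0); first exact: is_derive_cst.
    by apply/funext => y; rewrite big_nil.
  rewrite (_ : (fun x => _) = fun x => p.1 * ser p.2.1 p.2.2 x + \sum_(q <- L) q.1 * ser q.2.1 q.2.2 x); last first.
    by apply/funext => y; rewrite big_cons.
  have h : is_derive x (tdir o) (ser p.2.1 p.2.2) (ser (dq p).2.1 (dq p).2.2 x).
    by rewrite /dq; case: (o) => [i|]; [exact: ser_dx|exact: ser_dt].
  by rewrite /= big_cons; apply: (is_derive_eq (is_deriveD (is_deriveZ p.1 h) IH)).
by exists [:: (1, (g, w))]; apply/funext => x; rewrite big_seq1 mul1r.
Qed.

Lemma ser_iD (be : 'I_n -> nat) ga : iD (xdirs be ++ nseq ga dirt) (ser 0 [::]) = ser ga (wlet true be).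
Proof.
have -> : iD (xdirs be ++ nseq ga dirt) (ser 0 [::]) = iD (xdirs be) (iD (nseq ga dirt) (ser 0 [::])).
  by rewrite /iD foldr_cat.
have -> : iD (nseq ga dirt) (ser 0 [::]) = ser ga [::].
  elim: ga => [//|ga IH]; rewrite /= IH; apply/funext => p.
  by have [_ ->] := ser_dt ga [::] p.
rewrite /xdirs mdirs_letters wlet_letters; elim: (letters be) => [//|i s IH].
rewrite /= IH; apply/funext => p.
by have [_ ->] := ser_dx ga [seq (true, i) | i <- s] i p.
Qed.

Lemma ser_mpow (al : 'I_n -> nat) g w t x :
  mpow x al * ser g w (t, x) = ser g (wlet false al ++ w) (t, x).
Proof.
rewrite /ser -csumZ; last exact: ser_cint.
by congr csum; apply/funext => k; rewrite /term /= opw_cat opw_wX mulrCA.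
Qed.

End SeparatedSeries.

(** * Factorials of multi-indices *)

Section Factorials.
Context {R : realType} {n : nat}.

Lemma fact_add_le (p q : nat) : ((p + q)`! <= 2 ^ (p + q) * (p`! * q`!))%N.
Proof.
rewrite -(bin_fact (leq_addr q p)) addKn leq_mul2r; apply/orP; right.
have := Pascal 1 1 (p + q); rewrite (_ : 1 + 1 = 2)%N// => ->.
have hk : (p < (p + q).+1)%N by rewrite ltnS leq_addr.
by rewrite (bigD1 (Ordinal hk)) //= !exp1n !muln1 leq_addr.
Qed.

Lemma fact_sum_le (al : 'I_n -> nat) : ((mabs al)`! <= 2 ^ (n * mabs al) * mfact al)%N.
Proof.
suff H (s : seq 'I_n) : ((\sum_(i <- s) al i)`! <= 2 ^ (size s * \sum_(i <- s) al i) * \prod_(i <- s) (al i)`!)%N.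
  by have := H (index_enum 'I_n); rewrite (_ : size _ = n)// -[index_enum _]enumT size_enum_ord.
elim: s => [|i s IH]; first by rewrite !big_nil.
rewrite !big_cons /=; apply: (leq_trans (fact_add_le _ _)).
rewrite [in leqRHS]mulSn [in leqRHS]expnD -[leqRHS]mulnA leq_mul2l; apply/orP; right.
rewrite [leqRHS]mulnCA leq_mul2l; apply/orP; right.
by rewrite (leq_trans IH)// leq_mul2r leq_pexp2l ?orbT// leq_mul2l leq_addl orbT.
Qed.

(** Here mu >= 1/2 enters: sqrt (N!) is at most a geometric factor times (al! be!)^(1/2), which is
    bounded by the power mu because al! be! >= 1. *)
Lemma sqrt_fact_le (al be : 'I_n -> nat) (mu : R) : 2^-1 <= mu ->
  Num.sqrt (mabs al + mabs be)`!%:R <= (2 ^+ n * 2) ^+ (mabs al + mabs be) * (mfact al * mfact be)%N%:R `^ mu.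
Proof.
move=> hmu; set N := (mabs al + mabs be)%N.
have h : (N`! <= 2 ^ N * 2 ^ (n * N) * (mfact al * mfact be))%N.
  rewrite (leq_trans (fact_add_le _ _))// -/N -mulnA leq_mul//.
  rewrite (leq_trans (leq_mul (fact_sum_le al) (fact_sum_le be)))//.
  by rewrite mulnACA leq_mul// -expnD -mulnDr.
have f1 : (0 < mfact al * mfact be)%N.
  by rewrite muln_gt0 /mfact !prodn_gt0// => i; exact: fact_gt0.
apply: (@le_trans _ _ (Num.sqrt (2 ^ N * 2 ^ (n * N) * (mfact al * mfact be))%N%:R)).
  by rewrite ler_sqrt ?ler0n// ler_nat.
rewrite natrM sqrtrM// ler_pM ?sqrtr_ge0//.
  by rewrite (le_trans (sqrt_leN _))// natrM !natrX exprMn -exprM mulrC.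
by rewrite -powR12_sqrt// ler_powR// ler1n.
Qed.

End Factorials.

(** * Symmetry of second derivatives *)

Section Schwarz.
Context {R : realType} {X : normedModType R}.

Lemma hasD_line (f : X -> R) (y e : X) : rsmooth f -> hasD (fun s : R => f (y + s *: e)) (fun s => 'D_e f (y + s *: e)).
Proof.
move=> sf s; apply/is_derive_line.
rewrite (_ : (fun t => _) = fun t : R => f ((y + s *: e) + t *: e)); first by apply/is_derive_line; exact: rsmooth_is_derive.
by apply/funext => t; rewrite -addrA -scalerDl; congr (f (_ + (_ + _) *: _)); exact: mulr1.
Qed.

Definition dbl_diff (f : X -> R) (x e h : X) (s : R) : R :=
  f (x + s *: e + s *: h) - f (x + s *: e) - f (x + s *: h) + f x.

Lemma dbl_diff_mean (f : X -> R) (x e h : X) (s : R) : rsmooth f -> 0 < s ->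
  exists2 y, `|x - y| <= s * (`|e| + `|h|) & dbl_diff f x e h s = s ^+ 2 * 'D_e ('D_h f) y.
Proof.
move=> sf s0; have sDf := rsmooth_D h sf.
have hg := hasDB (@hasD_line f (x + s *: e) h sf) (@hasD_line f x h sf).
have [tau /andP[t0 ts] Et] := hasD_mvt hg (ltW s0).
have [sg /andP[g0 gs] Eg] := hasD_mvt (@hasD_line ('D_h f) (x + tau *: h) e sDf) (ltW s0).
exists (x + tau *: h + sg *: e).
  rewrite -addrA opprD addrA subrr add0r normrN (le_trans (ler_normD _ _))// !normrZ !ger0_norm//.
  by rewrite addrC mulrDr lerD// ler_wpM2r.
move: Et Eg; rewrite !scale0r !addr0 !subr0 => Et Eg.
rewrite [LHS](_ : _ = f (x + s *: e + s *: h) - f (x + s *: h) - (f (x + s *: e) - f x)); last by rewrite /dbl_diff; ring.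
by rewrite Et [x + s *: e + _]addrAC Eg; ring.
Qed.

Lemma dist_half (p u v eps : R) : `|u - p| <= eps / 2 -> `|v - p| <= eps / 2 -> `|u - v| <= eps.
Proof. by rewrite !ler_norml => /andP[? ?] /andP[? ?]; apply/andP; split; lra. Qed.

(** The same double difference, evaluated by mean values in both orders, gives the two mixed
    derivatives at points tending to x. Symmetry is needed because repeated integration by parts
    reverses the order of the derivatives. *)
Lemma schwarz (f : X -> R) (x e h : X) : rsmooth f -> 'D_e ('D_h f) x = 'D_h ('D_e f) x.
Proof.
move=> sf; apply/eqP; rewrite -subr_eq0 -normr_le0; apply/ler_addgt0Pl => eps eps0.
have cont u v : continuous ('D_u ('D_v f)) by apply: rsmooth_cont; do 2!apply: rsmooth_D.
have e2 : 0 < eps / 2 by rewrite divr_gt0.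
have /cvgrPdist_le /(_ _ e2) := cont e h x; rewrite -nbhs_ballE => -[d1 /= d10 h1].
have /cvgrPdist_le /(_ _ e2) := cont h e x; rewrite -nbhs_ballE => -[d2 /= d20 h2].
pose K := `|e| + `|h| + 1; have K0 : 0 < K by rewrite ltr_wpDl// addr_ge0.
pose s := Num.min d1 d2 / 2 / K.
have m0 : 0 < Num.min d1 d2 by rewrite lt_min d10.
have s0 : 0 < s by rewrite !divr_gt0.
have sK : s * (`|e| + `|h|) < Num.min d1 d2.
  apply: (@le_lt_trans _ _ (s * K)); first by rewrite ler_wpM2l ?(ltW s0)// lerDl.
  by rewrite /s divfK ?gt_eqF//; lra.
have [y1 y1s E1] := dbl_diff_mean x e h sf s0.
have [y2 y2s E2] := dbl_diff_mean x h e sf s0.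
have E : dbl_diff f x e h s = dbl_diff f x h e s by rewrite /dbl_diff [x + s *: e + _]addrAC; ring.
move: E; rewrite E1 E2 => /(mulfI (expf_neq0 2 (lt0r_neq0 s0))) E.
have n1 : `|x - y1| < d1.
  by apply: le_lt_trans y1s _; apply: lt_le_trans sK _; rewrite ge_min lexx.
have n2 : `|x - y2| < d2.
  by apply: le_lt_trans y2s _; rewrite [`|h| + _]addrC; apply: lt_le_trans sK _; rewrite ge_min lexx orbT.
have b1 : `|'D_e ('D_h f) x - 'D_e ('D_h f) y1| <= eps / 2 by apply: h1; rewrite -ball_normE.
have b2 : `|'D_h ('D_e f) x - 'D_h ('D_e f) y2| <= eps / 2 by apply: h2; rewrite -ball_normE.
by rewrite addr0; apply: (dist_half b1); rewrite E.
Qed.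

Lemma iD_swap (f : X -> R) (ds : seq X) (v : X) : rsmooth f -> iD ds ('D_v f) = 'D_v (iD ds f).
Proof.
move=> sf; elim: ds => [//|w ds IH]; rewrite /= -/(iD ds _) IH; apply/funext => x.
by rewrite schwarz; [|exact: rsmooth_iD].
Qed.

Lemma iD_rev (f : X -> R) (ds : seq X) : rsmooth f -> iD (rev ds) f = iD ds f.
Proof.
elim: ds f => [//|v ds IH] f sf; rewrite rev_cons iD_rcons IH; last exact: rsmooth_D.
by rewrite iD_swap.
Qed.

End Schwarz.

(** * Pairing bounded functions with eigenfunctions *)

Section Pairing.
Context {R : realType} {n : nat}.
Notation oword := (@oword n).
Notation rVm := (@rVm R n).
Notation ei := (@ei R n).
Notation nun := (@nu R n).
Notation Inu g := (Rintegral (@nu R n) [set: rVm] (g : rVm -> R)).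
Notation intg g := (nun.-integrable [set: rVm] (fun x : rVm => (g x)%:E)).

Lemma iD_slice (ds : seq 'rV[R]_n) (g : R * 'rV[R]_n -> R) t :
  iD ds (fun y => g (t, y)) = fun x => iD [seq (0, v) | v <- ds] g (t, x).
Proof.
elim: ds => [//|v ds IH]; rewrite /= -/(iD ds _) IH; apply/funext => x.
pose G := iD [seq ((0 : R), w) | w <- ds] g; rewrite -/G /derive.
have E : (fun h : R => h^-1 *: (((fun y => G (t, y)) \o shift x) (h *: v) - G (t, x))) =
         (fun h : R => h^-1 *: ((G \o shift (t, x)) (h *: ((0 : R), v)) - G (t, x))).
  apply/funext => h; congr (_ *: (_ - _)); rewrite /shift /=; congr G; congr (_, _).
  by rewrite /= scaler0 add0r.
by rewrite E.
Qed.

Lemma rsmooth_slice (g : R * 'rV[R]_n -> R) t : rsmooth g -> rsmooth (fun y => g (t, y)).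
Proof.
move=> sg ds; rewrite iD_slice; have [c d] := sg [seq (0, v) | v <- ds]; split.
  move=> x; apply: (@continuous_comp _ _ _ (fun y => (t, y)) (iD [seq (0, v) | v <- ds] g)); last exact: c.
  by apply: (@cvg_pair _ _ _ (nbhs x) (nbhs t) (nbhs x) _ _ _ (fun=> t) id); [exact: cvg_cst|exact: cvg_id].
move=> x v; have h : is_derive (t, x) (0, v) (iD [seq (0, v) | v <- ds] g) ('D_(0, v) (iD [seq (0, v) | v <- ds] g) (t, x)).
  by apply: is_derive_pt; exact: d.
have /is_derive_line h' := h.
suff [] : is_derive x v (fun x => iD [seq (0, v) | v <- ds] g (t, x)) ('D_(0, v) (iD [seq (0, v) | v <- ds] g) (t, x)) by [].
apply/is_derive_line; set G := iD _ _ in h' *.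
have E : (fun s : R => G (t, x + s *: v)) = (fun s : R => G ((t, x) + s *: (0, v))).
  by apply/funext => s; congr G; congr (_, _); rewrite /= scaler0 addr0.
by move: h'; rewrite -E.
Qed.

(** Integrating by parts letter by letter leaves suffixes of a sorted word. They are sorted again,
    so bounds indexed by multi-indices cover them. *)
Lemma letters_suffix (al : 'I_n -> nat) k : exists be : 'I_n -> nat, drop k (letters al) = letters be.
Proof.
rewrite /letters; have := enum_uniq 'I_n; elim: (enum 'I_n) k => [|i E IH] k; first by exists (fun=> 0%N).
move=> /= /andP[iE uE]; rewrite drop_cat size_nseq; case: ltnP => [ka|ak].
  exists (fun j => if j == i then (al i - k)%N else al j); rewrite eqxx drop_nseq; congr (_ ++ flatten _).
  by apply/eq_in_map => j jE; case: eqP => // ji; move: iE; rewrite -ji jE.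
have [be ->] := IH (k - al i)%N uE.
exists (fun j => if j == i then 0%N else be j); rewrite eqxx /=; congr flatten.
by apply/eq_in_map => j jE; case: eqP => // ji; move: iE; rewrite -ji jE.
Qed.

Definition bddf (f : 'rV[R]_n -> R) := exists B, forall x, `|f x| <= B.

Lemma WdomMb f g : bddf f -> Wdom g -> Wdom (fun x => f x * g x).
Proof. by move=> bf Wg; under eq_fun do rewrite mulrC; apply: WdomM. Qed.

Lemma intbW f g : continuous f -> continuous g -> bddf f -> Wdom g -> intg (fun x => f x * g x).
Proof.
move=> cf cg bf Wg; apply: integrable_Wdom; last exact: WdomMb.
by apply: continuous_measurable_rV; apply: cM.
Qed.

Lemma ibp1 (G H : 'rV[R]_n -> R) i : rsmooth G -> rsmooth H -> bddf G -> bddf ('D_(ei i) G) ->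
  Wdom H -> Wdom ('D_(ei i) H) ->
  Inu (fun x => 'D_(ei i) G x * H x) = - Inu (fun x => G x * 'D_(ei i) H x).
Proof.
move=> sG sH bG bDG WH WDH.
have hd x := is_deriveMr (rsmooth_is_derive x (ei i) sG) (rsmooth_is_derive x (ei i) sH).
have eD : 'D_(ei i) (fun x => G x * H x) = fun x => 'D_(ei i) G x * H x + G x * 'D_(ei i) H x.
  by apply/funext => x; have [_ ->] := hd x.
have [cG cH] := (rsmooth_cont sG, rsmooth_cont sH).
have [cDG cDH] := (rsmooth_cont (rsmooth_D (ei i) sG), rsmooth_cont (rsmooth_D (ei i) sH)).
have := @integral_derive_eq0 R n i (fun x => G x * H x); rewrite eD => h.
have : Inu (fun x => 'D_(ei i) G x * H x + G x * 'D_(ei i) H x) = 0.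
  apply: h.
  - exact: cM.
  - by move=> x; have [] := hd x.
  - by apply: cD; apply: cM.
  - exact: WdomMb.
  - by apply: WdomD; apply: WdomMb.
rewrite InuD; [|exact: intbW|exact: intbW].
by move=> /eqP; rewrite addr_eq0 => /eqP.
Qed.

Lemma ibp_word (V H : 'rV[R]_n -> R) (s : seq 'I_n) : rsmooth V -> rsmooth H ->
  (forall k, bddf (iD [seq ei i | i <- drop k s] V)) -> (forall w : oword, Wdom (opw w H)) ->
  Inu (fun x => iD [seq ei i | i <- s] V x * H x) = (-1) ^+ size s * Inu (fun x => V x * iD [seq ei i | i <- rev s] H x).
Proof.
move=> sV; elim: s H => [|i s IH] H sH bV WH; first by rewrite expr0 mul1r.
have bs k : bddf (iD [seq ei i | i <- drop k s] V) := bV k.+1.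
rewrite /= ibp1.
- rewrite IH; [|exact: rsmooth_D|exact: bs|].
  + by rewrite exprS mulN1r mulNr rev_cons map_rcons iD_rcons.
  + by move=> w; have := WH (rcons w (true, i)); rewrite opw_rcons.
- exact: rsmooth_iD.
- exact: sH.
- by have := bs 0%N; rewrite drop0.
- by have := bV 0%N.
- exact: (WH [::]).
- exact: (WH [:: (true, i)]).
Qed.

Context {m : nat} (cP : midx n m -> midx n m -> R).
Hypothesis sa : P_selfadjoint cP.

(** V is only bounded, with bounded derivatives; the decay of F justifies moving every derivative
    onto x^be F. The result is the formal adjoint applied to F, which self-adjointness identifies
    with P F = l F. *)
Lemma pop_pairing (V F : 'rV[R]_n -> R) l : rsmooth V -> rsmooth F ->
  (forall be : 'I_n -> nat, bddf (iD (mdirs be) V)) -> (forall w : oword, Wdom (opw w F)) ->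
  (forall x, PopR cP F x = l * F x) ->
  intg (fun x => PopR cP V x * F x) /\ Inu (fun x => PopR cP V x * F x) = l * Inu (fun x => V x * F x).
Proof.
move=> sV sF bV WF eF.
pose ok (q : midx n m * midx n m) := (mabs (mi q.1) + mabs (mi q.2) <= m)%N.
pose c (q : midx n m * midx n m) := if ok q then cP q.1 q.2 else 0.
pose H (q : midx n m * midx n m) := opw (wlet false (mi q.2)) F.
pose f1 q x := iD (mdirs (mi q.1)) V x * H q x.
pose f2 q x := V x * ((-1) ^+ mabs (mi q.1) * iD (mdirs (mi q.1)) (H q) x).
have sH q : rsmooth (H q) := opw_smooth _ sF.
have WH q (w : oword) : Wdom (opw w (H q)) by rewrite /H -opw_cat.
have PE (G : midx n m -> midx n m -> R) :
    \sum_(al : midx n m) \sum_(be : midx n m | (mabs (mi al) + mabs (mi be) <= m)%N) G al be =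
    \sum_(q : midx n m * midx n m) (if ok q then G q.1 q.2 else 0).
  by rewrite pair_big_dep big_mkcond.
have E1 x : PopR cP V x * F x = \sum_(q : midx n m * midx n m) c q * f1 q x.
  rewrite /PopR PE mulr_suml; apply: eq_bigr => q _; rewrite /c /f1 /H; case: ifP => _; last by rewrite !mul0r.
  by rewrite opw_wX; ring.
have HE q : H q = fun y => mpow y (mi q.2) * F y by apply/funext => y; rewrite /H opw_wX.
have E2 x : V x * (l * F x) = \sum_(q : midx n m * midx n m) c q * f2 q x.
  rewrite -eF -(PstarR_PopR sa)// /PstarR PE mulr_sumr; apply: eq_bigr => q _.
  by rewrite /c /f2 HE; case: ifP => _; [ring|rewrite mulr0 mul0r].
have cV := rsmooth_cont sV.
have bV0 : bddf V.
  have := bV (fun=> 0%N); rewrite (_ : mdirs _ = [::])//.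
  by rewrite /mdirs; elim: (enum 'I_n).
have cH q w : continuous (opw w (H q)) by exact: rsmooth_cont (opw_smooth w (sH q)).
have i1 q : intg (f1 q).
  by apply: intbW => //; [apply: rsmooth_cont; exact: rsmooth_iD|exact: (cH q [::])|exact: (WH q [::])].
have iDH q : iD (mdirs (mi q.1)) (H q) = opw (wlet true (mi q.1)) (H q) by rewrite opw_wD.
have i2 q : intg (f2 q).
  apply: intbW => //; rewrite iDH; first by apply: cZ; exact: cH.
  by apply: WdomZ; exact: WH.
have [j1 e1] := Inu_sum (index_enum _) c i1.
have [j2 e2] := Inu_sum (index_enum _) c i2.
split; first by move: j1; apply: eq_integrable => // x _; rewrite E1.
have -> : Inu (fun x => PopR cP V x * F x) = \sum_q c q * Inu (f1 q).
  by rewrite -e1; apply: eq_Rintegral => x _; exact: E1.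
have -> : l * Inu (fun x => V x * F x) = \sum_q c q * Inu (f2 q).
  rewrite -e2 -InuZ; last exact: (intbW cV (rsmooth_cont sF) bV0 (WF [::])).
  by apply: eq_Rintegral => x _; rewrite -E2; ring.
apply: eq_bigr => q _; congr (_ * _).
have hr : iD [seq ei i | i <- rev (letters (mi q.1))] (H q) = iD (mdirs (mi q.1)) (H q).
  by rewrite map_rev (iD_rev _ (sH q)) mdirs_letters.
have hV k : bddf (iD [seq ei i | i <- drop k (letters (mi q.1))] V).
  by have [be ->] := letters_suffix (mi q.1) k; rewrite -mdirs_letters.
have hs : size (letters (mi q.1)) = mabs (mi q.1) by rewrite -(size_wlet true) wlet_letters size_map.
have h := ibp_word sV (sH q) hV (WH q); rewrite hr hs -mdirs_letters in h.
rewrite [LHS]h -InuZ; last by rewrite iDH; apply: (intbW cV (cH q _) bV0 (WH q _)).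
by apply: eq_Rintegral => x _; rewrite /f2 mulrCA.
Qed.

Lemma Inu_derive_t (g : R * 'rV[R]_n -> R) (F : 'rV[R]_n -> R) (B t : R) : rsmooth g -> continuous F -> Wdom F ->
  (forall p, `|g p| <= B) -> (forall p, `|'D_dirt g p| <= B) ->
  is_derive t (1 : R) (fun t => Inu (fun x => g (t, x) * F x)) (Inu (fun x => 'D_dirt g (t, x) * F x)).
Proof.
move=> sg cF WF gB DgB.
have sl s := rsmooth_slice s sg; have sDl s := rsmooth_slice s (rsmooth_D dirt sg).
have bs s : bddf (fun x => g (s, x)) by exists B.
have hd s x : is_derive s (1 : R) (fun s => g (s, x) * F x) ('D_dirt g (s, x) * F x).
  have hs : is_derive s (1 : R) (fun s => g (s, x)) ('D_dirt g (s, x)).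
    apply/is_derive_line; have /is_derive_line := rsmooth_is_derive (s, x) (dirt : R * 'rV[R]_n) sg.
    have E : (fun t0 : R => g (s + t0 *: 1, x)) = (fun t0 : R => g ((s, x) + t0 *: dirt)).
      by apply/funext => t0; congr g; congr (_, _); rewrite /= scaler0 addr0.
    by rewrite -E.
  by apply: (is_derive_eq (is_deriveMr hs (is_derive_cst (F x) s 1))); rewrite mulr0 addr0.
have [K hK] := WF.
have It : `](t - 1), (t + 1)[%classic t by rewrite /= in_itv/=; apply/andP; split; lra.
have H1 : forall s, `](t - 1), (t + 1)[%classic s -> nun.-integrable [set: rVm] (EFin \o (fun x : rVm => g (s, x) * F x)).
  by move=> s _; apply: (intbW (rsmooth_cont (sl s)) cF (bs s) WF).
have H2 : forall (s : R) (x : rVm), `](t - 1), (t + 1)[%classic s -> [set: rVm] x -> derivable (fun s => g (s, x) * F x) s 1.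
  by move=> s x _ _; have [] := hd s x.
have B0 : 0 <= B by rewrite (le_trans _ (gB 0)).
have K0 : 0 <= K by have := le_trans (normr_ge0 _) (hK 0); rewrite pmulr_lge0// Wt_gt0.
have G0 : forall x : rVm, 0 <= B * K * Wt x by move=> x; rewrite !mulr_ge0// ltW// Wt_gt0.
have H3 : forall (s : R) (x : rVm), `](t - 1), (t + 1)[%classic s -> [set: rVm] x ->
    `|partial1of2 (fun s (x : rVm) => g (s, x) * F x) s x| <= B * K * Wt x.
  move=> s x _ _; rewrite partial1of2E (@derive_val _ _ _ _ _ _ _ (hd s x)) normrM -mulrA ler_pM//.
have iG : nun.-integrable [set: rVm] (EFin \o (fun x : rVm => B * K * Wt x)) := intgZ (B * K) (@integrable_Wt R n).
have d := @derivable_under_integral R _ rVm nun (fun s (x : rVm) => g (s, x) * F x) setT measurableT t _ _ It H1 H2 _ G0 iG H3.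
have e := @differentiation_under_integral R _ rVm nun (fun s (x : rVm) => g (s, x) * F x) setT measurableT t _ _ It H1 H2 _ G0 iG H3.
split; first exact: d.
rewrite -derive1E [LHS]e; apply: eq_Rintegral => x _.
by rewrite partial1of2E (@derive_val _ _ _ _ _ _ _ (hd t x)).
Qed.

End Pairing.

(* With U = UR + i UI, this is the imaginary part of (U exp (i l (A + i B)))'. *)
Lemma phase_ode (R : realType) (A B a b UR UI dUR dUI FR FI : R -> R) (l : R) : hasD A a -> hasD B b ->
  hasD UR dUR -> hasD UI dUI ->
  (forall t, FR t = dUI t + l * (a t * UR t - b t * UI t)) ->
  (forall t, FI t = - dUR t + l * (a t * UI t + b t * UR t)) ->
  hasD (fun t => expR (- (l * B t)) * (UI t * cos (l * A t) + UR t * sin (l * A t)))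
    (fun t => expR (- (l * B t)) * (FR t * cos (l * A t) - FI t * sin (l * A t))).
Proof.
move=> hA hB hUR hUI eR eI.
have hE : hasD (fun t => expR (- (l * B t))) (fun t => expR (- (l * B t)) * - (l * b t)).
  by apply: hasD_exp; apply: hasDN; exact: hasDZ.
have hc : hasD (@cos R) (fun x => - sin x) by move=> x; exact: is_derive_cos.
have hs : hasD (@sin R) (@cos R) by move=> x; exact: is_derive_sin.
have hcA := hasD_comp hc (hasDZ l hA); have hsA := hasD_comp hs (hasDZ l hA).
apply: (hasD_eq (hasDM hE (hasDD (hasDM hUI hcA) (hasDM hUR hsA)))) => t.
by rewrite eR eI; ring.
Qed.

(** * The equation satisfied by the coefficients of a solution *)

Section SolutionSide.
Context {R : realType} {n m : nat} (cP : midx n m -> midx n m -> R).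
Notation rVm := (@rVm R n).
Notation oword := (@oword n).
Notation nun := (@nu R n).
Notation Inu g := (Rintegral (@nu R n) [set: rVm] (g : rVm -> R)).
Notation intg g := (nun.-integrable [set: rVm] (fun x : rVm => (g x)%:E)).
Hypotheses (n0 : (0 < n)%N) (m2 : (2 <= m)%N) (sa : P_selfadjoint cP) (el : P_globally_elliptic cP).
Context (lam : nat -> R) (phi : nat -> 'rV[R]_n -> R[i]).
Hypothesis es : eigen_system cP lam phi.

Local Notation pR j := (cRe (phi j)).
Local Notation pI j := (cIm (phi j)).

(** Real part of the integral of f (t, x) conj (phi_j x), the imaginary part being [coefI]; both are
    integrals against [nu]. *)
Definition coefR (f : R * 'rV[R]_n -> R[i]) j t : R :=
  Inu (fun x => cRe f (t, x) * pR j x + cIm f (t, x) * pI j x).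
Definition coefI (f : R * 'rV[R]_n -> R[i]) j t : R :=
  Inu (fun x => cIm f (t, x) * pR j x - cRe f (t, x) * pI j x).

Lemma cabs_Re (z : R[i]) : `|complex.Re z| <= cabs z.
Proof. by rewrite -sqrtr_sqr /cabs ler_sqrt ?addr_ge0 ?sqr_ge0// lerDl sqr_ge0. Qed.

Lemma cabs_Im (z : R[i]) : `|complex.Im z| <= cabs z.
Proof. by rewrite -sqrtr_sqr /cabs ler_sqrt ?addr_ge0 ?sqr_ge0// lerDr sqr_ge0. Qed.

Lemma cabs_le (z : R[i]) : cabs z <= `|complex.Re z| + `|complex.Im z|.
Proof.
rewrite /cabs -(ger0_norm (_ : 0 <= `|complex.Re z| + `|complex.Im z|)) ?addr_ge0//.
rewrite -sqrtr_sqr ler_sqrt ?sqr_ge0// sqrrD !real_normK ?num_real//.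
by rewrite -addrA lerD2l lerDr mulrn_wge0// mulr_ge0.
Qed.

(* Only unweighted bounds on the derivatives of u are needed to pair it with the eigenfunctions. *)
Definition tame (g : R * 'rV[R]_n -> R) := [/\ rsmooth g,
  forall be : 'I_n -> nat, exists B, forall p, `|iD (xdirs be) g p| <= B &
  exists B, forall p, `|'D_dirt g p| <= B].

Lemma tame_parts mu u : Fmu mu u -> tame (cRe u) /\ tame (cIm u).
Proof.
move=> [sg [_ [[sR sI] _ [C [K [C0 H]]]]]].
have mp0 (x : 'rV[R]_n) : mpow x (fun=> 0%N) = 1 by rewrite /mpow big1.
have hb be ga p : cabs (ciD (xdirs be ++ nseq ga dirt) u p) <=
    K * C ^+ (mabs (fun _ : 'I_n => 0%N) + mabs be + ga) * (ga`!)%:R `^ sg *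
    ((mfact (fun _ : 'I_n => 0%N) * mfact be)%N)%:R `^ mu.
  by case: p => t x; have := H (fun=> 0%N) be ga t x; rewrite mp0 normr1 mul1r.
have x0 : xdirs (fun _ : 'I_n => 0%N) = [::] :> seq (R * 'rV[R]_n).
  by rewrite /xdirs /mdirs; elim: (enum 'I_n).
split; [apply: And3 sR _ _|apply: And3 sI _ _].
- move=> be; eexists => p; apply: le_trans (hb be 0%N p); rewrite cats0; exact: (cabs_Re (ciD (xdirs be) u p)).
- eexists => p; apply: le_trans (hb (fun=> 0%N) 1%N p); rewrite x0; exact: (cabs_Re (ciD [:: dirt] u p)).
- move=> be; eexists => p; apply: le_trans (hb be 0%N p); rewrite cats0; exact: (cabs_Im (ciD (xdirs be) u p)).
- eexists => p; apply: le_trans (hb (fun=> 0%N) 1%N p); rewrite x0; exact: (cabs_Im (ciD [:: dirt] u p)).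
Qed.

Lemma tame_bdd g : tame g -> exists B, (forall p, `|g p| <= B) /\ (forall p, `|'D_dirt g p| <= B).
Proof.
move=> [_ h [B1 h1]]; have [B0 h0] := h (fun=> 0%N).
have x0 : xdirs (fun _ : 'I_n => 0%N) = [::] :> seq (R * 'rV[R]_n).
  by rewrite /xdirs /mdirs; elim: (enum 'I_n).
rewrite x0 in h0; exists (Num.max B0 B1); split=> p; rewrite le_max.
  by have := h0 p; rewrite /= => ->.
by rewrite h1 orbT.
Qed.

Definition pair (g : R * 'rV[R]_n -> R) (F : 'rV[R]_n -> R) (t : R) : R := Inu (fun x => g (t, x) * F x).

Lemma pair_eig g F l : tame g -> unit_eigfun cP l F ->
  [/\ forall t, intg (fun x => g (t, x) * F x), forall t, intg (fun x => 'D_dirt g (t, x) * F x),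
      forall t, intg (fun x => PopR cP (fun y => g (t, y)) x * F x),
      hasD (pair g F) (pair ('D_dirt g) F) &
      forall t, Inu (fun x => PopR cP (fun y => g (t, y)) x * F x) = l * pair g F t].
Proof.
move=> tg uF; have [sg bg _] := tg; have [B [gB DB]] := tame_bdd tg.
have [sF _ _ eF] := uF; have WF0 := unit_eigfun_Wdom n0 m2 sa el uF.
have [K [C [_ _ H]]] := eigfun_bound n0 m2 sa el ltr01.
have WF (w : oword) : Wdom (opw w F) by eexists => x; exact: (H _ _ uF w x).
have cF := rsmooth_cont sF.
have sl t := rsmooth_slice t sg.
have sDl t := rsmooth_slice t (rsmooth_D dirt sg).
have bl t (be : 'I_n -> nat) : bddf (iD (mdirs be) (fun y => g (t, y))).
  by have [B' hB'] := bg be; exists B' => x; rewrite iD_slice; exact: hB'.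
have pp t := pop_pairing sa (sl t) sF (bl t) WF eF.
split.
- by move=> t; apply: (intbW (rsmooth_cont (sl t)) cF _ WF0); exists B => x; exact: gB.
- by move=> t; apply: (intbW (rsmooth_cont (sDl t)) cF _ WF0); exists B => x; exact: DB.
- by move=> t; have [] := pp t.
- by move=> t; exact: (Inu_derive_t t sg cF WF0 gB DB).
- by move=> t; have [] := pp t.
Qed.

Lemma pair_le g F (B K : R) t : (forall p, `|g p| <= B) -> continuous F -> (forall x, `|F x| <= K * Wt x) -> rsmooth g ->
  `|pair g F t| <= B * K * Inu Wt.
Proof.
move=> gB cF FK sg.
have WF : Wdom F by exists K.
have ig : intg (fun x => g (t, x) * F x).
  by apply: (intbW (rsmooth_cont (rsmooth_slice t sg)) cF _ WF); exists B => x; exact: gB.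
apply: (le_trans (le_normr_Rintegral measurableT ig)).
rewrite -InuZ; last exact: integrable_Wt.
apply: le_Rintegral => //; first exact: (integrable_norm ig).
- exact: intgZ (@integrable_Wt R n).
- by move=> x _; rewrite normrM -mulrA ler_pM.
Qed.

Context (a b A B : R -> R) (mu : R).
Hypotheses (hA : hasD A a) (hB : hasD B b).

Lemma Lop_parts u t x : complex.Re (Lop cP a b u (t, x)) = 'D_dirt (cIm u) (t, x) +
     (a t * PopR cP (fun y => cRe u (t, y)) x - b t * PopR cP (fun y => cIm u (t, y)) x) /\
   complex.Im (Lop cP a b u (t, x)) = - 'D_dirt (cRe u) (t, x) +
     (a t * PopR cP (fun y => cIm u (t, y)) x + b t * PopR cP (fun y => cRe u (t, y)) x).
Proof.
rewrite -(Re_Pop cP (fun y => u (t, y))) -(Im_Pop cP (fun y => u (t, y))).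
rewrite /Lop /= -/(cRe u) -/(cIm u); case: (Pop cP (fun y => u (t, y)) x) => p q /=.
by split; ring.
Qed.

Lemma Inu3 (f g h : 'rV[R]_n -> R) (e c d : R) : intg f -> intg g -> intg h ->
  intg (fun x => e * f x + (c * g x + d * h x)) /\
  Inu (fun x => e * f x + (c * g x + d * h x)) = e * Inu f + (c * Inu g + d * Inu h).
Proof.
move=> hf hg hh; have [hf' hg' hh'] := And3 (intgZ e hf) (intgZ c hg) (intgZ d hh).
split; first by do 2!apply: intgD => //.
by rewrite InuD//; [rewrite InuD// !InuZ|exact: intgD].
Qed.

(** W is the imaginary part of u_j exp (i lam_j (A + i B)). Its size comes from the boundedness of u
    and the [Wt]-weighted bound on phi_j, with loss exp (eta |lam_j|); the constant [Cu] does not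
    depend on j, which makes the final comparison possible. *)
Lemma solution_coef u f (eta : R) : Fmu mu u -> (forall p, Lop cP a b u p = f p) -> 0 < eta ->
  exists2 Cu, 0 <= Cu & forall j, exists2 W : R -> R,
    hasD W (fun t => expR (- (lam j * B t)) * (coefR f j t * cos (lam j * A t) - coefI f j t * sin (lam j * A t))) &
    forall t, `|W t| <= Cu * expR (eta * `|lam j|) * expR (- (lam j * B t)).
Proof.
move=> Fu Lu eta0; have [tR tI] := tame_parts Fu.
have [BR [BR0 _]] := tame_bdd tR; have [BI [BI0 _]] := tame_bdd tI.
have [K [C [K0 _ H]]] := eigfun_bound n0 m2 sa el eta0.
have IW0 : 0 <= Inu Wt by apply: Rintegral_ge0 => x _; rewrite ltW// Wt_gt0.
have b0 : 0 <= BR + BI by rewrite addr_ge0// ?(le_trans _ (BR0 0))// (le_trans _ (BI0 0)).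
exists (4 * ((BR + BI) * K * Inu Wt)); first by rewrite !mulr_ge0.
move=> j; have [u1 u2] := phi_unit es j.
have [_ _ _ d1 _] := pair_eig tR u1; have [_ _ _ d2 _] := pair_eig tR u2.
have [_ _ _ d3 _] := pair_eig tI u1; have [_ _ _ d4 _] := pair_eig tI u2.
pose UR t := pair (cRe u) (pR j) t + pair (cIm u) (pI j) t.
pose UI t := pair (cIm u) (pR j) t - pair (cRe u) (pI j) t.
have fRE t x : cRe f (t, x) = 1 * 'D_dirt (cIm u) (t, x) +
     (a t * PopR cP (fun y => cRe u (t, y)) x + - b t * PopR cP (fun y => cIm u (t, y)) x).
  by rewrite {1}/cRe -Lu; have [-> _] := Lop_parts u t x; ring.
have fIE t x : cIm f (t, x) = -1 * 'D_dirt (cRe u) (t, x) +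
     (a t * PopR cP (fun y => cIm u (t, y)) x + b t * PopR cP (fun y => cRe u (t, y)) x).
  by rewrite {1}/cIm -Lu; have [_ ->] := Lop_parts u t x; ring.
have key (F : 'rV[R]_n -> R) t : unit_eigfun cP (lam j) F ->
    [/\ intg (fun x => cRe f (t, x) * F x), intg (fun x => cIm f (t, x) * F x),
      Inu (fun x => cRe f (t, x) * F x) = pair ('D_dirt (cIm u)) F t + lam j * (a t * pair (cRe u) F t - b t * pair (cIm u) F t) &
      Inu (fun x => cIm f (t, x) * F x) = - pair ('D_dirt (cRe u)) F t + lam j * (a t * pair (cIm u) F t + b t * pair (cRe u) F t)].
  move=> uF; have [i1 i2 i3 _ e1] := pair_eig tR uF; have [i4 i5 i6 _ e2] := pair_eig tI uF.
  have [j1 k1] := @Inu3 _ _ _ 1 (a t) (- b t) (i5 t) (i3 t) (i6 t).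
  have [j2 k2] := @Inu3 _ _ _ (-1) (a t) (b t) (i2 t) (i6 t) (i3 t).
  have E1 x : cRe f (t, x) * F x = 1 * ('D_dirt (cIm u) (t, x) * F x) +
     (a t * (PopR cP (fun y => cRe u (t, y)) x * F x) + - b t * (PopR cP (fun y => cIm u (t, y)) x * F x)).
    by rewrite fRE; ring.
  have E2 x : cIm f (t, x) * F x = -1 * ('D_dirt (cRe u) (t, x) * F x) +
     (a t * (PopR cP (fun y => cIm u (t, y)) x * F x) + b t * (PopR cP (fun y => cRe u (t, y)) x * F x)).
    by rewrite fIE; ring.
  split.
  - by move: j1; apply: eq_integrable => // x _; rewrite E1.
  - by move: j2; apply: eq_integrable => // x _; rewrite E2.
  - transitivity (1 * pair ('D_dirt (cIm u)) F t + (a t * (lam j * pair (cRe u) F t) + - b t * (lam j * pair (cIm u) F t))).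
      by rewrite -e1 -e2 -[RHS]k1; apply: eq_Rintegral => x _; exact: E1.
    by ring.
  transitivity (-1 * pair ('D_dirt (cRe u)) F t + (a t * (lam j * pair (cIm u) F t) + b t * (lam j * pair (cRe u) F t))).
    by rewrite -e1 -e2 -[RHS]k2; apply: eq_Rintegral => x _; exact: E2.
  by ring.
have eFR t : coefR f j t = (pair ('D_dirt (cIm u)) (pR j) t - pair ('D_dirt (cRe u)) (pI j) t)
    + lam j * (a t * UR t - b t * UI t).
  have [k1 k2 e1' e2'] := key _ t u1; have [k3 k4 e3' e4'] := key _ t u2.
  by rewrite /coefR InuD// e1' e4' /UR /UI; ring.
have eFI t : coefI f j t = (- pair ('D_dirt (cRe u)) (pR j) t - pair ('D_dirt (cIm u)) (pI j) t)
    + lam j * (a t * UI t + b t * UR t).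
  have [k1 k2 e1' e2'] := key _ t u1; have [k3 k4 e3' e4'] := key _ t u2.
  rewrite /coefI (_ : Inu _ = Inu (fun x => cIm f (t, x) * pR j x + -1 * (cRe f (t, x) * pI j x))).
    by rewrite InuD//; [rewrite InuZ// e2' e3' /UR /UI; ring|exact: intgZ].
  by apply: eq_Rintegral => x _; ring.
have hUR := hasDD d1 d4; have hUI := hasDB d3 d2.
exists (fun t => expR (- (lam j * B t)) * (UI t * cos (lam j * A t) + UR t * sin (lam j * A t))).
  apply: (phase_ode hA hB hUR hUI) => t; first by rewrite eFR.
  by rewrite eFI opprD.
move=> t; rewrite normrM ger0_norm ?expR_ge0// mulrC ler_wpM2r ?expR_ge0//.
have Kb (F : 'rV[R]_n -> R) : unit_eigfun cP (lam j) F -> forall x, `|F x| <= K * expR (eta * `|lam j|) * Wt x.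
  move=> uF x; have := H _ _ uF [::] x; rewrite /= fact0 sqrtr1 expr0 !mulr1; exact.
have gb g F Bg : unit_eigfun cP (lam j) F -> rsmooth g -> (forall p, `|g p| <= Bg) -> Bg <= BR + BI ->
    `|pair g F t| <= (BR + BI) * K * Inu Wt * expR (eta * `|lam j|).
  move=> uF sg gB hBg; have [sF _ _ _] := uF.
  apply: (le_trans (pair_le t gB (rsmooth_cont sF) (Kb F uF) sg)).
  rewrite [leRHS](_ : _ = (BR + BI) * (K * expR (eta * `|lam j|)) * Inu Wt); last by ring.
  by rewrite ler_wpM2r// ler_wpM2r// mulr_ge0 ?expR_ge0.
have [sR _ _] := tR; have [sI _ _] := tI.
have BRp : 0 <= BR by rewrite (le_trans _ (BR0 0)).
have BIp : 0 <= BI by rewrite (le_trans _ (BI0 0)).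
have BRl : BR <= BR + BI by rewrite lerDl.
have BIl : BI <= BR + BI by rewrite lerDr.
have g1 := gb _ _ _ u1 sR BR0 BRl; have g2 := gb _ _ _ u2 sR BR0 BRl.
have g3 := gb _ _ _ u1 sI BI0 BIl; have g4 := gb _ _ _ u2 sI BI0 BIl.
rewrite (le_trans (ler_normD _ _))// !normrM.
have cU : `|UR t| <= 2 * ((BR + BI) * K * Inu Wt * expR (eta * `|lam j|)).
  by rewrite /UR (le_trans (ler_normD _ _))//; lra.
have sU : `|UI t| <= 2 * ((BR + BI) * K * Inu Wt * expR (eta * `|lam j|)).
  by rewrite /UI (le_trans (ler_normB _ _))//; lra.
have c1 : `|cos (lam j * A t)| <= 1 by rewrite ler_norml cos_geN1 cos_le1.
have s1 : `|sin (lam j * A t)| <= 1 by rewrite ler_norml sin_geN1 sin_le1.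
have m1 := ler_pM (normr_ge0 _) (normr_ge0 _) sU c1; have m3 := ler_pM (normr_ge0 _) (normr_ge0 _) cU s1.
apply: (le_trans (lerD m1 m3)); rewrite !mulr1 le_eqVlt; apply/orP; left; apply/eqP; ring.
Qed.

End SolutionSide.

(** * The right-hand side and its coefficients *)

Section RightHandSide.
Context {R : realType} {n m : nat} (cP : midx n m -> midx n m -> R).
Notation cnt := (@counting nat R).
Notation cint f := (cnt.-integrable [set: nat] (fun m : nat => (f m)%:E)).
Notation rVm := (@rVm R n).
Notation oword := (@oword n).
Notation nun := (@nu R n).
Notation Inu g := (Rintegral (@nu R n) [set: rVm] (g : rVm -> R)).
Notation intg g := (nun.-integrable [set: rVm] (fun x : rVm => (g x)%:E)).
Hypotheses (n0 : (0 < n)%N) (m2 : (2 <= m)%N) (sa : P_selfadjoint cP) (el : P_globally_elliptic cP).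
Context (lam : nat -> R) (phi : nat -> 'rV[R]_n -> R[i]).
Hypothesis es : eigen_system cP lam phi.

Lemma iD_lin2 (X : normedModType R) (ds : seq X) (c d : R) (f g : X -> R) : rsmooth f -> rsmooth g ->
  iD ds (fun x => c * f x + d * g x) = fun x => c * iD ds f x + d * iD ds g x.
Proof.
move=> sf sg; elim: ds => [//|v ds IH]; rewrite /= -/(iD ds _) IH; apply/funext => x.
have hf := rsmooth_is_derive x v (rsmooth_iD ds sf).
have hg := rsmooth_is_derive x v (rsmooth_iD ds sg).
by have [_ ->] := is_deriveD (is_deriveZ c hf) (is_deriveZ d hg).
Qed.

Context (jj : nat -> nat) (cR cI : nat -> R -> R) (Kc D th : R) (S : nat).
Hypotheses (jinj : injective jj) (th0 : 0 < th) (Kc0 : 0 <= Kc) (D0 : 0 <= D).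
Hypothesis lamk : forall k, k%:R <= `|lam (jj k)|.
Hypotheses (scR : forall k, smooth1 (cR k)) (scI : forall k, smooth1 (cI k)).
Hypotheses (pcR : forall k, periodic2pi (cR k)) (pcI : forall k, periodic2pi (cI k)).

Definition good (c : nat -> R -> R) := forall g k t,
  `|Dk g (c k) t| <= Kc * expR (- th * `|lam (jj k)|) * D ^+ g * g`!%:R ^+ S.
Hypotheses (gR : good cR) (gI : good cI).

Definition phR k := cRe (phi (jj k)).
Definition phI k := cIm (phi (jj k)).

(** Half of the decay exp (- th |lam|) pays for the eigenfunction bound with eta = th / 2; the other
    half is summable because k <= |lam (jj k)|. *)
Definition Ms (k : nat) : R := expR (- (th / 2)) ^+ k.

Lemma Ms_ge0 k : 0 <= Ms k. Proof. by rewrite exprn_ge0// expR_ge0. Qed.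

Lemma Ms_cint : cint Ms.
Proof.
apply: (@cint_bounded R Ms (1 - expR (- (th / 2)))^-1) => [k|N]; first exact: Ms_ge0.
rewrite big_mkord; apply: geom_le; first exact: expR_ge0.
by rewrite -expR0 ltr_expR oppr_lt0 divr_gt0.
Qed.

Definition Bs (Kp C : R) (g N : nat) : R := Kc * Kp * D ^+ g * g`!%:R ^+ S * (C ^+ N * Num.sqrt N`!%:R).

Lemma series_bound : exists Kp C : R, [/\ 0 <= Kp, 1 <= C &
  forall (c : nat -> R -> R) (ph : nat -> 'rV[R]_n -> R), good c -> (forall k, unit_eigfun cP (lam (jj k)) (ph k)) ->
   forall g (w : oword) k t x, `|Dk g (c k) t * opw w (ph k) x| <= Bs Kp C g (size w) * Ms k * Wt x].
Proof.
have th2 : 0 < th / 2 by rewrite divr_gt0.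
have [Kp [C [Kp0 C1 H]]] := eigfun_bound n0 m2 sa el th2.
exists Kp, C; split=> // c ph gc uph g w k t x; rewrite normrM.
apply: (le_trans (ler_pM (normr_ge0 _) (normr_ge0 _) (gc g k t) (H _ _ (uph k) w x))).
have C0 : 0 <= C by lra.
have e : expR (- th * `|lam (jj k)|) * expR (th / 2 * `|lam (jj k)|) <= Ms k.
  rewrite -expRD /Ms -expRM_natr ler_expR.
  have := ler_wpM2l (ltW th2) (lamk k); lra.
rewrite [leLHS](_ : _ = Kc * Kp * D ^+ g * g`!%:R ^+ S * (C ^+ size w * Num.sqrt (size w)`!%:R) *
  (expR (- th * `|lam (jj k)|) * expR (th / 2 * `|lam (jj k)|)) * Wt x); last by ring.
rewrite ler_wpM2r ?(ltW (Wt_gt0 _))// ler_wpM2l//.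
by rewrite !mulr_ge0 ?exprn_ge0 ?sqrtr_ge0.
Qed.

Definition fre (p : R * 'rV[R]_n) : R := ser cR phR 0 [::] p - ser cI phI 0 [::] p.
Definition fim (p : R * 'rV[R]_n) : R := ser cR phI 0 [::] p + ser cI phR 0 [::] p.
Definition frhs (p : R * 'rV[R]_n) : R[i] := Complex (fre p) (fim p).

Lemma uR k : unit_eigfun cP (lam (jj k)) (phR k).
Proof. by have [] := phi_unit es (jj k). Qed.

Lemma uI k : unit_eigfun cP (lam (jj k)) (phI k).
Proof. by have [] := phi_unit es (jj k). Qed.

Lemma Bs_ge0 Kp C g N : 0 <= Kp -> 1 <= C -> 0 <= Bs Kp C g N.
Proof. by move=> Kp0 C1; rewrite !mulr_ge0 ?exprn_ge0 ?sqrtr_ge0//; lra. Qed.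

Lemma smR k : rsmooth (phR k). Proof. by have [] := uR k. Qed.
Lemma smI k : rsmooth (phI k). Proof. by have [] := uI k. Qed.

Lemma norm4 (p s1 s2 s3 s4 X : R) : `|p * s1| <= X -> `|p * s2| <= X -> `|p * s3| <= X -> `|p * s4| <= X ->
  `|p * (1 * s1 + -1 * s2)| + `|p * (1 * s3 + 1 * s4)| <= 4 * X.
Proof.
have -> : p * (1 * s1 + -1 * s2) = p * s1 - p * s2 by ring.
have -> : p * (1 * s3 + 1 * s4) = p * s3 + p * s4 by ring.
move=> h1 h2 h3 h4; have := ler_normB (p * s1) (p * s2); have := ler_normD (p * s3) (p * s4); lra.
Qed.

(** Multiplying by x^al and differentiating by d^be applies a word of length N = |al| + |be|,
    bounded through sqrt (N!). The time derivatives give the Gevrey exponent sigma = S. *)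
Lemma frhs_Fmu (mu : R) : (1 < S)%N -> 2^-1 <= mu -> Fmu mu frhs.
Proof.
move=> S1 hmu; have [Kp [C [Kp0 C1 H]]] := series_bound.
have B0 g N := Bs_ge0 g N Kp0 C1.
have b1 := H _ _ gR uR; have b2 := H _ _ gI uI; have b3 := H _ _ gR uI; have b4 := H _ _ gI uR.
have s1 := ser_smooth scR smR Ms_cint B0 Ms_ge0 b1 0%N [::].
have s2 := ser_smooth scI smI Ms_cint B0 Ms_ge0 b2 0%N [::].
have s3 := ser_smooth scR smI Ms_cint B0 Ms_ge0 b3 0%N [::].
have s4 := ser_smooth scI smR Ms_cint B0 Ms_ge0 b4 0%N [::].
have eR : cRe frhs = fun p => 1 * ser cR phR 0 [::] p + -1 * ser cI phI 0 [::] p.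
  by apply/funext => p; rewrite /cRe /= /fre; ring.
have eI : cIm frhs = fun p => 1 * ser cR phI 0 [::] p + 1 * ser cI phR 0 [::] p.
  by apply/funext => p; rewrite /cIm /= /fim; ring.
have per (c : nat -> R -> R) (ph : nat -> 'rV[R]_n -> R) : (forall k, periodic2pi (c k)) -> forall t x, ser c ph 0 [::] (t + 2 * pi, x) = ser c ph 0 [::] (t, x).
  move=> pc t x; rewrite /ser; congr csum; apply/funext => k.
  by rewrite /term /= -[Dk 0%N _ _]/(c k (t + 2 * pi)) pc.
exists S%:R; split; first by rewrite ltr1n.
split.
- split; first by rewrite eR; apply: rsmoothD; apply: rsmoothZ.
  by rewrite eI; apply: rsmoothD; apply: rsmoothZ.
- by move=> t x; rewrite /frhs /fre /fim !per.
have M0 : 0 <= csum Ms by apply: csum_ge0 => k; exact: Ms_ge0.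
pose E := C * (2 ^+ n * 2); pose C' := 1 + D + E.
have C0 : 0 <= C by lra.
have E0 : 0 <= E by rewrite !mulr_ge0// exprn_ge0.
have C'0 : 0 < C' by rewrite /C' -addrA ltr_wpDr// addr_ge0.
have DC : D <= C' by rewrite /C' addrAC lerDr addr_ge0.
have EC : E <= C' by rewrite /C' lerDr addr_ge0.
exists C', (4 * (Kc * Kp * csum Ms)); split=> //.
move=> al be ga t x; set N := (mabs al + mabs be)%N.
have sb (c : nat -> R -> R) (ph : nat -> 'rV[R]_n -> R) : (forall k, rsmooth (ph k)) -> (forall k, smooth1 (c k)) ->
   (forall g (w : oword) k t x, `|Dk g (c k) t * opw w (ph k) x| <= Bs Kp C g (size w) * Ms k * Wt x) ->
   `|mpow x al * iD (xdirs be ++ nseq ga dirt) (ser c ph 0 [::]) (t, x)| <= Bs Kp C ga N * csum Ms.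
  move=> sph sc b; rewrite (ser_iD sc sph Ms_cint B0 Ms_ge0 b) (ser_mpow Ms_cint B0 Ms_ge0 b).
  have := ser_le Ms_cint b ga (wlet false al ++ wlet true be) t x.
  rewrite size_cat !size_wlet -/N => /le_trans; apply.
  by rewrite ler_piMr ?Wt_le1// mulr_ge0.
have e1 := sb _ _ smR scR b1; have e2 := sb _ _ smI scI b2.
have e3 := sb _ _ smI scR b3; have e4 := sb _ _ smR scI b4.
have tot : `|mpow x al| * cabs (ciD (xdirs be ++ nseq ga dirt) frhs (t, x)) <= 4 * (Bs Kp C ga N * csum Ms).
  apply: (le_trans (ler_wpM2l (normr_ge0 _) (cabs_le _))); rewrite mulrDr -!normrM /ciD eR eI !iD_lin2//=.
  exact: (norm4 e1 e2 e3 e4).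
apply: (le_trans tot).
have hS := sqrt_fact_le al be hmu; rewrite -/N in hS.
rewrite powR_mulrn ?ler0n// -mulrA.
have hC : D ^+ ga * (C ^+ N * (2 ^+ n * 2) ^+ N) <= C' ^+ (N + ga).
  rewrite -exprMn exprD mulrC ler_pM ?exprn_ge0//.
    by rewrite lerXn2r ?nnegrE// ltW.
  by rewrite lerXn2r ?nnegrE// ltW.
rewrite [leLHS](_ : _ = 4 * (Kc * Kp * csum Ms) * (D ^+ ga * (C ^+ N * Num.sqrt N`!%:R)) * ga`!%:R ^+ S); last by rewrite /Bs; ring.
rewrite [leRHS](_ : _ = 4 * (Kc * Kp * csum Ms) * (C' ^+ (N + ga) * (mfact al * mfact be)%N%:R `^ mu) * ga`!%:R ^+ S); last by ring.
rewrite ler_wpM2r ?exprn_ge0// ler_wpM2l ?mulr_ge0//.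
apply: (@le_trans _ _ (D ^+ ga * (C ^+ N * ((2 ^+ n * 2) ^+ N * (mfact al * mfact be)%N%:R `^ mu)))).
  by rewrite ler_wpM2l ?exprn_ge0// ler_wpM2l ?exprn_ge0.
by rewrite !mulrA -(mulrA (D ^+ ga)) ler_wpM2r// powR_ge0.
Qed.

Lemma ser_pair (c : nat -> R -> R) (ph : nat -> 'rV[R]_n -> R) (Kp C : R) (F : 'rV[R]_n -> R) t : 0 <= Kp -> 1 <= C ->
  (forall k, smooth1 (c k)) -> (forall k, rsmooth (ph k)) ->
  (forall g (w : oword) k t x, `|Dk g (c k) t * opw w (ph k) x| <= Bs Kp C g (size w) * Ms k * Wt x) ->
  continuous F -> Wdom F -> (forall k, Wdom (ph k)) ->
  [/\ intg (fun x => ser c ph 0 [::] (t, x) * F x), cint (fun k => c k t * Inu (fun x => ph k x * F x)) &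
    Inu (fun x => ser c ph 0 [::] (t, x) * F x) = csum (fun k => c k t * Inu (fun x => ph k x * F x))].
Proof.
move=> Kp0 C1 sc sph b cF WF Wph; have B0 g N := Bs_ge0 g N Kp0 C1.
have [BF hBF] : bddf F.
  have [K hK] := WF; exists K => x; rewrite (le_trans (hK x))// ler_piMr ?Wt_le1//.
  by have := le_trans (normr_ge0 _) (hK 0); rewrite pmulr_lge0// Wt_gt0.
have BF0 : 0 <= BF by rewrite (le_trans _ (hBF 0)).
have sS := rsmooth_slice t (ser_smooth sc sph Ms_cint B0 Ms_ge0 b 0%N [::]).
pose f k x := F x * term c ph 0 [::] k (t, x).
have tc k : continuous (fun x => term c ph 0 [::] k (t, x)).
  by apply: (@cZ R _ (c k t) (ph k)); exact: (rsmooth_cont (sph k)).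
have cs x : csum (f^~ x) = ser c ph 0 [::] (t, x) * F x.
  by rewrite [RHS]mulrC; exact: (csumZ (F x) (ser_cint Ms_cint B0 Ms_ge0 b 0%N [::] (t, x))).
have iS : intg (fun x => ser c ph 0 [::] (t, x) * F x).
  apply: (intbW (rsmooth_cont sS) cF _ WF); exists (Bs Kp C 0 0 * csum Ms) => x.
  apply: (le_trans (ser_le Ms_cint b 0%N [::] t x)); rewrite ler_piMr ?Wt_le1// mulr_ge0//.
  by apply: csum_ge0 => k; exact: Ms_ge0.
have [] := @Inu_csum R n f (fun k => BF * (Bs Kp C 0 0 * Ms k)).
- by move=> k; apply: cM; [exact: cF|exact: tc].
- move=> k x; rewrite /f normrM -[leRHS]mulrA ler_pM//.
  exact: (b 0%N [::] k t x).
- by apply: cintZ; apply: cintZ; exact: Ms_cint.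
- rewrite (_ : (fun x => _) = fun x => ser c ph 0 [::] (t, x) * F x); last by apply/funext.
  by apply: cM; [exact: (rsmooth_cont sS)|exact: cF].
have E : (fun k => Inu (f k)) = (fun k => c k t * Inu (fun x => ph k x * F x)).
  apply/funext => k; rewrite -InuZ; last first.
    have [B hB] : bddf F by exists BF.
    apply: integrable_Wdom; first by apply: continuous_measurable_rV; apply: cM => //; exact: (rsmooth_cont (sph k)).
    by apply: WdomM => //; exists B.
  by apply: eq_Rintegral => x _; rewrite /f /term /= -[Dk 0%N _ _]/(c k t); ring.
move=> i1 e1; have Ek k : Inu (f k) = c k t * Inu (fun x => ph k x * F x) := congr1 (fun h => h k) E.
split; first exact: iS.
  by move: i1; apply: eq_integrable => // k _; rewrite Ek.
rewrite -E -[RHS]e1; by apply: eq_Rintegral => x _; rewrite cs.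
Qed.

Lemma frhs_coef j t : coefR phi frhs j t = csum (fun k => cR k t * (jj k == j)%:R) /\
  coefI phi frhs j t = csum (fun k => cI k t * (jj k == j)%:R).
Proof.
have [Kp [C [Kp0 C1 H]]] := series_bound.
have b1 := H _ _ gR uR; have b2 := H _ _ gI uI; have b3 := H _ _ gR uI; have b4 := H _ _ gI uR.
have [cj1 cj2] := phi_cont es j; have [wj1 wj2] := phi_Wdom n0 m2 sa el es j.
have WR k : Wdom (phR k) := (phi_Wdom n0 m2 sa el es (jj k)).1.
have WI k : Wdom (phI k) := (phi_Wdom n0 m2 sa el es (jj k)).2.
have [i1 h1 e1] := ser_pair t Kp0 C1 scR smR b1 cj1 wj1 WR.
have [i2 h2 e2] := ser_pair t Kp0 C1 scI smI b2 cj1 wj1 WI.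
have [i3 h3 e3] := ser_pair t Kp0 C1 scR smI b3 cj1 wj1 WI.
have [i4 h4 e4] := ser_pair t Kp0 C1 scI smR b4 cj1 wj1 WR.
have [i1' h1' e1'] := ser_pair t Kp0 C1 scR smR b1 cj2 wj2 WR.
have [i2' h2' e2'] := ser_pair t Kp0 C1 scI smI b2 cj2 wj2 WI.
have [i3' h3' e3'] := ser_pair t Kp0 C1 scR smI b3 cj2 wj2 WI.
have [i4' h4' e4'] := ser_pair t Kp0 C1 scI smR b4 cj2 wj2 WR.
have Zi (f : 'rV[R]_n -> R) : intg f -> intg (fun x => -1 * f x) := @intgZ R n (-1) f.
have Zc (f : nat -> R) : cint f -> cint (fun k => -1 * f k) := @cintZ R (-1) f.
have orth k : Inu (fun x => phR k x * cRe (phi j) x) + Inu (fun x => phI k x * cIm (phi j) x) = (jj k == j)%:R /\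
    Inu (fun x => phI k x * cRe (phi j) x) - Inu (fun x => phR k x * cIm (phi j) x) = 0.
  have [p1 p2] := phi_orth n0 m2 sa el es (jj k) j.
  have ww (f g : 'rV[R]_n -> R) : continuous f -> continuous g -> Wdom f -> Wdom g -> intg (fun x => f x * g x) by exact: intWW.
  have cRk := rsmooth_cont (smR k); have cIk := rsmooth_cont (smI k).
  have a1 := ww _ _ cRk cj1 (WR k) wj1; have a2 := ww _ _ cIk cj2 (WI k) wj2.
  have a3 := ww _ _ cIk cj1 (WI k) wj1; have a4 := ww _ _ cRk cj2 (WR k) wj2.
  split; first by rewrite -p1 InuD.
  rewrite -p2 (_ : Inu (fun x => cIm (phi (jj k)) x * cRe (phi j) x - _) =
    Inu (fun x => phI k x * cRe (phi j) x + -1 * (phR k x * cIm (phi j) x))).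
    by rewrite InuD//; [rewrite InuZ// mulN1r|exact: Zi].
  by apply: eq_Rintegral => x _; rewrite mulN1r.
have cD4 (f1 f2 f3 f4 : nat -> R) : cint f1 -> cint f2 -> cint f3 -> cint f4 ->
   csum f1 + csum f2 + (csum f3 + csum f4) = csum (fun k => f1 k + f2 k + (f3 k + f4 k)).
  by move=> c1 c2 c3 c4; rewrite -!csumD//; under eq_fun do rewrite EFinD; apply: integrableD.
have iD4 (f1 f2 f3 f4 : 'rV[R]_n -> R) : intg f1 -> intg f2 -> intg f3 -> intg f4 ->
   Inu (fun x => f1 x + f2 x + (f3 x + f4 x)) = Inu f1 + Inu f2 + (Inu f3 + Inu f4).
  by move=> c1 c2 c3 c4; rewrite InuD; [rewrite !InuD|exact: intgD|exact: intgD].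
split.
- rewrite /coefR (_ : Inu _ = Inu (fun x => ser cR phR 0 [::] (t, x) * cRe (phi j) x + -1 * (ser cI phI 0 [::] (t, x) * cRe (phi j) x) +
    (ser cR phI 0 [::] (t, x) * cIm (phi j) x + ser cI phR 0 [::] (t, x) * cIm (phi j) x))); last first.
    by apply: eq_Rintegral => x _; rewrite -[cRe frhs (t, x)]/(fre (t, x)) -[cIm frhs (t, x)]/(fim (t, x)) /fre /fim; ring.
  rewrite iD4//; last exact: Zi.
  rewrite InuZ// e1 e2 e3' e4' -csumZ// cD4//; last exact: Zc.
  congr csum; apply/funext => k; have [p1 p2] := orth k; rewrite -p1.
  by move: p2 => /eqP; rewrite subr_eq0 => /eqP ->; ring.
- rewrite /coefI (_ : Inu _ = Inu (fun x => ser cR phI 0 [::] (t, x) * cRe (phi j) x + ser cI phR 0 [::] (t, x) * cRe (phi j) x +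
    (-1 * (ser cR phR 0 [::] (t, x) * cIm (phi j) x) + ser cI phI 0 [::] (t, x) * cIm (phi j) x))); last first.
    by apply: eq_Rintegral => x _; rewrite -[cRe frhs (t, x)]/(fre (t, x)) -[cIm frhs (t, x)]/(fim (t, x)) /fre /fim; ring.
  rewrite iD4//; last exact: Zi.
  rewrite InuZ// e3 e4 e1' e2' -csumZ// cD4//; last exact: Zc.
  congr csum; apply/funext => k; have [p1 p2] := orth k; rewrite -p1.
  by move: p2 => /eqP; rewrite subr_eq0 => /eqP ->; ring.
Qed.

(** Passes from the iterated integrals in the definition of [coef] to integrals against [nu]; the
    integrands are dominated by [Wt], since the series are bounded and phi_j decays. *)
Lemma frhs_coefE j t : coef phi j frhs t = Complex (coefR phi frhs j t) (coefI phi frhs j t).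
Proof.
have [Kp [C [Kp0 C1 H]]] := series_bound.
have b1 := H _ _ gR uR; have b2 := H _ _ gI uI; have b3 := H _ _ gR uI; have b4 := H _ _ gI uR.
have B0 g N := Bs_ge0 g N Kp0 C1.
have [cj1 cj2] := phi_cont es j; have [wj1 wj2] := phi_Wdom n0 m2 sa el es j.
have M0 : 0 <= csum Ms by apply: csum_ge0 => k; exact: Ms_ge0.
have bd (c : nat -> R -> R) (ph : nat -> 'rV[R]_n -> R) : (forall g (w : oword) k t x, `|Dk g (c k) t * opw w (ph k) x| <= Bs Kp C g (size w) * Ms k * Wt x) ->
    forall x, `|ser c ph 0 [::] (t, x)| <= Bs Kp C 0 0 * csum Ms.
  move=> b x; apply: (le_trans (ser_le Ms_cint b 0%N [::] t x)); rewrite ler_piMr ?Wt_le1// mulr_ge0//.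
have c1 := rsmooth_cont (rsmooth_slice t (ser_smooth scR smR Ms_cint B0 Ms_ge0 b1 0%N [::])).
have c2 := rsmooth_cont (rsmooth_slice t (ser_smooth scI smI Ms_cint B0 Ms_ge0 b2 0%N [::])).
have c3 := rsmooth_cont (rsmooth_slice t (ser_smooth scR smI Ms_cint B0 Ms_ge0 b3 0%N [::])).
have c4 := rsmooth_cont (rsmooth_slice t (ser_smooth scI smR Ms_cint B0 Ms_ge0 b4 0%N [::])).
have cre' : continuous (fun x => fre (t, x)) by apply: cB.
have cim' : continuous (fun x => fim (t, x)) by apply: cD.
have bre : bddf (fun x => fre (t, x)).
  exists (Bs Kp C 0 0 * csum Ms + Bs Kp C 0 0 * csum Ms) => x.
  by rewrite (le_trans (ler_normB _ _))// lerD// bd.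
have bim : bddf (fun x => fim (t, x)).
  exists (Bs Kp C 0 0 * csum Ms + Bs Kp C 0 0 * csum Ms) => x.
  by rewrite (le_trans (ler_normD _ _))// lerD// bd.
rewrite /coef /intC; congr Complex.
- rewrite (_ : cRe _ = fun x => fre (t, x) * cRe (phi j) x + fim (t, x) * cIm (phi j) x); last first.
    by apply/funext => x; rewrite /cRe /cIm /cconj /frhs; case: (phi j x) => p q /=; ring.
  rewrite intRn_nu//; first by apply: continuous_measurable_rV; apply: cD; apply: cM.
  by apply: WdomD; apply: WdomMb.
- rewrite (_ : cIm (fun x => _) = fun x => fim (t, x) * cRe (phi j) x - fre (t, x) * cIm (phi j) x); last first.
    by apply/funext => x; rewrite /cRe /cIm /cconj /frhs; case: (phi j x) => p q /=; ring.
  rewrite intRn_nu//; first by apply: continuous_measurable_rV; apply: cB; apply: cM.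
  by apply: WdomB; apply: WdomMb.
Qed.

End RightHandSide.

(** * Phases, resonant indices and the choice of a subsequence *)

Section FinalLemmas.
Context {R : realType}.
Notation leb := (@lebesgue_measure R).

Lemma gevrey_antiderivative (f : R -> R) : gevrey_T f -> exists2 F, F 0 = 0 & hasD F f.
Proof.
move=> /gevrey_nat [S [K [C [_ K0 C0 sf H]]]].
have b0 t : `|f t| <= K + K * C.
  by have := H S (leqnn _) 0%N t; rewrite fact0 expr1n expr0 !mulr1 => /le_trans -> //; rewrite lerDl mulr_ge0.
have b1 t : `|Dk 1%N f t| <= K + K * C.
  by have := H S (leqnn _) 1%N t; rewrite (_ : 1`!%:R = 1 :> R)// expr1n expr1 !mulr1 => /le_trans -> //; rewrite lerDr.
have c1 : continuous (Dk 1%N f) := hasD_cont (Dk_hasD 1%N sf).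
have [F F0 hF] := antiderivative (Dk_hasD 0%N sf) c1 b0 b1.
by exists F.
Qed.

Lemma prim_hasD (F f : R -> R) t : F 0 = 0 -> hasD F f -> continuous f -> 0 <= t -> prim f t = F t.
Proof. by move=> F0 hF cf t0; rewrite /prim (Rint_hasD hF cf t0) F0 subr0. Qed.

Lemma cexp_phase (l p q : R) : cexp (ci * (l%:C)%C * Complex p q) =
  Complex (expR (- (l * q)) * cos (l * p)) (expR (- (l * q)) * sin (l * p)).
Proof.
have eR : complex.Re (ci * (l%:C)%C * Complex p q) = - (l * q) by rewrite /=; ring.
have eI : complex.Im (ci * (l%:C)%C * Complex p q) = l * p by rewrite /=; ring.
by rewrite /cexp eR eI; congr Complex; rewrite /=; ring.
Qed.

(** An integer has imaginary part zero, which kills lam_j times the integral of b; the real part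
    says that lam_j times the integral of a is a multiple of 2 pi. *)
Lemma Zset_parts (lam : nat -> R) (a b : R -> R) j : Zset lam a b j ->
  lam j * prim b (2 * pi) = 0 /\ exists z : int, lam j * prim a (2 * pi) = z%:~R * (2 * pi).
Proof.
have p0 : 2 * pi != 0 :> R by rewrite mulf_neq0 ?gt_eqF ?pi_gt0.
move=> [z hz]; have e : (z%:~R : R[i]) = ((z%:~R : R)%:C)%C by rewrite -(rmorph_int (real_complex R)).
rewrite e in hz; have := congr1 (@complex.Im R) hz; have := congr1 (@complex.Re R) hz.
rewrite /cmean /= => hR hI; split.
  have hI' : (2 * pi)^-1 * (lam j * prim b (2 * pi)) = 0.
    by rewrite -hI; ring.
  by move/eqP: hI'; rewrite mulf_eq0 invr_eq0 (negbTE p0) => /eqP.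
by exists z; rewrite -hR mul0r subr0 [lam j * (_ * _)]mulrCA [_^-1 * _]mulrC divfK.
Qed.

(** Consecutive values are made to increase by more than 1, which gives both injectivity and the
    growth in k on which the summability relies. *)
Lemma increasing_choice (lam : nat -> R) (Z : set nat) (ep : R) :
  (forall L, exists2 j, Z j & L < ep * lam j) ->
  exists jj : nat -> nat, [/\ injective jj, forall k, Z (jj k) & forall k, k%:R <= ep * lam (jj k)].
Proof.
move=> H; have [J hJ] := choice (fun L => let: ex_intro2 j a b := H L in ex_intro _ j (conj a b)).
pose jj := fix jj k := if k is k'.+1 then J (ep * lam (jj k') + 1) else J 0.
have S1 k : ep * lam (jj k) + 1 < ep * lam (jj k.+1) by have [] := hJ (ep * lam (jj k) + 1).
have mono i j : (i < j)%N -> ep * lam (jj i) < ep * lam (jj j).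
  elim: j => // j IH; rewrite ltnS leq_eqVlt => /orP[/eqP ->|/IH h]; have := S1 j; lra.
exists jj; split.
- move=> i j e; have [//|h] := eqVneq i j; exfalso; move: h; rewrite neq_ltn => /orP[] /mono; rewrite e ltxx //.
- by case=> [|k]; [have [] := hJ 0|have [] := hJ (ep * lam (jj k) + 1)].
elim=> [|k IH]; first by have [_ /ltW] := hJ 0.
by rewrite -natr1; have := S1 k; lra.
Qed.

Lemma csum_pick (jj : nat -> nat) (c : nat -> R) k0 : injective jj ->
  csum (fun k => c k * (jj k == jj k0)%:R) = c k0.
Proof.
move=> jinj; rewrite (_ : (fun k => _) = point k0 (c k0)); first by have [] := csum_point k0 (c k0).
apply/funext => k; rewrite /point (inj_eq jinj); case: eqP => [->|_]; [exact: mulr1|exact: mulr0].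
Qed.

Lemma csum_eq0 (f : nat -> R) : (forall k, f k = 0) -> csum f = 0.
Proof.
move=> f0; rewrite (_ : f = point 0 0); first by have [] := csum_point 0 (0 : R).
by apply/funext => k; rewrite f0 /point; case: eqP.
Qed.

Lemma phase_cancel (A B : R -> R) (rho ep : R) (kp : nat -> R -> R) l t :
  expR (- (l * B t)) * (cre A B rho ep kp l t * cos (l * A t) - cim A B rho ep kp l t * sin (l * A t)) =
    kp 0%N t * expR (- (ep * l * rho)) /\
  expR (- (l * B t)) * (cim A B rho ep kp l t * cos (l * A t) + cre A B rho ep kp l t * sin (l * A t)) = 0.
Proof.
rewrite /cre /cim /cxp /cyp.
have e : expR (- (l * B t)) * expR (l * B t - ep * l * rho) = expR (- (ep * l * rho)).
  by rewrite -expRD; congr expR; ring.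
have cs := cos2Dsin2 (l * A t).
move: e cs; move: (expR (- (l * B t))) (expR (l * B t - ep * l * rho)) (cos (l * A t)) (sin (l * A t)) => E1 E2 c s e cs.
split; last by ring.
by rewrite -e -[LHS]mulr1 -[RHS]mulr1 -{2}cs; ring.
Qed.

Lemma near_level (B : R -> R) (Q1 Q2 lv eta ep : R) : continuous B -> 0 < eta ->
  ep * B Q1 <= lv - eta -> ep * B Q2 <= lv - eta ->
  exists2 d, 0 < d & forall s, `|s - Q1| < d \/ `|s - Q2| < d -> ep * B s <= lv - eta / 2.
Proof.
move=> cB e0 h1 h2.
have loc Q : ep * B Q <= lv - eta -> exists2 d, 0 < d & forall s, `|s - Q| < d -> ep * B s <= lv - eta / 2.
  move=> hQ; have cE : continuous (fun s => ep * B s) by apply: cZ.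
  have e2 : 0 < eta / 2 by rewrite divr_gt0.
  have /cvgrPdist_le /(_ _ e2) := cE Q; rewrite -nbhs_ballE => -[d /= d0 hd].
  exists d => // s hs; have : `|ep * B Q - ep * B s| <= eta / 2.
    by apply: hd; rewrite -ball_normE /ball_ /= distrC.
  by rewrite ler_norml => /andP[h _]; lra.
have [d1 d10 k1] := loc _ h1; have [d2 d20 k2] := loc _ h2.
exists (Num.min d1 d2); first by rewrite lt_min d10.
by move=> s [] h; [apply: k1|apply: k2]; apply: (lt_le_trans h); rewrite ge_min lexx ?orbT.
Qed.

End FinalLemmas.

Theorem theorem4p8 (R : realType) (n m : nat) (cP : midx n m -> midx n m -> R)
  (lam : nat -> R) (phi : nat -> 'rV[R]_n -> R[i]) (a b : R -> R) :
  (1 <= n)%N -> (2 <= m)%N ->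
  P_selfadjoint cP -> P_globally_elliptic cP -> eigen_system cP lam phi ->
  gevrey_T a -> gevrey_T b ->
  (exists t1 t2 : R, 0 < b t1 /\ b t2 < 0) ->
  infinite_set (Zset lam a b) ->
  (exists r : R, ~ connected (Omega b r)) ->
  forall mu : R, 2^-1 <= mu -> ~ globally_solvable cP lam phi a b mu.
Proof.
move=> n0 m2 sa el es Ga Gb _ iZ [r nc] mu hmu gs.
(* If neither sign were unbounded on the resonant set, |lam| would be bounded there, against
   [lam_unbounded]. *)
have [ep epE unb] : exists2 ep : R, ep = 1 \/ ep = -1 & forall L, exists2 j, Zset lam a b j & L < ep * lam j.
  apply: contrapT => h.
  have bad ep : ep = 1 \/ ep = -1 -> exists L, forall j, Zset lam a b j -> ep * lam j <= L.
    move=> he; apply: contrapT => h'; apply: h; exists ep => // L; apply: contrapT => h2; apply: h'; exists L => j Zj.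
    by rewrite leNgt; apply/negP => h3; apply: h2; exists j.
  have [L1 hL1] := bad 1 (or_introl erefl); have [L2 hL2] := bad (-1) (or_intror erefl).
  have [j Zj] := lam_unbounded n0 m2 sa el es (Num.max L1 L2) iZ.
  have := hL1 j Zj; have := hL2 j Zj; rewrite gt_max mul1r mulN1r => h1 h2 /andP[h3 h4].
  by move: h3 h4; case: (leP 0 (lam j)) => [/ger0_norm ->|/ltr0_norm ->]; lra.
have [jj [jinj jZ jk]] := increasing_choice unb.
have ep2 : ep * ep = 1 by case: epE => ->; rewrite ?mulrNN mulr1.
have labs k : `|lam (jj k)| = ep * lam (jj k).
  have h : 0 <= ep * lam (jj k) by rewrite (le_trans _ (jk k)).
  by rewrite -(ger0_norm h) normrM; case: epE => ->; rewrite ?normrN normr1 mul1r.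
have [A A0 hA] := gevrey_antiderivative Ga; have [B B0 hB] := gevrey_antiderivative Gb.
have [Sa [Ka [Ca [Sa2 Ka0 Ca0 sma bda]]]] := gevrey_nat Ga.
have [Sb [Kb [Cb [Sb2 Kb0 Cb0 smb bdb]]]] := gevrey_nat Gb.
have ca : continuous a := hasD_cont (Dk_hasD 0%N sma).
have cb : continuous b := hasD_cont (Dk_hasD 0%N smb).
have pa t : 0 <= t -> prim a t = A t by exact: prim_hasD.
have pb t : 0 <= t -> prim b t = B t by exact: prim_hasD.
have pi2 : 0 <= 2 * pi :> R by rewrite mulr_ge0// pi_ge0.
have Zp k : lam (jj k) * B (2 * pi) = 0 /\ exists z : int, lam (jj k) * A (2 * pi) = z%:~R * (2 * pi).
  by rewrite -pa// -pb//; exact: Zset_parts (jZ k).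
(* Index 1 is used because there the eigenvalue has absolute value at least 1 and is nonzero. Hence
   b has mean zero and B descends to the circle. *)
have B2 : B (2 * pi) = 0.
  have [/eqP + _] := Zp 1%N; rewrite mulf_eq0 => /orP[/eqP l0|/eqP//].
  by have := jk 1%N; rewrite l0 mulr0 ler10.
have [pera _ _] := Ga; have [perb _ _] := Gb.
have BP : periodic2pi B by move=> t; rewrite (periodic_antiderivative t hB perb) B2 B0 subrr addr0.
have AP t : A (t + 2 * pi) = A t + A (2 * pi) by rewrite (periodic_antiderivative t hA pera) A0 subr0.
have [P1 [Q1 [P2 [Q2 [rho [eta [[P10 PQ QP P22] /andP[Q20 Q22] Qo eta0 [lP1 lP2 lQ1 lQ2]]]]]]]] :=
  alternating_sign nc epE.
have [Q10 P20] : 0 <= Q1 /\ 0 <= P2 by clear - P10 PQ QP; split; lra.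
rewrite !pb// in lP1 lP2 lQ1 lQ2.
have [d d0 hd] := near_level (hasD_cont hB) eta0 lQ1 lQ2.
have [kp [Kp [K' [[hkp hKp] pkp [K'0 bkp] [Kp2 KpP] supp]]]] := kappa_exists P10 PQ QP P22 Q20 Q22 Qo d0.
(* On the support of kappa, ep B is at most rho - eta / 2 = rho - 2 th: one th absorbs the
   derivatives of the exponential, the other is the decay of the coefficients. *)
pose th := eta / 4; have th0 : 0 < th by rewrite divr_gt0.
have supp' k t : kp k t != 0 -> ep * B t <= rho - 2 * th.
  move=> /supp [z hz]; rewrite -(periodic_int z t BP) (le_trans (hd _ hz))// /th; clear - eta0; lra.
pose S := maxn Sa Sb; have S2 : (2 < S)%N by rewrite leq_max Sa2.
have K0 : 0 <= Ka + Kb by rewrite addr_ge0.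
have C0 : 0 <= Ca + Cb by rewrite addr_ge0.
have bda' k t : `|Dk k a t| <= (Ka + Kb) * (Ca + Cb) ^+ k * k`!%:R ^+ S.
  rewrite (le_trans (bda S (leq_maxl _ _) k t))// ler_wpM2r ?exprn_ge0// ler_pM ?exprn_ge0 ?lerDl//.
  by rewrite lerXn2r ?nnegrE// lerDl.
have bdb' k t : `|Dk k b t| <= (Ka + Kb) * (Ca + Cb) ^+ k * k`!%:R ^+ S.
  rewrite (le_trans (bdb S (leq_maxr _ _) k t))// ler_wpM2r ?exprn_ge0// ler_pM ?exprn_ge0 ?lerDr//.
  by rewrite lerXn2r ?nnegrE// lerDr.
have [D D0 bc] := cre_bound hA hB sma smb hkp S2 K0 C0 K'0 th0 bda' bdb' bkp supp' epE.
pose cR k := cre A B rho ep kp (lam (jj k)); pose cI k := cim A B rho ep kp (lam (jj k)).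
have l0 k : 0 <= ep * lam (jj k) by rewrite -labs.
pose Kc := 2 * K' * expR th; have Kc0 : 0 <= Kc by rewrite !mulr_ge0 ?expR_ge0.
have gR : good lam jj Kc D th S.+1 cR.
  by move=> g k t; rewrite labs; have [] := bc _ (l0 k) g t.
have gI : good lam jj Kc D th S.+1 cI.
  by move=> g k t; rewrite labs; have [] := bc _ (l0 k) g t.
have smc k : smooth1 (cR k) /\ smooth1 (cI k) by exact: cre_smooth.
have perc k : periodic2pi (cR k) /\ periodic2pi (cI k).
  by have [_ [z hz]] := Zp k; exact: cre_periodic (pkp 0%N) BP AP hz.
have scR k := (smc k).1; have scI k := (smc k).2.
have jk' k : k%:R <= `|lam (jj k)| by rewrite labs.
pose f := frhs phi jj cR cI.
have Ff : Fmu mu f.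
  apply: (frhs_Fmu n0 m2 sa el es th0 Kc0 D0 jk' scR scI _ _ gR gI) => //.
  - by move=> k; have [] := perc k.
  - by move=> k; have [] := perc k.
  - by rewrite ltnS (leq_trans _ S2).
have fc j t := frhs_coef n0 m2 sa el es th0 Kc0 D0 jk' scR scI gR gI j t.
have fcE j t := frhs_coefE n0 m2 sa el es th0 Kc0 D0 jk' scR scI gR gI j t.
have fcj k0 t : coefR phi f (jj k0) t = cR k0 t /\ coefI phi f (jj k0) t = cI k0 t.
  have [-> ->] := fc (jj k0) t.
  by rewrite (@csum_pick R jj (fun k => cR k t) k0 jinj) (@csum_pick R jj (fun k => cI k t) k0 jinj).
have Ef : E_L lam phi a b mu f.
  split=> // j Zj.
  (* Off the chosen subsequence the coefficient of f vanishes. On it the phases cancel, and the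
     compatibility integral is a multiple of the mean of kappa, which is zero. *)
  have [[k0 jE]|nj] := pselect (exists k0, j = jj k0); last first.
    have z t : coef phi j f t = 0.
      rewrite fcE; have [-> ->] := fc j t.
      have e0 k : (jj k == j) = false by apply/negP => /eqP e; apply: nj; exists k.
      by rewrite !csum_eq0// => k; rewrite e0 mulr0.
    rewrite /cint02pi (_ : (fun t => _) = fun=> 0); last by apply/funext => t; rewrite z mulr0.
    by rewrite !Rintegral_cst// /cRe /cIm /= !mul0r.
  have val t : `[0, 2 * pi]%classic t -> cexp (ci * ((lam j)%:C)%C * Complex (prim a t) (prim b t)) * coef phi j f t =
      Complex (expR (- (ep * lam j * rho)) * kp 0%N t) 0.
    rewrite /= in_itv/= => /andP[t0 _]; rewrite cexp_phase pa// pb// fcE jE.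
    have [-> ->] := fcj k0 t.
    have [c1 c2] := @phase_cancel R A B rho ep kp (lam (jj k0)) t.
    congr Complex; rewrite /=.
      rewrite mulrC [RHS]mulrC -c1 /cR /cI; set E := expR _; ring.
    by rewrite -[RHS]c2 /cR /cI; set E := expR _; ring.
  rewrite /cint02pi; congr Complex.
    transitivity (Rintegral lebesgue_measure `[0, 2 * pi] (fun t => expR (- (ep * lam j * rho)) * kp 0%N t)).
      by apply: eq_Rintegral => t; rewrite inE => ht; rewrite /cRe val.
    have ck : continuous (fun t => expR (- (ep * lam j * rho)) * kp 0%N t) by apply: cZ; exact: (hasD_cont (hkp 0%N)).
    by rewrite (Rint_hasD (hasDZ _ hKp) ck pi2) Kp2 subrr.
  transitivity (Rintegral lebesgue_measure `[0, 2 * pi] (fun=> (0 : R))).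
    by apply: eq_Rintegral => t; rewrite inE => ht; rewrite /cIm val.
  by rewrite Rintegral_cst// mul0r.
have [u [Fu Lu]] := gs f Ef.
(* The eigenfunction bound may lose exp (eta / 2 |lam|), half of the factor exp (- eta |lam|) gained
   at P1 and P2. *)
have eta2 : 0 < eta / 2 by rewrite divr_gt0.
have [Cu Cu0 HW] := solution_coef n0 m2 sa el es hA hB Fu Lu eta2.
pose Del := Kp P2 - Kp P1; have Del0 : 0 < Del by rewrite subr_gt0.
(* After division by exp (- |lam| rho) the comparison between P1 and P2 reads Del exp (eta / 2
   |lam|) <= 2 Cu. The bound 1 + x <= exp x and k <= |lam| make it linear in k, which no fixed [Cu]
   can satisfy for all k. *)
have main k : Del * (eta / 2 * k%:R) <= 2 * Cu.
  have [W hW bW] := HW (jj k); pose l := lam (jj k); pose mk := ep * l.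
  have hW' : hasD W (fun t => expR (- (mk * rho)) * kp 0%N t).
    apply: (hasD_eq hW) => t; have [-> ->] := fcj k t.
    by have [-> _] := @phase_cancel R A B rho ep kp (lam (jj k)) t; rewrite mulrC.
  have cst := hasD0_cst (hasD_eq (hasDB hW' (hasDZ (expR (- (mk * rho))) hKp)) (fun x => subrr _)) P2 P1.
  have eD : expR (- (mk * rho)) * Del = W P2 - W P1 by rewrite /Del; move: cst => /=; clear; lra.
  have lB P : rho + eta <= ep * B P -> expR (- (l * B P)) <= expR (- (mk * (rho + eta))).
    move=> hP; rewrite ler_expR lerN2 (_ : l * B P = mk * (ep * B P)).
      by apply: ler_wpM2l; [exact: l0|exact: hP].
    by rewrite /mk -(mul1r (l * B P)) -ep2; ring.
  have bP P : rho + eta <= ep * B P -> `|W P| <= Cu * (expR (- (eta / 2 * mk)) * expR (- (mk * rho))).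
    move=> hP; apply: (le_trans (bW P)); rewrite -[leLHS]mulrA ler_wpM2l//.
    apply: (le_trans (ler_wpM2l (expR_ge0 _) (lB P hP))).
    by rewrite -!expRD ler_expR labs -/l -/mk; clear; lra.
  have E1 : expR (- (mk * rho)) * Del <= expR (- (mk * rho)) * (2 * Cu * expR (- (eta / 2 * mk))).
    rewrite eD (le_trans (ler_norm _))// (le_trans (ler_normB _ _))//.
    by have := bP P1 lP1; have := bP P2 lP2; clear; lra.
  rewrite ler_pM2l ?expR_gt0// in E1.
  have E2 : Del * expR (eta / 2 * mk) <= 2 * Cu.
    by rewrite -ler_pdivlMr ?expR_gt0// -expRN.
  apply: (le_trans _ E2); rewrite ler_wpM2l ?(ltW Del0)//.
  have h1 := expR_ge1Dx (eta / 2 * mk); have h2 := ler_wpM2l (ltW eta2) (jk k).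
  by rewrite -/l -/mk in h2; clear - h1 h2; lra.
have q0 : 0 < Del * (eta / 2) by rewrite mulr_gt0.
have /andP[_] := truncn_itv (divr_ge0 (mulr_ge0 (ler0n R 2) Cu0) (ltW q0)).
rewrite ltr_pdivrMr// => h; have := main (Num.truncn (2 * Cu / (Del * (eta / 2)))).+1.
by rewrite mulrA mulrC leNgt h.
Qed.
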